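(* Let $A\in\mathrm{BIP}(X)$ with $\theta_A<\pi$, where $X$ is a Banach space with type $p\in[1,2]$ and cotype $q\in[2,\infty)$. Let $\psi\in(\theta_A,\pi)$. Then there exists a constant $C\geq0$ such that $D_{\log(A)}(\tfrac1p-\tfrac1q,1)\subseteq D(f(A))$ and $$\|f(A)\|_{\mathcal{L}(D_{\log(A)}(\frac1p-\frac1q,1),X)}\leq C\,\|f\|_{H^\infty(S_\psi)}$$ for all $f\in H^\infty(S_\psi)$.
   Context: All Banach spaces are complex and nonzero; $\mathcal{L}(Y,X)$ is the space of bounded operators from $Y$ to $X$. Type and cotype: let $(\gamma_k)_{k\in\mathbb{N}}$ be independent standard complex Gaussian random variables. $X$ has type $p\in[1,2]$ if there is $C$ with $(\mathbb{E}\|\sum_{k=1}^n\gamma_kx_k\|^2)^{1/2}\leq C(\sum_{k=1}^n\|x_k\|^p)^{1/p}$ for all $n$ and $x_1,\dots,x_n\in X$; $X$ has cotype $q\in[2,\infty)$ if there is $C$ with $(\sum_{k=1}^n\|x_k\|^q)^{1/q}\leq C(\mathbb{E}\|\sum_{k=1}^n\gamma_kx_k\|^2)^{1/2}$ for all $n$ and $x_1,\dots,x_n\in X$. Sectorial operators: for $\varphi\in(0,\pi)$ let $S_\varphi:=\{z\in\mathbb{C}\setminus\{0\}\mid|\arg(z)|<\varphi\}$, and let $H^\infty(S_\varphi)$ be the bounded holomorphic functions on $S_\varphi$ with the supremum norm. An operator $A$ on $X$ is sectorial of angle $\varphi$ if $\sigma(A)\subseteq\overline{S_\varphi}$ and $\sup\{\|z(z-A)^{-1}\|\mid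 z\in\mathbb{C}\setminus S_\psi\}<\infty$ for all $\psi\in(\varphi,\pi)$ (points $z\neq0$). Sectorial calculus: let $H_0^\infty(S_\psi)$ be the set of $g\in H^\infty(S_\psi)$ for which there are $C,\delta>0$ with $|g(z)|\leq C|z|^\delta/|1+z|^{2\delta}$ on $S_\psi$. For $A$ sectorial of angle $\varphi<\psi$ and $g\in H_0^\infty(S_\psi)$ set $g(A):=\frac1{2\pi i}\int_{\partial S_{\psi'}}g(z)(z-A)^{-1}dz$ with $\psi'\in(\varphi,\psi)$ and positively oriented boundary. If $A$ is injective, then for $f\in H^\infty(S_\psi)$, and also for $f=\log$, set $f(A):=e(A)^{-1}(ef)(A)$ with natural domain, where $e(z):=z(1+z)^{-2}$; this is a closed operator. Bounded imaginary powers: a sectorial operator $A$ has bounded imaginary powers, written $A\in\mathrm{BIP}(X)$, if $A$ is injective and $-i\log(A)$ generates a $C_0$-group $(U(s))_{s\in\mathbb{R}}\subseteq\mathcal{L}(X)$; then $U(s)=A^{-is}$. Set $\theta_A:=\theta(U):=\inf\{\theta\geq0\mid\exists M\geq1:\|U(s)\|\leq Me^{\theta|s|}\ \forall s\in\mathbb{R}\}$. If $\theta_A<\pi$ then $A$ is sectorial of angle $\theta_A$ (a known theorem), so $f(A)$ is defined for $f\in H^\infty(S_\psi)$ with $\psi\in(\theta_A,\pi)$. Real interpolation: for a closed operator $B$ on $X$, $D_B(\theta,r):=(X,D(B))_{\theta,r}$ is the real interpolation space (K-method) between $X$ and $D(B)$ with graph norm; in particular $D_B(0,1)=\{0\}$.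 *)

(* Defs.v *)
From HB Require Import structures.
From mathcomp Require Import all_boot all_order all_algebra.
From mathcomp Require Import complex.
From mathcomp Require Import all_classical all_reals all_analysis.

Set Implicit Arguments.
Unset Strict Implicit.
Unset Printing Implicit Defensive.

Import Order.TTheory GRing.Theory Num.Theory.
Import numFieldNormedType.Exports.

Local Open Scope classical_set_scope.
Local Open Scope ring_scope.
Local Open Scope complex_scope.

(* The norm of a normed space over R[i] takes its values in R[i]; [rnorm] is
   the same norm with values in R. *)
Definition rnorm (R : realType) (V : normedZmodType R[i]) (v : V) : R :=
  complex.Re `|v|.

Section type_cotype.
Context (R : realType) (d : measure_display) (Omega : measurableType d)
        (P : probability Omega R).
Implicit Types (g : nat -> Omega -> R[i]) (X : completeNormedModType R[i]).

(* Real part (for [false]) or imaginary part (for [true]) of g_k. *)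
Definition coordinate g (i : nat * bool) (w : Omega) : R :=
  if i.2 then complex.Im (g i.1 w) else complex.Re (g i.1 w).

Definition mutually_independent (I : eqType) (xi : I -> Omega -> R) : Prop :=
  forall (s : seq I) (B : I -> set R), uniq s ->
    (forall i, measurable (B i)) ->
    P (\bigcap_(i in [set` s]) (xi i @^-1` B i)) =
      (\prod_(i <- s) P (xi i @^-1` B i))%E.

(* Real and imaginary parts are all independent and of variance 1/2, so that
   each g_k is centred and circularly symmetric with E |g_k|^2 = 1. *)
Definition complex_gaussian_sequence g : Prop :=
  [/\ forall i, measurable_fun [set: Omega] (coordinate g i),
      forall i (B : set R), measurable B ->
        P (coordinate g i @^-1` B) = normal_prob 0 (Num.sqrt 2)^-1 B
    & mutually_independent (coordinate g)].

Definition gaussian_norm g X (n : nat) (x : nat -> X) : \bar R :=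
  ((\int[P]_w ((rnorm (\sum_(k < n) g k w *: x k)) ^+ 2)%:E) `^ 2^-1)%E.

Definition has_type g X (p : R) : Prop :=
  exists C : R, forall (n : nat) (x : nat -> X),
    (gaussian_norm g n x <=
      (C * (\sum_(k < n) rnorm (x k) `^ p) `^ p^-1)%:E)%E.

Definition has_cotype g X (q : R) : Prop :=
  exists C : R, forall (n : nat) (x : nat -> X),
    (((\sum_(k < n) rnorm (x k) `^ q) `^ q^-1)%:E <=
      C%:E * gaussian_norm g n x)%E.

End type_cotype.

Section complex_plane.
Context (R : realType).
Implicit Types (z : R[i]) (f : R[i] -> R[i]) (phi : R).

(* The principal argument, with values in ]-pi, pi] for z != 0. *)
Definition arg z : R :=
  if 0 <= complex.Im z then acos (complex.Re z / rnorm z)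
  else - acos (complex.Re z / rnorm z).

Definition clog z : R[i] := ln (rnorm z) +i* arg z.

Definition expi phi : R[i] := cos phi +i* sin phi.

Definition sector phi : set R[i] := [set z | z != 0 /\ `|arg z| < phi].

Definition Hinf phi : set (R[i] -> R[i]) :=
  [set f | (forall z, sector phi z -> derivable (f : R[i]^o -> R[i]^o) z 1) /\
           has_ubound [set rnorm (f z) | z in sector phi]].

Definition Hinf_norm phi f : R := sup [set rnorm (f z) | z in sector phi].

Definition Hinf0 phi : set (R[i] -> R[i]) :=
  [set f | Hinf phi f /\
           exists C delta : R, [/\ 0 < C, 0 < delta &
             forall z, sector phi z ->
               rnorm (f z) <=
                 C * rnorm z `^ delta / rnorm (1 + z) `^ (2 * delta)]].

Definition regularizer z : R[i] := z * (1 + z) ^- 2.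

End complex_plane.

Section bochner.
Context (R : realType) (X : completeNormedModType R[i]).
Let mu := @lebesgue_measure R.

(* A simple function is given by a list of pairs (E, v), standing for the sum
   of the \1_E v. *)
Definition simple_fun_on (D : set R) (s : seq (set R * X)) : Prop :=
  forall c, c \in s ->
    [/\ measurable c.1, c.1 `<=` D & (mu c.1 < +oo)%E].

Definition simple_eval (s : seq (set R * X)) (t : R) : X :=
  \sum_(c <- s) (\1_(c.1) t : R)%:C *: c.2.

Definition simple_integral (s : seq (set R * X)) : X :=
  \sum_(c <- s) (fine (mu c.1))%:C *: c.2.

(* h is Bochner integrable on D with integral y. *)
Definition is_bochner_integral (D : set R) (h : R -> X) (y : X) : Prop :=
  exists s : nat -> seq (set R * X),
    [/\ forall n, simple_fun_on D (s n),
        forall n, measurable_fun D (fun t => rnorm (h t - simple_eval (s n) t)),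
        (fun n => \int[mu]_(t in D) (rnorm (h t - simple_eval (s n) t))%:E)%E
          @ \oo --> (0 : \bar R)
      & (fun n => simple_integral (s n)) @ \oo --> y].

(* Integral of h dz along the boundary of the sector of angle phi; positively
   oriented, it comes in from infinity on the ray of argument phi and goes out
   on the ray of argument - phi. *)
Definition is_contour_integral (phi : R) (h : R[i] -> X) (y : X) : Prop :=
  exists y1 y2 : X,
    [/\ is_bochner_integral `]0, +oo[
          (fun r => expi (- phi) *: h (r%:C * expi (- phi))) y1,
        is_bochner_integral `]0, +oo[
          (fun r => expi phi *: h (r%:C * expi phi)) y2
      & y = y1 - y2].

End bochner.

(* Operators, bounded or not, are represented by their graphs. *)
Section operators.
Context (R : realType) (X : completeNormedModType R[i]).
Implicit Types (A B T : set (X * X)) (z : R[i]) (f : R[i] -> R[i]).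

Definition is_operator A : Prop :=
  [/\ A (0, 0),
      forall a x y x' y',
        A (x, y) -> A (x', y') -> A (a *: x + x', a *: y + y')
    & forall y, A (0, y) -> y = 0].

Definition domain A : set X := [set u.1 | u in A].

Definition injective_operator A : Prop := forall x, A (x, 0) -> x = 0.

Definition scale_operator z A : set (X * X) := [set (u.1, z *: u.2) | u in A].

(* Operator norm of the restriction of T to the normed space consisting of the
   vectors x such that N x < +oo, with norm N. *)
Definition opnorm_from (N : X -> \bar R) T : \bar R :=
  ereal_sup [set (rnorm u.2)%:E | u in [set u | T u /\ (N u.1 <= 1)%E]].

Definition opnorm T : \bar R := opnorm_from (fun x => (rnorm x)%:E) T.

(* The graph of the inverse of z - A. *)
Definition resolvent A z : set (X * X) :=
  [set u | A (u.2, z *: u.2 - u.1)].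

Definition resolvent_set A : set R[i] :=
  [set z | (forall x, exists! y, resolvent A z (x, y)) /\
           (opnorm (resolvent A z) < +oo)%E].

Definition spectrum A : set R[i] := ~` resolvent_set A.

Definition resolvent_fun A z (x : X) : X :=
  xget 0 [set y | resolvent A z (x, y)].

Definition sectorial (phi : R) A : Prop :=
  [/\ is_operator A,
      0 < phi < pi,
      spectrum A `<=` closure (sector phi : set R[i]^o)
    & forall psi, phi < psi < pi ->
        exists M : R, forall z, z != 0 -> ~ sector psi z ->
          (opnorm (scale_operator z (resolvent A z)) <= M%:E)%E].

(* The graph of g(A), for g in Hinf0 psi. *)
Definition elementary_calculus A (psi : R) (g : R[i] -> R[i]) :
    set (X * X) :=
  [set u | Hinf0 psi g /\
    exists phi psi' : R,
      [/\ sectorial phi A, phi < psi', psi' < psi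
        & is_contour_integral psi' (fun z => g z *: resolvent_fun A z u.1)
            ((2 * pi)%:C * 'i *: u.2)]].

(* The graph of f(A) = e(A)^-1 (e f)(A), for f defined on sector psi. *)
Definition functional_calculus A (psi : R) f : set (X * X) :=
  [set u | exists v : X,
    elementary_calculus A psi (fun z => regularizer z * f z) (u.1, v) /\
    elementary_calculus A psi (@regularizer R) (u.2, v)].

Definition log_operator A : set (X * X) :=
  [set u | exists psi : R,
    psi < pi /\ functional_calculus A psi (@clog R) u].

Definition C0_group (U : R -> {linear X -> X}) : Prop :=
  [/\ forall s, continuous (U s),
      forall x, U 0 x = x,
      forall s t x, U (s + t) x = U s (U t x)
    & forall x, continuous (fun s => U s x)].

Definition generator (U : R -> {linear X -> X}) : set (X * X) :=
  [set u | (h^-1)%:C *: (U h u.1 - u.1) @[h --> (0 : R)^'] --> u.2].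

Definition group_type (U : R -> {linear X -> X}) : R :=
  inf [set theta | 0 <= theta /\
    exists2 M : R, 1 <= M & forall s,
      (opnorm (range (fun x => (x, U s x))) <=
        (M * expR (theta * `|s|))%:E)%E].

(* A has bounded imaginary powers, with U s = A^(- i s). *)
Definition BIP A (U : R -> {linear X -> X}) : Prop :=
  [/\ exists phi : R, sectorial phi A,
      injective_operator A,
      C0_group U
    & generator U = scale_operator (- 'i) (log_operator A)].

(* K-functional of the couple (X, D(B)), D(B) having the graph norm. *)
Definition K_functional B (t : R) (x : X) : \bar R :=
  ereal_inf
    [set (rnorm (x - u.1) + t * (rnorm u.1 + rnorm u.2))%:E | u in B].

Definition interpolation_norm B (theta r : R) (x : X) : \bar R :=
  ((\int[@lebesgue_measure R]_(t in `]0%R, +oo[)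
      (((t `^ (- theta))%:E * K_functional B t x) `^ r * (t^-1)%:E)) `^ r^-1)%E.

Definition interpolation_space B (theta r : R) : set X :=
  [set x | (interpolation_norm B theta r x < +oo)%E].

End operators.

(* Main.v *)
From HB Require Import structures.
Require Import Defs.
From mathcomp Require Import all_boot all_order all_algebra.
From mathcomp Require Import complex.
From mathcomp Require Import all_classical all_reals all_analysis measurable_realfun.
From mathcomp Require Import ring lra.

(** In the logarithmic coordinate [z = exp w] the calculus reads
    [G(log A) x = Psi G x], a Cauchy integral over the lines [|Im w| = nu], and
    equals [\int k(s) A^{-is} x ds] with [k] the Fourier transform of [G] when
    [G] decays.  If [G] lives at scale [N], cutting the group orbit into steps
    of length [2 pi / N] turns this integral into a Toeplitz operator with an
    [N]-periodic symbol, that is, into a Fourier multiplier on vectors of length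
    [N].  Gaussian sums are invariant under the unitary Fourier matrix, so type
    [p] and cotype [q] bound it by [N^(1/p - 1/q)] up to a constant.  Splitting
    [f (exp w)] into dyadic pieces of scale [N = 2^k], and [x = (x - u) + u]
    with [u] in the domain of [log A], on which each piece gains a factor
    [1 / N], the sum over [k] is controlled by the dyadic sum of the
    [K]-functional, hence by the interpolation norm. *)

Set Implicit Arguments.
Unset Strict Implicit.
Unset Printing Implicit Defensive.

Import Order.TTheory GRing.Theory Num.Theory.
Import numFieldNormedType.Exports.

Local Open Scope classical_set_scope.
Local Open Scope ring_scope.
Local Open Scope complex_scope.

Local Notation "'i" := (@Complex _ 0 1) : ring_scope.
Local Notation Re := complex.Re.
Local Notation Im := complex.Im.

(** The exponent arises as follows: type turns [N] vectors of norm at most [B] into a Gaussian sum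
    of size [N^(1/p) B], and cotype followed by Hoelder bounds a sum of [N] norms with a factor
    [N^(1 - 1/q)]. The remaining powers of [N] come from the unnormalised Fourier matrices and
    cancel against an average over all [N^2] pairs of steps. Two things must be proved before any
    block can be estimated. The hypothesis on [A] provides some angle of sectoriality, possibly
    larger than [psi], so the contours of the calculus on the sector need not exist; the angle is
    lowered to any value above the group type, by writing differences of resolvents as integrals of
    the group. Also, only the generator of the group is given: that the group acts as [A^{-is}]
    inside the calculus follows from a derivative computation after multiplication by [e(A)], undone
    by the injectivity of [e(A)]. The cutoffs have to be holomorphic in the strip, hence they are
    rational and the dyadic pieces overlap. Vector integrals are weak ones, tested against real
    functionals; Bochner integrals serve to produce values and to meet the definition of the contour
    integral. *)

Ltac cparts := apply/eqP; rewrite eq_complex /=; apply/andP; split; apply/eqP; ring.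

(** * Real-valued norms and the Hahn-Banach theorem *)

Section real_norm.
Context (R : realType).
Implicit Types (V : normedZmodType R[i]).

Lemma realcD (r s : R) : (r + s)%:C = r%:C + s%:C.
Proof. exact: rmorphD. Qed.

Lemma realcM (r s : R) : (r * s)%:C = r%:C * s%:C.
Proof. exact: rmorphM. Qed.

Lemma rnormE V (v : V) : `|v| = (rnorm v)%:C.
Proof.
have := normr_ge0 v; rewrite lecE => /andP[/eqP h _].
by apply/eqP; rewrite eq_complex /= eqxx h eqxx.
Qed.

Lemma rnorm_ge0 V (v : V) : 0 <= rnorm v.
Proof. by have := normr_ge0 v; rewrite lecE => /andP[]. Qed.

Lemma rnorm0 V : rnorm (0 : V) = 0.
Proof. by rewrite /rnorm normr0. Qed.

Lemma rnorm_eq0 V (v : V) : rnorm v = 0 -> v = 0.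
Proof. by move=> h; apply/eqP; rewrite -normr_eq0 rnormE h. Qed.

Lemma rnormN V (v : V) : rnorm (- v) = rnorm v.
Proof. by rewrite /rnorm normrN. Qed.

Lemma rnormB V (u v : V) : rnorm (u - v) = rnorm (v - u).
Proof. by rewrite -rnormN opprB. Qed.

Lemma ler_rnormD V (u v : V) : rnorm (u + v) <= rnorm u + rnorm v.
Proof. by have := ler_normD u v; rewrite !rnormE -realcD lecR. Qed.

Lemma ler_rnormB V (u v : V) : rnorm (u - v) <= rnorm u + rnorm v.
Proof. by rewrite -[rnorm v]rnormN ler_rnormD. Qed.

Lemma ler_rnorm_dist V (u v : V) : rnorm u <= rnorm v + rnorm (u - v).
Proof. by rewrite -{1}[u](subrK v) addrC ler_rnormD. Qed.

Lemma ler_rnorm_sum V (I : Type) (r : seq I) (P : pred I) (F : I -> V) :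
 rnorm (\sum_(i <- r | P i) F i) <= \sum_(i <- r | P i) rnorm (F i).
Proof.
elim/big_rec2: _ => [|i y x _ h]; first by rewrite rnorm0.
by rewrite (le_trans (ler_rnormD _ _))// lerD2l.
Qed.

Lemma rnormM (a b : R[i]) : rnorm (a * b) = rnorm a * rnorm b.
Proof. by rewrite /rnorm normrM !rnormE /=; ring. Qed.

Lemma rnormZ (V : normedModType R[i]) (a : R[i]) (v : V) :
 rnorm (a *: v) = rnorm a * rnorm v.
Proof. by rewrite /rnorm normrZ !rnormE /=; ring. Qed.

Lemma rnorm1 : rnorm (1 : R[i]) = 1.
Proof. by rewrite /rnorm normr1. Qed.

Lemma rnormV (a : R[i]) : rnorm a^-1 = (rnorm a)^-1.
Proof.
have [->|a0] := eqVneq a 0; first by rewrite invr0 rnorm0 invr0.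
have h : rnorm a != 0 by apply/eqP => /rnorm_eq0 /eqP; rewrite (negbTE a0).
by apply: (mulfI h); rewrite -rnormM !mulfV // rnorm1.
Qed.

Lemma rnormX (a : R[i]) n : rnorm (a ^+ n) = rnorm a ^+ n.
Proof.
by elim: n => [|n IH]; rewrite ?rnorm1 // !exprS rnormM IH.
Qed.

Lemma rnorm_real (r : R) : rnorm r%:C = `|r|.
Proof. by rewrite /rnorm normc_def /= expr0n addr0 sqrtr_sqr. Qed.

Lemma rnormi : rnorm ('i : R[i]) = 1.
Proof. by rewrite /rnorm normc_def /= expr0n add0r expr1n sqrtr1. Qed.

Lemma rnormc (a : R[i]) :
 rnorm a = Num.sqrt (Re a ^+ 2 + Im a ^+ 2).
Proof. by rewrite /rnorm normc_def. Qed.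

Lemma sqr_rnormc (a : R[i]) :
 rnorm a ^+ 2 = Re a ^+ 2 + Im a ^+ 2.
Proof. by rewrite rnormc sqr_sqrtr // addr_ge0 ?sqr_ge0. Qed.

Lemma normr_Re_le (a : R[i]) : `|Re a| <= rnorm a.
Proof.
rewrite -sqrtr_sqr rnormc ler_sqrt ?lerDl ?sqr_ge0 //.
by rewrite addr_ge0 ?sqr_ge0.
Qed.

Lemma normr_Im_le (a : R[i]) : `|Im a| <= rnorm a.
Proof.
rewrite -sqrtr_sqr rnormc ler_sqrt ?lerDr ?sqr_ge0 //.
by rewrite addr_ge0 ?sqr_ge0.
Qed.

Lemma rnorm_le_ReIm (a : R[i]) : rnorm a <= `|Re a| + `|Im a|.
Proof.
rewrite -(@ler_pXn2r _ 2) ?nnegrE ?rnorm_ge0 //.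
by rewrite sqr_rnormc sqrrD !real_normK ?num_real // lerD2r lerDl mulrn_wge0.
Qed.

Lemma gt0_complex (d : R[i]) : 0 < d -> 0 < Re d /\ d = (Re d)%:C.
Proof.
rewrite ltcE /= => /andP[/eqP d0 h1]; split=> //.
by apply/eqP; rewrite eq_complex /= eqxx d0 eqxx.
Qed.

Lemma eq_rnorm_small V (x y : V) : (forall e, 0 < e -> rnorm (x - y) <= e) -> x = y.
Proof.
move=> h; apply/eqP; rewrite -subr_eq0; apply/eqP/rnorm_eq0/eqP; rewrite eq_le rnorm_ge0 andbT.
by apply/ler_addgt0Pr => e e0; rewrite add0r h.
Qed.

Lemma scalecE (V : lmodType R[i]) (c : R[i]) (v : V) :
 c *: v = (Re c)%:C *: v + (Im c)%:C *: ('i *: v).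
Proof.
rewrite scalerA -scalerDl {1}[c]complexE; congr (_ *: _); congr (_ + _).
by rewrite mulrC.
Qed.

End real_norm.

Local Hint Resolve rnorm_ge0 expR_ge0 powR_ge0 sqr_ge0 : core.

Section hahn_banach.
Context (R : realType) (V : normedModType R[i]).

(** Real-linear functionals are used on a complex space because the extension step and the scalar
    integrals are then real; the complex structure is recovered by [lc]. The norm is at most one, so
    estimates carry no constant for the functional. *)
Definition rfun (l : V -> R) :=
 [/\ forall u v, l (u + v) = l u + l v,
 forall (r : R) v, l (r%:C *: v) = r * l v
 & forall v, `|l v| <= rnorm v].

(** Graphs of partial functionals. The one-sided bound suffices: applied to the opposite vector it
    gives the other side, and at [0] it makes the relation single-valued. *)
Let good (G : set (V * R)) :=
 [/\ forall u a v b, G (u, a) -> G (v, b) -> G (u + v, a + b),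
 forall r u a, G (u, a) -> G (r%:C *: u, r * a)
 & forall u a, G (u, a) -> a <= rnorm u].

Let good_fun G u a b : good G -> G (u, a) -> G (u, b) -> a = b.
Proof.
move=> [gD gZ gn] ua ub.
have e : (-1)%:C *: u = - u :> V by rewrite rmorphN scaleN1r.
have := gD _ _ _ _ ua (gZ (-1) _ _ ub); rewrite e subrr mulN1r => /gn.
have := gD _ _ _ _ ub (gZ (-1) _ _ ua); rewrite e subrr mulN1r => /gn.
rewrite rnorm0; lra.
Qed.

(** The value at [v] has to lie between all [a - rnorm (u - v)] and all [rnorm (w + v) - b]. The
    triangle inequality orders these two families, so the supremum of the first one will do. *)
Let extend (G : set (V * R)) v : good G -> G (0, 0) ->
 exists2 G', good G' & G `<=` G' /\ exists a, G' (v, a).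
Proof.
move=> [gD gZ gn] G0.
pose S := [set x | exists u a, G (u, a) /\ x = a - rnorm (u - v)].
have key u a w b : G (u, a) -> G (w, b) -> a - rnorm (u - v) <= rnorm (w + v) - b.
 move=> ua wb; have := gn _ _ (gD _ _ _ _ ua wb).
 have := ler_rnormD (u - v) (w + v).
 rewrite addrACA [- v + v]addrC subrr addr0; lra.
have S0 : S !=set0 by exists (0 - rnorm (0 - v)), 0, 0.
have Sub : has_ubound S.
 by exists (rnorm (0 + v) - 0) => _ [u [a [ua ->]]]; exact: key.
pose al := sup S.
have al1 u a : G (u, a) -> a - rnorm (u - v) <= al.
 by move=> ua; apply: ub_le_sup => //; exists u, a.
have al2 w b : G (w, b) -> al <= rnorm (w + v) - b.
 move=> wb; apply: ge_sup => // _ [u [a [ua ->]]]; exact: key.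
exists [set p | exists u a r, [/\ G (u, a), p.1 = u + r%:C *: v & p.2 = a + r * al]].
 split=> /=.
 - move=> _ _ _ _ [u [a [r [ua /= -> ->]]]] [w [b [s [wb -> ->]]]].
 exists (u + w), (a + b), (r + s); split; [exact: gD| |by ring].
 by rewrite realcD scalerDl addrACA.
 - move=> s _ _ [u [a [r [ua /= -> ->]]]].
 exists (s%:C *: u), (s * a), (s * r); split; [exact: gZ| |by ring].
 by rewrite scalerDr scalerA -realcM.
 - move=> _ _ [u [a [r [ua /= -> ->]]]].
 have [r0|r0|->] := ltrgtP r 0; last first.
 + by rewrite scale0r mul0r !addr0; exact: gn.
 + have := al2 _ _ (gZ r^-1 _ _ ua) => h.
 have -> : u + r%:C *: v = r%:C *: ((r^-1)%:C *: u + v).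
 rewrite scalerDr scalerA -realcM mulfV ?gt_eqF //.
 by rewrite scale1r.
 rewrite rnormZ rnorm_real gtr0_norm //.
 move: h; rewrite -(ler_pM2l r0) mulrBr mulrA mulfV ?gt_eqF // mul1r.
 lra.
 + have r1 : 0 < - r by rewrite oppr_gt0.
 have := al1 _ _ (gZ (- r)^-1 _ _ ua) => h.
 have -> : u + r%:C *: v = (- r)%:C *: (((- r)^-1)%:C *: u - v).
 rewrite scalerBr scalerA -realcM mulfV ?gt_eqF //.
 by rewrite scale1r rmorphN /= scaleNr opprK.
 rewrite rnormZ rnorm_real gtr0_norm //.
 move: h; rewrite -(ler_pM2l r1) mulrBr mulrA mulfV ?gt_eqF // mul1r.
 lra.
split.
 by move=> [u a] ua; exists u, a, 0; split => //=; rewrite ?scale0r ?mul0r addr0.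
by exists al, 0, 0, 1; split => //=; rewrite ?scale1r ?mul1r add0r.
Qed.

Lemma hahn_banach (x : V) : exists2 l, rfun l & l x = rnorm x.
Proof.
pose line := [set p : V * R | exists r, p = (r%:C *: x, r * rnorm x)].
have good_line : good line.
 split.
 - move=> _ _ _ _ [r [-> ->]] [s [-> ->]]; exists (r + s).
 by rewrite realcD scalerDl mulrDl.
 - move=> s _ _ [r [-> ->]]; exists (s * r).
 by rewrite realcM scalerA mulrA.
 - move=> _ _ [r [-> ->]]; rewrite rnormZ rnorm_real ler_wpM2r ?rnorm_ge0 //.
 exact: ler_norm.
have linex : line (x, rnorm x) by exists 1; rewrite scale1r mul1r.
pose P G := G = set0 \/ good G /\ G (x, rnorm x).
have [|A [PA maxA]] := @Zorn_bigcup _ P.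
 move=> F FP tot.
 have [[G0 [FG0 G0x]]|nF] := pselect (exists G, F G /\ G (x, rnorm x)); last first.
 left; rewrite -subset0 => p [G FG Gp].
 have [G0|[_ Gx]] := FP _ FG; first by rewrite G0 in Gp.
 by apply: nF; exists G.
 right; split; last by exists G0.
 have gF G p : F G -> G p -> good G.
 by move=> /FP [->|[]].
 split.
 - move=> u a v b [G FG Gu] [H FH Hv].
 have [GH|HG] := tot _ _ FG FH.
 exists H => //; have [gD _ _] := gF _ _ FH Hv.
 by apply: gD => //; exact: GH.
 exists G => //; have [gD _ _] := gF _ _ FG Gu.
 by apply: gD => //; exact: HG.
 - move=> r u a [G FG Gu]; exists G => //.
 by have [_ gZ _] := gF _ _ FG Gu; exact: gZ.
 - by move=> u a [G FG Gu]; have [_ _ gn] := gF _ _ FG Gu; exact: gn.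
have [gA Ax] : good A /\ A (x, rnorm x).
 case: PA => // A0; exfalso; apply: (maxA line); last by right.
 rewrite A0; split; first by [].
 by move=> h; have := h _ linex.
have A00 : A (0, 0).
 by have [_ gZ _] := gA; have := gZ 0 _ _ Ax; rewrite scale0r mul0r.
have Atot v : exists a, A (v, a).
 have [G' gG' [AG' [a G'a]]] := extend v gA A00.
 exists a; apply: contrapT => nA; apply: (maxA G').
 by split => // G'A; apply: nA; exact: G'A.
 by right; split => //; exact: AG'.
have [l lP] := choice Atot.
have lE v a : A (v, a) -> l v = a.
 by move=> Av; apply: (good_fun gA (lP v) Av).
have [gD gZ gn] := gA.
exists l; last exact: lE.
split.
- by move=> u v; apply: lE; exact: gD.
- by move=> r v; apply: lE; exact: gZ.
- move=> v; rewrite ler_norml gn // andbT lerNl.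
 have := gn _ _ (gZ (-1) _ _ (lP v)).
 by rewrite mulN1r rnormZ rnorm_real normrN1 mul1r.
Qed.

Lemma rfun_eq (x y : V) : (forall l, rfun l -> l x = l y) -> x = y.
Proof.
move=> h; have [l [lD lZ ln] lx] := hahn_banach (x - y).
apply/eqP; rewrite -subr_eq0; apply/eqP/rnorm_eq0; rewrite -lx.
have e : (-1)%:C *: y = - y :> V by rewrite rmorphN scaleN1r.
by rewrite lD -e lZ h // mulN1r subrr.
Qed.

End hahn_banach.

(** * Integration of vector-valued functions *)

Section joint_measurability.
Context (R : realType) (d : measure_display) (T : measurableType d).
Local Notation RM := (measurableTypeR R).

(** Rounding [s] down to a grid of mesh [1/(n+1)] gives a function constant in [s] on each cell,
    whose level sets are countable unions of rectangles; continuity in [s] lets the mesh tend to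
    zero. *)
Lemma caratheodory_measurable_fun (f : R -> T -> R) :
 (forall s, measurable_fun setT (f s)) -> (forall t, continuous (f^~ t)) ->
 measurable_fun setT (fun p : RM * T => f p.1 p.2).
Proof.
move=> mf cf.
pose r n (s : R) : R := (Num.floor (n.+1%:R * s))%:~R / n.+1%:R.
apply: (@measurable_fun_cvg _ _ _ _ (fun n p => f (r n p.1) p.2)) => [n|[s t] _ /=].
 move=> _ Y mY; rewrite setTI.
 rewrite (_ : _ @^-1` Y = \bigcup_(k : int)
 ([set s | Num.floor (n.+1%:R * s) = k] `*`
 [set t | Y (f (k%:~R / n.+1%:R) t)])); last first.
 apply/seteqP; split => [[s t] /= Yst|[s t] [k _ [/= <-]] //].
 by exists (Num.floor (n.+1%:R * s)).
 apply: countable_bigcupT_measurable => // k; apply: measurableX; last first.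
 by have := mf (k%:~R / n.+1%:R) measurableT _ mY; rewrite setTI.
 rewrite (_ : [set s | _] = `[k%:~R / n.+1%:R, (k + 1)%:~R / n.+1%:R[%classic) //.
 apply/seteqP; split => s /=; rewrite in_itv /= ler_pdivrMr // ltr_pdivlMr // ![s * _]mulrC.
 by move=> <-; exact: floor_itv.
 by move=> /floor_def.
have : r n s @[n --> \oo] --> s.
 have h : forall n, s - n.+1%:R^-1 <= r n s <= s.
 move=> n; have /andP[h1 h2] := floor_itv (n.+1%:R * (s : R)).
 rewrite /r; apply/andP; split; last by rewrite ler_pdivrMr // [(s : R) * _]mulrC.
 rewrite ler_pdivlMr // mulrBl mulVf // [(s : R) * _]mulrC.
 by move: h2; rewrite rmorphD /=; lra.
 apply: (@squeeze_cvgr _ _ _ _ (fun n => s - n.+1%:R^-1) (fun=> s)).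
 - by near=> n; exact: h.
 - rewrite -[X in _ --> X]subr0; apply: cvgB; first exact: cvg_cst.
 exact: cvg_harmonic.
 - exact: cvg_cst.
by move=> rs; exact: (cvg_comp _ _ rs (cf t s)).
Unshelve. all: by end_near. Qed.

End joint_measurability.

Section real_integrals.
Context (R : realType).
Local Notation RM := (measurableTypeR R).
Let mu := @lebesgue_measure R.

Lemma le_rintegrable (D : set RM) (f g : R -> R) : measurable D ->
 measurable_fun D f -> (forall t, D t -> `|f t| <= g t) ->
 mu.-integrable D (EFin \o g) -> mu.-integrable D (EFin \o f).
Proof.
move=> mD mf fg; apply: le_integrable => //; first exact/measurable_EFinP.
move=> t Dt; rewrite /= lee_fin; apply: le_trans (fg t Dt) _; exact: ler_norm.
Qed.

Lemma eq_rintegrable (D : set RM) (f g : R -> R) : measurable D ->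
 mu.-integrable D (EFin \o f) -> (forall t, D t -> f t = g t) ->
 mu.-integrable D (EFin \o g).
Proof.
move=> mD fi fg; apply: eq_integrable fi => // t /[!inE] Dt.
by rewrite /= fg.
Qed.

Lemma EFin_Rintegral (D : set RM) (f : R -> R) : measurable D ->
 mu.-integrable D (EFin \o f) ->
 (\int[mu]_(x in D) f x)%:E = (\int[mu]_(x in D) (f x)%:E)%E.
Proof. by move=> mD fi; rewrite fineK //; exact: integrable_fin_num. Qed.

Lemma le_normr_Rint (D : set RM) (f g : R -> R) : measurable D ->
 mu.-integrable D (EFin \o f) -> mu.-integrable D (EFin \o g) ->
 (forall t, D t -> `|f t| <= g t) ->
 `|\int[mu]_(t in D) f t| <= \int[mu]_(t in D) g t.
Proof.
move=> mD fi gi fg; have h := le_normr_Rintegral mD fi; apply: le_trans h _.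
apply: le_Rintegral => //; exact: integrable_norm.
Qed.

Lemma integrable_cst_itv (a b c : R) : mu.-integrable (`[a, b]%classic : set RM) (EFin \o (fun _ : R => c)).
Proof.
apply: continuous_compact_integrable; first exact: segment_compact.
by apply: continuous_subspaceT => t; exact: cst_continuous.
Qed.

(** A majorant of product form makes the double integral finite by Tonelli and bounds both partial
    integrals as well, so a single hypothesis covers all integrability questions. *)
Lemma fubini_dominated (f : R -> R -> R) (a b : R -> R) :
 mu.-integrable setT (EFin \o a) -> mu.-integrable setT (EFin \o b) ->
 measurable_fun setT (fun p : RM * RM => f p.1 p.2) ->
 (forall s t, `|f s t| <= a s * b t) ->
 [/\ mu.-integrable setT (EFin \o (fun s => \int[mu]_t f s t)),
 mu.-integrable setT (EFin \o (fun t => \int[mu]_s f s t))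
 & \int[mu]_s \int[mu]_t f s t = \int[mu]_t \int[mu]_s f s t].
Proof.
move=> ia ib mf fab.
pose F (p : RM * RM) := (f p.1 p.2)%:E.
have mF : measurable_fun setT F by exact/measurable_EFinP.
have ms s : measurable_fun (setT : set RM) (f s).
 exact: (measurableT_comp mf (pair1_measurable s)).
have mt t : measurable_fun (setT : set RM) (f^~ t).
 exact: (measurableT_comp mf (pair2_measurable t)).
have is_ s : mu.-integrable setT (EFin \o f s).
 apply: (@le_rintegrable _ _ (fun t => a s * b t)) => //.
 exact: (integrableZl _ (a s) ib).
have it t : mu.-integrable setT (EFin \o f^~ t).
 apply: (@le_rintegrable _ _ (fun s => a s * b t)) => //.
 exact: (integrableZr _ (b t) ia).
have iF : (mu \x mu)%E.-integrable setT F.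
 apply/integrable12ltyP => //.
 apply: (@le_lt_trans _ _ (\int[mu]_s (`|a s| * \int[mu]_t `|b t|)%:E)%E).
 apply: ge0_le_integral => //.
 - by move=> s _; apply: integral_ge0.
 - apply: (@measurable_fun_fubini_tonelli_F _ _ _ _ _ mu (abse \o F)) => //.
 exact: measurableT_comp.
 by move=> x; exact: abse_ge0.
 - apply/measurable_EFinP; apply: measurable_funM => //.
 by apply: measurableT_comp => //; have /integrableP[/measurable_EFinP] := ia.
 - move=> s _; rewrite EFinM EFin_Rintegral //; last exact: integrable_norm.
 rewrite -ge0_integralZl //; last first.
 by apply/measurable_EFinP/measurableT_comp => //; have /integrableP[/measurable_EFinP] := ib.
 apply: ge0_le_integral => //.
 + by apply: measurableT_comp => //; apply/measurable_EFinP; exact: ms.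
 + apply/measurable_EFinP/measurable_funM => //.
 by apply: measurableT_comp => //; have /integrableP[/measurable_EFinP] := ib.
 + move=> t _; rewrite -EFinM lee_fin -normrM.
 by rewrite (le_trans (fab s t)) // ler_norm.
 have ia' := integrable_norm ia.
 have := integrableZr measurableT (\int[mu]_t `|b t|) ia'.
 by move=> /integrable_fin_num h; rewrite ltey_eq h.
have e1 s : (\int[mu]_t f s t)%:E = fubini_F mu F s by rewrite EFin_Rintegral.
have e2 t : (\int[mu]_s f s t)%:E = fubini_G mu F t by rewrite EFin_Rintegral.
have i1 : mu.-integrable setT (EFin \o (fun s => \int[mu]_t f s t)).
 apply: eq_integrable (integrable_fubini_F iF) => // s _.
 by rewrite /= e1.
have i2 : mu.-integrable setT (EFin \o (fun t => \int[mu]_s f s t)).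
 apply: (@le_rintegrable _ _ (fun t => `|b t| * \int[mu]_s `|a s|)) => //.
 - apply/measurable_EFinP; rewrite (_ : EFin \o _ = fubini_G mu F).
 exact: measurable_fubini_G iF.
 by apply/funext => t; rewrite -e2.
 - move=> t _; rewrite -RintegralZl //; last exact: integrable_norm.
 apply: le_normr_Rint => // [|s _].
 exact: (integrableZl _ `|b t| (integrable_norm ia)).
 by rewrite (le_trans (fab s t)) // (le_trans (ler_norm _)) // normrM mulrC.
 - exact: (integrableZr _ (\int[mu]_s `|a s|) (integrable_norm ib)).
split; [exact: i1|exact: i2|rewrite /Rintegral; congr fine].
under eq_integral do rewrite e1.
under [RHS]eq_integral do rewrite e2.
exact: Fubini.
Qed.

End real_integrals.

Section weak_integral.
Context (R : realType).
Local Notation RM := (measurableTypeR R).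
Let mu := @lebesgue_measure R.
Implicit Types (D : set RM).

(** The Pettis integral, against real functionals: identities and estimates become scalar, and
    Fubini needs no vector-valued version. Existence is supplied by [bochner_exists]. *)
Definition is_wint (V : normedModType R[i]) D (h : R -> V) (y : V) :=
 forall l, rfun l -> mu.-integrable D (EFin \o (l \o h)) /\
 \int[mu]_(t in D) l (h t) = l y.

Lemma wint_unique (V : normedModType R[i]) D (h : R -> V) y y' :
 is_wint D h y -> is_wint D h y' -> y = y'.
Proof.
by move=> hy hy'; apply: rfun_eq => l rl; rewrite -(hy l rl).2 -(hy' l rl).2.
Qed.

Lemma wint_eq (V : normedModType R[i]) D (h g : R -> V) y :
 measurable D -> is_wint D h y -> (forall t, D t -> h t = g t) ->
 is_wint D g y.
Proof.
move=> mD hy hg l rl; have [i e] := hy l rl; split.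
 by apply: eq_rintegrable i _ => // t Dt; rewrite /= hg.
by rewrite -e; apply: eq_Rintegral => t /[!inE] Dt; rewrite /= hg.
Qed.

Lemma wintD (V : normedModType R[i]) D (h g : R -> V) y z : measurable D ->
 is_wint D h y -> is_wint D g z -> is_wint D (fun t => h t + g t) (y + z).
Proof.
move=> mD hy gz l rl; have [i e] := hy l rl; have [i' e'] := gz l rl.
have [lD _ _] := rl; split.
 apply: (@eq_rintegrable _ _ (fun t => l (h t) + l (g t)) _ mD) => [|t _].
 exact: (integrableD mD i i').
 by rewrite /= lD.
under eq_Rintegral do rewrite lD.
by rewrite RintegralD // lD e e'.
Qed.

Definition rlinear_map (V W : normedModType R[i]) (C : R) (T : V -> W) :=
 [/\ forall u v, T (u + v) = T u + T v,
 forall (r : R) v, T (r%:C *: v) = r%:C *: T v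
 & forall v, rnorm (T v) <= C * rnorm v].

Lemma wint_map (V W : normedModType R[i]) D (h : R -> V) y C (T : V -> W) :
 measurable D -> rlinear_map C T -> is_wint D h y ->
 is_wint D (T \o h) (T y).
Proof.
move=> mD [TD TZ TC] hy l [lD lZ ln].
have C0 : 0 < `|C| + 1 by rewrite ltr_wpDl.
(* [l] after [T] has norm at most [C]; dividing by the absolute value of [C] plus one, which is
   never zero, brings it back among the functionals of norm at most one. *)
pose l' v := (`|C| + 1)^-1 * l (T v).
have rl' : rfun l'.
 split; rewrite /l'.
 - by move=> u v; rewrite TD lD mulrDr.
 - by move=> r v; rewrite TZ lZ; ring.
 - move=> v; rewrite normrM gtr0_norm ?invr_gt0 // mulrC ler_pdivrMr //.
 apply: le_trans (ln _) (le_trans (TC _) _).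
 rewrite mulrC ler_wpM2l ?rnorm_ge0 //.
 by rewrite (le_trans (ler_norm _)) // lerDl.
have [i e] := hy l' rl'.
have lT v : l (T v) = (`|C| + 1) * l' v by rewrite /l' mulrA mulfV ?gt_eqF // mul1r.
split.
 apply: (@eq_rintegrable _ _ (fun t => (`|C| + 1) * l' (h t)) _ mD) => [|t _].
 exact: (integrableZl mD (`|C| + 1) i).
 by rewrite /= lT.
under eq_Rintegral do rewrite /= lT.
by rewrite RintegralZl // e lT.
Qed.

Lemma rlinear_scale (V : normedModType R[i]) (c : R[i]) :
 rlinear_map (rnorm c) (fun v : V => c *: v).
Proof.
split; first by move=> u v; rewrite scalerDr.
 by move=> r v; rewrite !scalerA mulrC.
by move=> v; rewrite rnormZ.
Qed.

Lemma rlinear_scalel (V : normedModType R[i]) (v : V) :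
 rlinear_map (rnorm v) (fun c : R[i]^o => c *: v).
Proof.
split; first by move=> a b; rewrite scalerDl.
 by move=> r a; rewrite scalerA.
by move=> a; rewrite rnormZ mulrC.
Qed.

Lemma wintZ (V : normedModType R[i]) D (h : R -> V) y (c : R[i]) :
 measurable D -> is_wint D h y -> is_wint D (fun t => c *: h t) (c *: y).
Proof. by move=> mD; exact: (wint_map mD (rlinear_scale V c)). Qed.

Lemma wintB (V : normedModType R[i]) D (h g : R -> V) y z : measurable D ->
 is_wint D h y -> is_wint D g z -> is_wint D (fun t => h t - g t) (y - z).
Proof.
move=> mD hy gz; rewrite -scaleN1r; apply: wint_eq mD (wintD mD hy (wintZ (-1) mD gz)) _ => t _.
by rewrite scaleN1r.
Qed.

Lemma wint_norm (V : normedModType R[i]) D (h : R -> V) y (b : R -> R) :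
 measurable D -> is_wint D h y -> mu.-integrable D (EFin \o b) ->
 (forall t, D t -> rnorm (h t) <= b t) ->
 rnorm y <= \int[mu]_(t in D) b t.
Proof.
move=> mD hy ib hb; have [l rl <-] := hahn_banach y.
have [i <-] := hy l rl; apply: le_trans (ler_norm _) _.
apply: le_normr_Rint => // t Dt; apply: le_trans (hb t Dt).
by case: rl.
Qed.

Lemma wint0 (V : normedModType R[i]) D : measurable D ->
 is_wint D (fun=> 0 : V) 0.
Proof.
move=> mD l [lD lZ ln].
have l0 : l 0 = 0 by have := lZ 0 0; rewrite scale0r mul0r.
split; last by rewrite l0 /Rintegral integral0_eq // => t _; rewrite l0.
by apply: (@eq_rintegrable _ _ (fun=> 0) _ mD) => [|t _ /=]; [exact: integrable0|rewrite l0].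
Qed.

Lemma wint_sum (V : normedModType R[i]) D I (r : seq I) (h : I -> R -> V) y :
 measurable D -> (forall i, is_wint D (h i) (y i)) ->
 is_wint D (fun t => \sum_(i <- r) h i t) (\sum_(i <- r) y i).
Proof.
move=> mD hy; elim: r => [|i r IH].
 by rewrite big_nil; apply: (wint_eq mD (@wint0 V D mD)) => t _; rewrite big_nil.
rewrite big_cons; apply: (wint_eq mD (wintD mD (hy i) IH)) => t _.
by rewrite big_cons.
Qed.

(** Scalar Fubini for each [l (F s t)]. The form is chosen so that one known iterated integral
    yields the other without a separate existence proof; every exchange of two contours, or of a
    contour with the group, uses it. *)
Lemma wint_fubini (V : normedModType R[i]) (F : R -> R -> V) (a b : R -> R)
 (I J : R -> V) y :
 mu.-integrable setT (EFin \o a) -> mu.-integrable setT (EFin \o b) ->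
 (forall l, rfun l ->
 measurable_fun setT (fun p : RM * RM => l (F p.1 p.2))) ->
 (forall s t, rnorm (F s t) <= a s * b t) ->
 (forall s, is_wint setT (F s) (I s)) ->
 (forall t, is_wint setT (F^~ t) (J t)) ->
 is_wint setT I y -> is_wint setT J y.
Proof.
move=> ia ib mF Fab FI FJ Iy l rl; have [lD lZ ln] := rl.
have [i1 i2 e] := @fubini_dominated R (fun s t => l (F s t)) a b ia ib (mF l rl)
 (fun s t => le_trans (ln _) (Fab s t)).
have eI s : \int[mu]_t l (F s t) = l (I s) := (FI s l rl).2.
have eJ t : \int[mu]_s l (F s t) = l (J t) := (FJ t l rl).2.
split.
 by apply: eq_rintegrable i2 _ => // t _; rewrite /= eJ.
rewrite -(Iy l rl).2; under eq_Rintegral do rewrite -eJ.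
rewrite -e; by under eq_Rintegral do rewrite eI.
Qed.

End weak_integral.

Lemma eq_ler (R : numDomainType) (a b : R) : a = b -> a <= b.
Proof. by move=> ->. Qed.

Section rnorm_limits.
Context (R : realType) (V : normedModType R[i]).

Lemma cvg_rnormP (T : Type) (F : set_system T) {FF : Filter F} (f : T -> V) (y : V) :
 f @ F --> y <-> rnorm (f t - y) @[t --> F] --> (0 : R).
Proof.
split=> h.
 apply/cvgrPdist_lt => e e0.
 have e0' : 0 < e%:C :> R[i] by rewrite ltcR.
 have /cvgrPdist_lt/(_ _ e0') := h; apply: filterS => t.
 by rewrite rnormE ltcR sub0r normrN ger0_norm ?rnorm_ge0 // rnormB.
apply/cvgrPdist_lt => e e0.
have [e1 e2] := gt0_complex e0.
have /cvgrPdist_lt/(_ _ e1) := h; apply: filterS => t.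
by rewrite e2 rnormE ltcR sub0r normrN ger0_norm ?rnorm_ge0 // rnormB.
Qed.

Lemma cvg_rnorm_seqP (f : nat -> V) (y : V) :
 f @ \oo --> y <-> forall e, 0 < e -> \forall n \near \oo, rnorm (f n - y) < e.
Proof.
rewrite cvg_rnormP; split => [/cvgrPdist_lt h e /h|h].
 by apply: filterS => n; rewrite sub0r normrN ger0_norm ?rnorm_ge0.
apply/cvgrPdist_lt => e /h; apply: filterS => n.
by rewrite sub0r normrN ger0_norm ?rnorm_ge0.
Qed.

End rnorm_limits.

Lemma rnorm_cauchy_cvg (R : realType) (X : completeNormedModType R[i]) (u : nat -> X)
 (b : nat -> R) :
 (forall m n, rnorm (u n - u m) <= b n + b m) -> b n @[n --> \oo] --> (0 : R) ->
 exists y : X, u @ \oo --> y.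
Proof.
move=> hb b0; suff : cvg (u @ \oo) by move=> cu; exists (lim (u @ \oo)).
apply: cauchy_cvg; apply/cauchyP => e e0.
have [e1 e2] := gt0_complex e0.
have e3 : 0 < Re e / 2 by rewrite divr_gt0.
have /cvgrPdist_lt/(_ _ e3) [N _ hN] := b0.
exists (u N); exists N => // n /= Nn; rewrite -ball_normE /= e2 rnormE ltcR.
apply: le_lt_trans (hb _ _) _.
have := hN _ Nn; have := hN N (leqnn N) => /=; rewrite !sub0r !normrN.
move=> h1 h2; have := ler_norm (b n); have := ler_norm (b N); lra.
Qed.

Section bochner_theory.
Context (R : realType) (X : completeNormedModType R[i]).
Local Notation RM := (measurableTypeR R).
Let mu := @lebesgue_measure R.
Implicit Types (D : set RM) (s : seq (set R * X)).

Let simple_cons c s t : simple_eval (c :: s) t =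
 (\1_(c.1) t : R)%:C *: c.2 + simple_eval s t :> X.
Proof. by rewrite /simple_eval big_cons. Qed.

(** Measurability of the norm of a sum does not follow from that of the summands, so the simple
    function is absorbed one set at a time: on the set and on its complement it only adds a
    constant. Hence the arbitrary [a] and [E0] in the induction. *)
Lemma measurable_rnorm_simple D (E0 : set RM) s (h : R -> X) (a : X) :
 simple_fun_on D s -> measurable E0 ->
 (forall v, measurable_fun E0 (fun t => rnorm (h t - v))) ->
 measurable_fun E0 (fun t => rnorm (h t - (a + simple_eval s t))).
Proof.
move=> + mE0 + ; elim: s a E0 mE0 => [|c s IH] a E0 mE0 sD mh.
 apply: eq_measurable_fun (mh a) => t _ /=.
 by rewrite /simple_eval big_nil addr0.
have [mc _ _] := sD c (mem_head _ _).
have sD' : simple_fun_on D s by move=> c' cs; apply: sD; rewrite inE cs orbT.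
have mhS (E1 : set RM) : measurable E1 -> E1 `<=` E0 ->
 forall v, measurable_fun E1 (fun t => rnorm (h t - v)).
 by move=> mE1 E10 v; apply: (measurable_funS mE0 E10); exact: mh.
rewrite -(setUIDK E0 c.1).
apply/measurable_funU; [exact: measurableI|exact: measurableD|split].
- have mE1 : measurable (E0 `&` c.1) by exact: measurableI.
 apply: eq_measurable_fun (IH (a + c.2) _ mE1 sD' (mhS _ mE1 (@subIsetl _ _ _))).
 move=> t /[!inE] -[_ ct]; rewrite simple_cons indicE mem_set // scale1r.
 by rewrite addrA.
- have mE1 : measurable (E0 `\` c.1) by exact: measurableD.
 apply: eq_measurable_fun (IH a _ mE1 sD' (mhS _ mE1 (@subDsetl _ _ _))).
 move=> t /[!inE] -[_ ct]; rewrite simple_cons indicE memNset // scale0r.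
 by rewrite add0r.
Qed.

Lemma simple_wint D s : measurable D -> simple_fun_on D s ->
 is_wint D (simple_eval s) (simple_integral s).
Proof.
move=> mD; rewrite /simple_integral; elim: s => [|c s IH] sD.
 by rewrite big_nil; apply: (wint_eq mD (@wint0 _ X D mD)) => t _; rewrite /simple_eval big_nil.
have [mc cD fc] := sD c (mem_head _ _).
have w := IH (fun c' cs => sD c' (mem_behead (s := c :: s) cs)).
have ic : mu.-integrable D (EFin \o (\1_(c.1) : RM -> R)).
 apply/integrableP; split; first by apply/measurable_EFinP; exact: measurable_indic.
 rewrite (eq_integral (fun t : RM => (\1_(c.1) t)%:E)); last by move=> t _ /=; rewrite ger0_norm.
 by rewrite integral_indic // setIidl.
have w1 : is_wint D (fun t => (\1_(c.1) t : R)%:C *: c.2) ((fine (mu c.1))%:C *: c.2).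
 move=> l [_ lZ _]; split.
 by apply: eq_rintegrable (integrableZl mD (l c.2) ic) _ => // t _ /=; rewrite lZ mulrC.
 under eq_Rintegral do rewrite /= lZ mulrC.
 by rewrite RintegralZl // lZ mulrC /Rintegral integral_indic // setIidl.
by rewrite big_cons; apply: (wint_eq mD (wintD mD w1 w)) => t _; rewrite simple_cons.
Qed.

(** A norming functional reduces the distance to a scalar integral. The estimate serves twice: for
    the uniqueness of the Bochner integral and for the Cauchy property of the approximants. *)
Lemma simple_integral_dist D (h : R -> X) s s' : measurable D ->
 simple_fun_on D s -> simple_fun_on D s' ->
 measurable_fun D (fun t => rnorm (h t - simple_eval s t)) ->
 measurable_fun D (fun t => rnorm (h t - simple_eval s' t)) ->
 ((rnorm (simple_integral s - simple_integral s'))%:E <=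
 \int[mu]_(t in D) (rnorm (h t - simple_eval s t))%:E +
 \int[mu]_(t in D) (rnorm (h t - simple_eval s' t))%:E)%E.
Proof.
move=> mD sD sD' m1 m2.
have [l rl <-] := hahn_banach (simple_integral s - simple_integral s').
have [ig <-] := wintB mD (simple_wint mD sD) (simple_wint mD sD') rl; have [_ _ ln] := rl.
have mg := measurable_int _ ig; rewrite /Rintegral fineK; last exact: integrable_fin_num.
apply: (le_trans (lee_abs _)); apply: (le_trans (le_abse_integral mu mD mg)).
rewrite -ge0_integralD //; last 4 first.
- by move=> t _; rewrite lee_fin rnorm_ge0.
- exact/measurable_EFinP.
- by move=> t _; rewrite lee_fin rnorm_ge0.
- exact/measurable_EFinP.
apply: ge0_le_integral => //.
- exact: measurableT_comp.
- by apply/measurable_EFinP; exact: measurable_funD.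
- move=> t _; rewrite -EFinD lee_fin; apply: (le_trans (ln _)).
 have := ler_rnormB (h t - simple_eval s' t) (h t - simple_eval s t).
 by rewrite opprB addrC -addrA addKr [leRHS]addrC.
Qed.

Lemma bochner_unique D (h : R -> X) y y' : measurable D ->
 is_bochner_integral D h y -> is_bochner_integral D h y' -> y = y'.
Proof.
move=> mD [s [s1 s2 s3 s4]] [s' [s1' s2' s3' s4']].
apply: eq_rnorm_small => e e0.
have e4 : 0 < e / 4 by rewrite divr_gt0.
have /cvg_rnorm_seqP/(_ _ e4) h1 := s4; have /cvg_rnorm_seqP/(_ _ e4) h2 := s4'.
have small (f : nat -> \bar R) : (f @ \oo --> 0%E) ->
 \forall n \near \oo, (f n <= (e / 4)%:E)%E.
 move=> /fine_cvgP[ff /cvgrPdist_le/(_ _ e4)] f0.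
 near=> n; have fn : f n \is a fin_num by near: n.
 rewrite -(fineK fn) lee_fin.
 have : `|0 - (fine \o f) n| <= e / 4 by near: n.
 by rewrite sub0r normrN; apply: le_trans; exact: ler_norm.
have h3 := small _ s3; have h4 := small _ s3'.
have [n [[n1 n2] [n3 n4]]] := filter_ex (filterI (filterI h1 h2) (filterI h3 h4)).
have := simple_integral_dist mD (s1 n) (s1' n) (s2 n) (s2' n) => hn.
have : rnorm (simple_integral (s n) - simple_integral (s' n)) <= e / 4 + e / 4.
 by rewrite -lee_fin EFinD (le_trans hn) // leeD.
move=> n5; have -> : y - y' = (y - simple_integral (s n)) +
 (simple_integral (s n) - simple_integral (s' n)) + (simple_integral (s' n) - y').
 by rewrite -!addrA !addKr.
have := ler_rnormD ((y - simple_integral (s n)) +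
 (simple_integral (s n) - simple_integral (s' n))) (simple_integral (s' n) - y').
have := ler_rnormD (y - simple_integral (s n))
 (simple_integral (s n) - simple_integral (s' n)).
rewrite [rnorm (y - _)]rnormB; move: n1 n2 => /=; lra.
Unshelve. all: by end_near. Qed.

Lemma sum_unique_index (T : finType) (F : T -> X) (i : T) :
 (forall j, j != i -> F j = 0) -> \sum_j F j = F i.
Proof. by move=> h; rewrite (bigD1 i) //= big1 ?addr0. Qed.

Definition continuous_in D (h : R -> X) :=
 forall t : R, D t -> forall e : R, 0 < e ->
 exists2 d : R, 0 < d & forall u : R, D u -> `|u - t| < d -> rnorm (h u - h t) < e.

Lemma continuous_in_real D (h : R -> X) (phi : X -> R) : measurable D ->
 continuous_in D h -> (forall u v, `|phi u - phi v| <= rnorm (u - v)) ->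
 measurable_fun D (phi \o h).
Proof.
move=> mD ch lphi.
have : measurable_fun (D : set R) (phi \o h); last exact.
apply: subspace_continuous_measurable_fun => //.
apply/subspace_continuousP => t Dt; apply/cvgrPdist_lt => e e0.
have [d d0 hd] := ch t Dt e e0.
rewrite near_withinE; apply/nbhs_ballP; exists d => //= s ts Ds.
rewrite (le_lt_trans (lphi _ _)) // rnormB; apply: hd => //.
by move: ts; rewrite /ball /= distrC.
Qed.

Lemma measurable_rnormB D (h : R -> X) : measurable D -> continuous_in D h -> forall v,
 measurable_fun D (fun t => rnorm (h t - v)).
Proof.
move=> mD ch v; apply: (continuous_in_real (phi := fun u => rnorm (u - v)) mD ch) => u w.
rewrite ler_norml; have := ler_rnorm_dist (u - v) (w - v).
have := ler_rnorm_dist (w - v) (u - v).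
rewrite !opprB !addrA !subrK (rnormB w u); lra.
Qed.

(* The Bochner approximants take the value of [h] at a sample point of each
 dyadic cell, cut off where this would be larger than the trivial error
 [rnorm (h t)]; this makes them dominated. *)
Lemma bochner_approx D (h : R -> X) : measurable D -> continuous_in D h ->
 exists s : nat -> seq (set R * X),
 [/\ forall n, simple_fun_on D (s n),
 forall n t, D t -> rnorm (h t - simple_eval (s n) t) <= rnorm (h t)
 & forall t, D t -> rnorm (h t - simple_eval (s n) t) @[n --> \oo] --> (0 : R)].
Proof.
move=> mD ch.
have mnorm := measurable_rnormB mD ch.
have mnorm0 : measurable_fun D (fun t => rnorm (h t)).
 by apply: eq_measurable_fun (mnorm 0) => t _; rewrite subr0.
(* Cells of width [1/(n+1)]: [2 (n+1)^2] of them cover the interval from [-(n+1)] to [n+1], so mesh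
   and range improve together. *)
pose N n := (n.+1 ^ 2)%N.
pose cell n (i : nat) : set RM :=
 D `&` `[(i%:R - (N n)%:R) / n.+1%:R, (i.+1%:R - (N n)%:R) / n.+1%:R[%classic.
(* The default [0] occurs only when the cell misses [D], and then [E n i] is empty. *)
pose p n i := xget 0 (cell n i).
pose E n i : set RM := cell n i `&`
 (D `&` (fun t => rnorm (h t) - rnorm (h t - h (p n i))) @^-1` `[0, +oo[%classic).
pose s n := [seq (E n i : set R, h (p n i)) | i : 'I_(N n).*2].
have mcell n i : measurable (cell n i) by apply: measurableI.
have mE n i : measurable (E n i).
 apply: measurableI => //; exact: measurable_funB.
have cellP n i t : cell n i t ->
 (i%:R <= t * n.+1%:R + (N n)%:R) && (t * n.+1%:R + (N n)%:R < i.+1%:R).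
 by move=> [_]; rewrite /= in_itv /= ler_pdivrMr // ltr_pdivlMr // lerBlDr ltrBrDr.
have cell_inj n i j t : cell n i t -> cell n j t -> i = j.
 move=> /cellP/andP[h1 h2] /cellP/andP[h3 h4].
 have h5 := le_lt_trans h1 h4; have h6 := le_lt_trans h3 h2.
 rewrite !ltr_nat !ltnS in h5 h6; by apply/eqP; rewrite eqn_leq h5 h6.
have evalE n t : simple_eval (s n) t =
 \sum_(i < (N n).*2) (\1_(E n i) t : R)%:C *: h (p n i).
 by rewrite /simple_eval big_map /= big_enum.
have eval_in n t (i : 'I_(N n).*2) : E n i t -> simple_eval (s n) t = h (p n i).
 move=> Et; rewrite evalE (sum_unique_index (i := i)).
 by rewrite indicE mem_set // scale1r.
 move=> j ji; rewrite indicE memNset ?scale0r // => -[cj _].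
 have [ci _] := Et; move: ji; rewrite -(inj_eq val_inj) /=.
 by rewrite (cell_inj _ _ _ _ cj ci) eqxx.
have eval_out n t : (forall i : 'I_(N n).*2, ~ E n i t) -> simple_eval (s n) t = 0.
 move=> nE; rewrite evalE big1 // => i _; rewrite indicE memNset ?scale0r //.
have En n i t : E n i t -> rnorm (h t - h (p n i)) <= rnorm (h t).
 by move=> [_ [_]]; rewrite /= in_itv /= andbT subr_ge0.
have dom n t : rnorm (h t - simple_eval (s n) t) <= rnorm (h t).
 have [[i Ei]|nE] := pselect (exists i : 'I_(N n).*2, E n i t).
 by rewrite (eval_in _ _ _ Ei); exact: En.
 by rewrite eval_out ?subr0 // => i Ei; apply: nE; exists i.
exists s; split=> [n c /mapP[i _ ->] /=|n t _|t Dt].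
- split; [exact: mE|by move=> t [[]]|].
 pose itv : set RM := `[(i%:R - (N n)%:R) / n.+1%:R, (i.+1%:R - (N n)%:R) / n.+1%:R[%classic.
 have fin_itv : (mu itv < +oo)%E.
 by rewrite /mu lebesgue_measure_itv /=; case: ifP => _; rewrite ?ltry // -EFinB ltry.
 apply: le_lt_trans fin_itv.
 by apply: le_measure; rewrite ?inE /=; [exact: mE|exact: measurable_itv|move=> t [[]]].
- exact: dom.
- have [h0|h0] := eqVneq (rnorm (h t)) 0.
 rewrite (_ : (fun n => _) = fun=> 0); first exact: cvg_cst.
 by apply/funext => n; apply/eqP; rewrite eq_le rnorm_ge0 andbT -h0 dom.
 have hpos : 0 < rnorm (h t) by rewrite lt_neqAle eq_sym h0 rnorm_ge0.
 apply/cvgrPdist_lt => e e0.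
 have e1 : 0 < Num.min e (rnorm (h t)) by rewrite lt_min e0.
 have [d d0 hd] := ch t Dt _ e1.
 have [M hM] : exists M : nat, `|t| < M%:R /\ d^-1 < M%:R.
 exists (Num.truncn (Num.max `|t| d^-1)).+1.
 have := truncnS_gt (Num.max `|t| d^-1); rewrite gt_max => /andP[h1 h2].
 by split.
 exists M => // n /= Mn.
 have Mn' : M%:R <= n.+1%:R :> R by rewrite ler_nat (leq_trans Mn).
 have n0 : 0 < n.+1%:R :> R by [].
 have NE : (N n)%:R = n.+1%:R * n.+1%:R :> R by rewrite /N -natrM mulnn.
 have tN : 0 <= t * n.+1%:R + (N n)%:R < (N n).*2%:R.
 rewrite -muln2 natrM NE; have [+ _] := hM; rewrite ltr_norml => /andP[t1 t2].
 have t3 : - n.+1%:R < t by apply: le_lt_trans t1; rewrite lerN2.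
 have t4 : t < n.+1%:R by apply: lt_le_trans t2 _.
 apply/andP; split.
 by rewrite -mulrDl mulr_ge0 // ltW // -ltrBlDr sub0r.
 by rewrite [ltRHS]mulr_natr mulr2n ltrD2r ltr_pM2r.
 pose k := Num.truncn (t * n.+1%:R + (N n)%:R).
 have /andP[t0 t1] := tN.
 have /andP[k1 k2] := truncn_itv t0.
 have kN : (k < (N n).*2)%N by rewrite -(ltr_nat R); apply: le_lt_trans k1 t1.
 have ct : cell n k t.
 by split => //=; rewrite in_itv /= ler_pdivrMr // ltr_pdivlMr // lerBlDr ltrBrDr k1.
 have cp : cell n k (p n k) by rewrite /p; case: xgetP => [//|/(_ t)].
 have ptd : `|p n k - t| < d.
 have := cellP _ _ _ ct; have := cellP _ _ _ cp => /andP[a1 a2] /andP[a3 a4].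
 have a5 : `|(p n k - t) * n.+1%:R| < 1.
 rewrite ltr_norml mulrBl; apply/andP; split.
 by rewrite -[k.+1]addn1 natrD in a2 a4; lra.
 by rewrite -[k.+1]addn1 natrD in a2 a4; lra.
 rewrite normrM (gtr0_norm n0) -ltr_pdivlMr // mul1r in a5.
 apply: lt_trans a5 _; rewrite -[d]invrK ltf_pV2 ?posrE ?invr_gt0 //.
 by apply: lt_le_trans (proj2 hM) _.
 have [Dp _] := cp; have := hd _ Dp ptd; rewrite lt_min => /andP[h1 h2].
 rewrite sub0r normrN ger0_norm ?rnorm_ge0 //.
 have Ek : E n (Ordinal kN) t.
 split => //; split => //=; rewrite in_itv /= andbT subr_ge0 ltW //.
 by rewrite rnormB.
 by rewrite (eval_in _ _ _ Ek) rnormB.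
Qed.

(** The errors of the approximants are dominated by [b], so dominated convergence sends them to zero
    and the simple integrals are Cauchy. Both notions of integral come out with the same value:
    contours are defined by Bochner integrals, everything else is tested weakly. *)
Lemma bochner_exists D (h : R -> X) (b : R -> R) : measurable D ->
 continuous_in D h -> mu.-integrable D (EFin \o b) ->
 (forall t, D t -> rnorm (h t) <= b t) ->
 exists y, is_bochner_integral D h y /\ is_wint D h y.
Proof.
move=> mD ch ib hb.
have mphi (phi : X -> R) : (forall u v, `|phi u - phi v| <= rnorm (u - v)) ->
 measurable_fun D (phi \o h) by exact: continuous_in_real.
have mnorm := measurable_rnormB mD ch.
have [s [s1 s2 s3]] := bochner_approx mD ch.
have ms n : measurable_fun D (fun t => rnorm (h t - simple_eval (s n) t)).
 apply: eq_measurable_fun (measurable_rnorm_simple 0 (s1 n) mD mnorm) => t _.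
 by rewrite add0r.
pose I n := (\int[mu]_(t in D) (rnorm (h t - simple_eval (s n) t))%:E)%E.
have I0 : I n @[n --> \oo] --> 0%E.
 have := @dominated_cvg _ _ _ mu D mD
 (fun n t => (rnorm (h t - simple_eval (s n) t))%:E) (fun=> 0%E) (EFin \o b).
 rewrite integral0; apply => //.
 - by move=> n; apply/measurable_EFinP.
 - by move=> t Dt; apply/fine_cvgP; split; [exact: nearW|exact: s3].
 - move=> n t Dt; rewrite /= lee_fin ger0_norm ?rnorm_ge0 //.
 by rewrite (le_trans (s2 n t Dt)) // hb.
have fI n : I n \is a fin_num.
 apply: integrable_fin_num => //; apply: (le_rintegrable mD (ms n) _ ib) => t Dt.
 by rewrite ger0_norm ?rnorm_ge0 // (le_trans (s2 n t Dt)) // hb.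
have fI0 : fine (I n) @[n --> \oo] --> (0 : R).
 by have /fine_cvgP[_] := I0.
have [y sy] : exists y : X, simple_integral (s n) @[n --> \oo] --> y.
 apply: (@rnorm_cauchy_cvg _ _ _ (fine \o I)) => // m n /=.
 rewrite -lee_fin EFinD !fineK //.
 exact: (simple_integral_dist mD (s1 n) (s1 m) (ms n) (ms m)).
exists y; split; first by exists s.
move=> l rl; have [lD lZ ln] := rl.
have lB u v : l (u - v) = l u - l v.
 have -> : - v = (-1)%:C *: v by rewrite rmorphN scaleN1r.
 by rewrite lD lZ mulN1r.
have il : mu.-integrable D (EFin \o (l \o h)).
 apply: (le_rintegrable mD _ _ ib) => [|t Dt].
 by apply: mphi => u v; rewrite -lB.
 by apply: le_trans (ln _) _; exact: hb.
split => //.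
apply/eqP; rewrite -subr_eq0 -normr_le0; apply/ler_addgt0Pr => e e0; rewrite add0r.
have e2 : 0 < e / 2 by rewrite divr_gt0.
have /cvgrPdist_lt/(_ _ e2) h1 := fI0; have /cvg_rnorm_seqP/(_ _ e2) h2 := sy.
have [n [n1 n2]] := filter_ex (filterI h1 h2).
have [i1 i2] := simple_wint mD (s1 n) rl.
have : `|\int[mu]_(t in D) l (h t) - l (simple_integral (s n))| <= fine (I n).
 rewrite -i2 -RintegralB //.
 apply: (le_trans (le_normr_Rintegral mD (integrableB mD il i1))).
 apply: le_Rintegral => //.
 - exact: (integrable_norm (integrableB mD il i1)).
 - apply: (le_rintegrable mD (ms n) _ ib) => t Dt.
 by rewrite ger0_norm ?rnorm_ge0 // (le_trans (s2 n t Dt)) // hb.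
 - by move=> t Dt; rewrite -lB ln.
move: n1; rewrite sub0r normrN /= => n1 n3.
have n4 : `|l (simple_integral (s n)) - l y| <= rnorm (simple_integral (s n) - y).
 by rewrite -lB ln.
have := ler_distD (l (simple_integral (s n))) (\int[mu]_(t in D) l (h t)) (l y).
move=> tri; apply: (le_trans tri); rewrite (splitr e) lerD //.
 exact: le_trans n3 (le_trans (ler_norm _) (ltW n1)).
exact: le_trans n4 (ltW n2).
Qed.

End bochner_theory.

(** * Cauchy theory *)

Section complex_differentiation.
Context (R : realType).
Implicit Types (z w : R[i]) (f g : R[i] -> R[i]).

Definition ccont (V : normedZmodType R[i]) (F : R[i] -> V) z :=
 forall e : R, 0 < e -> exists2 d : R, 0 < d &
 forall w, rnorm (w - z) < d -> rnorm (F w - F z) < e.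

(* Caratheodory's form of complex differentiability. *)
Definition cdiff f z := exists phi : R[i] -> R[i],
 ccont phi z /\ forall w, f w - f z = phi w * (w - z).

Lemma ccont_cst (V : normedZmodType R[i]) (v : V) z : ccont (fun=> v) z.
Proof. by move=> e e0; exists 1 => // w _; rewrite subrr rnorm0. Qed.

Lemma ccont_id z : ccont id z.
Proof. by move=> e e0; exists e. Qed.

Lemma ccont_ext (V : normedZmodType R[i]) (F G : R[i] -> V) z :
 F =1 G -> ccont F z -> ccont G z.
Proof.
move=> FG cF e e0; have [d d0 h] := cF e e0.
by exists d => // w wz; rewrite -!FG h.
Qed.

Lemma ccont_local (V : normedZmodType R[i]) (F G : R[i] -> V) z (r : R) : 0 < r ->
 (forall w, rnorm (w - z) < r -> F w = G w) -> ccont F z -> ccont G z.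
Proof.
move=> r0 FG cF e e0; have [d d0 h] := cF e e0.
exists (Num.min d r); first by rewrite lt_min d0.
by move=> w; rewrite lt_min => /andP[h1 h2]; rewrite -!FG ?h // subrr rnorm0.
Qed.

Lemma ccontD (V : normedZmodType R[i]) (F G : R[i] -> V) z :
 ccont F z -> ccont G z -> ccont (fun w => F w + G w) z.
Proof.
move=> cF cG e e0; have e2 : 0 < e / 2 by rewrite divr_gt0.
have [d d0 h] := cF _ e2; have [d' d0' h'] := cG _ e2.
exists (Num.min d d'); first by rewrite lt_min d0.
move=> w; rewrite lt_min => /andP[/h h1 /h' h2].
rewrite opprD addrACA (splitr e); apply: le_lt_trans (ler_rnormD _ _) _.
exact: ltrD.
Qed.

Lemma ccontZ (V : normedModType R[i]) f (F : R[i] -> V) z :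
 ccont f z -> ccont F z -> ccont (fun w => f w *: F w) z.
Proof.
move=> cf cF e e0.
pose a := rnorm (f z) + 1; pose b := rnorm (F z) + 1.
have a0 : 0 < a by rewrite ltr_wpDl ?rnorm_ge0.
have b0 : 0 < b by rewrite ltr_wpDl ?rnorm_ge0.
have e1 : 0 < e / 2 / b by rewrite !divr_gt0.
have e2 : 0 < Num.min 1 (e / 2 / a) by rewrite lt_min ltr01 !divr_gt0.
have [d d0 h] := cf _ e1; have [d' d0' h'] := cF _ e2.
exists (Num.min d d'); first by rewrite lt_min d0.
move=> w; rewrite lt_min => /andP[/h h1 /h']; rewrite lt_min => /andP[h2 h3].
have -> : f w *: F w - f z *: F z = (f w - f z) *: F w + f z *: (F w - F z).
 by rewrite scalerBl scalerBr addrA subrK.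
apply: le_lt_trans (ler_rnormD _ _) _; rewrite !rnormZ.
have h4 : rnorm (F w) <= b.
 by rewrite (le_trans (ler_rnorm_dist _ (F z))) // lerD2l ltW.
have h5 : rnorm (f w - f z) * rnorm (F w) < e / 2.
 apply: le_lt_trans (ler_wpM2l (rnorm_ge0 _) h4) _.
 by rewrite -ltr_pdivlMr.
have h6 : rnorm (f z) * rnorm (F w - F z) <= e / 2.
 have : rnorm (f z) * rnorm (F w - F z) <= a * (e / 2 / a).
 by rewrite ler_pM ?rnorm_ge0 ?(ltW h3) // /a lerDl.
 by rewrite [a * _]mulrC divfK ?gt_eqF.
by rewrite (splitr e); exact: ltr_leD.
Qed.

Lemma ccontM f g z : ccont f z -> ccont g z -> ccont (fun w => f w * g w) z.
Proof. move=> cf cg; exact: (@ccontZ R[i]^o f g z cf cg). Qed.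

Lemma ccontN (V : normedModType R[i]) (F : R[i] -> V) z :
 ccont F z -> ccont (fun w => - F w) z.
Proof.
move=> cF; apply: ccont_ext (ccontZ (ccont_cst (-1 : R[i]) z) cF) => w.
by rewrite scaleN1r.
Qed.

Lemma ccont_comp (V : normedZmodType R[i]) f (F : R[i] -> V) z :
 ccont f z -> ccont F (f z) -> ccont (F \o f) z.
Proof.
move=> cf cF e e0; have [d d0 h] := cF e e0; have [d' d0' h'] := cf d d0.
by exists d' => // w /h' /h.
Qed.

Lemma ccontV f z : f z != 0 -> ccont f z -> ccont (fun w => (f w)^-1) z.
Proof.
move=> fz cf e e0; pose a := rnorm (f z).
have a0 : 0 < a.
 rewrite lt_neqAle rnorm_ge0 andbT eq_sym; apply/eqP => /rnorm_eq0/eqP.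
 by rewrite (negbTE fz).
have e1 : 0 < Num.min (a / 2) (e * a * a / 2).
 by rewrite lt_min divr_gt0 // divr_gt0 // !mulr_gt0.
have [d d0 h] := cf _ e1; exists d => // w /h; rewrite lt_min => /andP[h1 h2].
have h3 : a / 2 < rnorm (f w).
 have := ler_rnorm_dist (f z) (f w); rewrite rnormB -/a; move: h1; lra.
have fw : f w != 0.
 by apply: contraTneq h3 => ->; rewrite rnorm0 -leNgt divr_ge0 // ltW.
have -> : (f w)^-1 - (f z)^-1 = (f z - f w) / (f w * f z).
 by field; rewrite fw fz.
rewrite rnormM rnormV rnormM -/a ltr_pdivrMr; last first.
 by rewrite mulr_gt0 // (lt_trans _ h3) // divr_gt0.
rewrite rnormB; apply: (lt_trans h2).
have -> : e * a * a / 2 = e * a * (a / 2) by ring.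
have -> : e * (rnorm (f w) * a) = e * a * rnorm (f w) by ring.
by rewrite ltr_pM2l ?mulr_gt0.
Qed.

Lemma cdiff_ccont f z : cdiff f z -> ccont f z.
Proof.
move=> [phi [cphi h]].
have c1 : ccont (fun w => f z + phi w * (w - z)) z.
 apply: ccontD; first exact: ccont_cst.
 by apply: ccontM => //; apply: ccontD; [exact: ccont_id|exact: ccont_cst].
by apply: ccont_ext c1 => w; rewrite -h addrC subrK.
Qed.

Lemma cdiff_ext f g z : f =1 g -> cdiff f z -> cdiff g z.
Proof. by move=> fg [phi [c h]]; exists phi; split => // w; rewrite -!fg h. Qed.

Lemma cdiff_cst (c : R[i]) z : cdiff (fun=> c) z.
Proof. by exists (fun=> 0); split; [exact: ccont_cst|move=> w; rewrite subrr mul0r]. Qed.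

Lemma cdiff_id z : cdiff id z.
Proof. by exists (fun=> 1); split; [exact: ccont_cst|move=> w; rewrite mul1r]. Qed.

Lemma cdiffD f g z : cdiff f z -> cdiff g z -> cdiff (fun w => f w + g w) z.
Proof.
move=> [p [cp hp]] [q [cq hq]]; exists (fun w => p w + q w); split.
 exact: ccontD.
by move=> w; rewrite mulrDl -hp -hq opprD addrACA.
Qed.

Lemma cdiffM f g z : cdiff f z -> cdiff g z -> cdiff (fun w => f w * g w) z.
Proof.
move=> df dg; have [p [cp hp]] := df; have [q [cq hq]] := dg.
exists (fun w => p w * g w + f z * q w); split.
 apply: ccontD; apply: ccontM => //; first exact: cdiff_ccont.
 exact: ccont_cst.
by move=> w; rewrite mulrDl mulrAC -hp -mulrA -hq; ring.
Qed.

Lemma cdiffN f z : cdiff f z -> cdiff (fun w => - f w) z.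
Proof.
move=> df; apply: cdiff_ext (cdiffM (cdiff_cst (-1) z) df) => w.
by rewrite mulN1r.
Qed.

Lemma cdiffB f g z : cdiff f z -> cdiff g z -> cdiff (fun w => f w - g w) z.
Proof. by move=> df dg; apply: cdiffD => //; exact: cdiffN. Qed.

Lemma cdiffV f z : f z != 0 -> cdiff f z -> cdiff (fun w => (f w)^-1) z.
Proof.
move=> fz df; have [p [cp hp]] := df.
have cf := cdiff_ccont df.
(* Where [f] vanishes the inverse is the conventional [0] and the quotient formula fails; the raw
   difference quotient is taken there, which is harmless because [f] has no zero near [z]. *)
exists (fun w => if f w == 0 then ((f w)^-1 - (f z)^-1) / (w - z)
 else - p w / (f w * f z)); split.
 have c1 : ccont (fun w => - p w / (f w * f z)) z.
 apply: ccontM; first exact: (@ccontN R[i]^o).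
 by apply: ccontV; [rewrite mulf_neq0|apply: ccontM => //; exact: ccont_cst].
 have a0 : 0 < rnorm (f z).
 rewrite lt_neqAle rnorm_ge0 andbT eq_sym; apply/eqP => /rnorm_eq0/eqP.
 by rewrite (negbTE fz).
 have [d d0 hd] := cf _ a0; apply: ccont_local d0 _ c1 => w /hd.
 by case: eqVneq => // ->; rewrite sub0r rnormN ltxx.
move=> w; case: eqVneq => [fw|fw].
 have [->|wz] := eqVneq w z; first by rewrite !subrr mulr0.
 by rewrite divfK // subr_eq0.
rewrite mulrAC mulNr -hp; field; by rewrite fw fz.
Qed.

Lemma cdiff_comp f g z : cdiff f z -> cdiff g (f z) -> cdiff (g \o f) z.
Proof.
move=> df [q [cq hq]]; have [p [cp hp]] := df.
exists (fun w => q (f w) * p w); split.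
 by apply: ccontM => //; apply: (ccont_comp (F := q)) => //; exact: cdiff_ccont.
by move=> w /=; rewrite hq hp mulrA.
Qed.

Lemma cdiffX f n z : cdiff f z -> cdiff (fun w => f w ^+ n) z.
Proof.
move=> df; elim: n => [|n IH].
 by apply: cdiff_ext (cdiff_cst 1 z) => w; rewrite expr0.
by apply: cdiff_ext (cdiffM df IH) => w; rewrite exprS.
Qed.

Lemma derivable_cdiff f z : derivable (f : R[i]^o -> R[i]^o) z 1 -> cdiff f z.
Proof.
move=> df; set l := 'D_1 (f : R[i]^o -> R[i]^o) z.
exists (fun w => if w == z then l else (f w - f z) / (w - z)); split; last first.
 move=> w; case: eqVneq => [->|wz]; first by rewrite !subrr mulr0.
 by rewrite divfK // subr_eq0.
move=> e e0; have e0' : 0 < e%:C :> R[i] by rewrite ltcR.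
have /cvgrPdist_lt/(_ _ e0') := df; rewrite near_withinE => /nbhs_ballP[d d0 hd].
have [d1 d2] := gt0_complex d0.
exists (Re d) => // w wz; rewrite eqxx; case: eqVneq => [_|neq].
 by rewrite subrr rnorm0.
have := hd (w - z); rewrite /ball /= sub0r normrN rnormE d2 ltcR => /(_ wz).
rewrite subr_eq0 => /(_ neq); rewrite rnormE ltcR -/l rnormB; apply: le_lt_trans.
apply: eq_ler; congr (rnorm (_ - _)).
have -> : (w - z)%R *: (1 : R[i]^o) + z = w :> R[i] by rewrite /GRing.scale /= mulr1 subrK.
by rewrite mulrC.
Qed.

End complex_differentiation.

Section complex_exponential.
Context (R : realType).
Implicit Types (z w : R[i]).

Definition cexp w : R[i] := (expR (Re w))%:C * expi (Im w).

Lemma expiD (a b : R) : expi (a + b) = expi a * expi b.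
Proof.
rewrite /expi cosD sinD; apply/eqP; rewrite eq_complex /=.
by rewrite eqxx /= addrC.
Qed.

Lemma rnorm_expi (a : R) : rnorm (expi a) = 1.
Proof. by rewrite rnormc /= cos2Dsin2 sqrtr1. Qed.

Lemma cexpD z w : cexp (z + w) = cexp z * cexp w.
Proof. by rewrite /cexp !raddfD /= expRD realcM expiD; ring. Qed.

Lemma cexp0 : cexp 0 = 1.
Proof. by rewrite /cexp /expi /= expR0 cos0 sin0 mul1r. Qed.

Lemma rnorm_cexp w : rnorm (cexp w) = expR (Re w).
Proof. by rewrite rnormM rnorm_real rnorm_expi mulr1 ger0_norm // expR_ge0. Qed.

Lemma cexp_neq0 w : cexp w != 0.
Proof.
apply/eqP => h; have := rnorm_cexp w; rewrite h rnorm0 => /esym/eqP.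
by rewrite gt_eqF // expR_gt0.
Qed.

Lemma cexpN w : cexp (- w) = (cexp w)^-1.
Proof.
apply: (mulfI (cexp_neq0 w)); rewrite -cexpD subrr cexp0 mulfV //.
exact: cexp_neq0.
Qed.

Lemma is_derive_small (f : R -> R) (df : R) : is_derive (0 : R) (1 : R) f df ->
 forall e : R, 0 < e -> exists2 d : R, 0 < d &
 forall h : R, `|h| < d -> `|f h - f 0 - df * h| <= e * `|h|.
Proof.
move=> [dfx <-] e e0; have /cvgrPdist_le/(_ _ e0) := dfx.
rewrite near_withinE => /nbhs_ballP[d d0 hd]; exists d => // h hd'.
have [->|h0] := eqVneq h 0; first by rewrite subrr mulr0 subr0 normr0 mulr0.
have := hd h; rewrite /ball /= sub0r normrN => /(_ hd' h0).
rewrite /GRing.scale /= mulr1 addr0 -/('D_1 f 0) => hh.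
have h1 : 0 < `|h| by rewrite normr_gt0.
rewrite -ler_pdivrMr //.
apply: le_trans hh; rewrite distrC; apply: eq_ler.
by rewrite -normfV -normrM; congr `|_|; field.
Qed.

Lemma cexp_small : forall e : R, 0 < e -> exists2 d : R, 0 < d &
 forall h : R[i], rnorm h < d -> rnorm (cexp h - 1 - h) <= e * rnorm h.
Proof.
(* [B] exceeds [exp x] for [x] of absolute value at most 1, and is at least 2. The real and the
   imaginary part of the remainder are each at most [2 B e'] times the norm of [h], so
   [e' <= e / (4 B)] is enough. *)
move=> e e0; pose B := expR 1 + 1 + 1 : R.
have B0 : 0 < B by rewrite /B !addr_gt0 // expR_gt0.
have e1 : 0 < Num.min 1 (e / (4 * B)) by rewrite lt_min ltr01 divr_gt0 // mulr_gt0.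
set e' := Num.min _ _ in e1.
have [d1 d10 h1] := is_derive_small (is_derive_expR (0 : R)) e1.
have [d2 d20 h2] := is_derive_small (is_derive_cos (0 : R)) e1.
have [d3 d30 h3] := is_derive_small (is_derive_sin (0 : R)) e1.
exists (Num.min (Num.min d1 (Num.min d2 d3)) e'); first by rewrite 3!lt_min d10 d20 d30.
move=> h; rewrite 3!lt_min => /andP[/andP[k1 /andP[k2 k3]] k4].
set x := Re h; set y := Im h.
have xh : `|x| <= rnorm h := normr_Re_le h.
have yh : `|y| <= rnorm h := normr_Im_le h.
have {h1} := h1 x (le_lt_trans xh k1); have {h2} := h2 y (le_lt_trans yh k2).
have {h3} := h3 y (le_lt_trans yh k3).
rewrite expR0 cos0 sin0 !subr0 oppr0 mul0r !subr0 !mul1r => h3 h2 h1.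
have e'1 : e' <= 1 by rewrite ge_min lexx.
have x1 : `|x| <= 1 by apply: (le_trans xh); apply: (le_trans (ltW k4)).
have ex : `|expR x| <= B.
 rewrite ger0_norm ?expR_ge0 // /B -addrA (@le_trans _ _ (expR 1)) ?lerDl ?addr_ge0 //.
 by rewrite ler_expR (le_trans (ler_norm _)).
have r0 := rnorm_ge0 h.
have ex1 : `|expR x - 1| <= 2 * rnorm h.
 have -> : expR x - 1 = (expR x - 1 - x) + x by rewrite subrK.
 apply: (le_trans (ler_normD _ _)); rewrite mulrDl mul1r lerD //.
 by apply: (le_trans h1); rewrite -[leRHS]mul1r ler_pM // ltW.
have eB : 4 * B * e' <= e.
 by rewrite mulrC -ler_pdivlMr ?mulr_gt0 // ge_min lexx orbT.
have B1 : 1 <= B by rewrite /B lerDr addr_ge0 // expR_ge0.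
have B2 : 2 <= B by rewrite /B -addrA lerDr expR_ge0.
have re : `|Re (cexp h - 1 - h)| <= 2 * B * e' * rnorm h.
 have -> : Re (cexp h - 1 - h) = (expR x - 1 - x) + expR x * (cos y - 1).
 by rewrite /cexp /expi !raddfB /= -/x -/y; ring.
 apply: (le_trans (ler_normD _ _)); rewrite normrM.
 have a1 : `|expR x - 1 - x| <= B * e' * rnorm h.
 apply: (le_trans h1); rewrite -mulrA -[leLHS]mul1r ler_pM ?mulr_ge0 // ?(ltW e1) //.
 by rewrite ler_wpM2l // ltW.
 have a2 : `|expR x| * `|cos y - 1| <= B * e' * rnorm h.
 rewrite -mulrA ler_pM //; apply: (le_trans h2).
 by rewrite ler_wpM2l // ltW.
 by move: a1 a2; lra.
have im : `|Im (cexp h - 1 - h)| <= 2 * B * e' * rnorm h.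
 have -> : Im (cexp h - 1 - h) = expR x * (sin y - y) + (expR x - 1) * y.
 by rewrite /cexp /expi !raddfB /= -/x -/y; ring.
 apply: (le_trans (ler_normD _ _)); rewrite !normrM.
 have a1 : `|expR x| * `|sin y - y| <= B * e' * rnorm h.
 rewrite -mulrA ler_pM //; apply: (le_trans h3).
 by rewrite ler_wpM2l // ltW.
 have a2 : `|expR x - 1| * `|y| <= B * e' * rnorm h.
 apply: (@le_trans _ _ (2 * rnorm h * rnorm h)).
 by rewrite ler_pM.
 rewrite ler_wpM2r // ler_pM // ltW //.
 by move: a1 a2; lra.
apply: (le_trans (rnorm_le_ReIm _)); apply: (le_trans (lerD re im)).
by rewrite -mulrDl ler_wpM2r //; move: eB; lra.
Qed.

Lemma cdiff_cexp z : cdiff cexp z.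
Proof.
exists (fun w => if w == z then cexp z else (cexp w - cexp z) / (w - z)); split; last first.
 move=> w; case: eqVneq => [->|wz]; first by rewrite !subrr mulr0.
 by rewrite divfK // subr_eq0.
move=> e e0; have c0 : 0 < rnorm (cexp z) by rewrite rnorm_cexp expR_gt0.
have e1 : 0 < e / 2 / rnorm (cexp z) by rewrite !divr_gt0.
have [d d0 hd] := cexp_small e1; exists d => // w wz; rewrite eqxx.
case: eqVneq => [_|neq]; first by rewrite subrr rnorm0.
have n0 : w - z != 0 by rewrite subr_eq0.
have -> : (cexp w - cexp z) / (w - z) - cexp z =
 cexp z * (cexp (w - z) - 1 - (w - z)) / (w - z).
 have -> : cexp w = cexp z * cexp (w - z) by rewrite -cexpD addrC subrK.
 by field.
have r0 : 0 < rnorm (w - z).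
 rewrite lt_neqAle rnorm_ge0 andbT eq_sym; apply/eqP => /rnorm_eq0/eqP.
 by rewrite (negbTE n0).
rewrite rnormM rnormM rnormV ltr_pdivrMr //.
apply: (@le_lt_trans _ _ (rnorm (cexp z) * (e / 2 / rnorm (cexp z) * rnorm (w - z)))).
 by rewrite ler_wpM2l ?rnorm_ge0 // hd.
have -> : rnorm (cexp z) * (e / 2 / rnorm (cexp z) * rnorm (w - z)) = e / 2 * rnorm (w - z).
 by field; rewrite gt_eqF.
by rewrite ltr_pM2r // ltr_pdivrMr // ltr_pMr // ltr1n.
Qed.

End complex_exponential.

Section complex_integral.
Context (R : realType).
Local Notation RM := (measurableTypeR R).
Let mu := @lebesgue_measure R.
Implicit Types (D : set RM) (g : R -> R[i]).

Definition cint D g : R[i] :=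
 (\int[mu]_(t in D) Re (g t)) +i* (\int[mu]_(t in D) Im (g t)).

Lemma rfun_Re : rfun (fun z : R[i]^o => Re z).
Proof.
split; [by move=> u v; rewrite raddfD| |exact: normr_Re_le].
move=> r v; change (Re (r%:C * (v : R[i])) = r * Re v).
by case: v => x y /=; rewrite mul0r subr0.
Qed.

Lemma rfun_Im : rfun (fun z : R[i]^o => Im z).
Proof.
split; [by move=> u v; rewrite raddfD| |exact: normr_Im_le].
move=> r v; change (Im (r%:C * (v : R[i])) = r * Im v).
by case: v => x y /=; rewrite mul0r addr0.
Qed.

Lemma wint_cint D g y : is_wint (V := R[i]^o) D g y -> y = cint D g.
Proof.
move=> h; apply/eqP; rewrite eq_complex /=.
by rewrite -(h _ rfun_Re).2 -(h _ rfun_Im).2 !eqxx.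
Qed.

Lemma cint_wint D g : measurable D ->
 mu.-integrable D (EFin \o (fun t => Re (g t))) ->
 mu.-integrable D (EFin \o (fun t => Im (g t))) ->
 is_wint (V := R[i]^o) D g (cint D g).
Proof.
move=> mD ir ii l [lD lZ ln].
have lE z : l z = l (1 : R[i]^o) * Re z + l ('i : R[i]^o) * Im z.
 have e : z = (Re z)%:C *: (1 : R[i]^o) + (Im z)%:C *: ('i : R[i]^o).
 by rewrite {1}[z]complexE /GRing.scale /= mulr1 ['i * _]mulrC.
 by rewrite {1}e lD !lZ mulrC [_ * l 'i]mulrC.
have i1 := integrableZl mD (l (1 : R[i]^o)) ir.
have i2 := integrableZl mD (l ('i : R[i]^o)) ii.
split.
 apply: (@eq_rintegrable _ _ (fun t => l (1 : R[i]^o) * Re (g t) +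
 l ('i : R[i]^o) * Im (g t)) _ mD) => [|t _]; last by rewrite /= [RHS]lE.
 exact: (integrableD mD i1 i2).
under eq_Rintegral do rewrite lE.
by rewrite RintegralD // !RintegralZl // [RHS]lE.
Qed.

Definition tcont (V : normedZmodType R[i]) (g : R -> V) (t : R) :=
 forall e : R, 0 < e -> exists2 d : R, 0 < d &
 forall u : R, `|u - t| < d -> rnorm (g u - g t) < e.

Lemma tcont_real (V : normedZmodType R[i]) (g : R -> V) (phi : V -> R) t :
 tcont g t -> (forall u v, `|phi u - phi v| <= rnorm (u - v)) ->
 {for t, continuous (phi \o g)}.
Proof.
move=> cg lphi; apply/cvgrPdist_lt => e e0; have [d d0 hd] := cg e e0.
apply/nbhs_ballP; exists d => //= u tu.
rewrite (le_lt_trans (lphi _ _)) // rnormB; apply: hd.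
by move: tu; rewrite /ball /= distrC.
Qed.

Lemma tcont_h (V : normedZmodType R[i]) (F : R[i] -> V) (eta t : R) :
 ccont F (t +i* eta) -> tcont (fun u => F (u +i* eta)) t.
Proof.
move=> cF e e0; have [d d0 hd] := cF e e0; exists d => // u ut.
apply: hd; rewrite rnormc /= subrr expr0n addr0 sqrtr_sqr //.
Qed.

Lemma tcont_v (V : normedZmodType R[i]) (F : R[i] -> V) (eta t : R) :
 ccont F (t +i* eta) -> tcont (fun u => F (t +i* u)) eta.
Proof.
move=> cF e e0; have [d d0 hd] := cF e e0; exists d => // u ut.
apply: hd; rewrite rnormc /= subrr expr0n add0r sqrtr_sqr //.
Qed.

Definition sint (a b : R) g := cint `[a, b]%classic g.

Lemma sint_wint a b g : (forall t, a <= t <= b -> tcont g t) ->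
 is_wint (V := R[i]^o) `[a, b]%classic g (sint a b g).
Proof.
move=> cg; apply: cint_wint => //.
 apply: continuous_compact_integrable; first exact: segment_compact.
 apply: continuous_in_subspaceT => t; rewrite inE /= in_itv /= => tab.
 by apply: (tcont_real (phi := fun z : R[i] => Re z) (cg t tab)) => u v; rewrite -raddfB normr_Re_le.
apply: continuous_compact_integrable; first exact: segment_compact.
apply: continuous_in_subspaceT => t; rewrite inE /= in_itv /= => tab.
by apply: (tcont_real (phi := fun z : R[i] => Im z) (cg t tab)) => u v; rewrite -raddfB normr_Im_le.
Qed.

Lemma sint_split a m b g : (forall t, a <= t <= b -> tcont g t) -> a <= m <= b ->
 sint a b g = sint a m g + sint m b g.
Proof.
move=> cg /andP[am mb].
have split_ (phi : R[i] -> R) :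
 (forall u v, `|phi u - phi v| <= rnorm (u - v)) ->
 \int[mu]_(t in `[a, b]) phi (g t) =
 \int[mu]_(t in `[a, m]) phi (g t) + \int[mu]_(t in `[m, b]) phi (g t).
 move=> lphi.
 have i (x y : R) : a <= x -> y <= b -> mu.-integrable `[x, y] (EFin \o (phi \o g)).
 move=> ax yb; apply: continuous_compact_integrable; first exact: segment_compact.
 apply: continuous_in_subspaceT => t; rewrite inE /= in_itv /= => /andP[xt ty].
 by apply: tcont_real => //; apply: cg; rewrite (le_trans ax) //= (le_trans ty).
 rewrite -(@Rintegral_itv_obnd_cbnd _ m (BRight b)); last first.
 have mi (I : interval R) : measurable ([set` I] : set RM) by exact: measurable_itv.
 apply: (integrableS (mi _) (mi _) _ (i m b am (lexx b))).
 by apply: subset_itvr; rewrite bnd_simp.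
 have /= <- := @Rintegral_itvB _ (phi \o g) (BLeft a) (BRight b) m.
 - by rewrite addrC subrK.
 - exact: i.
 - by rewrite bnd_simp.
 - by rewrite bnd_simp.
apply/eqP; rewrite eq_complex /=; apply/andP; split; apply/eqP; apply: split_ => u v.
 by rewrite -raddfB normr_Re_le.
by rewrite -raddfB normr_Im_le.
Qed.

Lemma fine_lebesgue_itv (a b : R) : a <= b -> fine (mu `[a, b]%classic) = b - a.
Proof.
move=> ab; rewrite /mu lebesgue_measure_itv /= lte_fin.
case: ifPn => // h; apply/esym/eqP; rewrite subr_eq0 eq_le ab andbT.
by rewrite leNgt.
Qed.

Lemma sint_norm a b g (M : R) : a <= b -> (forall t, a <= t <= b -> tcont g t) ->
 (forall t, a <= t <= b -> rnorm (g t) <= M) -> rnorm (sint a b g) <= M * (b - a).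
Proof.
move=> ab cg gM.
rewrite -(fine_lebesgue_itv ab) -Rintegral_cst //.
apply: (@wint_norm _ R[i]^o _ _ _ (fun=> M) _ (sint_wint cg)); [by []| |];
 last by move=> t; rewrite /= in_itv /=; exact: gM.
apply: continuous_compact_integrable; first exact: segment_compact.
by apply: continuous_subspaceT => t; exact: cvg_cst.
Qed.

Lemma sintB a b g h : (forall t, a <= t <= b -> tcont g t) ->
 (forall t, a <= t <= b -> tcont h t) ->
 sint a b (fun t => g t - h t) = sint a b g - sint a b h.
Proof.
move=> cg ch; apply/esym/wint_cint.
exact: (wintB _ (sint_wint cg) (sint_wint ch)).
Qed.

Lemma sint_cst a b (k : R[i]) : a <= b -> sint a b (fun=> k) = k * (b - a)%:C.
Proof.
move=> ab; rewrite -(fine_lebesgue_itv ab) /sint /cint !Rintegral_cst //.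
by case: k => x y; apply/eqP; rewrite eq_complex /= !mulr0 subr0 add0r !eqxx.
Qed.

Lemma eq_sint a b g h : (forall t, a <= t <= b -> g t = h t) -> sint a b g = sint a b h.
Proof.
move=> gh; rewrite /sint /cint; congr (_ +i* _); apply: eq_Rintegral => t;
 by rewrite inE /= in_itv /= => /gh ->.
Qed.

End complex_integral.

Section goursat.
Context (R : realType).
Implicit Types (f : R[i] -> R[i]) (a b c d : R).

(** Counterclockwise boundary integral of the rectangle with sides [[a, b]] and [[c, d]]; on the
    vertical sides [dz] is ['i] times [ds]. *)
Definition rint f a b c d : R[i] :=
 sint a b (fun t => f (t +i* c)) + 'i * sint c d (fun s => f (b +i* s))
 - sint a b (fun t => f (t +i* d)) - 'i * sint c d (fun s => f (a +i* s)).

Definition rcont f a b c d :=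
 forall t s, a <= t <= b -> c <= s <= d -> ccont f (t +i* s).

(** Only the boundary is involved, because rectangles with a pole inside are split as well: the two
    copies of the inner cut cancel whatever their value. *)
Definition bcont f a b c d :=
 forall t s, a <= t <= b -> c <= s <= d ->
 (t == a) || (t == b) || (s == c) || (s == d) -> ccont f (t +i* s).

Lemma rcont_boundary f a b c d : rcont f a b c d -> bcont f a b c d.
Proof. by move=> cf t s ht hs _; exact: cf. Qed.

Definition rholo f a b c d :=
 forall t s, a <= t <= b -> c <= s <= d -> cdiff f (t +i* s).

Lemma rholo_cont f a b c d : rholo f a b c d -> rcont f a b c d.
Proof. by move=> h t s tab scd; apply: cdiff_ccont; exact: h. Qed.

Lemma rcontS f a b c d a' b' c' d' : rcont f a b c d ->
 a <= a' -> b' <= b -> c <= c' -> d' <= d -> rcont f a' b' c' d'.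
Proof.
move=> h aa bb cc dd t s /andP[t1 t2] /andP[s1 s2].
by apply: h; apply/andP; split; [exact: le_trans t1|exact: le_trans bb|
 exact: le_trans s1|exact: le_trans dd].
Qed.

Lemma rint_hsplit f a m b c d : bcont f a b c d -> a <= m <= b -> c <= d ->
 rint f a b c d = rint f a m c d + rint f m b c d.
Proof.
move=> cf amb cd; have /andP[am mb] := amb.
have hc s : (s == c) || (s == d) -> forall t, a <= t <= b ->
 tcont (fun u => f (u +i* s)) t.
 move=> scd t tab; apply: tcont_h; apply: cf => //; last by rewrite -!orbA scd !orbT.
 by case/orP: scd => /eqP ->; rewrite lexx ?andbT.
rewrite /rint (sint_split (hc c _) amb) ?eqxx // (sint_split (hc d _) amb) ?eqxx ?orbT //.
by ring.
Qed.

Lemma rint_vsplit f a b c n d : bcont f a b c d -> c <= n <= d -> a <= b ->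
 rint f a b c d = rint f a b c n + rint f a b n d.
Proof.
move=> cf cnd ab; have /andP[am mb] := cnd.
have hc t : (t == a) || (t == b) -> forall s, c <= s <= d ->
 tcont (fun u => f (t +i* u)) s.
 move=> tab s scd; apply: tcont_v; apply: cf => //; last by rewrite tab.
 by case/orP: tab => /eqP ->; rewrite lexx ?andbT.
rewrite /rint (sint_split (hc b _) cnd) ?eqxx ?orbT // (sint_split (hc a _) cnd) ?eqxx //.
by ring.
Qed.

Lemma rintB f g a b c d : bcont f a b c d -> bcont g a b c d -> a <= b -> c <= d ->
 rint (fun z => f z - g z) a b c d = rint f a b c d - rint g a b c d.
Proof.
move=> cf cg ab cd.
have hc (h : R[i] -> R[i]) s : bcont h a b c d -> (s == c) || (s == d) ->
 forall t, a <= t <= b -> tcont (fun u => h (u +i* s)) t.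
 move=> ch scd t tab; apply: tcont_h; apply: ch => //; last by rewrite -!orbA scd !orbT.
 by case/orP: scd => /eqP ->; rewrite lexx ?andbT.
have vc (h : R[i] -> R[i]) t : bcont h a b c d -> (t == a) || (t == b) ->
 forall s, c <= s <= d -> tcont (fun u => h (t +i* u)) s.
 move=> ch tab s scd; apply: tcont_v; apply: ch => //; last by rewrite tab.
 by case/orP: tab => /eqP ->; rewrite lexx ?andbT.
rewrite /rint !sintB; first (by ring); solve [by apply: hc => //; rewrite eqxx ?orbT|
 by apply: vc => //; rewrite eqxx ?orbT].
Qed.

Lemma rint_norm f a b c d (M : R) : bcont f a b c d -> a <= b -> c <= d ->
 (forall t s, a <= t <= b -> c <= s <= d ->
 (t == a) || (t == b) || (s == c) || (s == d) -> rnorm (f (t +i* s)) <= M) ->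
 rnorm (rint f a b c d) <= M * (2 * (b - a) + 2 * (d - c)).
Proof.
move=> cf ab cd fM.
have hn s : (s == c) || (s == d) ->
 rnorm (sint a b (fun t => f (t +i* s))) <= M * (b - a).
 move=> scd; have scd' : c <= s <= d by case/orP: scd => /eqP ->; rewrite lexx ?andbT.
 apply: sint_norm => // t tab.
 by apply: tcont_h; apply: cf => //; rewrite -!orbA scd !orbT.
 by apply: fM => //; rewrite -!orbA scd !orbT.
have vn t : (t == a) || (t == b) ->
 rnorm (sint c d (fun s => f (t +i* s))) <= M * (d - c).
 move=> tab; have tab' : a <= t <= b by case/orP: tab => /eqP ->; rewrite lexx ?andbT.
 apply: sint_norm => // s scd; first by apply: tcont_v; apply: cf => //; rewrite tab.
 by apply: fM => //; rewrite tab.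
have h1 := hn c; have h2 := hn d; have h3 := vn a; have h4 := vn b.
rewrite !eqxx ?orbT in h1 h2 h3 h4.
have {h1 h2 h3 h4} [h1 h2 h3 h4] := And4 (h1 isT) (h2 isT) (h3 isT) (h4 isT).
rewrite /rint; apply: (le_trans (ler_rnormB _ _)).
have k1 := ler_rnormB (sint a b (fun t => f (t +i* c)) +
 'i * sint c d (fun s => f (b +i* s))) (sint a b (fun t => f (t +i* d))).
have k2 := ler_rnormD (sint a b (fun t => f (t +i* c)))
 ('i * sint c d (fun s => f (b +i* s))).
move: k1 k2; rewrite !rnormM !rnormi !mul1r; move: h1 h2 h3 h4; clear; lra.
Qed.

Lemma rint_affine (p q : R[i]) a b c d : a <= b -> c <= d ->
 rint (fun z => p + q * z) a b c d = 0.
Proof.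
move=> ab cd.
have cf : forall z, ccont (fun z => p + q * z) z.
 move=> z; apply: ccontD; first exact: ccont_cst.
 by apply: ccontM; [exact: ccont_cst|exact: ccont_id].
rewrite /rint.
have h : sint a b (fun t => p + q * (t +i* c)) - sint a b (fun t => p + q * (t +i* d)) =
 q * ('i * (c - d)%:C) * (b - a)%:C.
 rewrite -sintB; [|by move=> t _; exact: (tcont_h (cf _))..].
 rewrite -(sint_cst (q * ('i * (c - d)%:C)) ab); apply: eq_sint => t _.
 have e (x : R) : t +i* x = t%:C + 'i * x%:C by rewrite [LHS]complexE.
 by rewrite (e c) (e d) rmorphB /=; ring.
have v : sint c d (fun s => p + q * (b +i* s)) - sint c d (fun s => p + q * (a +i* s)) =
 q * (b - a)%:C * (d - c)%:C.
 rewrite -sintB; [|by move=> t _; exact: (tcont_v (cf _))..].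
 rewrite -(sint_cst (q * (b - a)%:C) cd); apply: eq_sint => s _.
 have e (x : R) : x +i* s = x%:C + 'i * s%:C by rewrite [LHS]complexE.
 by rewrite (e b) (e a) rmorphB /=; ring.
rewrite [X in X - _]addrAC h -addrA -mulrBr v !rmorphB /=.
by ring.
Qed.

Let quarter_pigeonhole (x p q r s : R) :
 x <= (p + q) + (r + s) -> 4 * p < x -> 4 * q < x -> 4 * r < x -> 4 * s < x -> False.
Proof. by lra. Qed.

Lemma rint_quarter f a b c d : rcont f a b c d -> a <= b -> c <= d ->
 exists q : (R * R) * (R * R),
 [/\ a <= q.1.1, q.1.1 <= q.1.2, q.1.2 <= b &
 [/\ c <= q.2.1, q.2.1 <= q.2.2, q.2.2 <= d &
 [/\ q.1.2 - q.1.1 = (b - a) / 2, q.2.2 - q.2.1 = (d - c) / 2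
 & rnorm (rint f a b c d) <= 4 * rnorm (rint f q.1.1 q.1.2 q.2.1 q.2.2)]]].
Proof.
move=> cf ab cd; pose m := (a + b) / 2; pose n := (c + d) / 2.
have [am mb m1 m2] : [/\ a <= m, m <= b, m - a = (b - a) / 2 & b - m = (b - a) / 2].
 by rewrite /m; move: ab; clear; split; lra.
have [cn nd n1 n2] : [/\ c <= n, n <= d, n - c = (d - c) / 2 & d - n = (d - c) / 2].
 by rewrite /n; move: cd; clear; split; lra.
have e : rint f a b c d = (rint f a m c n + rint f a m n d) +
 (rint f m b c n + rint f m b n d).
 rewrite (rint_hsplit (rcont_boundary cf) (m := m)) ?am //.
 by rewrite (rint_vsplit (n := n) (rcont_boundary (rcontS cf _ mb _ _))) ?cn //
 (rint_vsplit (n := n) (rcont_boundary (rcontS cf am _ _ _))) ?cn.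
have tri : rnorm (rint f a b c d) <= (rnorm (rint f a m c n) + rnorm (rint f a m n d)) +
 (rnorm (rint f m b c n) + rnorm (rint f m b n d)).
 by rewrite e (le_trans (ler_rnormD _ _)) // lerD // ler_rnormD.
have [h1|h1] := leP (rnorm (rint f a b c d)) (4 * rnorm (rint f a m c n)).
 by exists ((a, m), (c, n)); repeat split.
have [h2|h2] := leP (rnorm (rint f a b c d)) (4 * rnorm (rint f a m n d)).
 by exists ((a, m), (n, d)); repeat split.
have [h3|h3] := leP (rnorm (rint f a b c d)) (4 * rnorm (rint f m b c n)).
 by exists ((m, b), (c, n)); repeat split.
have [h4|h4] := leP (rnorm (rint f a b c d)) (4 * rnorm (rint f m b n d)).
 by exists ((m, b), (n, d)); repeat split.
by case: (quarter_pigeonhole tri h1 h2 h3 h4).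
Qed.

(* Bisection: a rectangle of large boundary integral contains quarters of
 proportionally large integral, shrinking to a point of differentiability. *)
Lemma goursat f a b c d : rholo f a b c d -> a <= b -> c <= d ->
 rint f a b c d = 0.
Proof.
move=> hf ab cd; have cf := rholo_cont hf.
pose inv (q : (R * R) * (R * R)) :=
 [/\ a <= q.1.1, q.1.1 <= q.1.2, q.1.2 <= b &
 [/\ c <= q.2.1, q.2.1 <= q.2.2 & q.2.2 <= d]].
pose I (q : (R * R) * (R * R)) := rint f q.1.1 q.1.2 q.2.1 q.2.2.
have step q : exists q', inv q -> [/\ inv q', q.1.1 <= q'.1.1, q'.1.2 <= q.1.2 &
 [/\ q.2.1 <= q'.2.1, q'.2.2 <= q.2.2, q'.1.2 - q'.1.1 = (q.1.2 - q.1.1) / 2,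
 q'.2.2 - q'.2.1 = (q.2.2 - q.2.1) / 2 & rnorm (I q) <= 4 * rnorm (I q')]].
 have [iq|] := pselect (inv q); last by exists q.
 have [q1 q2 q3 [q4 q5 q6]] := iq.
 have [q' [r1 r2 r3 [r4 r5 r6 [r7 r8 r9]]]] :=
 rint_quarter (rcontS cf q1 q3 q4 q6) q2 q5.
 exists q' => _; split=> //.
 by split; [exact: le_trans r1| | exact: le_trans q3|split;
 [exact: le_trans r4| |exact: le_trans q6]].
have [F hF] := choice step.
pose q n := iter n F ((a, b), (c, d)).
have iq n : inv (q n).
 elim: n => [|n IH]; first by split => //; split.
 by have [] := hF _ IH.
have am n m : (n <= m)%N -> (q n).1.1 <= (q m).1.1 /\ (q m).1.2 <= (q n).1.2 /\
 (q n).2.1 <= (q m).2.1 /\ (q m).2.2 <= (q n).2.2.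
 move=> /subnK <-; elim: (m - n)%N => [|k [h1 [h2 [h3 h4]]]] //=.
 have [_ k1 k2 [k3 k4 _ _ _]] := hF _ (iq (k + n)%N).
 by split; [exact: le_trans k1|split; [exact: le_trans h2|
 split; [exact: le_trans k3|exact: le_trans h4]]].
have len n : (q n).1.2 - (q n).1.1 = (b - a) / 2 ^+ n /\
 (q n).2.2 - (q n).2.1 = (d - c) / 2 ^+ n.
 elim: n => [|n [h1 h2]]; first by rewrite /= expr0 !divr1.
 have [_ _ _ [_ _ /= -> -> _]] := hF _ (iq n); rewrite h1 h2 exprS.
 by split; field.
have big n : rnorm (rint f a b c d) <= 4 ^+ n * rnorm (I (q n)).
 elim: n => [|n IH]; first by rewrite expr0 mul1r.
 have [_ _ _ [_ _ _ _ h]] := hF _ (iq n).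
 apply: (le_trans IH); rewrite exprSr -mulrA ler_wpM2l //.
have key (x y : nat -> R) : (forall n m, (n <= m)%N -> x n <= x m /\ y m <= y n) ->
 (forall n, x n <= y n) -> exists z, forall n, x n <= z <= y n.
 move=> mono xy.
 have ub m n : x n <= y m.
 have [/mono[h1 h2]|/ltnW/mono[h1 h2]] := leqP n m.
 exact: le_trans h1 (xy m).
 exact: le_trans (xy n) h2.
 exists (sup (range x)) => n; apply/andP; split.
 apply: ub_le_sup; last by exists n.
 by exists (y 0%N) => _ [k _ <-].
 by apply: ge_sup; [exists (x 0%N), 0%N|move=> _ [k _ <-]].
have [zx hzx] := key (fun n => (q n).1.1) (fun n => (q n).1.2)
 (fun n m nm => conj (am n m nm).1 (am n m nm).2.1)
 (fun n => let: And4 _ h _ _ := iq n in h).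
have [zy hzy] := key (fun n => (q n).2.1) (fun n => (q n).2.2)
 (fun n m nm => (am n m nm).2.2)
 (fun n => let: And4 _ _ _ (And3 _ h _) := iq n in h).
have [phi [cphi hphi]] := hf zx zy (hzx 0%N) (hzy 0%N).
set z0 := zx +i* zy in cphi hphi.
apply: rnorm_eq0; apply/eqP; rewrite eq_le rnorm_ge0 andbT.
pose L := (b - a) + (d - c).
have L0 : 0 <= L by rewrite addr_ge0 // subr_ge0.
apply/ler_addgt0Pr => e e0; rewrite add0r.
(* The n-th rectangle has diameter at most [L / 2^n] and perimeter [2 L / 2^n]. Their product
   cancels the factor [4^n] lost in the bisection, and [e L^2 / (L + 1)^2] remains. *)
have e1 : 0 < e / (2 * (L + 1) * (L + 1)).
 by rewrite divr_gt0 // !mulr_gt0 // ltr_wpDl.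
have [de de0 hde] := cphi _ e1.
have [n hn] : exists n, L / 2 ^+ n < de.
 exists (Num.truncn (L / de)).+1.
 rewrite ltr_pdivrMr // mulrC -ltr_pdivrMr //.
 apply: (lt_trans (truncnS_gt _)); rewrite -natrX ltr_nat.
 exact: ltn_expl.
apply: (le_trans (big n)).
have [q1 q2 q3 [q4 q5 q6]] := iq n.
have cq : rcont f (q n).1.1 (q n).1.2 (q n).2.1 (q n).2.2 := rcontS cf q1 q3 q4 q6.
pose g z := (f z0 - phi z0 * z0) + phi z0 * z.
have cg : forall z, ccont g z.
 move=> z; apply: ccontD; first exact: ccont_cst.
 by apply: ccontM; [exact: ccont_cst|exact: ccont_id].
have -> : I (q n) = rint (fun z => f z - g z) (q n).1.1 (q n).1.2 (q n).2.1 (q n).2.2.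
 by rewrite rintB ?rint_affine ?subr0 //; exact: rcont_boundary.
have [l1 l2] := len n.
have dist (t s : R) : (q n).1.1 <= t <= (q n).1.2 -> (q n).2.1 <= s <= (q n).2.2 ->
 rnorm ((t +i* s) - z0) <= L / 2 ^+ n.
 move=> /andP[t1 t2] /andP[s1 s2]; apply: (le_trans (rnorm_le_ReIm _)).
 have /andP[x1 x2] := hzx n; have /andP[y1 y2] := hzy n.
 rewrite /= /L mulrDl -l1 -l2; apply: lerD; rewrite ler_norml.
 by move: t1 t2 x1 x2; clear; lra.
 by move: s1 s2 y1 y2; clear; lra.
have bound : rnorm (rint (fun z => f z - g z) (q n).1.1 (q n).1.2 (q n).2.1 (q n).2.2) <=
 (e / (2 * (L + 1) * (L + 1)) * (L / 2 ^+ n)) *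
 (2 * ((q n).1.2 - (q n).1.1) + 2 * ((q n).2.2 - (q n).2.1)).
 apply: rint_norm => // [t s ht hs _|t s ht hs _].
 by apply: ccontD; [exact: cq|apply: (@ccontN R R[i]^o)].
 have -> : f (t +i* s) - g (t +i* s) = (phi (t +i* s) - phi z0) * (t +i* s - z0).
 rewrite mulrBl -hphi /g; ring.
 rewrite rnormM ler_pM ?rnorm_ge0 //; last exact: dist.
 by apply/ltW/hde; apply: le_lt_trans hn; exact: dist.
apply: (le_trans (ler_wpM2l (exprn_ge0 _ _) bound)) => //.
have e4 : 4 ^+ n = 2 ^+ n * 2 ^+ n :> R by rewrite -exprMn; congr (_ ^+ _); ring.
have -> : 4 ^+ n * (e / (2 * (L + 1) * (L + 1)) * (L / 2 ^+ n) *
 (2 * ((q n).1.2 - (q n).1.1) + 2 * ((q n).2.2 - (q n).2.1))) =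
 e * (L * L / ((L + 1) * (L + 1))).
 have L1 : L + 1 != 0 by rewrite gt_eqF // ltr_wpDl.
 have gen (K x : R) : K + 1 != 0 -> x != 0 ->
 x * x * (e / (2 * (K + 1) * (K + 1)) * (K / x) * (2 * (K / x))) =
 e * (K * K / ((K + 1) * (K + 1))).
 by move=> K1 x0; field; rewrite x0 K1.
 by rewrite l1 l2 e4 -mulrDr -mulrDl -/L; apply: gen => //; rewrite gt_eqF.
rewrite -[leRHS]mulr1 ler_wpM2l ?(ltW e0) //.
by rewrite ler_pdivrMr ?mulr_gt0 ?ltr_wpDl // mul1r ler_pM // lerDl.
Qed.

End goursat.

Section residues.
Context (R : realType).
Local Notation RM := (measurableTypeR R).
Let mu := @lebesgue_measure R.
Implicit Types (f D : R[i] -> R[i]) (a b c d : R).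

Lemma sint_real a b (phi : R -> R) :
 sint a b (fun t => (phi t)%:C) = (\int[mu]_(t in `[a, b]) phi t)%:C.
Proof.
by rewrite /sint /cint; congr (_ +i* _); rewrite Rintegral_cst ?mul0r.
Qed.

Lemma sintZ a b (k : R[i]) (g : R -> R[i]) : (forall t, a <= t <= b -> tcont g t) ->
 sint a b (fun t => k * g t) = k * sint a b g.
Proof.
move=> cg; apply/esym/wint_cint.
exact: (wintZ k _ (sint_wint cg)).
Qed.

Lemma tcont_realC (phi : R -> R) t :
 {for t, continuous phi} -> tcont (fun u => (phi u)%:C : R[i]) t.
Proof.
move=> /cvgrPdist_lt cphi e e0; have /nbhs_ballP[d d0 hd] := cphi e e0.
exists d => // u ut; rewrite -rmorphB rnorm_real distrC.
by apply: (hd u); rewrite /ball /= distrC.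
Qed.

(** The antiderivative is [2 atan ((t - c) / r)], with values [pi / 2] and [- pi / 2] at the end
    points. The integrand is what two opposite sides of a square of half-width [r] contribute around
    a simple pole at its centre. *)
Lemma integral_poisson_kernel (c r : R) : 0 < r ->
 \int[mu]_(t in `[c - r, c + r]) (2 * r / ((t - c) ^+ 2 + r ^+ 2)) = pi.
Proof.
move=> r0.
have pos t : 0 < (t - c) ^+ 2 + r ^+ 2 by rewrite ltr_wpDl ?sqr_ge0 // exprn_gt0.
pose F (t : R) := 2 * atan (r^-1 * (t - c)).
have dF t : is_derive t (1 : R) F (2 * r / ((t - c) ^+ 2 + r ^+ 2)).
 have d1 : is_derive t (1 : R) (fun t => r^-1 * (t - c)) (r^-1 * (1 - 0)).
 exact: (is_deriveZ r^-1 (is_deriveB (is_derive_id t 1) (is_derive_cst c t 1))).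
 have d2 := @is_derive1_comp _ atan (fun t => r^-1 * (t - c)) t _ _ (is_derive1_atan _) d1.
 have d3 := is_deriveZ 2 d2; apply: (is_derive_eq d3).
 rewrite /GRing.scale /= subr0 mulr1.
 have -> : 1 + (r^-1 * (t - c)) ^+ 2 = ((t - c) ^+ 2 + r ^+ 2) / r ^+ 2.
 by field; rewrite gt_eqF.
 by field; rewrite !gt_eqF.
have cF t : {for t, continuous F}.
 by apply/differentiable_continuous/derivable1_diffP; have [] := dF t.
rewrite /Rintegral (@continuous_FTC2 _ _ F).
- rewrite /F /= [c + r - c]addrAC subrr add0r [c - r - c]addrAC subrr add0r.
 by rewrite mulrN mulVf ?gt_eqF // atanN atan1; lra.
- by move: r0; lra.
- apply: continuous_subspaceT => t; apply: cvgM; first exact: cvg_cst.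
 apply: cvgV; first by rewrite gt_eqF.
 apply: cvgD; last exact: cvg_cst.
 by apply: (cvg_comp (fun t => t - c) (fun x => x ^+ 2)) (@exprn_continuous _ 2 _); apply: cvgB; [exact: cvg_id|exact: cvg_cst].
- split; [by move=> t _; have [] := dF t| |].
 by apply: cvg_at_right_filter; exact: cF.
 by apply: cvg_at_left_filter; exact: cF.
- by move=> t _; rewrite derive1E; have [_ ->] := dF t.
Qed.

Let sint_poisson (k : R[i]) (c r : R) : 0 < r ->
 sint (c - r) (c + r) (fun t => k * (2 * r / ((t - c) ^+ 2 + r ^+ 2))%:C) = k * pi%:C.
Proof.
move=> r0; rewrite sintZ ?sint_real ?integral_poisson_kernel // => t _.
apply: tcont_realC; apply: cvgM; first exact: cvg_cst.
apply: cvgV; first by rewrite gt_eqF // ltr_wpDl ?sqr_ge0 // exprn_gt0.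
apply: cvgD; last exact: cvg_cst.
by apply: (cvg_comp (fun t => t - c) (fun x => x ^+ 2)) (@exprn_continuous _ 2 _); apply: cvgB; [exact: cvg_id|exact: cvg_cst].
Qed.

(** Opposite sides are subtracted before integrating: the pair combines into a Poisson kernel, and
    the horizontal and the vertical pair each contribute [i pi]. *)
Lemma rint_inv (u v r : R) : 0 < r ->
 rint (fun z => (z - (u +i* v))^-1) (u - r) (u + r) (v - r) (v + r) = 2 * pi%:C * 'i.
Proof.
move=> r0; set f := fun z => _.
have cf t s : (t != u) || (s != v) -> ccont f (t +i* s).
 move=> h; apply: ccontV.
 by rewrite subr_eq0 eq_complex /= negb_and.
 by apply: ccontD; [exact: ccont_id|exact: ccont_cst].
have vr : v - r != v by rewrite -subr_eq0 addrAC subrr add0r oppr_eq0 gt_eqF.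
have vr' : v + r != v by rewrite -subr_eq0 addrAC subrr add0r gt_eqF.
have ur : u - r != u by rewrite -subr_eq0 addrAC subrr add0r oppr_eq0 gt_eqF.
have ur' : u + r != u by rewrite -subr_eq0 addrAC subrr add0r gt_eqF.
have ch s : s != v -> forall t, tcont (fun x => f (x +i* s)) t.
 by move=> sv t; apply: tcont_h; apply: cf; rewrite sv orbT.
have cv t : t != u -> forall s, tcont (fun x => f (t +i* x)) s.
 by move=> tu s; apply: tcont_v; apply: cf; rewrite tu.
have i2 : ('i : R[i]) * 'i = -1 by rewrite -expr2 sqr_i.
have prod (x y : R) : (x%:C - 'i * y%:C) * (x%:C + 'i * y%:C) = (x ^+ 2 + y ^+ 2)%:C :> R[i].
 rewrite rmorphD !rmorphXn /=.
 transitivity (x%:C ^+ 2 - ('i * 'i) * y%:C ^+ 2 : R[i]); first by ring.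
 by rewrite i2; ring.
have nz (x y : R) : (x != 0) || (y != 0) ->
 (x%:C - 'i * y%:C != 0 :> R[i]) && (x%:C + 'i * y%:C != 0 :> R[i]).
 move=> xy; rewrite -negb_or -mulf_eq0 prod.
 by rewrite (inj_eq (@complexI R)) paddr_eq0 ?sqr_ge0 // !expf_eq0 /= negb_and.
have split_ (x y : R) : (2 * y / (x ^+ 2 + y ^+ 2))%:C =
 2 * y%:C / ((x%:C - 'i * y%:C) * (x%:C + 'i * y%:C)) :> R[i].
 by rewrite fmorph_div /= realcM prod rmorph_nat.
have nzl x := nz x r (introT orP (or_intror (negbT (gt_eqF r0)))).
have nzr y := nz r y (introT orP (or_introl (negbT (gt_eqF r0)))).
have h : sint (u - r) (u + r) (fun t => f (t +i* (v - r))) -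
 sint (u - r) (u + r) (fun t => f (t +i* (v + r))) = 'i * pi%:C.
 rewrite -sintB; [|by move=> t _; exact: ch..].
 rewrite -(sint_poisson 'i u r0); apply: eq_sint => t _.
 have /andP[n1 n2] := nzl (t - u).
 rewrite /f split_.
 have -> : t +i* (v - r) - (u +i* v) = (t - u)%:C - 'i * r%:C.
 by cparts.
 have -> : t +i* (v + r) - (u +i* v) = (t - u)%:C + 'i * r%:C.
 by cparts.
 by move: n1 n2; move: (t - u)%:C => x n1 n2; field; rewrite n1 n2.
have w : sint (v - r) (v + r) (fun s => f ((u + r) +i* s)) -
 sint (v - r) (v + r) (fun s => f ((u - r) +i* s)) = pi%:C.
 rewrite -sintB; [|by move=> t _; exact: cv..].
 rewrite -[RHS]mul1r -(sint_poisson 1 v r0); apply: eq_sint => s _.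
 have /andP[n1 n2] := nzr (s - v).
 have -> : (2 * r / ((s - v) ^+ 2 + r ^+ 2))%:C =
 2 * r%:C / ((r%:C - 'i * (s - v)%:C) * (r%:C + 'i * (s - v)%:C)) :> R[i].
 by rewrite prod fmorph_div /= realcM rmorph_nat addrC.
 rewrite /f mul1r.
 have -> : (u + r) +i* s - (u +i* v) = r%:C + 'i * (s - v)%:C.
 by cparts.
 have -> : (u - r) +i* s - (u +i* v) = - (r%:C - 'i * (s - v)%:C).
 by cparts.
 by rewrite invrN opprK; move: n1 n2; move: (s - v)%:C => x n1 n2; field; rewrite n1 n2.
rewrite /rint [X in X - _]addrAC h -addrA -mulrBr w.
by ring.
Qed.

(* The rectangle is cut along the four lines bounding a small square centred at
 the pole; the outer pieces contribute nothing. *)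
Lemma rint_residue D a b c d (u v : R) (k : R[i]) : a < u < b -> c < v < d ->
 (forall t s, a <= t <= b -> c <= s <= d -> (t != u) || (s != v) ->
 cdiff D (t +i* s)) ->
 (forall e : R, 0 < e -> exists2 r : R, 0 < r & forall z, z != u +i* v ->
 rnorm (z - (u +i* v)) < r -> rnorm ((z - (u +i* v)) * D z - k) <= e) ->
 rint D a b c d = 2 * pi%:C * 'i * k.
Proof.
move=> /andP[au ub] /andP[cv vd] hD hk; set w := u +i* v in hk *.
apply: eq_rnorm_small => e e0.
have e8 : 0 < e / 8 by rewrite divr_gt0.
have [del del0 hdel] := hk _ e8.
pose r := Num.min (del / 4) (Num.min (Num.min ((u - a) / 2) ((b - u) / 2))
 (Num.min ((v - c) / 2) ((d - v) / 2))).
have r0 : 0 < r by rewrite /r !lt_min !divr_gt0 // subr_gt0.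
have [r1 r2 r3 [r4 r5]] : [/\ r <= del / 4, r <= (u - a) / 2, r <= (b - u) / 2 &
 r <= (v - c) / 2 /\ r <= (d - v) / 2].
 by rewrite /r !ge_min !lexx !orbT.
have {r2 r3 r4 r5} [a1 b1 [c1 d1]] : [/\ a < u - r, u + r < b & c < v - r /\ v + r < d].
 by move: r2 r3 r4 r5 au ub cv vd r0; clear; repeat split; lra.
have hc t s : a <= t <= b -> c <= s <= d -> (t != u) || (s != v) -> ccont D (t +i* s).
 by move=> *; apply: cdiff_ccont; exact: hD.
have bc a' b' c' d' : a <= a' -> b' <= b -> c <= c' -> d' <= d ->
 a' != u -> b' != u -> c' != v -> d' != v -> bcont D a' b' c' d'.
 move=> aa bb cc dd n1 n2 n3 n4 t s /andP[t1 t2] /andP[s1 s2] h.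
 apply: hc; rewrite ?(le_trans aa t1) ?(le_trans t2 bb) ?(le_trans cc s1) ?(le_trans s2 dd) //.
 by move: h; rewrite -!orbA => /or4P[] /eqP ->; rewrite ?n1 ?n2 ?n3 ?n4 ?orbT.
have zero a' b' c' d' : a <= a' -> b' <= b -> c <= c' -> d' <= d -> a' <= b' -> c' <= d' ->
 (b' < u) || (u < a') || (d' < v) || (v < c') -> rint D a' b' c' d' = 0.
 move=> aa bb cc dd ab cd h; apply: goursat => // t s /andP[t1 t2] /andP[s1 s2].
 apply: hD; rewrite ?(le_trans aa t1) ?(le_trans t2 bb) ?(le_trans cc s1) ?(le_trans s2 dd) //.
 move: h; rewrite -!orbA => /or4P[] h.
 - by rewrite lt_eqF ?(le_lt_trans t2 h).
 - by rewrite gt_eqF ?(lt_le_trans h t1).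
 - by apply/orP; right; rewrite lt_eqF ?(le_lt_trans s2 h).
 - by apply/orP; right; rewrite gt_eqF ?(lt_le_trans h s1).
have ne : [/\ a != u, b != u, u - r != u, u + r != u & [/\ c != v, d != v, v - r != v & v + r != v]].
 have h1 : u - r < u by rewrite ltrBlDr ltrDl.
 have h2 : u < u + r by rewrite ltrDl.
 have h3 : v - r < v by rewrite ltrBlDr ltrDl.
 have h4 : v < v + r by rewrite ltrDl.
 by rewrite (lt_eqF au) (gt_eqF ub) (lt_eqF h1) (gt_eqF h2) (lt_eqF cv) (gt_eqF vd)
 (lt_eqF h3) (gt_eqF h4).
have [ne1 ne2 ne3 ne4 [ne5 ne6 ne7 ne8]] := ne.
have ur : u - r <= u + r by move: r0; clear; lra.
have vr : v - r <= v + r by move: r0; clear; lra.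
have cd : c <= d by rewrite ltW // (lt_trans cv).
have A1 := ltW a1; have B1 := ltW b1; have C1 := ltW c1; have D1 := ltW d1.
have urb := le_trans ur B1; have vrd := le_trans vr D1; have cvr := le_trans C1 vr.
have u1 : u - r < u by rewrite ltrBlDr ltrDl.
have u2 : u < u + r by rewrite ltrDl.
have v1 : v - r < v by rewrite ltrBlDr ltrDl.
have v2 : v < v + r by rewrite ltrDl.
have -> : rint D a b c d = rint D (u - r) (u + r) (v - r) (v + r).
 rewrite (@rint_hsplit _ D a (u - r) b c d); [|exact: bc|by rewrite A1|by []].
 rewrite (zero a (u - r)) ?u1 // add0r.
 rewrite (@rint_hsplit _ D (u - r) (u + r) b c d); [|exact: bc|by rewrite ur|by []].
 rewrite (zero (u + r) b) ?u2 ?orbT ?addr0 ?(le_trans A1) //.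
 rewrite (@rint_vsplit _ D (u - r) (u + r) c (v - r) d); [|exact: bc|by rewrite C1|by []].
 rewrite (zero _ _ c (v - r)) ?v1 ?orbT ?add0r //.
 rewrite (@rint_vsplit _ D (u - r) (u + r) (v - r) (v + r) d);
 [|exact: bc|by rewrite vr|by []].
 by rewrite (zero _ _ (v + r) d) ?v2 ?orbT ?addr0 ?(le_trans C1).
have cinv z : z != w -> ccont (fun z => k * (z - w)^-1) z.
 move=> zw; apply: ccontM; first exact: ccont_cst.
 by apply: ccontV; [rewrite subr_eq0|apply: ccontD; [exact: ccont_id|exact: ccont_cst]].
have bw t s : u - r <= t <= u + r -> v - r <= s <= v + r ->
 (t == u - r) || (t == u + r) || (s == v - r) || (s == v + r) -> t +i* s != w.
 move=> _ _; rewrite /w eq_complex /= negb_and -!orbA.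
 by case/or4P => /eqP ->; rewrite ?ne3 ?ne4 ?ne7 ?ne8 ?orbT.
have bD : bcont D (u - r) (u + r) (v - r) (v + r) by exact: bc.
have bi : bcont (fun z => k * (z - w)^-1) (u - r) (u + r) (v - r) (v + r).
 by move=> t s ht hs h; apply: cinv; exact: bw.
have ei : 2 * pi%:C * 'i * k = rint (fun z => k * (z - w)^-1) (u - r) (u + r) (v - r) (v + r).
 rewrite -(rint_inv u v r0) /rint -/w.
 have ci z : z != w -> ccont (fun z => (z - w)^-1) z.
 move=> zw; apply: ccontV; first by rewrite subr_eq0.
 by apply: ccontD; [exact: ccont_id|exact: ccont_cst].
 rewrite !sintZ; first by ring.
 1,3: by move=> x hx; apply: (tcont_v (F := fun z : R[i] => (z - w)^-1)); apply: ci; apply: bw => //; rewrite ?lexx ?eqxx ?orbT ?andbT.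
 1-2: by move=> x hx; apply: (tcont_h (F := fun z : R[i] => (z - w)^-1)); apply: ci; apply: bw => //; rewrite ?lexx ?eqxx ?orbT ?andbT.
rewrite ei -rintB //.
(* The small square has perimeter [8 r], and on it the distance to the pole is at least [r], so an
   error [e / 8] in the residue becomes [e] in the integral. *)
apply: le_trans (rint_norm (M := e / 8 / r) _ ur vr _) _.
- move=> t s ht hs h; apply: ccontD; first exact: bD.
 by apply: (@ccontN R R[i]^o); exact: bi.
- move=> t s ht hs h; set z := t +i* s; have zw : z != w by exact: bw.
 have zw0 : z - w != 0 by rewrite subr_eq0.
 have zr : rnorm (z - w) < del.
 apply: (le_lt_trans (rnorm_le_ReIm _)); rewrite /=.
 have h1 : `|t - u| <= r by rewrite ler_norml; move: ht => /andP[]; clear; lra.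
 have h2 : `|s - v| <= r by rewrite ler_norml; move: hs => /andP[]; clear; lra.
 by move: h1 h2 r1 del0; clear; lra.
 have rz : r <= rnorm (z - w).
 have absr : `|r| = r by rewrite gtr0_norm.
 move: h; rewrite -!orbA => /or4P[]/eqP hz.
 + apply: le_trans (normr_Re_le _); rewrite /= hz.
 by rewrite addrAC subrr add0r normrN absr.
 + by apply: le_trans (normr_Re_le _); rewrite /= hz addrAC subrr add0r absr.
 + apply: le_trans (normr_Im_le _); rewrite /= hz.
 by rewrite addrAC subrr add0r normrN absr.
 + by apply: le_trans (normr_Im_le _); rewrite /= hz addrAC subrr add0r absr.
 have -> : D z - k / (z - w) = ((z - w) * D z - k) / (z - w) by field.
 rewrite rnormM rnormV ler_pM ?invr_ge0 ?rnorm_ge0 //; first exact: hdel.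
 by rewrite lef_pV2 // posrE // (lt_le_trans r0).
- apply: eq_ler; field; by rewrite gt_eqF.
Qed.

End residues.

Section strips.
Context (R : realType).
Local Notation RM := (measurableTypeR R).
Let mu := @lebesgue_measure R.
Implicit Types (f : R[i] -> R[i]) (a c d : R).

(** The single integrable weight in which decay along horizontal lines is measured throughout. *)
Definition rho (t : R) : R := (1 + t ^+ 2)^-1.

Lemma rho_gt0 t : 0 < rho t.
Proof. by rewrite invr_gt0 ltr_pwDl ?sqr_ge0. Qed.

Lemma rho_ge0 t : 0 <= rho t. Proof. exact/ltW/rho_gt0. Qed.

Local Hint Resolve rho_ge0 : core.

Lemma rho_le1 t : rho t <= 1.
Proof. by rewrite invf_le1 ?lerDl ?sqr_ge0 // ltr_pwDl ?sqr_ge0. Qed.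

Lemma rho_le (s t : R) : `|s| <= `|t| -> rho t <= rho s.
Proof.
move=> st; rewrite lef_pV2 ?posrE ?ltr_pwDl ?sqr_ge0 // lerD2l.
by rewrite -(real_normK (num_real s)) -(real_normK (num_real t)) lerXn2r.
Qed.

Lemma continuous_rho : continuous rho.
Proof. exact: continuous_oneDsqrV. Qed.

Lemma integrable_rho : mu.-integrable [set: RM] (EFin \o rho).
Proof.
apply/integrableP; split.
 by apply/measurable_EFinP; apply: continuous_measurable_fun; exact: continuous_rho.
rewrite (eq_integral (fun t : RM => (rho t)%:E)); last first.
 by move=> t _ /=; rewrite ger0_norm // rho_ge0.
rewrite ge0_symfun_integralT; [|exact: rho_ge0|exact: continuous_rho|by move=> t; rewrite /rho /= sqrrN].
have := integral0y_oneDsqr R; rewrite set_itvcy => h.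
by rewrite [X in (_ * X)%E]h -EFinM ltry.
Qed.

Lemma integrable_rhoZ a : mu.-integrable [set: RM] (EFin \o (fun t => a * rho t)).
Proof. exact: (integrableZl measurableT a integrable_rho). Qed.

Lemma dominated_Rcvg (D : set RM) (h : nat -> R -> R) (f g : R -> R) : measurable D ->
 (forall n, measurable_fun D (h n)) ->
 (forall t, D t -> h n t @[n --> \oo] --> f t) ->
 mu.-integrable D (EFin \o g) -> (forall n t, D t -> `|h n t| <= g t) ->
 mu.-integrable D (EFin \o f) /\
 \int[mu]_(t in D) h n t @[n --> \oo] --> \int[mu]_(t in D) f t.
Proof.
move=> mD mh hf ig hg.
have mf : measurable_fun D f by apply: (measurable_fun_cvg mh).
have cv t : D t -> (h n t)%:E @[n --> \oo] --> (f t)%:E.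
 by move=> Dt; apply/fine_cvgP; split; [exact: nearW|exact: hf].
have fg t : D t -> `|f t| <= g t.
 move=> Dt; have h1 : `|h n t| @[n --> \oo] --> `|f t| by apply: cvg_norm; exact: hf.
 rewrite -(cvg_lim _ h1) //; apply: limr_le; first by apply/cvg_ex; exists `|f t|.
 by apply: nearW => n; exact: hg.
have fi : mu.-integrable D (EFin \o f) by exact: le_rintegrable ig.
split => //.
have h1 := @dominated_cvg _ _ _ mu D mD (fun n t => (h n t)%:E) (EFin \o f) (EFin \o g)
 (fun n => (measurable_EFinP _ _).2 (mh n)) cv (fun t _ => isT) ig
 (fun n t Dt => hg n t Dt).
apply: fine_cvg; rewrite fineK; first exact: h1.
exact: integrable_fin_num.
Qed.

Lemma Rintegral_growing (phi : R -> R) : mu.-integrable [set: RM] (EFin \o phi) ->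
 \int[mu]_(t in `[(- n%:R), n%:R]) phi t @[n --> \oo] --> \int[mu]_t phi t.
Proof.
move=> iphi; have /integrableP[/measurable_EFinP mphi _] := iphi.
under eq_fun do rewrite Rintegral_mkcond.
apply: (dominated_Rcvg (g := fun t => `|phi t|) measurableT _ _ _ _).2.
- move=> n; apply/measurable_restrict => //.
 by rewrite setTI; apply: measurable_funS mphi.
- move=> t _; apply: cvg_near_cst; exists (Num.truncn `|t|).+1 => // n /= tn.
 rewrite patchE mem_set // /= in_itv /= -ler_norml.
 by rewrite (le_trans (ltW (truncnS_gt _))) // ler_nat.
- exact: integrable_norm.
- by move=> n t _; rewrite patchE; case: ifP => // _; rewrite normr0.
Qed.

Definition lint f (eta : R) : R[i] := cint [set: RM] (fun t => f (t +i* eta)).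

Lemma tcont_measurable (V : normedZmodType R[i]) (g : R -> V) (phi : V -> R) :
 (forall t, tcont g t) -> (forall u v, `|phi u - phi v| <= rnorm (u - v)) ->
 measurable_fun [set: RM] (phi \o g).
Proof.
by move=> cg lphi; apply: continuous_measurable_fun => t; exact: tcont_real.
Qed.

Lemma cint_wint_dominated (g : R -> R[i]) (b : R -> R) : (forall t, tcont g t) ->
 mu.-integrable [set: RM] (EFin \o b) -> (forall t, rnorm (g t) <= b t) ->
 is_wint (V := R[i]^o) [set: RM] g (cint [set: RM] g).
Proof.
move=> cg ib gb; apply: cint_wint => //; apply: (@le_rintegrable _ _ _ b) => //.
- apply: (tcont_measurable (phi := fun z => Re z) cg) => u v.
 by rewrite -raddfB normr_Re_le.
- by move=> t _; rewrite (le_trans (normr_Re_le _)).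
- apply: (tcont_measurable (phi := fun z => Im z) cg) => u v.
 by rewrite -raddfB normr_Im_le.
- by move=> t _; rewrite (le_trans (normr_Im_le _)).
Qed.

Lemma line_wint f eta a : (forall t, ccont f (t +i* eta)) ->
 (forall t, rnorm (f (t +i* eta)) <= a * rho t) ->
 is_wint (V := R[i]^o) [set: RM] (fun t => f (t +i* eta)) (lint f eta).
Proof.
move=> cf fa; apply: (cint_wint_dominated (b := fun t => a * rho t)) => //.
 by move=> t; exact: tcont_h.
exact: integrable_rhoZ.
Qed.

Lemma lint_growing f eta a : (forall t, ccont f (t +i* eta)) ->
 (forall t, rnorm (f (t +i* eta)) <= a * rho t) ->
 rnorm (sint (- n%:R) n%:R (fun t => f (t +i* eta)) - lint f eta) @[n --> \oo] --> (0 : R).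
Proof.
move=> cf fa; have w := line_wint cf fa.
have [ir _] := w _ (rfun_Re R); have [ii _] := w _ (rfun_Im R).
have hr := Rintegral_growing ir; have hi := Rintegral_growing ii.
apply/cvgrPdist_lt => e e0; have e2 : 0 < e / 2 by rewrite divr_gt0.
have /cvgrPdist_lt/(_ _ e2) h1 := hr; have /cvgrPdist_lt/(_ _ e2) h2 := hi.
near=> n; rewrite sub0r normrN ger0_norm ?rnorm_ge0 //.
apply: (le_lt_trans (rnorm_le_ReIm _)); rewrite (splitr e).
rewrite /= distrC [X in _ + X]distrC; apply: ltrD; near: n; [exact: h1|exact: h2].
Unshelve. all: by end_near. Qed.

(** The vertical sides at [n] and [-n] are at most [a * rho n * (d - c)] and vanish in the limit.
    The threshold [N] leaves room for a pole inside the strip. *)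
Lemma strip_limit f c d a (Z : R[i]) (N : nat) : c <= d ->
 (forall t, ccont f (t +i* c)) -> (forall t, ccont f (t +i* d)) ->
 (forall t, rnorm (f (t +i* c)) <= a * rho t) ->
 (forall t, rnorm (f (t +i* d)) <= a * rho t) ->
 (forall t s, c <= s <= d -> N%:R <= `|t| ->
 ccont f (t +i* s) /\ rnorm (f (t +i* s)) <= a * rho t) ->
 (forall n : nat, (N <= n)%N -> rint f (- n%:R) n%:R c d = Z) ->
 lint f c - lint f d = Z.
Proof.
move=> cd cc ccd bc bd side hZ.
apply: eq_rnorm_small => e e0.
have e4 : 0 < e / 4 by rewrite divr_gt0.
have /cvgrPdist_lt/(_ _ e4) h1 := lint_growing cc bc.
have /cvgrPdist_lt/(_ _ e4) h2 := lint_growing ccd bd.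
have a0 : 0 <= a.
 by have := le_trans (rnorm_ge0 _) (bc 0); rewrite pmulr_lge0 // rho_gt0.
pose M := a * (d - c) / (e / 4).
have M0 : 0 <= M by rewrite !mulr_ge0 ?invr_ge0 ?(ltW e4) ?subr_ge0.
have h3 : \forall n \near \oo, a * rho n%:R * (d - c) < e / 4.
 exists (Num.truncn M).+1 => // n /= Mn.
 have Mn' : M < n%:R by apply: (lt_le_trans (truncnS_gt _)); rewrite ler_nat.
 rewrite mulrAC /rho ltr_pdivrMr // [ltRHS]mulrC -ltr_pdivrMr // -/M.
 apply: (lt_le_trans Mn'); rewrite -natrX -[1]/(1%:R) -natrD ler_nat.
 by rewrite (leq_trans _ (leq_addl _ _)) // -mulnn leq_pmulr // (leq_trans _ Mn).
near \oo => n.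
have nN : (N <= n)%N by near: n; exists N.
have nR : N%:R <= `|n%:R : R| by rewrite ger0_norm // ler_nat.
have k1 : rnorm (sint (- n%:R) n%:R (fun t => f (t +i* c)) - lint f c) < e / 4.
 have : `|0 - rnorm (sint (- n%:R) n%:R (fun t => f (t +i* c)) - lint f c)| < e / 4.
 by near: n.
 by rewrite sub0r normrN ger0_norm ?rnorm_ge0.
have k2 : rnorm (sint (- n%:R) n%:R (fun t => f (t +i* d)) - lint f d) < e / 4.
 have : `|0 - rnorm (sint (- n%:R) n%:R (fun t => f (t +i* d)) - lint f d)| < e / 4.
 by near: n.
 by rewrite sub0r normrN ger0_norm ?rnorm_ge0.
have k3 : a * rho n%:R * (d - c) < e / 4 by near: n.
have side_int (x : R) : `|x| = n%:R ->
 rnorm (sint c d (fun s => f (x +i* s))) < e / 4.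
 move=> xn; apply: le_lt_trans k3; apply: sint_norm => // s scd.
 by apply: tcont_v; apply: (side x s scd _).1; rewrite xn -[n%:R]ger0_norm.
 apply: (le_trans (side x s scd _).2); first by rewrite xn -[n%:R]ger0_norm.
 by rewrite ler_wpM2l // rho_le // xn ger0_norm.
have k4 := side_int n%:R (ger0_norm (ler0n _ _)).
have k5 : rnorm (sint c d (fun s => f (- n%:R +i* s))) < e / 4.
 by apply: side_int; rewrite normrN ger0_norm.
have := hZ n nN; rewrite /rint.
set S1 := sint _ _ _ in k1 *; set S2 := sint _ _ _ in k4 *.
set S3 := sint _ _ _ in k2 *; set S4 := sint _ _ _ in k5 * => <-.
have -> : lint f c - lint f d - (S1 + 'i * S2 - S3 - 'i * S4) =
 - (S1 - lint f c) + (S3 - lint f d) - 'i * S2 + 'i * S4 by ring.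
have t1 := ler_rnormD (- (S1 - lint f c) + (S3 - lint f d) - 'i * S2) ('i * S4).
have t2 := ler_rnormB (- (S1 - lint f c) + (S3 - lint f d)) ('i * S2).
have t3 := ler_rnormD (- (S1 - lint f c)) (S3 - lint f d).
move: t1 t2 t3; rewrite rnormN [rnorm ('i * S4)]rnormM [rnorm ('i * S2)]rnormM rnormi !mul1r.
move: k1 k2 k4 k5; clear; lra.
Unshelve. all: by end_near. Qed.

Lemma strip_cauchy f c d a : c <= d ->
 (forall t s, c <= s <= d -> cdiff f (t +i* s)) ->
 (forall t s, c <= s <= d -> rnorm (f (t +i* s)) <= a * rho t) ->
 lint f c = lint f d.
Proof.
move=> cd hf fa; apply/eqP; rewrite -subr_eq0; apply/eqP.
have c1 : c <= c <= d by rewrite lexx.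
have d1 : c <= d <= d by rewrite lexx andbT.
apply: (strip_limit (a := a) (N := 0)) => //.
- by move=> t; apply: cdiff_ccont; exact: hf.
- by move=> t; apply: cdiff_ccont; exact: hf.
- by move=> t; exact: fa.
- by move=> t; exact: fa.
- by move=> t s scd _; split; [apply: cdiff_ccont; exact: hf|exact: fa].
- move=> n _; apply: goursat => //; last by rewrite -subr_ge0 opprK addr_ge0.
 by move=> t s _ scd; exact: hf.
Qed.

Lemma strip_residue f c d a (u v : R) (k : R[i]) : c < v < d ->
 (forall t s, c <= s <= d -> (t != u) || (s != v) -> cdiff f (t +i* s)) ->
 (forall t s, c <= s <= d -> (s == c) || (s == d) || (1 <= `|t - u|) ->
 rnorm (f (t +i* s)) <= a * rho t) ->
 (forall e : R, 0 < e -> exists2 r : R, 0 < r & forall z, z != u +i* v ->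
 rnorm (z - (u +i* v)) < r -> rnorm ((z - (u +i* v)) * f z - k) <= e) ->
 lint f c - lint f d = 2 * pi%:C * 'i * k.
Proof.
move=> cvd hf fa hk; have /andP[cv vd] := cvd.
have cd : c <= d by rewrite ltW // (lt_trans cv).
have c1 : c <= c <= d by rewrite lexx.
have d1 : c <= d <= d by rewrite lexx andbT.
(* Beyond [N] a vertical side is at distance more than 1 from the pole, where the bound on [f] is
   available. *)
pose N := (Num.truncn `|u|).+2.
have uN : `|u| + 1 < N%:R.
 by rewrite /N -[(_).+2]addn1 natrD ltrD2r; exact: truncnS_gt.
apply: (strip_limit (a := a) (N := N)) => //.
- by move=> t; apply: cdiff_ccont; apply: hf => //; rewrite (lt_eqF cv) orbT.
- by move=> t; apply: cdiff_ccont; apply: hf => //; rewrite (gt_eqF vd) orbT.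
- by move=> t; apply: fa => //; rewrite eqxx.
- by move=> t; apply: fa => //; rewrite eqxx orbT.
- move=> t s scd Nt.
 have tu : 1 < `|t - u|.
 have := lerB_dist t u; have := lt_le_trans uN Nt; move: (`|t - u|) => x; lra.
 split; last by apply: fa => //; rewrite (ltW tu) orbT.
 apply: cdiff_ccont; apply: hf => //; apply/orP; left; apply: contraTneq tu => ->.
 by rewrite subrr normr0 -leNgt.
- move=> n Nn; apply: rint_residue hk => //.
 have : `|u| < n%:R.
 apply: lt_le_trans (_ : N%:R <= _); last by rewrite ler_nat.
 by apply: lt_trans uN; rewrite ltrDl.
 by rewrite ltr_norml.
 by move=> t s _ scd; exact: hf.
Qed.

End strips.

Section substitutions.
Context (R : realType).
Local Notation RM := (measurableTypeR R).
Let mu := @lebesgue_measure R.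

(** The change of variable that carries a ray of the sector to a horizontal line. From this compact
    case, nonnegative integrands follow by exhaustion and integrable ones by positive and negative
    parts. *)
Lemma exp_substitution_itv (g : R -> R) (n : R) : 0 <= n ->
 (forall r, 0 < r -> {for r, continuous g}) ->
 (\int[mu]_(r in `[expR (- n)%R, expR n]) (g r)%:E =
 \int[mu]_(t in `[(- n)%R, n]) (g (expR t) * expR t)%:E)%E.
Proof.
move=> n0 cg; have dE : derive1 (expR : R -> R) = expR.
 by apply/funext => x; rewrite derive1E; exact: derive_val.
rewrite (@integration_by_substitution_increasing R expR g (- n) n).
- by apply: eq_integral => t _ /=; rewrite dE.
- by lra.
- by move=> x y _ _ xy; rewrite ltr_expR.
- by rewrite dE => x _; exact: continuous_expR.
- rewrite dE; apply/cvg_ex; exists (expR (- n)).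
 by apply: cvg_at_right_filter; exact: continuous_expR.
- rewrite dE; apply/cvg_ex; exists (expR n).
 by apply: cvg_at_left_filter; exact: continuous_expR.
- split.
 + by move=> x _; exact: derivable_expR.
 + by apply: cvg_at_right_filter; exact: continuous_expR.
 + by apply: cvg_at_left_filter; exact: continuous_expR.
- apply: continuous_in_subspaceT => x; rewrite inE /= in_itv /= => /andP[h _].
 by apply: cg; apply: lt_le_trans h; rewrite expR_gt0.
Qed.

Lemma measurable_pos_continuous (g : R -> R) :
 (forall r, 0 < r -> {for r, continuous g}) ->
 measurable_fun (`]0, +oo[%classic : set RM) g.
Proof.
move=> cg; apply: open_continuous_measurable_fun => //.
by move=> x; rewrite inE /= in_itv /= andbT; exact: cg.
Qed.

Lemma exp_bigcup : \bigcup_n `[expR (- n%:R), expR n%:R]%classic = `]0, +oo[%classic :> set R.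
Proof.
apply/seteqP; split=> [r [n _] /=|r /=]; rewrite !in_itv /=.
 by move=> /andP[h _]; rewrite andbT; apply: lt_le_trans h; rewrite expR_gt0.
rewrite andbT => r0; exists (Num.truncn `|ln r|).+1 => //=.
have := ltW (truncnS_gt `|ln r|); rewrite ler_norml => /andP[h1 h2].
by rewrite in_itv /= -[X in _ <= X <= _]lnK ?posrE // !ler_expR h1 h2.
Qed.

Lemma line_bigcup : \bigcup_n `[(- n%:R), n%:R]%classic = [set: R].
Proof.
apply/seteqP; split=> // t _; exists (Num.truncn `|t|).+1 => //=.
by rewrite in_itv /= -ler_norml ltW // truncnS_gt.
Qed.

Lemma exp_substitution_ge0 (g : R -> R) :
 (forall r, 0 < r -> {for r, continuous g}) -> (forall r, 0 < r -> 0 <= g r) ->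
 (\int[mu]_(r in `]0%R, +oo[) (g r)%:E = \int[mu]_t (g (expR t) * expR t)%:E)%E.
Proof.
move=> cg g0.
have mg := measurable_pos_continuous cg.
have cge t : {for t, continuous (fun t => g (expR t) * expR t)}.
 apply: continuousM; last exact: continuous_expR.
 apply: continuous_comp; first exact: continuous_expR.
 by apply: cg; rewrite expR_gt0.
have h1 := @ge0_nondecreasing_set_cvg_integral _ _ _
 (fun n : nat => `[expR (- n%:R), expR n%:R]%classic : set RM) (EFin \o g) mu _ _ _ _.
have h2 := @ge0_nondecreasing_set_cvg_integral _ _ _
 (fun n : nat => `[(- n%:R), n%:R]%classic : set RM) (fun t => (g (expR t) * expR t)%:E) mu _ _ _ _.
rewrite exp_bigcup in h1; rewrite line_bigcup in h2.
apply: (cvg_unique _ (h1 _ _ _ _)) => //.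
- move=> m n mn; apply/subsetPset => r /=; rewrite !in_itv /= => /andP[a b].
 rewrite (le_trans _ a) ?(le_trans b) // ler_expR ?ler_nat //.
 by rewrite lerN2 ler_nat.
- move=> n; apply/measurable_EFinP; apply: measurable_funS mg => //.
 move=> r; rewrite /= !in_itv /= andbT => /andP[h _].
 by apply: lt_le_trans h; rewrite expR_gt0.
- move=> n r; rewrite /= in_itv /= => /andP[h _]; rewrite lee_fin g0 //.
 by apply: lt_le_trans h; rewrite expR_gt0.
have -> : (fun n : nat => (\int[mu]_(x in `[expR (- n%:R)%R, expR n%:R]) (EFin \o g) x)%E) =
 (fun n : nat => (\int[mu]_(t in `[(- n%:R)%R, n%:R]) (g (expR t) * expR t)%:E)%E).
 by apply/funext => n; rewrite -exp_substitution_itv.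
apply: h2.
- move=> m n mn; apply/subsetPset => r /=; rewrite !in_itv /= => /andP[a b].
 rewrite (le_trans _ a) ?(le_trans b) // ?ler_nat //.
 by rewrite lerN2 ler_nat.
- by [].
- move=> n; apply/measurable_EFinP; apply: (@measurable_funS _ _ _ _ [set: RM]) => //.
 by apply: continuous_measurable_fun; exact: cge.
- move=> n t _; rewrite lee_fin mulr_ge0 ?expR_ge0 // g0 // expR_gt0.
- by [].
Qed.

Lemma exp_substitution_integrable (g : R -> R) :
 (forall r, 0 < r -> {for r, continuous g}) ->
 mu.-integrable [set: RM] (fun t => (g (expR t) * expR t)%:E) ->
 mu.-integrable (`]0, +oo[%classic : set RM) (EFin \o g).
Proof.
move=> cg /integrableP[_ ig]; apply/integrableP; split.
 by apply/measurable_EFinP; exact: measurable_pos_continuous.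
have cn r : 0 < r -> {for r, continuous (fun r => `|g r|)}.
 by move=> r0; apply: continuous_comp; [exact: cg|exact: norm_continuous].
have e := exp_substitution_ge0 cn (fun r _ => normr_ge0 (g r)).
rewrite [ltLHS]e; apply: le_lt_trans ig; rewrite le_eqVlt; apply/orP; left; apply/eqP.
by apply: eq_integral => t _ /=; rewrite normrM [`|expR t|]ger0_norm ?expR_ge0.
Qed.

Lemma exp_substitution (g : R -> R) :
 (forall r, 0 < r -> {for r, continuous g}) ->
 mu.-integrable [set: RM] (fun t => (g (expR t) * expR t)%:E) ->
 \int[mu]_(r in `]0%R, +oo[) g r = \int[mu]_t (g (expR t) * expR t).
Proof.
move=> cg ig; have ig' := exp_substitution_integrable cg ig.
apply: EFin_inj; rewrite !EFin_Rintegral //.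
rewrite integralE [RHS]integralE; congr (_ - _)%E.
- have e : (forall r, 0 < r -> {for r, continuous (fun r => Num.max (g r) 0)}).
 by move=> r r0; apply: continuous_max; [exact: cg|exact: cvg_cst].
 have h := exp_substitution_ge0 e.
 have -> : (\int[mu]_(x in `]0%R, +oo[) (EFin \o g)^\+ x =
 \int[mu]_(r in `]0%R, +oo[) (Num.max (g r) 0)%:E)%E.
 by apply: eq_integral => t _; rewrite funeposE /= EFin_max.
 rewrite h; last by move=> r _; rewrite le_max lexx orbT.
 apply: eq_integral => t _; rewrite funeposE /= -EFin_max; congr (_%:E).
 by rewrite maxr_pMl ?expR_ge0 // mul0r.
- have e : (forall r, 0 < r -> {for r, continuous (fun r => Num.max (- g r) 0)}).
 move=> r r0; apply: continuous_max; last exact: cvg_cst.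
 by apply: continuousN; exact: cg.
 have h := exp_substitution_ge0 e.
 have -> : (\int[mu]_(x in `]0%R, +oo[) (EFin \o g)^\- x =
 \int[mu]_(r in `]0%R, +oo[) (Num.max (- g r) 0)%:E)%E.
 by apply: eq_integral => t _; rewrite funenegE /= EFin_max.
 rewrite h; last by move=> r _; rewrite le_max lexx orbT.
 apply: eq_integral => t _; rewrite funenegE /= -EFin_max; congr (_%:E).
 by rewrite maxr_pMl ?expR_ge0 // mul0r mulNr.
Qed.

(** The scaled image measure agrees with Lebesgue measure on half-open intervals, hence everywhere
    by uniqueness. *)
Lemma lebesgue_affine (c e : R) (f : RM -> \bar R) : 0 < c ->
 measurable_fun setT f -> (forall t, 0 <= f t)%E ->
 (\int[mu]_t f (c * t + e)%R = (c^-1)%:E * \int[mu]_t f t)%E.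
Proof.
move=> c0 mf f0.
pose phi (t : RM) : RM := c * t + e.
have mphi : measurable_fun setT phi.
 apply: continuous_measurable_fun => t; apply: cvgD; last exact: cvg_cst.
 by apply: cvgM; [exact: cvg_cst|exact: cvg_id].
pose nu := mscale (NngNum (ltW c0)) (pushforward mu phi).
have e1 (A : set RM) : measurable A -> mu A = nu mphi A.
 apply: lebesgue_measure_unique => _ [[a b] _ <-] /=.
 rewrite /nu /mscale /= /pushforward.
 have -> : phi @^-1` `]a, b] = `](a - e) / c, (b - e) / c]%classic.
 apply/seteqP; split => t; rewrite /= !in_itv /= /phi;
 by rewrite ltr_pdivrMr // ler_pdivlMr // ltrBlDr lerBrDr mulrC.
 rewrite !lebesgue_measure_itv /= !lte_fin ltr_pM2r ?invr_gt0 // ltrD2r.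
 case: ifP => // ab; last by rewrite mule0.
 rewrite -!EFinB -EFinM; congr (_%:E); field; exact: lt0r_neq0.
have -> : (\int[mu]_t f t = \int[nu mphi]_t f t)%E.
 by apply: eq_measure_integral => A mA _; exact: e1.
rewrite ge0_integral_mscale // ge0_integral_pushforward // preimage_setT muleA -EFinM mulVf ?mul1e //.
exact: lt0r_neq0.
Qed.

End substitutions.

(** * Sectorial operators in the logarithmic coordinate *)

Section sectors.
Context (R : realType).
Implicit Types (z w : R[i]) (f : R[i] -> R[i]) (phi : R).

Lemma ltr_cos_pi (phi nu : R) : 0 < phi -> phi < nu -> nu <= pi -> cos nu < cos phi.
Proof. by move=> h1 h2 h3; rewrite ltr_cos // in_itv /=; apply/andP; split; lra. Qed.

Lemma Re_div_rnorm z : z != 0 -> -1 <= Re z / rnorm z <= 1.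
Proof.
move=> z0; have r0 : 0 < rnorm z.
 by rewrite lt_neqAle rnorm_ge0 andbT eq_sym; apply/eqP => /rnorm_eq0/eqP; rewrite (negbTE z0).
have := normr_Re_le z; rewrite ler_norml => /andP[a b].
by rewrite ler_pdivlMr // ler_pdivrMr // mulN1r mul1r a b.
Qed.

Lemma abs_arg z : z != 0 -> `|arg z| = acos (Re z / rnorm z).
Proof.
move=> z0; have h := acos_ge0 (Re_div_rnorm z0).
by rewrite /arg; case: ifP => _; rewrite ?normrN ger0_norm.
Qed.

Lemma rnorm_gt0 (V : normedZmodType R[i]) (v : V) : v != 0 -> 0 < rnorm v.
Proof.
move=> z0; rewrite lt_neqAle rnorm_ge0 andbT eq_sym.
by apply/eqP => /rnorm_eq0/eqP; rewrite (negbTE z0).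
Qed.

(** The absolute value of [arg z] is an arccosine and cosine decreases, so membership becomes an
    inequality free of the case split in [arg]. In the logarithmic coordinate it depends on the
    imaginary part only modulo [2 pi]. *)
Lemma sectorP phi z : 0 <= phi <= pi -> z != 0 ->
 sector phi z <-> rnorm z * cos phi < Re z.
Proof.
move=> phi0 z0; have h := Re_div_rnorm z0.
rewrite -ltr_pdivlMl ?rnorm_gt0 // mulrC /sector /= z0 abs_arg //.
have [/andP[a b] c] := acos_def h.
split=> [[_ k]|k]; first by rewrite -{1}c ltr_cos ?in_itv //= ?a.
by split=> //; rewrite -ltr_cos ?c // in_itv /= ?a.
Qed.

Lemma cexpE (t s : R) : cexp (t +i* s) = (expR t)%:C * expi s.
Proof. by []. Qed.

Lemma Re_cexp (t s : R) : Re (cexp (t +i* s)) = expR t * cos s.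
Proof. by rewrite /= mul0r subr0. Qed.

Lemma Im_cexp (t s : R) : Im (cexp (t +i* s)) = expR t * sin s.
Proof. by rewrite /= mul0r addr0. Qed.

Lemma sector_cexp phi (t s : R) : 0 <= phi <= pi ->
 sector phi (cexp (t +i* s)) <-> cos phi < cos s.
Proof.
move=> phi0; rewrite sectorP ?cexp_neq0 // rnorm_cexp /= mul0r subr0.
by rewrite ltr_pM2l ?expR_gt0.
Qed.

Lemma clog_cexp (t s : R) : `|s| < pi -> clog (cexp (t +i* s)) = t +i* s.
Proof.
move=> s1; rewrite /clog rnorm_cexp /= expRK; congr (_ +i* _).
rewrite /arg rnorm_cexp Re_cexp Im_cexp mulrAC mulfV ?gt_eqF ?expR_gt0 // mul1r.
rewrite pmulr_rge0 ?expR_gt0 //.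
have := s1; rewrite ltr_norml => /andP[a b].
case: (leP 0 s) => s0.
 rewrite sin_ge0_pi ?cosK // ?in_itv /= ?s0 ?ltW //.
rewrite ifF; last by apply/negbTE; rewrite -ltNge -oppr_gt0 -sinN sin_gt0_pi // oppr_gt0 s0 ltrNl a.
by rewrite cosKN ?opprK // ltW //= ltW.
Qed.

Lemma sector_closure phi z : 0 <= phi <= pi -> z != 0 ->
 Re z < rnorm z * cos phi -> ~ closure (sector phi : set R[i]^o) z.
Proof.
move=> phi0 z0 h; pose e := (rnorm z * cos phi - Re z) / 3.
have e0 : 0 < e by rewrite divr_gt0 // subr_gt0.
move=> /(_ [set w | rnorm (w - z) < e]) [|w [sw wz]].
 apply/(@nbhs_normP R[i] R[i]^o); exists e%:C; first by rewrite /= ltcR.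
 by move=> w; rewrite /= distrC rnormE ltcR.
have w0 : w != 0 by case: sw.
have := (sectorP phi0 w0).1 sw; move: wz => /= wz.
have a1 := le_lt_trans (normr_Re_le (w - z)) wz.
have a3 := ler_rnorm_dist w z; have a4 := ler_rnorm_dist z w.
have c1 : `|cos phi| <= 1 by rewrite ler_norml cos_geN1 cos_le1.
have b : `|rnorm w * cos phi - rnorm z * cos phi| <= e.
 rewrite -mulrBl normrM -[e]mulr1 ler_pM // ler_norml.
 by rewrite [rnorm (z - w)]rnormB in a4; move: a3 a4 wz; clear; lra.
move: a1 b; rewrite raddfB /= ltr_norml ler_norml => /andP[_ a1] /andP[b _].
rewrite -/(Re w) in a1 *.
by have : 3 * e = rnorm z * cos phi - Re z; [rewrite /e; field|lra].
Qed.

(** With [c = cos (s - t)] the squared distance equals [(a + b)^2 (1 - c) / 2 + (a - b)^2 (1 + c) /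
    2], and the second summand is nonnegative. *)
Lemma rnorm_expi_sub (a b s t : R) :
 (a + b) ^+ 2 * ((1 - cos (s - t)) / 2) <= rnorm (a%:C * expi s - b%:C * expi t) ^+ 2.
Proof.
rewrite sqr_rnormc /= !mul0r !subr0 !addr0 cosB.
have hs := cos2Dsin2 s; have ht := cos2Dsin2 t.
have := cos_geN1 (s - t); rewrite cosB => h.
have e : (a * cos s - b * cos t) ^+ 2 + (a * sin s - b * sin t) ^+ 2 =
 a ^+ 2 * (cos s ^+ 2 + sin s ^+ 2) + b ^+ 2 * (cos t ^+ 2 + sin t ^+ 2)
 - 2 * a * b * (cos s * cos t + sin s * sin t) by ring.
rewrite e hs ht; set c := _ + _ in h *.
have : 0 <= (a - b) ^+ 2 * ((1 + c) / 2).
 by rewrite mulr_ge0 ?sqr_ge0 // divr_ge0 // -lerBlDl sub0r.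
rewrite !expr2; nra.
Qed.

Lemma rnorm_expi_sub_ge (a b s t c : R) : 0 <= a -> 0 <= b -> cos (s - t) <= c -> c <= 1 ->
 (a + b) * Num.sqrt ((1 - c) / 2) <= rnorm (a%:C * expi s - b%:C * expi t).
Proof.
move=> a0 b0 sc c1; have h : 0 <= (1 - c) / 2 by rewrite divr_ge0 // subr_ge0.
rewrite -(@ler_pXn2r _ 2) ?nnegrE ?rnorm_ge0 ?mulr_ge0 ?addr_ge0 ?sqrtr_ge0 //.
rewrite exprMn sqr_sqrtr //; apply: le_trans (rnorm_expi_sub a b s t).
by rewrite ler_wpM2l ?sqr_ge0 // ler_wpM2r ?invr_ge0 // lerD2l lerN2.
Qed.

End sectors.

Section complex_functionals.
Context (R : realType).
Local Notation RM := (measurableTypeR R).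
Let mu := @lebesgue_measure R.

(* The complex-linear functional with real part [l]. *)
Definition lc (V : normedModType R[i]) (l : V -> R) (v : V) : R[i] := l v +i* (- l ('i *: v)).

Lemma lcD (V : normedModType R[i]) (l : V -> R) u v : rfun l -> lc l (u + v) = lc l u + lc l v.
Proof. by move=> [lD _ _]; rewrite /lc scalerDr !lD; cparts. Qed.

Lemma lcZ (V : normedModType R[i]) (l : V -> R) c v : rfun l -> lc l (c *: v) = c * lc l v.
Proof.
move=> [lD lZ _]; have e (u : V) : l (c *: u) = Re c * l u + Im c * l ('i *: u).
 by rewrite scalecE lD !lZ.
rewrite /lc scalerA mulrC -scalerA !e scalerA.
have -> : 'i * 'i = (-1)%:C :> R[i] by cparts.
by rewrite lZ; case: c {e} => a b; cparts.
Qed.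

Lemma lcB (V : normedModType R[i]) (l : V -> R) u v : rfun l -> lc l (u - v) = lc l u - lc l v.
Proof. by move=> rl; rewrite -scaleN1r lcD // lcZ // mulN1r. Qed.

Lemma lcN (V : normedModType R[i]) (l : V -> R) u : rfun l -> lc l (- u) = - lc l u.
Proof. by move=> rl; rewrite -scaleN1r lcZ // mulN1r. Qed.

Lemma lc_norm (V : normedModType R[i]) (l : V -> R) v : rfun l -> rnorm (lc l v) <= 2 * rnorm v.
Proof.
move=> [_ _ ln]; apply: (le_trans (rnorm_le_ReIm _)); rewrite /= normrN mulr2n mulrDl mul1r.
by rewrite lerD // (le_trans (ln _)) // rnormZ rnormi mul1r.
Qed.

Lemma lc_rlinear (V : normedModType R[i]) (l : V -> R) : rfun l ->
 rlinear_map 2 (lc l : V -> R[i]^o).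
Proof.
move=> rl; split=> [u v|r v|v]; [exact: lcD|exact: lcZ|exact: lc_norm].
Qed.

Lemma lc_eq (V : normedModType R[i]) (x y : V) :
 (forall l, rfun l -> lc l x = lc l y) -> x = y.
Proof. by move=> h; apply: rfun_eq => l rl; have /(congr1 (@Re R)) := h l rl. Qed.

Lemma lc_wint (V : normedModType R[i]) (D : set RM) (h : R -> V) y l : measurable D -> rfun l ->
 is_wint D h y -> lc l y = cint D (lc l \o h).
Proof. by move=> mD rl hy; apply: wint_cint; exact: wint_map (lc_rlinear rl) hy. Qed.

Lemma lc_ccont (V : normedModType R[i]) (F : R[i] -> V) l z : rfun l -> ccont F z -> ccont (lc l \o F) z.
Proof.
move=> rl cF e e0; have e2 : 0 < e / 2 by rewrite divr_gt0.
have [d d0 h] := cF _ e2; exists d => // w /h wz.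
rewrite /= -lcB //; apply: (le_lt_trans (lc_norm _ rl)).
by rewrite mulrC -ltr_pdivlMr.
Qed.

(** Weak holomorphy is all that Cauchy's theorem and the residue theorem require, since both are
    tested against functionals. *)
Definition vholo (V : normedModType R[i]) (F : R[i] -> V) z :=
 forall l, rfun l -> cdiff (lc l \o F) z.

Lemma vholoZ (V : normedModType R[i]) (f : R[i] -> R[i]) (F : R[i] -> V) z :
 cdiff f z -> vholo F z -> vholo (fun w => f w *: F w) z.
Proof.
move=> df hF l rl; apply: cdiff_ext (cdiffM df (hF l rl)) => w.
by rewrite /= lcZ.
Qed.

Lemma vstrip_cauchy (V : normedModType R[i]) (F : R[i] -> V) c d a y y' : c <= d ->
 (forall t s, c <= s <= d -> vholo F (t +i* s)) ->
 (forall t s, c <= s <= d -> rnorm (F (t +i* s)) <= a * rho t) ->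
 is_wint [set: RM] (fun t => F (t +i* c)) y -> is_wint [set: RM] (fun t => F (t +i* d)) y' ->
 y = y'.
Proof.
move=> cd hF Fa wy wy'; apply: lc_eq => l rl.
rewrite (lc_wint _ rl wy) // (lc_wint _ rl wy') //.
apply: (@strip_cauchy _ (lc l \o F) c d (2 * a)) => // t s cs; first exact: hF.
by apply: (le_trans (lc_norm _ rl)); rewrite -mulrA ler_pM2l // Fa.
Qed.

Lemma vstrip_residue (V : normedModType R[i]) (F : R[i] -> V) c d a (u v : R) (k : V) y y' :
 c < v < d ->
 (forall t s, c <= s <= d -> (t != u) || (s != v) -> vholo F (t +i* s)) ->
 (forall t s, c <= s <= d -> (s == c) || (s == d) || (1 <= `|t - u|) ->
 rnorm (F (t +i* s)) <= a * rho t) ->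
 (forall e : R, 0 < e -> exists2 r : R, 0 < r & forall z, z != u +i* v ->
 rnorm (z - (u +i* v)) < r -> rnorm ((z - (u +i* v)) *: F z - k) <= e) ->
 is_wint [set: RM] (fun t => F (t +i* c)) y -> is_wint [set: RM] (fun t => F (t +i* d)) y' ->
 y - y' = (2 * pi%:C * 'i) *: k.
Proof.
move=> cd hF Fa hk wy wy'; apply: lc_eq => l rl.
rewrite lcB // lcZ // (lc_wint _ rl wy) // (lc_wint _ rl wy') //.
apply: (@strip_residue _ (lc l \o F) c d (2 * a) u v) => //.
- by move=> t s cs h; exact: hF.
- move=> t s cs h; apply: (le_trans (lc_norm _ rl)).
 by rewrite -mulrA ler_pM2l // Fa.
- move=> e e0; have e2 : 0 < e / 2 by rewrite divr_gt0.
 have [r r0 h] := hk _ e2; exists r => // z z1 z2.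
 rewrite /= -lcZ // -lcB //; apply: (le_trans (lc_norm _ rl)).
 by rewrite mulrC -ler_pdivlMr // h.
Qed.

End complex_functionals.

(* Identities between linear combinations of vectors, tested against functionals. *)
Ltac vring := let l := fresh "l" in let H := fresh "H" in apply: lc_eq => l H;
 rewrite ?(lcD _ _ H, lcB _ _ H, lcZ _ _ H, lcN _ H); clear H; ring.

Section bounded_operators.
Context (R : realType) (X : completeNormedModType R[i]).
Implicit Types (A T : set (X * X)) (z w : R[i]).

Lemma opnorm_bound T (M : R) : (forall c u v, T (u, v) -> T (c *: u, c *: v)) ->
 (opnorm T <= M%:E)%E -> forall u v, T (u, v) -> rnorm v <= M * rnorm u.
Proof.
move=> hT hM u v Tuv; apply/ler_addgt0Pr => e e0.
pose d := e / (`|M| + 1); have M1 : 0 < `|M| + 1 by rewrite ltr_wpDl.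
have d0 : 0 < d by rewrite divr_gt0.
(* The slack [d] permits the division also for [u = 0]; it costs at most [e] at the end. *)
pose c := rnorm u + d; have c0 : 0 < c by rewrite ltr_wpDl ?rnorm_ge0.
have h : rnorm (c^-1%:C *: v) <= M.
 rewrite -lee_fin; apply: le_trans hM; apply: ereal_sup_ubound.
 exists (c^-1%:C *: u, c^-1%:C *: v) => //=; split; first exact: hT.
 rewrite lee_fin rnormZ rnorm_real ger0_norm ?invr_ge0 ?(ltW c0) //.
 by rewrite mulrC ler_pdivrMr // mul1r lerDl ltW.
move: h; rewrite rnormZ rnorm_real ger0_norm ?invr_ge0 ?(ltW c0) //.
rewrite mulrC ler_pdivrMr // => h; apply: (le_trans h); rewrite mulrDr lerD2l.
rewrite /d mulrCA ler_piMr ?(ltW e0) // ler_pdivrMr // mul1r.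
by rewrite (le_trans (ler_norm M)) // lerDl.
Qed.

Lemma opnorm_le T (M : R) : (forall u v, T (u, v) -> rnorm v <= M * rnorm u) -> 0 <= M ->
 (opnorm T <= M%:E)%E.
Proof.
move=> h M0; apply: ge_ereal_sup => r [[u v] /= [Tuv]]; rewrite lee_fin => u1 <-; rewrite lee_fin.
by apply: (le_trans (h _ _ Tuv)); rewrite ler_piMr.
Qed.

End bounded_operators.

Section resolvents.
Context (R : realType) (X : completeNormedModType R[i]) (A : set (X * X)).
Hypothesis opA : is_operator A.
Implicit Types (x y : X) (z w : R[i]).

Let A00 : A (0, 0). Proof. by case: opA. Qed.
Let AD a x y x' y' : A (x, y) -> A (x', y') -> A (a *: x + x', a *: y + y').
Proof. by case: opA => _ h _; exact: h. Qed.
Let AZ a x y : A (x, y) -> A (a *: x, a *: y).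
Proof. by move=> h; have := AD a h A00; rewrite !addr0. Qed.

Lemma operator_sub x y x' y' : A (x, y) -> A (x', y') -> A (x - x', y - y').
Proof. by move=> h h'; have := AD (-1) h' h; rewrite !scaleN1r ![- _ + _]addrC. Qed.

Lemma resolventZ z c x y : resolvent A z (x, y) -> resolvent A z (c *: x, c *: y).
Proof.
rewrite /resolvent /= => /(AZ c); rewrite scalerBr !scalerA [c * z]mulrC.
by rewrite -scalerA.
Qed.

Section one_point.
Variable z : R[i].
Hypothesis rz : resolvent_set A z.

Lemma resolvent_funP x : A (resolvent_fun A z x, z *: resolvent_fun A z x - x).
Proof.
have [/(_ x)[y [hy _]] _] := rz.
by have := @xgetPex _ 0 [set y | resolvent A z (x, y)] (ex_intro _ y hy).
Qed.

Lemma resolvent_fun_eq x y : A (y, z *: y - x) -> resolvent_fun A z x = y.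
Proof.
have [/(_ x)[y' [hy' u]] _] := rz => h.
by rewrite -(u _ h); apply/esym/u; exact: resolvent_funP.
Qed.

Lemma resolvent_funD x y :
 resolvent_fun A z (x + y) = resolvent_fun A z x + resolvent_fun A z y.
Proof.
apply: resolvent_fun_eq; have := AD 1 (resolvent_funP x) (resolvent_funP y).
by rewrite !scale1r scalerDr opprD addrACA.
Qed.

Lemma resolvent_funZ c x : resolvent_fun A z (c *: x) = c *: resolvent_fun A z x.
Proof. by apply: resolvent_fun_eq; exact: resolventZ (resolvent_funP x). Qed.

End one_point.

Lemma resolvent_identity z w x : resolvent_set A z -> resolvent_set A w ->
 resolvent_fun A z x - resolvent_fun A w x =
 (w - z) *: resolvent_fun A z (resolvent_fun A w x).
Proof.
move=> rz rw; rewrite -(resolvent_funZ rz); apply/esym/resolvent_fun_eq => //.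
have := operator_sub (resolvent_funP rz x) (resolvent_funP rw x).
set y := resolvent_fun A z x; set y' := resolvent_fun A w x.
congr (A (_, _)); vring.
Qed.

Lemma resolvent_inj z x : resolvent_set A z -> resolvent_fun A z x = 0 -> x = 0.
Proof.
move=> rz h; have := resolvent_funP rz x; rewrite h scaler0 sub0r => k.
by have [_ _ /(_ _ k)/eqP] := opA; rewrite oppr_eq0 => /eqP.
Qed.

End resolvents.

Section sectorial_operators.
Context (R : realType) (X : completeNormedModType R[i]) (A : set (X * X)) (phi : R).
Hypothesis sA : sectorial phi A.
Implicit Types (x y : X) (z w : R[i]).

Let opA : is_operator A. Proof. by case: sA. Qed.
Let phi0 : 0 <= phi <= pi. Proof. by case: sA => _ /andP[a b] _ _; rewrite !ltW. Qed.

Lemma sectorial_resolvent z : z != 0 -> Re z < rnorm z * cos phi ->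
 resolvent_set A z.
Proof.
move=> z0 h; have [_ _ sp _] := sA; apply: contrapT => nz.
exact: sector_closure phi0 z0 h (sp z nz).
Qed.

(* [exp w] lies outside the closed sector exactly when [cos (Im w) < cos phi]. *)
Definition off w := cos (Im w) < cos phi.

Lemma off_resolvent w : off w -> resolvent_set A (cexp w).
Proof.
move=> h; apply: sectorial_resolvent; first exact: cexp_neq0.
by rewrite rnorm_cexp /= mul0r subr0 ltr_pM2l ?expR_gt0.
Qed.

(** The operator [z (z - A)^-1] at [z = exp w]. The factor [z] is the Jacobian [dz = z dw], so
    [g(z) (z - A)^-1 dz] becomes [G(w) Q w dw], and sectoriality says exactly that [Q] is bounded
    away from the sector. *)
Definition Q w x := cexp w *: resolvent_fun A (cexp w) x.

Lemma QD w x y : off w -> Q w (x + y) = Q w x + Q w y.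
Proof. by move=> /off_resolvent r; rewrite /Q resolvent_funD // scalerDr. Qed.

Lemma QZ w c x : off w -> Q w (c *: x) = c *: Q w x.
Proof. by move=> /off_resolvent r; rewrite /Q resolvent_funZ // !scalerA mulrC. Qed.

Lemma Q_bound psi : phi < psi < pi -> exists2 M : R, 0 <= M &
 forall w x, cos (Im w) <= cos psi -> rnorm (Q w x) <= M * rnorm x.
Proof.
move=> hpsi; have [_ _ _ /(_ _ hpsi)[M hM]] := sA.
have /andP[pp ppi] := hpsi; have /andP[ph0 ph1] := phi0.
have psi0 : 0 <= psi <= pi by rewrite (ltW ppi) andbT (le_trans ph0 (ltW pp)).
exists `|M| => // w x h.
have ow : off w by apply: le_lt_trans h _; rewrite ltr_cos // in_itv /= ?ph0 ?ph1.
have nS : ~ sector psi (cexp w).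
 by case: w h {ow} => t s /= h; rewrite sector_cexp //; apply/negP; rewrite -leNgt.
have hom c u v : scale_operator (cexp w) (resolvent A (cexp w)) (u, v) ->
 scale_operator (cexp w) (resolvent A (cexp w)) (c *: u, c *: v).
 move=> [[a b] h1 [<- <-]]; exists (c *: a, c *: b); first exact: (@resolventZ _ _ _ opA).
 by rewrite /= !scalerA mulrC.
apply: le_trans (_ : M * rnorm x <= _).
 apply: (opnorm_bound hom (hM _ (cexp_neq0 w) nS)).
 exists (x, resolvent_fun A (cexp w) x) => //.
 exact: (resolvent_funP (off_resolvent ow)).
by rewrite ler_wpM2r ?rnorm_ge0 // ler_norm.
Qed.

Lemma cos_Im_near w (c : R) : cos (Im w) < c -> exists2 d : R, 0 < d &
 forall w', rnorm (w' - w) < d -> cos (Im w') < c.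
Proof.
move=> ow; have cc : {for Im w, continuous (cos : R -> R)} by exact: continuous_cos.
have /cvgrPdist_lt/(_ (c - cos (Im w))) := cc.
rewrite subr_gt0 => /(_ ow)/nbhs_ballP[d d0 h]; exists d => // w' ww.
have e : `|Im w - Im w'| < d.
 by rewrite distrC -raddfB; exact: le_lt_trans (normr_Im_le _) ww.
have := h (Im w') e; rewrite distrC => /(le_lt_trans (ler_norm _)).
by rewrite ltrD2r.
Qed.

(* [z |-> z (z - A)^-1 x] is holomorphic: this is its difference quotient. *)
Lemma Q_sub w w' x : off w -> off w' ->
 Q w' x - Q w x = (cexp w' - cexp w) *: (resolvent_fun A (cexp w) x -
 Q w' (resolvent_fun A (cexp w) x)).
Proof.
move=> /off_resolvent r /off_resolvent r'.
have h := resolvent_identity opA x r' r; rewrite /Q.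
set a := cexp w' in r' h *; set b := cexp w in r h *.
have -> : resolvent_fun A a x = resolvent_fun A b x +
 (b - a) *: resolvent_fun A a (resolvent_fun A b x) by rewrite -h addrC subrK.
vring.
Qed.

(** Sectoriality gives bounds only for angles strictly larger than [phi]; the arccosine of the
    midpoint between [c] and [cos phi] is such an angle. *)
Lemma off_psi (c : R) : -1 <= c -> c < cos phi -> exists2 psi, phi < psi < pi & c < cos psi.
Proof.
move=> c1 h; pose m := (cos phi + c) / 2.
have mi : -1 < m < 1.
 by have := cos_le1 phi; move: c1 h; rewrite /m; lra.
have mm : -1 <= m <= 1 by move: mi => /andP[a b]; rewrite !ltW.
have [/andP[a b] e] := acos_def mm; exists (acos m); last by rewrite e /m; lra.
have cm : m < cos phi by rewrite /m; lra.
rewrite acos_ltpi ?andbT; last by move: mi => /andP[k ?]; rewrite k ltW.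
by rewrite -ltr_cos ?e // in_itv /= ?a.
Qed.

Lemma ccont_Q w x : off w -> ccont (Q^~ x) w.
Proof.
move=> ow e e0; have [psi hpsi ow1] := off_psi (cos_geN1 _) ow.
have [d d0 hd] := cos_Im_near ow1; have [M M0 hM] := Q_bound hpsi.
have pp : cos psi < cos phi.
 have /andP[a b] := hpsi; have /andP[a' b'] := phi0.
 by rewrite ltr_cos // in_itv /= ?a' ?b' // (ltW b) (le_trans a') // ltW.
set y := resolvent_fun A (cexp w) x; pose B := rnorm y + M * rnorm y + 1.
have B0 : 0 < B by rewrite ltr_wpDl // addr_ge0 ?mulr_ge0 ?rnorm_ge0.
have [d' d'0 hd'] := cdiff_ccont (cdiff_cexp w) (divr_gt0 e0 B0).
exists (Num.min d d'); first by rewrite lt_min d0.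
move=> w'; rewrite lt_min => /andP[/hd h1 /hd' h2].
have ow' : off w' by exact: lt_trans pp.
rewrite Q_sub // rnormZ; apply: le_lt_trans (_ : _ <= rnorm (cexp w' - cexp w) * B) _.
 rewrite ler_wpM2l ?rnorm_ge0 //; apply: (le_trans (ler_rnormB _ _)).
 by rewrite /B -addrA lerD2l (le_trans (hM _ _ _)) ?(ltW h1) // lerDl ler01.
by rewrite -ltr_pdivlMr.
Qed.

End sectorial_operators.

Section Q_holo.
Context (R : realType) (X : completeNormedModType R[i]) (A : set (X * X)) (phi : R).
Hypothesis sA : sectorial phi A.

Lemma vholo_Q w x : off phi w -> vholo ((Q A)^~ x) w.
Proof.
move=> ow l rl; have [p [cp hp]] := cdiff_cexp w.
set y := resolvent_fun A (cexp w) x.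
have [d d0 hd] := cos_Im_near ow.
pose q w' := if rnorm (w' - w) < d then p w' * lc l (y - Q A w' y) else
 (lc l (Q A w' x) - lc l (Q A w x)) / (w' - w).
exists q; split.
 apply: (@ccont_local _ _ (fun w' => p w' * lc l (y - Q A w' y)) _ _ d) => //.
 by move=> w' h; rewrite /q h.
 apply: ccontM => //; apply: (lc_ccont (F := fun w' => y - Q A w' y)) => //.
 by apply: ccontD; [exact: ccont_cst|apply: ccontN; exact: (ccont_Q sA)].
move=> w'; rewrite /q; case: ifPn => h /=.
 by rewrite -lcB // (Q_sub sA) ?lcZ //; [rewrite hp; ring|exact: hd].
rewrite divfK // subr_eq0; apply: contraNneq h => ->.
by rewrite subrr rnorm0.
Qed.

End Q_holo.

Section exponential_kernel.
Context (R : realType).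
Implicit Types (z w : R[i]).

Lemma cos_lt1 (x : R) : 0 < `|x| < 2 * pi -> cos x < 1.
Proof.
move=> h; have -> : cos x = cos `|x| by case: (ger0P x); rewrite ?cosN.
move: `|x| h => y /andP[y0 y1].
have e : y = y / 2 + y / 2 by lra.
have s0 : 0 < sin (y / 2).
 by rewrite sin_gt0_pi // divr_gt0 //= ltr_pdivrMr // mulrC.
rewrite e cosD; have := cos2Dsin2 (y / 2); rewrite -!expr2 => h.
have : 0 < sin (y / 2) ^+ 2 by rewrite exprn_gt0.
by move: h; lra.
Qed.

Lemma cexp_sub (t s t' s' : R) (c : R) : cos (s - s') <= c -> c <= 1 ->
 (expR t + expR t') * Num.sqrt ((1 - c) / 2) <= rnorm (cexp (t +i* s) - cexp (t' +i* s')).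
Proof. by move=> h c1; rewrite !cexpE rnorm_expi_sub_ge. Qed.

(** When the real parts are at distance 1 the moduli differ by a factor at least [e >= 2], so there
    is no cancellation whatever the arguments are. *)
Lemma cexp_sub_far (t s t' s' : R) : 1 <= `|t - t'| ->
 expR t <= 2 * rnorm (cexp (t +i* s) - cexp (t' +i* s')).
Proof.
move=> h.
have e2 : 2 <= expR 1 :> R by apply: le_trans (expR_ge1Dx 1); lra.
have a1 := ler_rnorm_dist (cexp (t +i* s)) (cexp (t' +i* s')).
have a2 := ler_rnorm_dist (cexp (t' +i* s')) (cexp (t +i* s)).
rewrite [rnorm (cexp (t' +i* s') - _)]rnormB in a2; rewrite !rnorm_cexp /= in a1 a2.
case: (leP t t') => tt.
 have : 2 * expR t <= expR t'.
 rewrite -[t'](subrK t) expRD ler_wpM2r //; apply: (le_trans e2).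
 by rewrite ler_expR; move: h; rewrite ler0_norm ?subr_le0 // opprB.
 by move: a1 a2; lra.
have : 2 * expR t' <= expR t.
 rewrite -[t](subrK t') expRD ler_wpM2r //; apply: (le_trans e2).
 by rewrite ler_expR; move: h; rewrite ger0_norm ?subr_ge0 // ltW.
by move: a1 a2; lra.
Qed.

Lemma cexp_neq (t s t' s' : R) : `|s - s'| < 2 * pi -> (t != t') || (s != s') ->
 cexp (t +i* s) != cexp (t' +i* s').
Proof.
move=> ss h; apply/eqP => e.
have tt : t = t'.
 by have := congr1 (@rnorm R _) e; rewrite !rnorm_cexp /= => /expR_inj.
move: h; rewrite tt eqxx /= => nss.
have c1 : cos (s - s') < 1.
 by apply: cos_lt1; rewrite ss andbT normr_gt0 subr_eq0.
have := @cexp_sub t s t' s' _ (lexx _) (ltW c1); rewrite e subrr rnorm0.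
rewrite leNgt mulr_gt0 ?addr_gt0 ?expR_gt0 // sqrtr_gt0 divr_gt0 // subr_gt0.
exact: c1.
Qed.

(** The Cauchy kernel [dz' / (z' - z)] in the logarithmic coordinate; as a function of [w'] it has
    residue 1 at [w]. *)
Definition kap w' w := cexp w' / (cexp w' - cexp w).

Lemma kap_bound (t s t' s' c : R) : cos (s - s') <= c -> c < 1 ->
 rnorm (kap (t +i* s) (t' +i* s')) <= (Num.sqrt ((1 - c) / 2))^-1.
Proof.
move=> sc c1; have m0 : 0 < Num.sqrt ((1 - c) / 2) by rewrite sqrtr_gt0 divr_gt0 // subr_gt0.
have h := cexp_sub t t' sc (ltW c1).
have p0 := expR_gt0 t; have p1 := expR_gt0 t'.
have h0 : 0 < rnorm (cexp (t +i* s) - cexp (t' +i* s')).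
 by apply: lt_le_trans h; rewrite mulr_gt0 ?addr_gt0.
rewrite /kap rnormM rnormV rnorm_cexp /= ler_pdivrMr // mulrC ler_pdivlMr //.
by apply: le_trans h; rewrite ler_wpM2r // lerDl ltW.
Qed.

Lemma kap_far (t s t' s' : R) : 1 <= `|t - t'| ->
 rnorm (kap (t +i* s) (t' +i* s')) <= 2.
Proof.
move=> h; have := cexp_sub_far s s' h; have p0 := expR_gt0 t => k.
have h0 : 0 < rnorm (cexp (t +i* s) - cexp (t' +i* s')) by move: k p0; lra.
by rewrite /kap rnormM rnormV rnorm_cexp /= ler_pdivrMr.
Qed.

Lemma cdiff_kapl (t s t' s' : R) : `|s - s'| < 2 * pi -> (t != t') || (s != s') ->
 cdiff (kap^~ (t' +i* s')) (t +i* s).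
Proof.
move=> h1 h2; apply: cdiffM; first exact: cdiff_cexp.
apply: cdiffV; first by rewrite subr_eq0 cexp_neq.
by apply: cdiffB; [exact: cdiff_cexp|exact: cdiff_cst].
Qed.

Lemma cdiff_kapr (t s t' s' : R) : `|s - s'| < 2 * pi -> (t != t') || (s != s') ->
 cdiff (kap (t +i* s)) (t' +i* s').
Proof.
move=> h1 h2; apply: cdiffM; first exact: cdiff_cst.
apply: cdiffV; first by rewrite subr_eq0 cexp_neq.
by apply: cdiffB; [exact: cdiff_cst|exact: cdiff_cexp].
Qed.

Definition cexp_quotient w := if w == 0 then 1 else (cexp w - 1) / w.

Lemma ccont_cexp_quotient : ccont cexp_quotient 0.
Proof.
move=> e e0; have e2 : 0 < e / 2 by rewrite divr_gt0.
have [d d0 h] := @cexp_small R _ e2; exists d => // w; rewrite subr0 => /h k.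
have [->|w0] := eqVneq w 0; first by rewrite subrr rnorm0.
rewrite /cexp_quotient eqxx (negbTE w0).
apply: le_lt_trans (_ : e / 2 < e); last by rewrite ltr_pdivrMr // mulr_natr mulr2n ltrDl.
rewrite -(ler_pM2r (rnorm_gt0 w0)) -rnormM; apply: le_trans k.
by rewrite mulrBl divfK // mul1r.
Qed.

Lemma residue_of_ccont (V : normedModType R[i]) (f F : R[i] -> V) w : ccont F w ->
 (forall z, z != w -> (z - w) *: f z = F z) ->
 forall e : R, 0 < e -> exists2 r : R, 0 < r & forall z, z != w ->
 rnorm (z - w) < r -> rnorm ((z - w) *: f z - F w) <= e.
Proof.
move=> cF hf e e0; have [d d0 h] := cF e e0; exists d => // z zw /h zd.
by rewrite hf // ltW.
Qed.

(** With [h = z - w], the product of [h] and the kernel is [exp h] divided by [(exp h - 1) / h],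
    which extends continuously by 1 at [h = 0]. *)
Lemma kap_residue (V : normedModType R[i]) (G : R[i] -> V) w : ccont G w ->
 forall e : R, 0 < e -> exists2 r : R, 0 < r & forall z, z != w ->
 rnorm (z - w) < r -> rnorm ((z - w) *: (kap z w *: G z) - G w) <= e.
Proof.
move=> cG; pose F z := (cexp (z - w) * (cexp_quotient (z - w))^-1) *: G z.
have Fw : F w = G w by rewrite /F subrr cexp0 /cexp_quotient eqxx invr1 mulr1 scale1r.
have csub : ccont (fun z => z - w) w.
 by apply: ccontD; [exact: ccont_id|exact: ccont_cst].
have cF : ccont F w.
 apply: ccontZ => //; apply: ccontM.
 by apply: (ccont_comp csub); exact/cdiff_ccont/cdiff_cexp.
 apply: ccontV; first by rewrite subrr /cexp_quotient eqxx oner_neq0.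
 by apply: (ccont_comp csub); rewrite subrr; exact: ccont_cexp_quotient.
move=> e e0; rewrite -Fw; apply: residue_of_ccont => // z zw.
rewrite /F scalerA; congr (_ *: _).
have zw' : z - w != 0 by rewrite subr_eq0.
rewrite /cexp_quotient (negbTE zw') invf_div [RHS]mulrCA; congr (_ * _).
have e1 : cexp z = cexp w * cexp (z - w) by rewrite -cexpD addrC subrK.
have e2 : cexp z - cexp w = cexp w * (cexp (z - w) - 1) by rewrite mulrBr mulr1 -e1.
by rewrite /kap e2 {1}e1 -mulf_div divff ?cexp_neq0 ?mul1r.
Qed.

End exponential_kernel.

Section contour.
Context (R : realType) (X : completeNormedModType R[i]) (A : set (X * X)) (phi : R).
Hypothesis sA : sectorial phi A.
Local Notation RM := (measurableTypeR R).
Let mu := @lebesgue_measure R.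
Implicit Types (x y : X) (G : R[i] -> R[i]) (eta nu : R).

Definition Irho : R := \int[mu]_t rho t.

Lemma Irho_ge0 : 0 <= Irho.
Proof. by apply: Rintegral_ge0 => t _; exact: rho_ge0. Qed.

Lemma wint_rho_norm (V : normedModType R[i]) (h : R -> V) (y : V) (a : R) :
 is_wint [set: RM] h y -> (forall t, rnorm (h t) <= a * rho t) -> rnorm y <= a * Irho.
Proof.
move=> hy ha; have := wint_norm measurableT hy (integrable_rhoZ a) (fun t _ => ha t).
by rewrite RintegralZl //; exact: integrable_rho.
Qed.

Lemma wint_exists (h : R -> X) (b : R -> R) : (forall t, tcont h t) ->
 mu.-integrable [set: RM] (EFin \o b) -> (forall t, rnorm (h t) <= b t) ->
 exists y, is_wint [set: RM] h y.
Proof.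
move=> ch ib hb; have cin : continuous_in [set: RM] h.
 by move=> t _ e e0; have [d d0 hd] := ch t e e0; exists d => // u _; exact: hd.
have [y [_ wy]] := bochner_exists measurableT cin ib (fun t _ => hb t).
by exists y.
Qed.

Lemma scale_lin (k c : R[i]) (u v : X) : k *: (c *: u + v) = c *: (k *: u) + k *: v.
Proof. by rewrite scalerDr !scalerA mulrC. Qed.

Definition line_term G eta x t := G (t +i* eta) *: Q A (t +i* eta) x.

(** A total function, with value [0] if the integral does not exist, so that [Psi] can be written
    before convergence is known; [wlineP] covers the admissible [G]. *)
Definition wline G eta x : X := xget 0 [set y | is_wint [set: RM] (line_term G eta x) y].

Definition line_bound G eta (a : R) :=
 forall t, ccont G (t +i* eta) /\ rnorm (G (t +i* eta)) <= a * rho t.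

Lemma line_bound_ge0 G eta a : line_bound G eta a -> 0 <= a.
Proof. by move=> /(_ 0)[_ h]; have := le_trans (rnorm_ge0 _) h; rewrite pmulr_lge0 ?rho_gt0. Qed.

Definition Qbound eta (M : R) := 0 <= M /\ forall t x, rnorm (Q A (t +i* eta) x) <= M * rnorm x.

Lemma Qbound_ex eta : cos eta < cos phi -> exists M, Qbound eta M.
Proof.
move=> h; have [psi hpsi /ltW k] := off_psi sA (cos_geN1 _) h.
by have [M M0 hM] := Q_bound sA hpsi; exists M; split=> // t x; exact: hM.
Qed.

Lemma line_term_tcont G eta a x t : cos eta < cos phi -> line_bound G eta a ->
 tcont (line_term G eta x) t.
Proof.
move=> h gb; apply: (tcont_h (F := fun w => G w *: Q A w x)).
by apply: ccontZ; [exact: (gb t).1|exact: (ccont_Q sA)].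
Qed.

Lemma line_term_bound G eta a M x t : line_bound G eta a -> Qbound eta M ->
 rnorm (line_term G eta x t) <= a * M * rnorm x * rho t.
Proof.
move=> gb [M0 hM]; rewrite rnormZ.
have -> : a * M * rnorm x * rho t = (a * rho t) * (M * rnorm x) by ring.
by rewrite ler_pM ?rnorm_ge0 //; exact: (gb t).2.
Qed.

Lemma wlineP G eta a x : cos eta < cos phi -> line_bound G eta a ->
 is_wint [set: RM] (line_term G eta x) (wline G eta x).
Proof.
move=> h gb; have [M hM] := Qbound_ex h.
have [y hy] := wint_exists (fun t => line_term_tcont x t h gb)
 (integrable_rhoZ _) (fun t => line_term_bound x t gb hM).
by have := @xgetPex _ 0 [set y | is_wint [set: RM] (line_term G eta x) y] (ex_intro _ y hy).
Qed.

Lemma wline_norm G eta a M x : cos eta < cos phi -> line_bound G eta a -> Qbound eta M ->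
 rnorm (wline G eta x) <= a * M * Irho * rnorm x.
Proof.
move=> h gb hM; have := wint_rho_norm (wlineP x h gb) (fun t => line_term_bound x t gb hM).
by rewrite [_ * rnorm x * _]mulrAC.
Qed.

Lemma offN eta : cos eta < cos phi -> cos (- eta) < cos phi. Proof. by rewrite cosN. Qed.

Definition psi_term G nu x t := line_term G (- nu) x t - line_term G nu x t.

(** The operator [G(log A)]. The boundary of the strip is run counterclockwise: the lower line from
    left to right, the upper one from right to left. *)
Definition Psi nu G x : X := (2 * pi%:C * 'i)^-1 *: (wline G (- nu) x - wline G nu x).

Lemma twopii_neq0 : 2 * pi%:C * 'i != 0 :> R[i].
Proof.
have -> : 2 * pi%:C * 'i = (0 +i* (2 * pi)) :> R[i].
 have -> : (2 : R[i]) = 2%:C by rewrite rmorphMn.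
 cparts.
by rewrite eq_complex /= eqxx /= mulf_neq0 // gt_eqF // pi_gt0.
Qed.

Definition pair_bound G nu a := line_bound G (- nu) a /\ line_bound G nu a.

Lemma Psi_wint G nu a x : cos nu < cos phi -> pair_bound G nu a ->
 is_wint [set: RM] (psi_term G nu x) ((2 * pi%:C * 'i) *: Psi nu G x).
Proof.
move=> h [g1 g2]; rewrite /Psi scalerA mulfV ?twopii_neq0 // scale1r.
by apply: wintB => //; [apply: (wlineP (a := a)) => //; exact: offN|exact: (wlineP (a := a))].
Qed.

Lemma Psi_eq G nu a x y : cos nu < cos phi -> pair_bound G nu a ->
 is_wint [set: RM] (psi_term G nu x) ((2 * pi%:C * 'i) *: y) -> y = Psi nu G x.
Proof.
by move=> h gb hy; apply: (scalerI twopii_neq0); exact: wint_unique hy (Psi_wint x h gb).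
Qed.

Lemma Psi_norm nu : cos nu < cos phi -> exists2 K : R, 0 <= K & forall G a x,
 pair_bound G nu a -> rnorm (Psi nu G x) <= K * a * rnorm x.
Proof.
move=> h; have [M1 h1] := Qbound_ex (offN h); have [M2 h2] := Qbound_ex h.
have I0 := Irho_ge0.
exists (rnorm (2 * pi%:C * 'i : R[i])^-1 * (M1 * Irho + M2 * Irho)).
 by rewrite mulr_ge0 ?rnorm_ge0 // addr_ge0 // mulr_ge0 //; [case: h1|case: h2].
move=> G a x [g1 g2]; rewrite rnormZ -!mulrA ler_wpM2l ?rnorm_ge0 //.
apply: (le_trans (ler_rnormB _ _)).
apply: (le_trans (lerD (wline_norm x (offN h) g1 h1) (wline_norm x h g2 h2))).
by apply: eq_ler; ring.
Qed.

Lemma Psi_lin nu G a c x y : cos nu < cos phi -> pair_bound G nu a ->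
 Psi nu G (c *: x + y) = c *: Psi nu G x + Psi nu G y.
Proof.
move=> h gb; apply/esym/(Psi_eq h gb); rewrite scale_lin.
apply: wint_eq (wintD _ (wintZ c _ (Psi_wint x h gb)) (Psi_wint y h gb)) _ => // t _.
by rewrite /psi_term /line_term !(QD sA) ?(QZ sA) ?/(off _ _) /= ?cosN //; vring.
Qed.

Lemma Psi0 nu G a : cos nu < cos phi -> pair_bound G nu a -> Psi nu G 0 = 0.
Proof.
move=> h gb; have := Psi_lin 1 0 0 h gb; rewrite !scale1r addr0 => /eqP.
by rewrite -subr_eq0 opprD addrA subrr sub0r oppr_eq0 => /eqP.
Qed.

Lemma PsiZ nu G a c x : cos nu < cos phi -> pair_bound G nu a ->
 Psi nu G (c *: x) = c *: Psi nu G x.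
Proof. by move=> h gb; have := Psi_lin c x 0 h gb; rewrite (Psi0 h gb) !addr0. Qed.

Lemma Psi_linl nu G a G' a' G'' a'' c x : cos nu < cos phi -> pair_bound G nu a ->
 pair_bound G' nu a' -> pair_bound G'' nu a'' ->
 (forall w, `|Im w| = `|nu| -> G'' w = c * G w + G' w) ->
 Psi nu G'' x = c *: Psi nu G x + Psi nu G' x.
Proof.
move=> h gb gb' gb'' e; apply/esym/(Psi_eq h gb''); rewrite scale_lin.
apply: wint_eq (wintD _ (wintZ c _ (Psi_wint x h gb)) (Psi_wint x h gb')) _ => // t _.
by rewrite /psi_term /line_term !e ?normrN //=; vring.
Qed.

Lemma Psi_ext nu G G' x : (forall w, `|Im w| = `|nu| -> G w = G' w) ->
 Psi nu G x = Psi nu G' x.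
Proof.
move=> e; rewrite /Psi /wline; congr (_ *: (xget _ _ - xget _ _)); apply/seteqP; split=> y /=;
 by move=> h; apply: wint_eq h _ => // t _; rewrite /line_term e //= normrN.
Qed.

Definition strip_decay G (b a : R) := forall t s, `|s| < b ->
 cdiff G (t +i* s) /\ rnorm (G (t +i* s)) <= a * rho t.

Lemma strip_pair G b a nu : strip_decay G b a -> `|nu| < b -> pair_bound G nu a.
Proof.
move=> h nb; split=> t; last by have [k ?] := h t _ nb; split=> //; exact: cdiff_ccont.
by have [|k ?] := h t (- nu); rewrite ?normrN //; split=> //; exact: cdiff_ccont.
Qed.

Lemma wline_indep G c d a m x : c <= d -> m < cos phi ->
 (forall s, c <= s <= d -> cos s <= m) ->
 (forall t s, c <= s <= d -> cdiff G (t +i* s) /\ rnorm (G (t +i* s)) <= a * rho t) ->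
 wline G c x = wline G d x.
Proof.
move=> cd mp offm hG.
have off s : c <= s <= d -> cos s < cos phi by move=> /offm h; exact: le_lt_trans mp.
have c1 : c <= c <= d by rewrite lexx.
have d1 : c <= d <= d by rewrite lexx andbT.
have lb s : c <= s <= d -> line_bound G s a.
 by move=> h t; have [k ?] := hG t s h; split=> //; exact: cdiff_ccont.
have [M0 M0' hM] : exists2 M, 0 <= M & forall t s x, c <= s <= d -> rnorm (Q A (t +i* s) x) <= M * rnorm x.
 have [psi hpsi /ltW k] := off_psi sA (le_trans (cos_geN1 c) (offm _ c1)) mp.
 have [M M0 hM] := Q_bound sA hpsi; exists M => // t s x' /offm sm.
 by apply: hM; exact: le_trans k.
apply: (vstrip_cauchy (F := fun w => G w *: Q A w x) (a := a * M0 * rnorm x) cd).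
- move=> t s sc; apply: vholoZ; first exact: (hG t s sc).1.
 by apply: (vholo_Q sA); exact: off.
- move=> t s sc; rewrite rnormZ.
 have -> : a * M0 * rnorm x * rho t = (a * rho t) * (M0 * rnorm x) by ring.
 by rewrite ler_pM ?rnorm_ge0 //; [exact: (hG t s sc).2|exact: hM].
- by apply: (wlineP (a := a)); [exact: off|exact: lb].
- by apply: (wlineP (a := a)); [exact: off|exact: lb].
Qed.

(** Cosine decreases up to [pi] and is symmetric about it, so it is largest at the two ends. Lines
    beyond [pi] can thus be treated like the others, which the rational functions with poles off the
    sector require. *)
Lemma cos_le_far (s c : R) : 0 <= c <= pi -> c <= s <= 2 * pi - c -> cos s <= cos c.
Proof.
move=> /andP[c0 cpi] /andP[cs sd]; case: (leP s pi) => sp.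
 by rewrite leNgt ltr_cos -?leNgt // in_itv /= // (le_trans c0).
have -> : cos s = cos (2 * pi - s).
 have -> : cos s = cos (s - 2 * pi + pi + pi) by congr cos; lra.
 by rewrite !cosDpi opprK -[RHS]cosN opprB.
rewrite leNgt ltr_cos -?leNgt ?in_itv /= ?c0 //; first by lra.
by apply/andP; split; lra.
Qed.

(** Between two admissible lines [exp w] stays outside the closed sector and [G] decays, so each of
    the two lines can be moved by Cauchy's theorem separately. *)
Lemma Psi_indep G b a nu nu' x : strip_decay G b a -> phi < nu < b -> phi < nu' < b -> b <= pi ->
 Psi nu G x = Psi nu' G x.
Proof.
wlog nn : nu nu' / nu <= nu'.
 move=> h; case: (leP nu nu') => [|/ltW] nn; first exact: h.
 by move=> sd h1 h2 bpi; apply/esym/(h nu' nu).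
move=> sd /andP[n1 n2] /andP[n3 n4] bpi.
have p0 : 0 < phi by case: sA => _ /andP[].
have nu0 : 0 <= nu <= pi by apply/andP; split; lra.
have cm : cos nu < cos phi.
 by rewrite ltr_cos // in_itv /= //; have := nu0; lra.
rewrite /Psi; have -> : wline G (- nu) x = wline G (- nu') x.
 apply/esym/(wline_indep x (a := a) (m := cos nu)) => //; first by rewrite lerN2.
 move=> s /andP[s1 s2]; rewrite -cosN cos_le_far //; apply/andP; split; lra.
 by move=> t s /andP[s1 s2]; apply: sd; rewrite ltr_norml; apply/andP; split; lra.
have -> : wline G nu x = wline G nu' x; last by [].
apply: (wline_indep x (a := a) (m := cos nu)) => //.
 by move=> s /andP[s1 s2]; rewrite cos_le_far //; apply/andP; split; lra.
by move=> t s /andP[s1 s2]; apply: sd; rewrite ltr_norml; apply/andP; split; lra.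
Qed.

End contour.

(** * Multiplicativity of the calculus, by two nested contours *)

Section multiplicativity.
Context (R : realType) (X : completeNormedModType R[i]) (A : set (X * X)) (phi : R).
Hypothesis sA : sectorial phi A.
Local Notation RM := (measurableTypeR R).
Let mu := @lebesgue_measure R.
Implicit Types (x y : X) (G : R[i] -> R[i]) (eta nu : R).

(* Partial fractions for [z' (z' - A)^-1 z (z - A)^-1]. *)
Lemma Q_mul w w' x : off phi w -> off phi w' -> cexp w != cexp w' ->
 Q A w (Q A w' x) = kap w' w *: Q A w x + kap w w' *: Q A w' x.
Proof.
move=> o o' ne; have r := off_resolvent sA o; have r' := off_resolvent sA o'.
have opA : is_operator A by case: sA.
have h := resolvent_identity opA x r r'.
rewrite /Q (resolvent_funZ opA r) /kap.
have d : cexp w' - cexp w != 0 by rewrite subr_eq0 eq_sym.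
have d' : cexp w - cexp w' != 0 by rewrite subr_eq0.
have -> : resolvent_fun A (cexp w) (resolvent_fun A (cexp w') x) =
 (cexp w' - cexp w)^-1 *: (resolvent_fun A (cexp w) x - resolvent_fun A (cexp w') x).
 by rewrite h scalerA mulVf // scale1r.
apply: lc_eq => l rl; rewrite ?(lcD, lcB, lcZ, lcN) //.
by move: d d'; move: (cexp w) (cexp w') => a b d d'; field; rewrite d d'.
Qed.

Section two_contours.
Variables (G1 G2 : R[i] -> R[i]) (b a1 a2 nu1 nu2 : R) (x : X).
Hypotheses (sd1 : strip_decay G1 b a1) (sd2 : strip_decay G2 b a2)
 (h1 : phi < nu1) (h12 : nu1 < nu2) (h2 : nu2 < b) (bpi : b <= pi).

Let p0 : 0 < phi. Proof. by case: sA => _ /andP[]. Qed.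
Let n1 : 0 < nu1. Proof. exact: lt_trans h1. Qed.
Let n2 : 0 < nu2. Proof. exact: lt_trans h12. Qed.
Let n2pi : nu2 < pi. Proof. exact: lt_le_trans bpi. Qed.

Let cosphi nu : phi < nu -> nu < pi -> cos nu < cos phi.
Proof.
move=> pn np; have q0 := p0.
by rewrite ltr_cos // in_itv /=; apply/andP; split; move: q0 pn np; lra.
Qed.

Let on1 : cos nu1 < cos phi. Proof. by apply: cosphi => //; exact: lt_trans n2pi. Qed.
Let on2 : cos nu2 < cos phi. Proof. by apply: cosphi => //; exact: lt_trans h12. Qed.

Let kb : exists2 C : R, 0 <= C & forall t s e e', `|e| <= nu1 -> `|e'| = nu2 ->
 rnorm (kap (t +i* e) (s +i* e')) <= C /\ rnorm (kap (s +i* e') (t +i* e)) <= C.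
Proof.
(* The angular separation of the inner strip from the outer lines, measured modulo [2 pi] on both
   sides; it bounds both kernels uniformly. *)
pose c0 := Num.min (nu2 - nu1) (2 * pi - (nu2 + nu1)).
have np := n2pi; have q1 := n1.
have c0p : 0 < c0 by rewrite lt_min; apply/andP; split; move: h12 np q1; lra.
have c0l : c0 <= nu2 - nu1 by rewrite ge_min lexx.
have c0r : c0 <= 2 * pi - (nu2 + nu1) by rewrite ge_min lexx orbT.
have c1 : cos c0 < 1.
 by apply: cos_lt1; rewrite gtr0_norm // c0p /=; move: c0l np q1; lra.
have cs e e' : `|e| <= nu1 -> `|e'| = nu2 -> cos (e' - e) <= cos c0.
 move=> he he'; have -> : cos (e' - e) = cos `|e' - e| by case: (ger0P (e' - e)); rewrite ?cosN.
 apply: cos_le_far; first by apply/andP; split; move: c0p c0l np q1; lra.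
 have := lerB_dist e' e; have := ler_normB e' e; rewrite he'.
 by move: he c0l c0r; move: `|e' - e| `|e| => u v; lra.
exists ((Num.sqrt ((1 - cos c0) / 2))^-1); first by rewrite invr_ge0 sqrtr_ge0.
by move=> t s e e' he he'; split; apply: kap_bound => //; [rewrite -cosN opprB|]; exact: cs.
Qed.

Let nu_lt (e e' : R) : `|e| <= nu2 -> `|e'| <= nu2 -> `|e - e'| < 2 * pi.
Proof. by move=> a b'; apply: le_lt_trans (ler_normB _ _) _; have := n2pi; lra. Qed.

Lemma inner_residue t e : `|e| = nu1 ->
 lint (fun w => G2 w * kap w (t +i* e)) (- nu2) - lint (fun w => G2 w * kap w (t +i* e)) nu2 =
 2 * pi%:C * 'i * G2 (t +i* e).
Proof.
move=> he; have [C C0 hC] := kb.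
have eb : - nu2 < e < nu2 by rewrite -ltr_norml he.
have cle s : - nu2 <= s <= nu2 -> `|s| <= nu2 by rewrite ler_norml.
have a20 : 0 <= a2 by apply: (line_bound_ge0 (G := G2) (eta := nu2)) => s;
 have [|k ?] := sd2 s (s := nu2); [rewrite gtr0_norm|split=> //; exact: cdiff_ccont].
apply: (@strip_residue _ _ (- nu2) nu2 (a2 * (C + 2)) t e) => //.
- move=> s s' /cle cs ne; apply: cdiffM; first by apply: (sd2 _ _).1; exact: le_lt_trans h2.
 by apply: cdiff_kapl => //; apply: nu_lt => //; rewrite he ltW.
- move=> s s' cs k; rewrite rnormM.
 have -> : a2 * (C + 2) * rho s = (a2 * rho s) * (C + 2) by ring.
 rewrite ler_pM ?rnorm_ge0 //; first by apply: (sd2 _ _).2; exact: le_lt_trans (cle _ cs) h2.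
 have h' : (s' == - nu2) || (s' == nu2) -> `|s'| = nu2.
 by move=> /orP[] /eqP ->; rewrite ?normrN gtr0_norm.
 case/orP: k => [/h' k|k].
 by apply: (le_trans (hC t s e s' (eq_ler he) k).2); rewrite lerDl.
 by apply: (le_trans (kap_far _ _ k)); rewrite lerDr.
- have cG : ccont (G2 : R[i] -> R[i]^o) (t +i* e).
 by apply/cdiff_ccont/(sd2 _ _).1; rewrite he (lt_trans h12).
 move=> d d0; have [r r0 hr] := kap_residue cG d0; exists r => // z z1 z2.
 by have := hr z z1 z2; rewrite [G2 z * _]mulrC.
Qed.

Lemma inner_cauchy s e' : `|e'| = nu2 ->
 lint (fun w => G1 w * kap w (s +i* e')) (- nu1) = lint (fun w => G1 w * kap w (s +i* e')) nu1.
Proof.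
move=> he; have [C C0 hC] := kb; have q1 := n1.
have cle s' : - nu1 <= s' <= nu1 -> `|s'| <= nu1 by rewrite ler_norml.
apply: (@strip_cauchy _ _ (- nu1) nu1 (a1 * C)); first by move: q1; lra.
- move=> t s' /cle cs; apply: cdiffM; first by apply: (sd1 _ _).1; rewrite (le_lt_trans cs) // (lt_trans h12).
 apply: cdiff_kapl; first by apply: nu_lt; rewrite ?he // (le_trans cs) // ltW.
 by apply/orP; right; apply: contraTneq cs => ->; rewrite he -ltNge.
- move=> t s' /cle cs; rewrite rnormM.
 have -> : a1 * C * rho t = (a1 * rho t) * C by ring.
 rewrite ler_pM ?rnorm_ge0 //; last exact: (hC t s s' e' cs he).1.
 by apply: (sd1 _ _).2; rewrite (le_lt_trans cs) // (lt_trans h12).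
Qed.

(** The part of the partial fraction whose kernel has its pole, as a function of the inner variable,
    on the outer lines; integrating it over the inner contour therefore gives zero. *)
Let K e e' t s := (G1 (t +i* e) * G2 (s +i* e') * kap (t +i* e) (s +i* e')) *: Q A (s +i* e') x.

Let offe e : `|e| = nu1 \/ `|e| = nu2 -> cos e < cos phi.
Proof.
have -> : cos e = cos `|e| by case: (ger0P e); rewrite ?cosN.
by case=> ->.
Qed.

Let d1 t e : `|e| = nu1 -> cdiff G1 (t +i* e) /\ rnorm (G1 (t +i* e)) <= a1 * rho t.
Proof. by move=> he; apply: sd1; rewrite he (lt_trans h12). Qed.

Let d2 t e : `|e| = nu2 -> cdiff G2 (t +i* e) /\ rnorm (G2 (t +i* e)) <= a2 * rho t.
Proof. by move=> he; apply: sd2; rewrite he. Qed.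

Let a1_ge0 : 0 <= a1.
Proof.
have [_ h] := @d1 0 nu1 (gtr0_norm n1).
by have := le_trans (rnorm_ge0 _) h; rewrite pmulr_lge0 ?rho_gt0.
Qed.

Let a2_ge0 : 0 <= a2.
Proof.
have [_ h] := @d2 0 nu2 (gtr0_norm n2).
by have := le_trans (rnorm_ge0 _) h; rewrite pmulr_lge0 ?rho_gt0.
Qed.

Let neq12 (t s e e' : R) : `|e| = nu1 -> `|e'| = nu2 -> (t != s) || (e != e').
Proof. by move=> he he'; apply/orP; right; apply: contra_eq_neq he => ->; rewrite he' gt_eqF. Qed.

Let close12 (e e' : R) : `|e| = nu1 -> `|e'| = nu2 -> `|e - e'| < 2 * pi.
Proof. by move=> he he'; apply: nu_lt; rewrite ?he ?he' // ltW. Qed.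

Lemma inner_term t e e' : `|e| = nu1 -> `|e'| = nu2 ->
 is_wint [set: RM] (K e e' t) (G1 (t +i* e) *: (Q A (t +i* e) (wline A G2 e' x)
 - lint (fun w => G2 w * kap w (t +i* e)) e' *: Q A (t +i* e) x)).
Proof.
move=> he he'; have [C C0 hC] := kb.
have oe : off phi (t +i* e) by apply: offe; left.
have oe' s : off phi (s +i* e') by apply: offe; right.
have [M [M0 hM]] := Qbound_ex sA oe.
have rQ : rlinear_map M (Q A (t +i* e)).
 by split=> [u v|r v|v]; [exact: (QD sA)|exact: (QZ sA)|exact: hM].
have lb : line_bound G2 e' a2.
 by move=> s; have [k ?] := d2 s he'; split=> //; exact: cdiff_ccont.
have w1 := wint_map measurableT rQ (wlineP sA x (oe' 0) lb).
have w2 : is_wint (V := R[i]^o) [set: RM] (fun s => G2 (s +i* e') * kap (s +i* e') (t +i* e))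
 (lint (fun w => G2 w * kap w (t +i* e)) e').
 apply: (@line_wint _ (fun w => G2 w * kap w (t +i* e)) _ (a2 * C)) => s.
 apply: ccontM; first exact: (lb s).1.
 apply/cdiff_ccont/cdiff_kapl; first by rewrite distrC close12.
 by rewrite eq_sym [e' == e]eq_sym neq12.
 rewrite rnormM [a2 * C * _]mulrAC ler_pM ?rnorm_ge0 //; first exact: (lb s).2.
 exact: (hC t s e e' (eq_ler he) he').2.
have w3 := wint_map measurableT (rlinear_scalel (Q A (t +i* e) x)) w2.
apply: wint_eq (wintZ (G1 (t +i* e)) measurableT (wintB measurableT w1 w3)) _ => // s _.
rewrite /= /line_term (QZ sA) // Q_mul //; last by rewrite cexp_neq ?close12 ?neq12.
by rewrite /K; vring.
Qed.

Lemma outer_term s e' : `|e'| = nu2 ->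
 is_wint [set: RM] (fun t => K (- nu1) e' t s - K nu1 e' t s) 0.
Proof.
move=> he'; have [C C0 hC] := kb.
have w e : `|e| = nu1 -> is_wint (V := R[i]^o) [set: RM]
 (fun t => G1 (t +i* e) * kap (t +i* e) (s +i* e'))
 (lint (fun w => G1 w * kap w (s +i* e')) e).
 move=> he; apply: (@line_wint _ (fun w => G1 w * kap w (s +i* e')) _ (a1 * C)) => t.
 apply: ccontM; first exact/cdiff_ccont/(d1 t he).1.
 by apply/cdiff_ccont/cdiff_kapl; [exact: close12|exact: neq12].
 rewrite rnormM [a1 * C * _]mulrAC ler_pM ?rnorm_ge0 //; first exact: (d1 t he).2.
 exact: (hC t s e e' (eq_ler he) he').1.
have e1 : `|- nu1| = nu1 by rewrite normrN gtr0_norm.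
have e2 : `|nu1| = nu1 by rewrite gtr0_norm.
have h := wint_map measurableT (rlinear_scalel (G2 (s +i* e') *: Q A (s +i* e') x))
 (wintB measurableT (w _ e1) (w _ e2)).
rewrite inner_cauchy // subrr scale0r in h.
by apply: wint_eq h _ => // t _; rewrite /= /K; vring.
Qed.

Let F t s := (K (- nu1) (- nu2) t s - K (- nu1) nu2 t s) - (K nu1 (- nu2) t s - K nu1 nu2 t s).

Let e1N : `|- nu1| = nu1. Proof. by rewrite normrN gtr0_norm. Qed.
Let e1P : `|nu1| = nu1. Proof. by rewrite gtr0_norm. Qed.
Let e2N : `|- nu2| = nu2. Proof. by rewrite normrN gtr0_norm. Qed.
Let e2P : `|nu2| = nu2. Proof. by rewrite gtr0_norm. Qed.

Let K_ccontl e e' t s : `|e| = nu1 -> `|e'| = nu2 -> tcont (fun t => K e e' t s) t.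
Proof.
move=> he he'; apply: (tcont_h (F := fun w => (G1 w * G2 (s +i* e') * kap w (s +i* e')) *: Q A (s +i* e') x)).
apply: ccontZ; last exact: ccont_cst.
apply/cdiff_ccont/cdiffM; last by apply: cdiff_kapl; [exact: close12|exact: neq12].
by apply: cdiffM; [exact: (d1 t he).1|exact: cdiff_cst].
Qed.

Let K_ccontr e e' t s : `|e| = nu1 -> `|e'| = nu2 -> tcont (fun s => K e e' t s) s.
Proof.
move=> he he'; apply: (tcont_h (F := fun w => (G1 (t +i* e) * G2 w * kap (t +i* e) w) *: Q A w x)).
apply: ccontZ; last by apply: (ccont_Q sA); apply: offe; right.
apply/cdiff_ccont/cdiffM; last by apply: cdiff_kapr; [exact: close12|exact: neq12].
by apply: cdiffM; [exact: cdiff_cst|exact: (d2 s he').1].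
Qed.

Lemma tcontB (V : normedZmodType R[i]) (g h : R -> V) t : tcont g t -> tcont h t ->
 tcont (fun t => g t - h t) t.
Proof.
move=> cg ch e e0; have e2 : 0 < e / 2 by rewrite divr_gt0.
have [d d0 hd] := cg _ e2; have [d' d0' hd'] := ch _ e2.
exists (Num.min d d'); first by rewrite lt_min d0.
move=> u; rewrite lt_min => /andP[/hd h1' /hd' h2'].
have -> : g u - h u - (g t - h t) = (g u - g t) - (h u - h t) by rewrite !opprB addrACA [RHS]addrACA [- h u - _]addrC.
by apply: (le_lt_trans (ler_rnormB _ _)); rewrite [e]splitr ltrD.
Qed.

Lemma rfun_lip (V : normedModType R[i]) (l : V -> R) u v : rfun l -> `|l u - l v| <= rnorm (u - v).
Proof.
move=> [lD lZ ln]; have -> : l u - l v = l (u - v); last exact: ln.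
have e : - v = (-1)%:C *: v by rewrite rmorphN scaleN1r.
by rewrite e lD lZ mulN1r.
Qed.

(** The double integral of [K] is computed in both orders. Integrated over the outer lines first, it
    is the product of the two operators minus the term with the residue of [G2], that is, the
    operator of [G1 G2]; integrated over the inner lines first, it is zero. *)
Lemma Psi_mul_two : Psi A nu1 G1 (Psi A nu2 G2 x) = Psi A nu1 (fun w => G1 w * G2 w) x.
Proof.
have [C C0 hC] := kb.
pose k : R[i] := 2 * pi%:C * 'i; pose y := wline A G2 (- nu2) x - wline A G2 nu2 x.
have pb1 : pair_bound G1 nu1 a1.
 have D' e : `|e| = nu1 -> line_bound G1 e a1.
 by move=> he t; have [c ?] := d1 t he; split=> //; exact: cdiff_ccont.
 by split; exact: D'.
have rr (t : R) : rho t * rho t <= rho t by rewrite ler_piMr ?rho_ge0 // rho_le1.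
have pb12 : pair_bound (fun w => G1 w * G2 w) nu1 (a1 * a2).
 have D e t : `|e| = nu1 -> cdiff G1 (t +i* e) /\ rnorm (G1 (t +i* e)) <= a1 * rho t /\
 cdiff G2 (t +i* e) /\ rnorm (G2 (t +i* e)) <= a2 * rho t.
 move=> he; have [c ?] := d1 t he; have [|c' ?] := sd2 t (s := e); last by [].
 by rewrite he (lt_trans h12).
 have D' e : `|e| = nu1 -> line_bound (fun w => G1 w * G2 w) e (a1 * a2).
 move=> he t; have [c [c1 [c2 c3]]] := D e t he; split; first exact/cdiff_ccont/cdiffM.
 rewrite rnormM; apply: le_trans (ler_pM (rnorm_ge0 _) (rnorm_ge0 _) c1 c3) _.
 by rewrite mulrACA; apply: ler_wpM2l; [exact: mulr_ge0|exact: rr].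
 by split; apply: D'.
pose I e t := G1 (t +i* e) *: Q A (t +i* e) y - (k * (G1 (t +i* e) * G2 (t +i* e))) *: Q A (t +i* e) x.
have FI e t : `|e| = nu1 ->
 is_wint [set: RM] (fun s => K e (- nu2) t s - K e nu2 t s) (I e t).
 move=> he; have := wintB measurableT (inner_term t he e2N) (inner_term t he e2P).
 congr (is_wint _ _ _); have oe : off phi (t +i* e) by apply: offe; left.
 have hr := inner_residue t he.
 have -> : I e t = G1 (t +i* e) *: Q A (t +i* e) y - (G1 (t +i* e) * (k * G2 (t +i* e))) *: Q A (t +i* e) x.
 by rewrite /I mulrCA.
 have -> : Q A (t +i* e) y = Q A (t +i* e) (wline A G2 (- nu2) x) - Q A (t +i* e) (wline A G2 nu2 x).
 by rewrite /y -[X in _ + X](scaleN1r (wline A G2 nu2 x)) (QD sA) // (QZ sA) // scaleN1r.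
 have -> : k * G2 (t +i* e) = lint (fun w => G2 w * kap w (t +i* e)) (- nu2)
 - lint (fun w => G2 w * kap w (t +i* e)) nu2 by rewrite hr.
 move: (lint _ _) (lint _ _) (G1 _) => p q g.
 by move: (Q A _ _) (Q A _ _) (Q A _ _) => u v z; vring.
have FI' t : is_wint [set: RM] (F t) (I (- nu1) t - I nu1 t).
 exact: wintB (FI _ t e1N) (FI _ t e1P).
have FJ s : is_wint [set: RM] (F^~ s) 0.
 have := wintB measurableT (outer_term s e2N) (outer_term s e2P); rewrite subr0.
 move=> h; apply: wint_eq h _ => // t _; rewrite /F; move: (K _ _ _ _) (K _ _ _ _) (K _ _ _ _) (K _ _ _ _).
 by move=> p q r t'; vring.
have wI : is_wint [set: RM] (fun t => I (- nu1) t - I nu1 t)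
 (k *: Psi A nu1 G1 y - k *: (k *: Psi A nu1 (fun w => G1 w * G2 w) x)).
 have w1 := Psi_wint sA y on1 pb1.
 have w2 := wintZ k measurableT (Psi_wint sA x on1 pb12).
 apply: wint_eq (wintB measurableT w1 w2) _ => // t _.
 by rewrite /psi_term /line_term /I; vring.
have yE : y = k *: Psi A nu2 G2 x by rewrite /Psi scalerA mulfV ?twopii_neq0 // scale1r.
suff /eqP : k *: Psi A nu1 G1 y - k *: (k *: Psi A nu1 (fun w => G1 w * G2 w) x) = 0.
 rewrite subr_eq0 => /eqP /(scalerI (twopii_neq0 R)); rewrite yE (PsiZ sA _ _ on1 pb1).
 by move=> /(scalerI (twopii_neq0 R)).
have [MN [MN0 hMN]] := Qbound_ex sA (offN on2); have [MP [MP0 hMP]] := Qbound_ex sA on2.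
have KB e e' t s : `|e| = nu1 -> e' = - nu2 \/ e' = nu2 ->
 rnorm (K e e' t s) <= (a1 * rho t) * ((a2 * C * (MN + MP) * rnorm x) * rho s).
 move=> he he2; have he' : `|e'| = nu2 by case: he2 => ->.
 rewrite /K rnormZ rnormM [rnorm (_ * G2 _)]rnormM.
 have -> : (a1 * rho t) * ((a2 * C * (MN + MP) * rnorm x) * rho s) =
 (a1 * rho t) * (a2 * rho s) * C * ((MN + MP) * rnorm x) by ring.
 rewrite ler_pM ?mulr_ge0 ?rnorm_ge0 //.
 rewrite ler_pM ?mulr_ge0 ?rnorm_ge0 //; last exact: (hC t s e e' (eq_ler he) he').1.
 by rewrite ler_pM ?rnorm_ge0 //; [exact: (d1 t he).2|exact: (d2 s he').2].
 rewrite mulrDl; case: he2 => ->; [apply: (le_trans (hMN _ _))|apply: (le_trans (hMP _ _))].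
 by rewrite lerDl mulr_ge0 ?rnorm_ge0.
 by rewrite lerDr mulr_ge0 ?rnorm_ge0.
have mF l : rfun l -> measurable_fun setT (fun p : RM * RM => l (F p.1 p.2)).
 move=> rl; refine (@caratheodory_measurable_fun R _ RM (fun t s => l (F t s)) _ _).
 move=> t; apply: (tcont_measurable (phi := l)) => [s|u v]; last exact: rfun_lip.
 by apply: tcontB; apply: tcontB; exact: K_ccontr.
 move=> s t; refine (@tcont_real R X (fun t => F t s) l t _ (fun u v => rfun_lip u v rl)).
 by apply: tcontB; apply: tcontB; apply: K_ccontl.
have Fb t s : rnorm (F t s) <= (a1 * rho t) * ((4 * (a2 * C * (MN + MP) * rnorm x)) * rho s).
 rewrite /F.
 have B1 := KB _ _ t s e1N (or_introl erefl); have B2 := KB _ _ t s e1N (or_intror erefl).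
 have B3 := KB _ _ t s e1P (or_introl erefl); have B4 := KB _ _ t s e1P (or_intror erefl).
 set p := K _ _ _ _ in B1 *; set q := K _ _ _ _ in B2 *.
 set p' := K _ _ _ _ in B3 *; set q' := K _ _ _ _ in B4 *.
 have t1 := ler_rnormB (p - q) (p' - q'); have t2 := ler_rnormB p q; have t3 := ler_rnormB p' q'.
 have -> : a1 * rho t * (4 * (a2 * C * (MN + MP) * rnorm x) * rho s) =
 4 * (a1 * rho t * (a2 * C * (MN + MP) * rnorm x * rho s)) by ring.
 by move: t1 t2 t3 B1 B2 B3 B4; move: (a1 * rho t * _) => z; lra.
have := wint_fubini (integrable_rhoZ a1) (integrable_rhoZ _) mF Fb FI' FJ wI.
by move=> w0; apply: (wint_unique w0); exact: wint0.
Qed.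

End two_contours.

Lemma Psi_mul G1 G2 b a1 a2 nu x : strip_decay G1 b a1 -> strip_decay G2 b a2 ->
 phi < nu < b -> b <= pi ->
 Psi A nu G1 (Psi A nu G2 x) = Psi A nu (fun w => G1 w * G2 w) x.
Proof.
move=> sd1 sd2 /andP[n1 n2] bpi; pose nu' := (nu + b) / 2.
have n3 : nu < nu' by rewrite /nu'; lra.
have n4 : nu' < b by rewrite /nu'; lra.
have hn : phi < nu < b by rewrite n1.
have hn' : phi < nu' < b by rewrite (lt_trans n1).
rewrite [Psi A nu G2 x](Psi_indep sA x sd2 hn hn' bpi).
exact: (@Psi_mul_two G1 G2 b a1 a2).
Qed.

End multiplicativity.

Section exponential_decay.
Context (R : realType).
Implicit Types (G : R[i] -> R[i]) (t s u : R).

(** The Taylor terms of orders 2 and 4 of the exponential dominate [(1 + t^2)^2]; the constant 48 is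
    not sharp. *)
Lemma expRN_rho t : expR (- `|t|) <= 48 * rho t ^+ 2.
Proof.
rewrite /rho exprVn expRN -[_^-1]mul1r ler_pdivrMr // mulrAC ler_pdivlMr; last first.
 by rewrite exprn_gt0 // ltr_pwDl ?sqr_ge0.
rewrite mul1r; have t0 := normr_ge0 t.
have -> : t ^+ 2 = `|t| ^+ 2 by rewrite real_normK ?num_real.
have h2 := expR_ge1Dxn 1 t0; have h4 := expR_ge1Dxn 3 t0.
have f2 : 2`! = 2%N by []. have f4 : 4`! = 24%N by [].
rewrite f2 in h2; rewrite f4 in h4.
have -> : (1 + `|t| ^+ 2) ^+ 2 = 1 + 2 * `|t| ^+ 2 + `|t| ^+ 4 by ring.
have e0 := expR_ge0 `|t|; move: (`|t| ^+ 2) (`|t| ^+ 4) (expR `|t|) h2 h4 e0 => a b e h2 h4 e0; lra.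
Qed.

Lemma expR_sech t : expR t <= expR (- `|t|) * (1 + expR t) ^+ 2.
Proof.
have p := expR_gt0 t.
case: (ger0P t) => t0.
 rewrite expRN mulrC ler_pdivlMr // -expr2 ler_pXn2r ?nnegrE //.
 by rewrite lerDr.
rewrite opprK ler_peMr //; apply: exprn_ege1.
by rewrite lerDl expR_ge0.
Qed.

Lemma rho_sqr_le t : rho t ^+ 2 <= rho t.
Proof. by rewrite expr2 ler_piMr ?rho_ge0 // rho_le1. Qed.

Lemma exp_pole_decay t (a b : R) : 0 < a -> 0 < b ->
 expR t / ((expR t + a) * (expR t + b)) <= 48 / (Num.min 1 a * Num.min 1 b) * rho t ^+ 2.
Proof.
move=> a0 b0; have p := expR_gt0 t.
have ha (c : R) : 0 < c -> 0 < Num.min 1 c /\ Num.min 1 c * (1 + expR t) <= expR t + c.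
 move=> c0; split; first by rewrite lt_min ltr01.
 rewrite mulrDr mulr1 addrC lerD ?ge_min ?lexx ?orbT //.
 by rewrite ler_piMl // ge_min lexx.
have [ma0 hA] := ha a a0; have [mb0 hB] := ha b b0.
rewrite ler_pdivrMr ?mulr_gt0 ?addr_gt0 //.
have h1 := expR_sech t; have h2 := expRN_rho t.
apply: (le_trans h1); apply: le_trans (ler_wpM2r (sqr_ge0 _) h2) _.
have e : 48 / (Num.min 1 a * Num.min 1 b) * rho t ^+ 2 *
 ((Num.min 1 a * (1 + expR t)) * (Num.min 1 b * (1 + expR t))) = 48 * rho t ^+ 2 * (1 + expR t) ^+ 2.
 by field; rewrite !gt_eqF.
rewrite -e ler_wpM2l //; last first.
 by rewrite ler_pM // ?mulr_ge0 // // ltW.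
by rewrite mulr_ge0 ?sqr_ge0 // divr_ge0 // mulr_ge0 // ltW.
Qed.

(** One power of [rho] makes the line integrals converge. The second one is a reserve that pays for
    a factor [w] or [w^2], hence for differentiation in the group parameter. *)
Definition strip_decay2 G (b a : R) := forall t s, `|s| < b ->
 cdiff G (t +i* s) /\ rnorm (G (t +i* s)) <= a * rho t ^+ 2.

Lemma strip_decay2W G b a : 0 <= a -> strip_decay2 G b a -> strip_decay G b a.
Proof.
move=> a0 h t s sb; have [k1 k2] := h t s sb; split=> //.
by apply: (le_trans k2); rewrite ler_wpM2l // rho_sqr_le.
Qed.

Definition bounded_strip (H : R[i] -> R[i]) (b m : R) := forall t s, `|s| < b ->
 cdiff H (t +i* s) /\ rnorm (H (t +i* s)) <= m.

Lemma strip_decayM G H b a m : 0 <= a -> strip_decay G b a -> bounded_strip H b m ->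
 strip_decay (fun w => G w * H w) b (a * m).
Proof.
move=> a0 h k t s sb; have [h1 h2] := h t s sb; have [k1 k2] := k t s sb; split.
 exact: cdiffM.
by rewrite rnormM [a * m * _]mulrAC ler_pM ?rnorm_ge0.
Qed.

Definition ereg (w : R[i]) : R[i] := regularizer (cexp w).

Lemma rnorm_regularizer (z : R[i]) : rnorm (regularizer z) = rnorm z / rnorm (1 + z) ^+ 2.
Proof. by rewrite /regularizer rnormM rnormV rnormX. Qed.

Lemma cexp_ipi : cexp (0 +i* pi) = -1 :> R[i].
Proof. by rewrite /cexp /= expR0 mul1r /expi cospi sinpi; apply/eqP; rewrite eq_complex /= oppr0 !eqxx. Qed.

Lemma one_cexp_ge (b t s : R) : 0 <= b < pi -> `|s| <= b ->
 (expR t + 1) * Num.sqrt ((1 + cos b) / 2) <= rnorm (1 + cexp (t +i* s)) /\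
 0 < Num.sqrt ((1 + cos b) / 2).
Proof.
move=> /andP[b0 bpi] sb; split; last first.
 have i1 : b \in `[0, pi] by rewrite in_itv /= b0 ltW.
 have i2 : (pi : R) \in `[0, pi] by rewrite in_itv /= lexx andbT (le_trans b0) // ltW.
 by rewrite sqrtr_gt0 divr_gt0 // -ltrBlDl sub0r -cospi ltr_cos.
have -> : 1 + cexp (t +i* s) = cexp (t +i* s) - cexp (0 +i* pi).
 by rewrite cexp_ipi opprK addrC.
rewrite -[X in _ + X](@expR0 R) -[cos b]opprK; apply: cexp_sub.
 have -> : cos (s - pi) = - cos s by rewrite cosB cospi sinpi mulr0 addr0 mulrN1.
 have -> : cos s = cos `|s| by case: (ger0P s) => _; rewrite ?cosN.
 rewrite lerN2 leNgt ltr_cos -?leNgt // in_itv /= ?b0 ?(ltW bpi) //.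
 by rewrite normr_ge0 (le_trans sb) // ltW.
by rewrite -lerN2 opprK cos_geN1.
Qed.

Lemma ereg_decay b : 0 <= b < pi -> exists2 a, 0 <= a & forall t s, `|s| <= b ->
 cdiff ereg (t +i* s) /\ rnorm (ereg (t +i* s)) <= a * rho t ^+ 2.
Proof.
move=> hb; pose m := Num.sqrt ((1 + cos b) / 2 : R).
exists (48 / m ^+ 2); first by rewrite divr_ge0 ?sqr_ge0.
move=> t s sb; have [h m0] := one_cexp_ge t hb sb; rewrite -/m in h m0.
have d0 : 0 < rnorm (1 + cexp (t +i* s)).
 by apply: lt_le_trans h; rewrite mulr_gt0.
have ne : 1 + cexp (t +i* s) != 0 by apply: contraTneq d0 => ->; rewrite rnorm0 ltxx.
split.
 apply: cdiffM; first exact: cdiff_cexp.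
 apply: cdiffV; first by rewrite expf_neq0.
 apply: cdiffX; apply: cdiffD; [exact: cdiff_cst|exact: cdiff_cexp].
rewrite /ereg rnorm_regularizer rnorm_cexp /= ler_pdivrMr ?exprn_gt0 //.
apply: (le_trans (expR_sech t)).
apply: (le_trans (ler_wpM2r (sqr_ge0 _) (expRN_rho t))).
have -> : 48 * rho t ^+ 2 * (1 + expR t) ^+ 2 = 48 / m ^+ 2 * rho t ^+ 2 * ((expR t + 1) * m) ^+ 2.
 by field; rewrite gt_eqF.
rewrite ler_wpM2l //; last first.
 by rewrite ler_pXn2r ?nnegrE ?mulr_ge0 // ltW.
by rewrite mulr_ge0 ?sqr_ge0 // divr_ge0 // sqr_ge0.
Qed.

End exponential_decay.

(** * Resolvents inside the calculus, and the injectivity of the regularizer *)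

Section rational_functions.
Context (R : realType) (X : completeNormedModType R[i]) (A : set (X * X)) (phi : R).
Hypothesis sA : sectorial phi A.
Local Notation RM := (measurableTypeR R).
Implicit Types (x y : X) (p w : R[i]).

(* [z / ((z - a) (z - b))] with poles [a = exp p1] and [b = exp p2]. *)
Definition gpole p1 p2 w := cexp w / ((cexp w - cexp p1) * (cexp w - cexp p2)).

Lemma gpoleE p1 p2 w : gpole p1 p2 w = kap w p1 * (cexp w - cexp p2)^-1.
Proof. by rewrite /gpole /kap invfM mulrA. Qed.

Lemma gpoleC p1 p2 w : gpole p1 p2 w = gpole p2 p1 w.
Proof. by rewrite /gpole [(cexp w - cexp p1) * _]mulrC. Qed.

(** The constant depends on the poles only through their moduli and the separation [c], not through
    their arguments. This uniformity is what later makes the step in the angle independent of the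
    current angle. *)
Lemma gpole_bound (u1 u2 c : R) : 0 < c -> exists2 a, 0 <= a & forall p1 p2 t s,
 Re p1 = u1 -> Re p2 = u2 ->
 c * (expR t + rnorm (cexp p1)) <= rnorm (cexp (t +i* s) - cexp p1) ->
 c * (expR t + rnorm (cexp p2)) <= rnorm (cexp (t +i* s) - cexp p2) ->
 rnorm (gpole p1 p2 (t +i* s)) <= a * rho t ^+ 2.
Proof.
move=> c0; set A1 := expR u1; set A2 := expR u2.
have a1 : 0 < A1 by exact: expR_gt0.
have a2 : 0 < A2 by exact: expR_gt0.
exists ((c * c)^-1 * (48 / (Num.min 1 A1 * Num.min 1 A2))).
 apply: mulr_ge0; first by rewrite invr_ge0 mulr_ge0 // ltW.
 by rewrite divr_ge0 // mulr_ge0 // le_min ler01 /= ltW.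
move=> p1 p2 t s e1 e2 h1 h2; have p := expR_gt0 t.
have {}h1 : c * (expR t + A1) <= rnorm (cexp (t +i* s) - cexp p1) by rewrite /A1 -e1 -rnorm_cexp.
have {}h2 : c * (expR t + A2) <= rnorm (cexp (t +i* s) - cexp p2) by rewrite /A2 -e2 -rnorm_cexp.
rewrite /gpole rnormM rnormV rnormM rnorm_cexp /= -mulrA.
apply: le_trans (ler_wpM2l _ (exp_pole_decay t a1 a2)); last by rewrite invr_ge0 mulr_ge0 // ltW.
rewrite mulrCA ler_wpM2l // -invfM lef_pV2 ?posrE.
- by rewrite mulrACA ler_pM ?mulr_ge0 ?addr_ge0 // ltW.
- by apply: mulr_gt0; [apply: lt_le_trans h1|apply: lt_le_trans h2]; rewrite mulr_gt0 // addr_gt0.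
- by rewrite !mulr_gt0 // addr_gt0.
Qed.

Lemma sub_cexp_far t s p : 1 <= `|t - Re p| ->
 4^-1 * (expR t + rnorm (cexp p)) <= rnorm (cexp (t +i* s) - cexp p).
Proof.
case: p => u v /= h; have h1 := cexp_sub_far s v h; rewrite distrC in h.
have h2 := cexp_sub_far v s h; rewrite rnormB in h2.
by rewrite rnorm_cexp /=; move: h1 h2; lra.
Qed.

Lemma sub_cexp_line t s p c : c < 1 -> cos (s - Im p) <= c ->
 Num.sqrt ((1 - c) / 2) * (expR t + rnorm (cexp p)) <= rnorm (cexp (t +i* s) - cexp p).
Proof.
case: p => u v /= c1 h; rewrite rnorm_cexp /= mulrC; apply: cexp_sub => //.
exact: ltW.
Qed.

Lemma cdiff_cexpB p w : cdiff (fun w => cexp w - cexp p) w.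
Proof. by apply: cdiffB; [exact: cdiff_cexp|exact: cdiff_cst]. Qed.

(** Both lines lie off the spectrum and only the pole [p1] lies between them; the residue of
    [gpole p1 p2] there is the inverse of [exp p1 - exp p2]. *)
Lemma wline_pole c d m p1 p2 k x : c < Im p1 < d -> d - c < 2 * pi ->
 m < cos phi -> (forall s, c <= s <= d -> cos s <= m) -> k < 1 ->
 (forall s, c <= s <= d -> cos (s - Im p2) <= k) ->
 cos (c - Im p1) <= k -> cos (d - Im p1) <= k ->
 wline A (gpole p1 p2) c x - wline A (gpole p1 p2) d x =
 (2 * pi%:C * 'i) *: ((cexp p1 - cexp p2)^-1 *: Q A p1 x).
Proof.
case: p1 => u v /= cvd dc mp offm k1 far2 lc1 ld1; have /andP[cv vd] := cvd.
have c1 : c <= c <= d by rewrite lexx ltW // (lt_trans cv).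
have d1 : c <= d <= d by rewrite lexx andbT ltW // (lt_trans cv).
have oo s : c <= s <= d -> cos s < cos phi by move=> /offm h; exact: le_lt_trans mp.
have [psi hpsi /ltW kk] := off_psi sA (le_trans (cos_geN1 c) (offm _ c1)) mp.
have [M M0 hM] := Q_bound sA hpsi.
pose sk := Num.sqrt ((1 - k) / 2).
have sk0 : 0 < sk by rewrite sqrtr_gt0 divr_gt0 // subr_gt0.
pose c0 := Num.min sk 4^-1; have c00 : 0 < c0 by rewrite lt_min sk0 /= invr_gt0 ltr0n.
have c0sk : c0 <= sk by rewrite ge_min lexx.
have c04 : c0 <= 4^-1 by rewrite ge_min lexx orbT.
have [a a0 ha'] := gpole_bound u (Re p2) c00.
have ha t s := ha' (u +i* v) p2 t s erefl erefl.
have B2 t s : c <= s <= d ->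
 c0 * (expR t + rnorm (cexp p2)) <= rnorm (cexp (t +i* s) - cexp p2).
 move=> sc; apply: le_trans (sub_cexp_line t k1 (far2 s sc)).
 by rewrite ler_wpM2r // addr_ge0 ?rnorm_ge0.
have B1 t s : c <= s <= d -> (s == c) || (s == d) || (1 <= `|t - u|) ->
 c0 * (expR t + rnorm (cexp (u +i* v))) <= rnorm (cexp (t +i* s) - cexp (u +i* v)).
 move=> sc h; have nn : 0 <= expR t + rnorm (cexp (u +i* v)).
 by rewrite addr_ge0 ?rnorm_ge0.
 case/orP: h => [h|h]; last first.
 by apply: le_trans (sub_cexp_far s (p := u +i* v) h); rewrite ler_wpM2r.
 have hk : cos (s - v) <= k by case/orP: h => /eqP ->.
 by apply: le_trans (sub_cexp_line t (p := u +i* v) k1 hk); rewrite ler_wpM2r.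
have ne2 t s : c <= s <= d -> cexp (t +i* s) - cexp p2 != 0.
 move=> sc; apply: contraTneq (B2 t s sc) => ->; rewrite rnorm0 -ltNge.
 by rewrite mulr_gt0 // ltr_pwDl ?expR_gt0 ?rnorm_ge0.
have vs s : c <= s <= d -> `|s - v| < 2 * pi.
 by rewrite ltr_norml => /andP[h1 h2]; apply/andP; split; move: cv vd dc; lra.
have hgp t s : c <= s <= d -> (t != u) || (s != v) -> cdiff (gpole (u +i* v) p2) (t +i* s).
 move=> sc ne; have cd := cdiff_kapl (vs s sc) ne.
 apply: (@cdiff_ext _ (fun w => kap w (u +i* v) * (cexp w - cexp p2)^-1)) => [w|].
 by rewrite gpoleE.
 by apply: cdiffM => //; apply: cdiffV; [exact: ne2|exact: cdiff_cexpB].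
have bd t s : c <= s <= d -> (s == c) || (s == d) || (1 <= `|t - u|) ->
 rnorm (gpole (u +i* v) p2 (t +i* s)) <= a * rho t.
 move=> sc h; apply: le_trans (ha t s (B1 t s sc h) (B2 t s sc)) _.
 by rewrite ler_wpM2l // rho_sqr_le.
have lb s : c <= s <= d -> (s == c) || (s == d) -> line_bound (gpole (u +i* v) p2) s a.
 move=> sc h t; split; last by apply: bd; rewrite // h.
 apply/cdiff_ccont/hgp => //; apply/orP; right.
 by case/orP: h => /eqP ->; [rewrite lt_eqF|rewrite gt_eqF].
apply: (vstrip_residue (F := fun w => gpole (u +i* v) p2 w *: Q A w x)
 (a := a * M * rnorm x) (u := u) (v := v) cvd).
- move=> t s sc ne; apply: vholoZ; first exact: hgp.
 by apply: (vholo_Q sA); exact: oo.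
- move=> t s sc h; rewrite rnormZ.
 have -> : a * M * rnorm x * rho t = (a * rho t) * (M * rnorm x) by ring.
 rewrite ler_pM ?rnorm_ge0 //; first exact: bd.
 by apply: hM; exact: le_trans (offm _ sc) kk.
- have cG : ccont (fun w => (cexp w - cexp p2)^-1 *: Q A w x) (u +i* v).
 have vcd : c <= v <= d by rewrite !ltW.
 apply: ccontZ; last by apply: (ccont_Q sA); exact: oo.
 by apply/cdiff_ccont/cdiffV; [exact: ne2|exact: cdiff_cexpB].
 move=> e e0; have [r r0 h] := kap_residue cG e0; exists r => // z z1 z2.
 have -> : gpole (u +i* v) p2 z *: Q A z x =
 kap z (u +i* v) *: ((cexp z - cexp p2)^-1 *: Q A z x) by rewrite gpoleE; exact/esym/scalerA.
 exact: h.
- by apply: (wlineP sA (a := a)); [exact: oo|apply: lb; rewrite ?eqxx].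
- by apply: (wlineP sA (a := a)); [exact: oo|apply: lb; rewrite ?eqxx ?orbT].
Qed.

Lemma cexp_2pi t s : cexp (t +i* (2 * pi - s)) = cexp (t -i* s) :> R[i].
Proof.
rewrite !cexpE; congr (_ * _); rewrite /expi; congr (_ +i* _).
 by have := @cosD2pi R (- s); rewrite mulr_natl addrC.
by have := @sinD2pi R (- s); rewrite mulr_natl addrC.
Qed.

Lemma wline_eq G eta G' eta' x : line_term A G eta x =1 line_term A G' eta' x ->
 wline A G eta x = wline A G' eta' x.
Proof. by move=> /funext e; rewrite /wline e. Qed.

(** The line at height [- nu] describes the same ray as the one at [2 pi - nu]. Seen there, the
    contour is the difference of two lines with both poles between them; an intermediate line at
    height [m] separates the poles, and the symmetry of [gpole] in its poles lets each crossing use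
    the same lemma. *)
Lemma Psi_gpole nu p1 p2 x : phi < nu < pi -> nu < Im p1 ->
 Im p1 < Im p2 -> Im p2 < 2 * pi - nu ->
 Psi A nu (gpole p1 p2) x = (cexp p1 - cexp p2)^-1 *: (Q A p2 x - Q A p1 x).
Proof.
case: p1 p2 => [u1 v1] [u2 v2] /andP[pn np] /= h1 h12 h2.
have p0 : 0 < phi by case: sA => _ /andP[].
pose m := (v1 + v2) / 2.
pose c0 := Num.min (Num.min ((v2 - v1) / 2) (v1 - nu)) (Num.min (2 * pi - nu - v2) nu).
have c00 : 0 < c0 by rewrite !lt_min; apply/andP; split; apply/andP; split; lra.
have l1 : c0 <= (v2 - v1) / 2 by rewrite !ge_min lexx.
have l2 : c0 <= v1 - nu by rewrite !ge_min lexx orbT.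
have l3 : c0 <= 2 * pi - nu - v2 by rewrite !ge_min lexx ?orbT.
have l4 : c0 <= nu by rewrite !ge_min lexx ?orbT.
have far s v : (c0 <= s - v <= 2 * pi - c0) || (c0 <= v - s <= 2 * pi - c0) -> cos (s - v) <= cos c0.
 have c0pi : 0 <= c0 <= pi by apply/andP; split; move: c00 l4 np; lra.
 by case/orP => h; [|rewrite -cosN opprB]; exact: cos_le_far.
have nu0 : 0 <= nu <= pi by apply/andP; split; lra.
have cm : cos nu < cos phi.
 by rewrite ltr_cos // in_itv /=; apply/andP; split; move: nu0 p0 pn np; lra.
have k1 : cos c0 < 1 by apply: cos_lt1; rewrite gtr0_norm // c00 /=; move: l4 np c00; lra.
have vm : v1 < m < v2 by rewrite /m; apply/andP; split; lra.
have /andP[vm1 vm2] := vm; have em : m - v1 = (v2 - v1) / 2 by rewrite /m; lra.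
have em' : v2 - m = (v2 - v1) / 2 by rewrite /m; lra.
have e1 := @wline_pole nu m (cos nu) (u1 +i* v1) (u2 +i* v2) (cos c0) x.
have e2 := @wline_pole m (2 * pi - nu) (cos nu) (u2 +i* v2) (u1 +i* v1) (cos c0) x.
have {}e1 : wline A (gpole (u1 +i* v1) (u2 +i* v2)) nu x - wline A (gpole (u1 +i* v1) (u2 +i* v2)) m x =
 (2 * pi%:C * 'i) *: ((cexp (u1 +i* v1) - cexp (u2 +i* v2))^-1 *: Q A (u1 +i* v1) x).
 apply: e1 => //=.
 - by rewrite h1.
 - by move: vm2 h2 nu0; lra.
 - by move=> s /andP[s1 s2]; apply: cos_le_far => //; rewrite s1 /=; move: vm2 h2 s2; lra.
 - move=> s /andP[s1 s2]; apply: far; apply/orP; right.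
 by apply/andP; split; move: s1 s2 l1 em' l4 h2; lra.
 - by apply: far; apply/orP; right; apply/andP; split; move: l2 l4 vm2 vm1 h2 nu0; lra.
 - by apply: far; apply/orP; left; rewrite em; apply/andP; split; move: l1 h2 h1 l4 l3; lra.
have {}e2 : wline A (gpole (u2 +i* v2) (u1 +i* v1)) m x - wline A (gpole (u2 +i* v2) (u1 +i* v1)) (2 * pi - nu) x =
 (2 * pi%:C * 'i) *: ((cexp (u2 +i* v2) - cexp (u1 +i* v1))^-1 *: Q A (u2 +i* v2) x).
 apply: e2 => //=.
 - by rewrite vm2 h2.
 - by move: vm1 h1 nu0; lra.
 - by move=> s /andP[s1 s2]; apply: cos_le_far => //; apply/andP; split; move: vm1 h1 s1 s2; lra.
 - move=> s /andP[s1 s2]; apply: far; apply/orP; left.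
 by apply/andP; split; move: s1 s2 l1 em l4 h1 l2; lra.
 - by apply: far; apply/orP; right; rewrite em'; apply/andP; split; move: l1 h2 h1 l4 l3; lra.
 - by apply: far; apply/orP; left; apply/andP; split; move: l3 l4 vm2 vm1 h2 h1 nu0; lra.
have eN : wline A (gpole (u1 +i* v1) (u2 +i* v2)) (- nu) x =
 wline A (gpole (u2 +i* v2) (u1 +i* v1)) (2 * pi - nu) x.
 have lt t : line_term A (gpole (u1 +i* v1) (u2 +i* v2)) (- nu) x t =
 line_term A (gpole (u2 +i* v2) (u1 +i* v1)) (2 * pi - nu) x t.
 by rewrite /line_term gpoleC /gpole /Q !cexp_2pi.
 exact: wline_eq.
have eM : wline A (gpole (u1 +i* v1) (u2 +i* v2)) m x = wline A (gpole (u2 +i* v2) (u1 +i* v1)) m x.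
 by apply: wline_eq => t; rewrite /line_term gpoleC.
apply: (scalerI (twopii_neq0 R)); rewrite /Psi scalerA mulfV ?twopii_neq0 // scale1r.
rewrite eN; move: e1 e2; rewrite eM.
move: (wline _ _ _ _) (wline _ _ _ _) (wline _ _ _ _) (Q _ _ _) (Q _ _ _) => a b c q1 q2 e1 e2.
have -> : a - c = - ((c - b) + (b - a)) by rewrite addrA subrK opprB.
rewrite e1 e2.
have -> : (cexp (u2 +i* v2) - cexp (u1 +i* v1))^-1 = - (cexp (u1 +i* v1) - cexp (u2 +i* v2))^-1.
 by rewrite -invrN opprB.
by move: (_^-1) (_ * 'i) => k k'; vring.
Qed.

(** If the two values of [Q] agree, subtracting the resolvent equations puts the difference of the
    two resolvent vectors in the kernel of [A]. So the vectors coincide, while multiples by distinct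
    scalars agree, and both are zero. *)
Lemma Psi_gpole_inj nu p1 p2 y : injective_operator A -> phi < nu < pi -> nu < Im p1 ->
 Im p1 < Im p2 -> Im p2 < 2 * pi - nu ->
 Psi A nu (gpole p1 p2) y = 0 -> y = 0.
Proof.
move=> iA nn h1 h12 h2; rewrite Psi_gpole //; have opA : is_operator A by case: sA.
have p0 : 0 < phi by case: sA => _ /andP[].
have /andP[n1 n2] := nn; have nu0 : 0 <= nu <= pi by apply/andP; split; lra.
have cm : cos nu < cos phi.
 by rewrite ltr_cos // in_itv /=; apply/andP; split; move: p0 n1 n2; lra.
have oo p : nu < Im p < 2 * pi - nu -> off phi p.
 move=> /andP[a b]; apply: le_lt_trans cm; apply: cos_le_far => //.
 by rewrite !ltW.
have r1 : resolvent_set A (cexp p1).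
 by apply: (off_resolvent sA); apply: oo; rewrite h1 (lt_trans h12).
have r2 : resolvent_set A (cexp p2).
 by apply: (off_resolvent sA); apply: oo; rewrite h2 (lt_trans h1).
have ne : cexp p1 - cexp p2 != 0.
 case: p1 p2 h1 h12 h2 {r1 r2} => [u1 v1] [u2 v2] /= h1 h12 h2; rewrite subr_eq0 cexp_neq //.
 by rewrite ltr0_norm ?subr_lt0 // opprB; move: nu0 n1 h1 h2 p0; lra.
 by rewrite (lt_eqF h12) orbT.
move=> /eqP; rewrite scaler_eq0 invr_eq0 (negbTE ne) /= subr_eq0 /Q => /eqP e.
have := operator_sub opA (resolvent_funP r1 y) (resolvent_funP r2 y).
rewrite e opprB addrA subrK subrr => /iA /eqP; rewrite subr_eq0 => /eqP e'.
apply: (resolvent_inj opA r1); apply/eqP.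
have : (cexp p1 - cexp p2) *: resolvent_fun A (cexp p1) y == 0.
 by rewrite scalerBl {2}e' e subrr.
by rewrite scaler_eq0 (negbTE ne).
Qed.

Lemma gpole_strip (u1 u2 del : R) : 0 < del -> del <= pi -> exists2 a, 0 <= a & forall p1 p2 b,
 Re p1 = u1 -> Re p2 = u2 ->
 b + del <= Im p1 <= 2 * pi - b - del -> b + del <= Im p2 <= 2 * pi - b - del ->
 strip_decay2 (gpole p1 p2) b a.
Proof.
move=> d0 d1.
have k1 : cos del < 1 by apply: cos_lt1; rewrite gtr0_norm // d0 /=; lra.
pose c := Num.sqrt ((1 - cos del) / 2).
have c0 : 0 < c by rewrite sqrtr_gt0 divr_gt0 // subr_gt0.
have [a a0 ha] := gpole_bound u1 u2 c0; exists a => // p1 p2 b e1 e2 h1 h2 t s sb.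
have B p : b + del <= Im p <= 2 * pi - b - del ->
 c * (expR t + rnorm (cexp p)) <= rnorm (cexp (t +i* s) - cexp p).
 move=> /andP[a1 a2]; apply: sub_cexp_line => //; rewrite -cosN opprB; apply: cos_le_far.
 by rewrite d1 andbT ltW.
 by move: sb; rewrite ltr_norml => /andP[b1 b2]; apply/andP; split; lra.
have ne p : b + del <= Im p <= 2 * pi - b - del -> cexp (t +i* s) - cexp p != 0.
 move=> h; apply: contraTneq (B p h) => ->; rewrite rnorm0 -ltNge.
 by rewrite mulr_gt0 // ltr_pwDl ?expR_gt0 ?rnorm_ge0.
split; last exact: (ha _ _ t s e1 e2 (B _ h1) (B _ h2)).
apply: cdiffM; first exact: cdiff_cexp.
apply: cdiffV; first by rewrite mulf_neq0 ?ne.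
by apply: cdiffM; exact: cdiff_cexpB.
Qed.

(** The regularizer has a double pole at [-1], whereas [gpole] is understood for distinct poles.
    Multiplying by [gpole q1 q2] gives the product of [gpole q1 p] and [gpole p q2] with [p] over
    [-1], and both factors are injective. *)
Lemma Psi_ereg_inj nu x : injective_operator A -> phi < nu < pi -> Psi A nu (@ereg R) x = 0 -> x = 0.
Proof.
move=> iA nn h; have /andP[n1 n2] := nn.
have p0 : 0 < phi by case: sA => _ /andP[].
pose del := (pi - nu) / 4 : R.
have d0 : 0 < del by rewrite /del; lra.
have dn : nu = pi - 4 * del by rewrite /del; lra.
have d1 : del <= pi / 2 by rewrite /del; lra.
pose b := pi - 2 * del.
have nb : phi < nu < b by apply/andP; split => //; rewrite /b; lra.
have bpi : b <= pi by rewrite /b; lra.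
pose p : R[i] := 0 +i* pi; pose q1 : R[i] := 0 +i* (pi - del); pose q2 : R[i] := 0 +i* (pi + del).
have d2 : del <= pi by move: d0 d1; lra.
have hp : b + del <= Im p <= 2 * pi - b - del by rewrite /b /=; apply/andP; split; move: d0; lra.
have hq1 : b + del <= Im q1 <= 2 * pi - b - del by rewrite /b /=; apply/andP; split; move: d0; lra.
have hq2 : b + del <= Im q2 <= 2 * pi - b - del by rewrite /b /=; apply/andP; split; move: d0; lra.
have [a a0 sd] := gpole_strip 0 0 d0 d2.
have sg p1 p2 := fun e1 e2 h1 h2 => strip_decay2W a0 (sd p1 p2 b e1 e2 h1 h2).
have {sg} [s1 s2 s3] := And3 (sg q1 q2 erefl erefl hq1 hq2) (sg q1 p erefl erefl hq1 hp) (sg p q2 erefl erefl hp hq2).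
have b0 : 0 <= b < pi by apply/andP; split; rewrite /b; lra.
have [a4 a40 s4] := ereg_decay b0.
have {}s4 : strip_decay (@ereg R) b a4.
 by apply: strip_decay2W => // t s sb; apply: s4; exact: ltW.
have m1 := Psi_mul sA x s1 s4 nb bpi; have m2 := Psi_mul sA x s2 s3 nb bpi.
have on := ltr_cos_pi p0 n1 (ltW n2).
have nub : `|nu| < b by rewrite gtr0_norm ?(lt_trans p0) //; have /andP[] := nb.
rewrite h (Psi0 sA on (strip_pair s1 nub)) in m1.
have e : Psi A nu (fun w => gpole q1 q2 w * ereg w) x = Psi A nu (fun w => gpole q1 p w * gpole p q2 w) x.
 apply: Psi_ext => w _; rewrite /gpole /ereg /regularizer cexp_ipi opprK [cexp w + 1]addrC.
 by rewrite expr2 !invfM; ring.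
rewrite -e -m1 in m2; have y0 : Psi A nu (gpole p q2) x = 0.
 apply: (Psi_gpole_inj (nu := nu) (p1 := q1) (p2 := p) iA nn _ _ _ m2) => /=.
 - by move: dn d0; lra.
 - by move: d0; lra.
 - by move: dn d0; lra.
apply: (Psi_gpole_inj (nu := nu) (p1 := p) (p2 := q2) iA nn _ _ _ y0) => /=.
- by move: dn d0; lra.
- by move: d0; lra.
- by move: dn d0; lra.
Qed.

End rational_functions.

Section contour_integrals.
Context (R : realType) (X : completeNormedModType R[i]) (A : set (X * X)).
Local Notation RM := (measurableTypeR R).
Let mu := @lebesgue_measure R.
Implicit Types (x y : X) (G g : R[i] -> R[i]) (phi psi nu eta : R).

Lemma ray_bochner phi G eta a x (h : R -> X) : sectorial phi A -> cos eta < cos phi ->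
 line_bound G eta a ->
 (forall r, 0 < r -> h r = r^-1%:C *: line_term A G eta x (ln r)) ->
 is_bochner_integral `]0, +oo[ h (wline A G eta x).
Proof.
move=> sA on gb hE; have [M hM] := Qbound_ex sA on.
pose K := a * M * rnorm x.
have ecancel (t v : R) : (expR t)^-1 * v * expR t = v.
 by rewrite mulrAC mulVf ?mul1r // gt_eqF // expR_gt0.
have mD : measurable (`]0, +oo[%classic : set RM) by [].
have cl t : tcont (line_term A G eta x) t := line_term_tcont sA x t on gb.
have cont_l (l : X -> R) (r : R) : rfun l -> 0 < r ->
 {for r, continuous (fun r : R => r^-1 * l (line_term A G eta x (ln r)))}.
 move=> rl r0; apply: continuousM; first by apply: inv_continuous; exact: lt0r_neq0.
 refine (@continuous_comp _ _ _ (@ln R) (fun t => l (line_term A G eta x t)) r _ _).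
 exact: continuous_ln.
 by refine (@tcont_real R X (line_term A G eta x) l (ln r) _ (fun u v => rfun_lip u v rl)).
have ch : continuous_in `]0, +oo[%classic h.
 move=> r; rewrite /= in_itv /= andbT => r0 e e0.
 have c1 : {for r, continuous (fun u : R => u^-1)} by apply: inv_continuous; exact: lt0r_neq0.
 have c2 : {for r, continuous (@ln R)} by exact: continuous_ln.
 set L := line_term A G eta x in hE cl *.
 pose B := rnorm (L (ln r)) + 1; have B0 : 0 < B by rewrite ltr_wpDl ?rnorm_ge0.
 have r'0 : 0 < r^-1 + 1 by rewrite addr_gt0 ?invr_gt0.
 have e1 : 0 < e / 2 / (r^-1 + 1) by rewrite !divr_gt0.
 have e2 : 0 < e / 2 / B by rewrite !divr_gt0.
 have [d1 d10 h1] := cl (ln r) _ e1.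
 have /cvgrPdist_lt/(_ _ d10) N1 := c2.
 have /cvgrPdist_lt/(_ _ e2) N2 := c1.
 have /cvgrPdist_lt/(_ _ ltr01) N3 := c1.
 have H : \forall u \near r, 0 < u -> rnorm (h u - h r) < e.
 near=> u => u0.
 have n1 : rnorm (L (ln u) - L (ln r)) < e / 2 / (r^-1 + 1).
 apply: h1; rewrite distrC; near: u; exact: N1.
 have n2 : `|r^-1 - u^-1| < e / 2 / B by near: u; exact: N2.
 have n3 : `|r^-1 - u^-1| < 1 by near: u; exact: N3.
 have n4 : u^-1 < r^-1 + 1.
 by move: n3; rewrite distrC => /(le_lt_trans (ler_norm _)); rewrite ltrBlDl.
 rewrite !hE //.
 have -> : u^-1%:C *: L (ln u) - r^-1%:C *: L (ln r) =
 u^-1%:C *: (L (ln u) - L (ln r)) - (r^-1 - u^-1)%:C *: L (ln r).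
 by rewrite rmorphB; vring.
 apply: (le_lt_trans (ler_rnormB _ _)); rewrite (rnormZ u^-1%:C) (rnormZ (r^-1 - u^-1)%:C) !rnorm_real [e]splitr ltrD //.
 rewrite mulrC -ltr_pdivlMr ?normr_gt0 ?invr_eq0 ?gt_eqF //; apply: (lt_le_trans n1).
 rewrite ler_pdivlMr ?normr_gt0 ?invr_eq0 ?gt_eqF // mulrAC ler_pdivrMr //.
 by rewrite ler_pM2l ?divr_gt0 // ger0_norm ?invr_ge0 ltW.
 apply: le_lt_trans (_ : `|r^-1 - u^-1| * B < _); last by rewrite -ltr_pdivlMr.
 by rewrite ler_wpM2l // lerDl.
 have /nbhs_ballP[d d0 hd] := H; exists d => // u; rewrite in_itv /= andbT => u0 ur.
 by apply: hd => //; rewrite /ball /= distrC.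
have ib : mu.-integrable (`]0, +oo[%classic : set RM) (EFin \o (fun r => r^-1 * (K * rho (ln r)))).
 apply: exp_substitution_integrable.
 move=> r r0; apply: continuousM; first by apply: inv_continuous; exact: lt0r_neq0.
 apply: continuousM; first exact: cst_continuous.
 by apply: continuous_comp; [exact: continuous_ln|exact: continuous_rho].
 apply: eq_rintegrable (integrable_rhoZ K) _ => // t _.
 by rewrite ?expRK ecancel ?expRK.
have hb r : `]0, +oo[%classic r -> rnorm (h r) <= r^-1 * (K * rho (ln r)).
 rewrite /= in_itv /= andbT => r0; rewrite hE // rnormZ rnorm_real ger0_norm ?invr_ge0 ?(ltW r0) //.
 by rewrite ler_wpM2l ?invr_ge0 ?(ltW r0) //; exact: line_term_bound.
have [y [by_ wy]] := bochner_exists mD ch ib hb.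
suff -> : wline A G eta x = y by [].
apply: wint_unique (wlineP sA x on gb) _ => l rl.
have [il el] := wy l rl; have [lD lZ ln_] := rl.
have iL : mu.-integrable [set: RM] (EFin \o (l \o line_term A G eta x)).
 by have [] := wlineP sA x on gb rl.
have eq1 r : 0 < r -> l (h r) = r^-1 * l (line_term A G eta x (ln r)) by move=> r0; rewrite hE // lZ.
split=> //; rewrite -el.
have -> : \int[mu]_(r in `]0%R, +oo[) l (h r) =
 \int[mu]_(r in `]0%R, +oo[) ((fun r : R => r^-1 * l (line_term A G eta x (ln r))) r).
 by apply: eq_Rintegral => r; rewrite inE /= in_itv /= andbT => /eq1.
rewrite exp_substitution.
- by apply: eq_Rintegral => t _; rewrite ecancel expRK.
- by move=> r; exact: cont_l.
- apply: eq_rintegrable iL _ => // t _.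
 by rewrite /= ecancel expRK.
Unshelve. all: by end_near. Qed.

Lemma twopiiE : (2 * pi)%:C * Num.imaginary = 2 * pi%:C * 'i :> R[i].
Proof. by rewrite realcM rmorphMn. Qed.

Lemma contour_integral_Psi phi nu g a x v : sectorial phi A -> phi < nu < pi ->
 pair_bound (g \o @cexp R) nu a ->
 is_contour_integral nu (fun z => g z *: resolvent_fun A z x) v <->
 v = (2 * pi%:C * 'i) *: Psi A nu (g \o @cexp R) x.
Proof.
move=> sA /andP[n1 n2] [gb1 gb2]; have p0 : 0 < phi by case: sA => _ /andP[].
have on := ltr_cos_pi p0 n1 (ltW n2).
have hr eta r : 0 < r -> expi eta *: (g (r%:C * expi eta) *: resolvent_fun A (r%:C * expi eta) x) =
 r^-1%:C *: line_term A (g \o @cexp R) eta x (ln r).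
 move=> r0; rewrite /line_term /Q /= cexpE lnK ?posrE // !scalerA; congr (_ *: _).
 have rr : r%:C != 0 :> R[i] by rewrite eq_complex /= eqxx andbT gt_eqF.
 by rewrite fmorphV mulrA mulrCA; set z := g _; field.
have b1 := ray_bochner (h := fun r => expi (- nu) *: (g (r%:C * expi (- nu)) *: resolvent_fun A (r%:C * expi (- nu)) x))
 sA (offN on) gb1 (hr _).
have b2 := ray_bochner (h := fun r => expi nu *: (g (r%:C * expi nu) *: resolvent_fun A (r%:C * expi nu) x))
 sA on gb2 (hr _).
rewrite /Psi scalerA mulfV ?twopii_neq0 // scale1r; split.
 move=> [y1 [y2 [B1 B2 ->]]].
 by rewrite (bochner_unique _ B1 b1) // (bochner_unique _ B2 b2).
by move=> ->; exists (wline A (g \o @cexp R) (- nu) x), (wline A (g \o @cexp R) nu x).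
Qed.

Lemma elementary_Psi psi g a phi nu x v : psi <= pi ->
 strip_decay (g \o @cexp R) psi a -> elementary_calculus A psi g (x, v) ->
 sectorial phi A -> phi < nu < psi -> v = Psi A nu (g \o @cexp R) x.
Proof.
move=> ppi sd [_ [phi' [nu' [sA' p1 p2 ci]]]] sA /andP[n1 n2].
have p0 : 0 < phi by case: sA => _ /andP[].
have p0' : 0 < phi' by case: sA' => _ /andP[].
have nu'psi : `|nu'| < psi by rewrite gtr0_norm // (lt_trans p0').
have hnu' : phi' < nu' < pi by rewrite p1 (lt_le_trans p2).
rewrite twopiiE in ci; have e := (contour_integral_Psi x _ sA' hnu' (strip_pair sd nu'psi)).1 ci.
have {e} /= -> := scalerI (twopii_neq0 R) e.
(* The graph hides its own angle and contour. The smaller of the two angles of sectoriality admits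
   both contours, which can then be compared. *)
case: (leP phi phi') => pp.
 by apply: (Psi_indep sA (b := psi) (a := a)) => //; rewrite ?n1 ?p2 ?andbT //= (le_lt_trans pp).
by apply: (Psi_indep sA' (b := psi) (a := a)) => //; rewrite ?p1 ?n2 ?andbT //= (lt_trans pp).
Qed.

Lemma Psi_elementary psi g a phi nu x : psi <= pi ->
 strip_decay (g \o @cexp R) psi a -> Hinf0 psi g ->
 sectorial phi A -> phi < nu < psi ->
 elementary_calculus A psi g (x, Psi A nu (g \o @cexp R) x).
Proof.
move=> ppi sd h0 sA /andP[n1 n2]; have p0 : 0 < phi by case: sA => _ /andP[].
split=> //; exists phi, nu; split=> //.
have nupsi : `|nu| < psi by rewrite gtr0_norm // (lt_trans p0).
rewrite twopiiE; apply/(contour_integral_Psi x _ sA _ (strip_pair sd nupsi)) => //.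
by rewrite n1 (lt_le_trans n2).
Qed.

End contour_integrals.

(** * The group of imaginary powers *)

Section uniform_boundedness.
Context (R : realType) (X : completeNormedModType R[i]).
Local Notation RM := (measurableTypeR R).
Implicit Types (x y : X) (s t : R).

Lemma rnorm_continuous_at (T : {linear X -> X}) : continuous T -> forall x (e : R), 0 < e ->
 exists2 d : R, 0 < d & forall y, rnorm (y - x) < d -> rnorm (T y - T x) < e.
Proof.
move=> cT x e e0; have e0' : 0 < e%:C :> R[i] by rewrite ltcR.
have /cvgrPdist_lt/(_ _ e0') := cT x => /nbhs_normP[d /= d0 hd].
have [d1 d2] := gt0_complex d0.
exists (Re d) => // y yx; have := hd y; rewrite /= d2 distrC rnormE ltcR => /(_ yx).
by rewrite distrC rnormE ltcR.
Qed.

(** Nested closed balls instead of Baire's theorem: on the n-th ball some operator of the family has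
    values of norm at least [n], and the common point of the balls contradicts pointwise
    boundedness. *)
Lemma uniform_boundedness (I : Type) (D : set I) (T : I -> {linear X -> X}) :
 (forall i, continuous (T i)) ->
 (forall x, exists M : R, forall i, D i -> rnorm (T i x) <= M) ->
 exists2 M : R, 0 <= M & forall i x, D i -> rnorm (T i x) <= M * rnorm x.
Proof.
move=> cT pb; apply: contrapT => nb.
have big (K : R) : 0 <= K -> exists i x, D i /\ K * rnorm x < rnorm (T i x).
 move=> K0; apply: contrapT => h; apply: nb; exists K => // i x Di.
 by rewrite leNgt; apply/negP => h'; apply: h; exists i, x.
(* Pairs consist of a centre and a radius. The centre moves by at most half the old radius and the
   new radius is at most a quarter of it, so each ball lies in the preceding one. *)
pose good (n : nat) (p q : X * R) :=
 [/\ 0 < q.2, q.2 <= p.2 / 4, rnorm (q.1 - p.1) <= p.2 / 2 &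
 exists2 i, D i & forall y, rnorm (y - q.1) <= q.2 -> n%:R <= rnorm (T i y)].
have step n (p : X * R) : 0 < p.2 -> exists q, good n p q.
 case: p => x r /= r0.
 have [i [v [Di hv]]] := big (2 / r * n.+1%:R) (mulr_ge0 (divr_ge0 (ler0n _ 2) (ltW r0)) (ler0n _ _)).
 have v0 : 0 < rnorm v.
 apply: rnorm_gt0; apply: contraTneq hv => ->; rewrite raddf0 rnorm0 mulr0.
 by rewrite ltxx.
 pose xi := (r / 2 / rnorm v)%:C *: v.
 have nxi : rnorm xi = r / 2.
 by rewrite rnormZ rnorm_real ger0_norm ?divfK ?gt_eqF // !divr_ge0 // ltW.
 have Txi : n.+1%:R <= rnorm (T i xi).
 rewrite linearZ rnormZ rnorm_real ger0_norm; last by rewrite !divr_ge0 // ltW.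
 have -> : r / 2 / rnorm v * rnorm (T i v) = r / 2 * (rnorm (T i v) / rnorm v) by ring.
 rewrite -ler_pdivrMl ?divr_gt0 // invf_div ler_pdivlMr //.
 exact: ltW.
 (* Since [2 T xi] is the difference of [T (x + xi)] and [T (x - xi)], one of the two is at least as
    large as [T xi]. *)
 have [x' [dx' Tx']] : exists x', rnorm (x' - x) <= r / 2 /\ n.+1%:R <= rnorm (T i x').
 case: (leP n.+1%:R (rnorm (T i (x + xi)))) => h1.
 by exists (x + xi); rewrite addrC addKr nxi.
 exists (x - xi); rewrite addrC addKr rnormN nxi; split=> //.
 rewrite raddfB; rewrite raddfD in h1.
 have := ler_rnormB (T i x + T i xi) (T i x - T i xi).
 have -> : T i x + T i xi - (T i x - T i xi) = (2%:R)%:C *: T i xi.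
 by rewrite rmorphMn; vring.
 rewrite rnormZ.
 by rewrite rnorm_real ger0_norm //; move: Txi h1; lra.
 have [d d0 hd] := rnorm_continuous_at (cT i) x' ltr01.
 exists (x', Num.min (d / 2) (r / 4)); split=> /=.
 - by rewrite lt_min !divr_gt0.
 - by rewrite ge_min lexx orbT.
 - by [].
 - exists i => // y yx.
 have yd : rnorm (y - x') < d.
 apply: (le_lt_trans yx); rewrite gt_min; apply/orP; left.
 by rewrite ltr_pdivrMr // ltr_pMr // ltr1n.
 have := hd y yd; have := ler_rnorm_dist (T i x') (T i y); rewrite rnormB.
 by move: Tx'; rewrite -[n.+1]addn1 natrD; lra.
have [f hf] : exists f : nat -> X * R, 0 < (f 0%N).2 /\ forall n, good n (f n) (f n.+1).
 have ch n (p : X * R) : {q | 0 < p.2 -> good n p q}.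
 by apply: cid; case: (ltP 0 p.2) => h; [have [q hq] := step n p h; exists q|exists p; move: h => /[swap] ?; rewrite leNgt => /negP].
 pose f := fix f n := if n is m.+1 then sval (ch m (f m)) else (0, 1) : X * R.
 exists f; split; first exact: ltr01.
 have pos n : 0 < (f n).2.
 elim: n => [|n IH] //=.
 by have [] := svalP (ch n (f n)) IH.
 by move=> n; exact: (svalP (ch n (f n)) (pos n)).
have [f0 hfn] := hf.
have pos n : 0 < (f n).2 by case: n => // n; have [] := hfn n.
have nest n k : rnorm ((f (n + k)%N).1 - (f n).1) <= (f n).2 - (f (n + k)%N).2.
 elim: k => [|k IH]; first by rewrite addn0 !subrr rnorm0.
 have [h1 h2 h3 _] := hfn (n + k)%N; rewrite addnS.
 have := ler_rnormD ((f (n + k).+1).1 - (f (n + k)%N).1) ((f (n + k)%N).1 - (f n).1).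
 by rewrite addrA subrK; have := pos (n + k)%N; move: h1 h2 h3 IH; lra.
have small n : (f n).2 <= (f 0%N).2 * 4^-1 ^+ n.
 elim: n => [|n IH]; first by rewrite expr0 mulr1.
 have [_ h _ _] := hfn n; apply: (le_trans h); rewrite exprSr mulrA.
 by rewrite ler_wpM2r // invr_ge0.
have b0 : (f n).2 @[n --> \oo] --> (0 : R).
 apply: (@squeeze_cvgr _ _ _ _ (fun=> 0) (fun n => (f 0%N).2 * 4^-1 ^+ n)).
 - by apply: nearW => n; rewrite small ltW.
 - exact: cvg_cst.
 - have -> : (0 : R) = (f 0%N).2 * 0 by rewrite mulr0.
 apply: cvgM; first exact: cvg_cst.
 by apply: cvg_expr; rewrite ger0_norm ?invr_ge0 // invf_lt1 // ltr1n.
have cau m n : rnorm ((f n).1 - (f m).1) <= (f n).2 + (f m).2.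
 wlog mn : m n / (m <= n)%N.
 move=> h; case/orP: (leq_total m n) => mn; first exact: h.
 by rewrite rnormB [leRHS]addrC; exact: h.
 have := nest m (n - m)%N; rewrite subnKC // => h; apply: (le_trans h).
 by have := pos n; have := pos m; lra.
have [y hy] := rnorm_cauchy_cvg cau b0.
have yin n : rnorm (y - (f n).1) <= (f n).2.
 apply/ler_addgt0Pr => e e0; have /cvg_rnorm_seqP/(_ _ e0)[N _ hN] := hy.
 have := hN (N + n)%N (leq_addr _ _) => h1.
 have := nest n N; rewrite addnC => h2.
 have := ler_rnormD (y - (f (N + n)%N).1) ((f (N + n)%N).1 - (f n).1).
 rewrite addrA subrK (rnormB y (f (N + n)%N).1).
 by have := pos (N + n)%N; move: h1 h2; lra.
have [M hM] := pb y.
have [_ _ _ [i Di hi]] := hfn (Num.truncn `|M|).+1.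
have := hi y (yin _); apply/negP; rewrite -ltNge.
apply: (le_lt_trans (hM i Di)); apply: (le_lt_trans (ler_norm M)); exact: truncnS_gt.
Qed.

End uniform_boundedness.

Section groups.
Context (R : realType) (X : completeNormedModType R[i]) (U : R -> {linear X -> X}).
Hypothesis hU : C0_group U.
Local Notation RM := (measurableTypeR R).
Implicit Types (x y : X) (s t : R).

Let U0 x : U 0 x = x. Proof. by case: hU. Qed.
Let UD s t x : U (s + t) x = U s (U t x). Proof. by case: hU. Qed.

Lemma group_tcont x t : tcont (fun s => U s x) t.
Proof.
have [_ _ _ c] := hU; move=> e e0; have e0' : 0 < e%:C :> R[i] by rewrite ltcR.
have /cvgrPdist_lt/(_ _ e0')/nbhs_ballP[d d0 hd] := c x t.
exists d => // u ut; have := hd u; rewrite /ball /= distrC => /(_ ut).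
by rewrite distrC rnormE ltcR.
Qed.

Lemma group_local_bound : exists2 M : R, 1 <= M & forall s x, `|s| <= 1 -> rnorm (U s x) <= M * rnorm x.
Proof.
have [cU _ _ _] := hU.
have [|M M0 hM] := @uniform_boundedness R X R [set s | `|s| <= 1] U cU.
 move=> x; have [||c _ hc] := @EVT_max R (fun s => rnorm (U s x)) (-1) 1; first by lra.
 apply: continuous_subspaceT => t.
 refine (@tcont_real R X (fun s => U s x) (@rnorm R X) t (group_tcont x t) _) => u v.
 rewrite ler_norml; have := ler_rnorm_dist u v; have := ler_rnorm_dist v u.
 by rewrite [rnorm (v - u)]rnormB => h1 h2; apply/andP; split; lra.
 by exists (rnorm (U c x)) => s /= s1; apply: hc; rewrite in_itv /= -ler_norml.
exists (M + 1); first by rewrite lerDr.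
move=> s x s1; apply: (le_trans (hM s x s1)); rewrite ler_wpM2r ?rnorm_ge0 //.
by rewrite lerDl.
Qed.

(** The interval from [0] to [s] is cut into steps of length at most 1; each costs a factor [M],
    whence the growth rate [ln M]. *)
Lemma group_growth : exists th M : R, [/\ 0 <= th, 1 <= M &
 forall s x, rnorm (U s x) <= M * expR (th * `|s|) * rnorm x].
Proof.
have [M M1 hM] := group_local_bound; have M0 : 0 < M by apply: lt_le_trans M1.
have it n s x : `|s| <= 1 -> rnorm (U (s *+ n) x) <= M ^+ n * rnorm x.
 move=> s1; elim: n => [|n IH]; first by rewrite mulr0n U0 expr0 mul1r.
 rewrite mulrS UD exprS -mulrA; apply: (le_trans (hM _ _ s1)).
 by rewrite ler_pM2l.
exists (ln M), M; split=> //; first exact: ln_ge0.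
move=> s x; pose n := (Num.truncn `|s|).+1.
have n0 : 0 < n%:R :> R by [].
have sn : `|s / n%:R| <= 1.
 by rewrite normrM normfV [`|n%:R|]ger0_norm // ler_pdivrMr // mul1r ltW // truncnS_gt.
have := it n (s / n%:R) x sn; rewrite -(mulr_natr (s / n%:R) n) divfK ?gt_eqF // => h.
apply: (le_trans h); rewrite ler_wpM2r ?rnorm_ge0 //.
rewrite /n exprS ler_pM2l // -[M in M ^+ _](lnK M0) -expRM_natl ler_expR mulrC.
rewrite ler_wpM2l ?ln_ge0 //.
by rewrite truncn_le.
Qed.

Lemma group_type_bound psi : group_type U < psi -> exists th M : R,
 [/\ 0 <= th, th < psi, 1 <= M & forall s x, rnorm (U s x) <= M * expR (th * `|s|) * rnorm x].
Proof.
rewrite /group_type; set S := [set _ | _] => h.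
have hom s : forall c u v, range (fun x => (x, U s x)) (u, v) -> range (fun x => (x, U s x)) (c *: u, c *: v).
 by move=> c u v [x _ [<- <-]]; exists (c *: x) => //; rewrite linearZ.
have Sne : S !=set0.
 have [th [M [th0 M1 b]]] := group_growth; exists th; split=> //; exists M => // s.
 apply: opnorm_le; first by move=> u v [x _ [<- <-]].
 by rewrite mulr_ge0 ?expR_ge0 // (le_trans ler01).
have [th [th0 [M M1 hM]] thpsi] := inf_lt Sne h.
exists th, M; split=> // s x; apply: (opnorm_bound (hom s) (hM s)).
by exists x.
Qed.

Lemma generatorP u v : generator U (u, v) <-> forall e : R, 0 < e -> exists2 d : R, 0 < d &
 forall h, `|h| < d -> rnorm (U h u - u - h%:C *: v) <= e * `|h|.
Proof.
have scal (h : R) : h != 0 -> U h u - u - h%:C *: v = h%:C *: (h^-1%:C *: (U h u - u) - v).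
 by move=> h0; rewrite scalerBr scalerA -realcM mulfV // scale1r.
rewrite /generator /=; split=> [g e e0|g].
 have e0' : 0 < e%:C :> R[i] by rewrite ltcR.
 have /cvgrPdist_lt/(_ _ e0') := g; rewrite near_withinE => /nbhs_ballP[d d0 hd].
 exists d => // h hd'; have [->|h0] := eqVneq h 0.
 by rewrite U0 subrr scale0r subrr rnorm0 normr0 mulr0.
 have := hd h; rewrite /ball /= sub0r normrN => /(_ hd' h0).
 rewrite distrC rnormE ltcR => /ltW k.
 by rewrite scal // rnormZ rnorm_real mulrC ler_wpM2r.
apply/cvgrPdist_lt => e e0.
have [d1 d2] := gt0_complex e0.
have [d d0 hd] := g (Re e / 2) (divr_gt0 d1 (ltr0n _ 2)).
rewrite near_withinE; apply/nbhs_ballP; exists d => // h; rewrite /ball /= sub0r normrN => hd' h0.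
rewrite d2 distrC rnormE ltcR; have := hd h hd'; rewrite scal // rnormZ rnorm_real [_ * `|h|]mulrC.
rewrite ler_pM2l ?normr_gt0 // => k; apply: (le_lt_trans k).
by rewrite ltr_pdivrMr // ltr_pMr // ltr1n.
Qed.

Lemma U_bounded s : exists2 C : R, 0 < C & forall x, rnorm (U s x) <= C * rnorm x.
Proof.
have [th [M [_ M1 h]]] := group_growth; exists (M * expR (th * `|s|)); last exact: h.
by rewrite mulr_gt0 ?expR_gt0 // (lt_le_trans ltr01).
Qed.

Lemma generator_orbit u v s : generator U (u, v) -> generator U (U s u, U s v).
Proof.
move=> /generatorP g; apply/generatorP => e e0; have [C C0 hC] := U_bounded s.
have [d d0 hd] := g (e / C) (divr_gt0 e0 C0); exists d => // h hd'.
have -> : U h (U s u) - U s u - h%:C *: U s v = U s (U h u - u - h%:C *: v).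
 have eU : U h (U s u) = U s (U h u) by rewrite -!UD addrC.
 have eZ : U s (h%:C *: v) = h%:C *: U s v by exact: linearZ.
 have eB : U s (U h u - u - h%:C *: v) = U s (U h u) - U s u - U s (h%:C *: v) by rewrite !raddfB.
 by rewrite eB eU eZ.
apply: (le_trans (hC _)); rewrite mulrC -ler_pdivlMr // mulrAC; exact: hd.
Qed.

Lemma orbit_derivative u v s : generator U (u, v) -> forall e : R, 0 < e -> exists2 d : R, 0 < d &
 forall h, `|h| < d -> rnorm (U (s + h) u - U s u - h%:C *: U s v) <= e * `|h|.
Proof.
move=> g0 e e0; have /generatorP g := @generator_orbit u v s g0; have [d d0 hd] := g e e0.
by exists d => // h /hd; rewrite [s + h]addrC UD.
Qed.

Let mu := @lebesgue_measure R.

Lemma orbit_integral a b x : exists y, is_wint (`[a, b]%classic : set RM) (fun s => U s x) y.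
Proof.
have [th [M [th0 M1 hM]]] := group_growth.
have mD : measurable (`[a, b]%classic : set RM) by [].
have cin : continuous_in (`[a, b]%classic : set RM) (fun s => U s x).
 by move=> t _ e e0; have [d d0 hd] := group_tcont x t e0; exists d => // u _; exact: hd.
have ib : mu.-integrable (`[a, b]%classic : set RM) (EFin \o (fun _ : R => M * expR (th * (`|a| + `|b|)) * rnorm x)).
 by exact: integrable_cst_itv.
have [|y [_ wy]] := bochner_exists mD cin ib; last by exists y.
move=> s; rewrite /= in_itv /= => /andP[s1 s2]; apply: (le_trans (hM s x)).
rewrite ler_wpM2r ?rnorm_ge0 // ler_wpM2l ?(le_trans ler01) // ler_expR ler_wpM2l // ler_norml.
have := ler_norm b; have := ler_norm (- a); have := normr_ge0 a; have := normr_ge0 b; rewrite normrN.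
by move: s1 s2 => s1 s2 *; apply/andP; split; lra.
Qed.

Let J a b x : X := xget 0 [set y | is_wint (`[a, b]%classic : set RM) (fun s => U s x) y].

Let JP a b x : is_wint (`[a, b]%classic : set RM) (fun s => U s x) (J a b x).
Proof.
by have := @xgetPex _ 0 [set y | is_wint (`[a, b]%classic : set RM) (fun s => U s x) y] (orbit_integral a b x).
Qed.

Let lcJ a b x l : rfun l -> lc l (J a b x) = sint a b (fun s => lc l (U s x)).
Proof. by move=> rl; rewrite (lc_wint _ rl (JP a b x)). Qed.

Let J_split a m b x : a <= m <= b -> J a b x = J a m x + J m b x.
Proof.
move=> amb; apply: lc_eq => l rl; rewrite lcD // !lcJ //.
apply: sint_split => // t _ e e0.
have [d d0 hd] := group_tcont x t (divr_gt0 e0 (ltr0n _ 2)); exists d => // u /hd k.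
by rewrite -lcB //; apply: (le_lt_trans (lc_norm _ rl)); rewrite mulrC -ltr_pdivlMr.
Qed.

Let J_near a b x z (e : R) : a <= b -> (forall s, a <= s <= b -> rnorm (U s x - z) <= e) ->
 rnorm (J a b x - (b - a)%:C *: z) <= e * (b - a).
Proof.
move=> ab hz; have mD : measurable (`[a, b]%classic : set RM) by [].
have wz : is_wint (`[a, b]%classic : set RM) (fun=> z) ((b - a)%:C *: z).
 move=> l [lD lZ ln_]; split.
 by exact: integrable_cst_itv.
 by rewrite Rintegral_cst // fine_lebesgue_itv // lZ mulrC.
have := wint_norm mD (wintB mD (JP a b x) wz) (b := fun=> e) _ _.
rewrite Rintegral_cst // fine_lebesgue_itv //; apply.
 by exact: integrable_cst_itv.
by move=> s; rewrite /= in_itv /=; exact: hz.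
Qed.

Lemma Rintegral_shift (f : R -> R) a b h : a <= b -> continuous f ->
 \int[mu]_(s in `[(a + h), (b + h)]) f s = \int[mu]_(s in `[a, b]) f (s + h).
Proof.
move=> ab cf; rewrite /Rintegral; congr fine.
have dE : derive1 (fun s : R => s + h) = cst 1.
 by apply/funext => s; rewrite derive1E deriveD // derive_id derive_cst addr0.
rewrite (@integration_by_substitution_increasing R (fun s => s + h) f a b) //.
- by apply: eq_integral => s _ /=; rewrite dE /= mulr1.
- by move=> s t _ _; rewrite ltrD2r.
- by rewrite dE => s _; exact: cst_continuous.
- by rewrite dE; exact: is_cvg_cst.
- by rewrite dE; exact: is_cvg_cst.
- have c : continuous (fun s : R => s + h).
 by move=> s; apply: cvgD; [exact: cvg_id|exact: cvg_cst].
 split; first by move=> s _; apply: derivableD => //; exact: derivable_id.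
 by apply: cvg_at_right_filter; exact: c.
 by apply: cvg_at_left_filter; exact: c.
- exact: continuous_subspaceT.
Qed.

Let J_shift a b h x : a <= b -> U h (J a b x) = J (a + h) (b + h) x.
Proof.
move=> ab; have mD : measurable (`[a, b]%classic : set RM) by [].
have [C C0 hC] := U_bounded h.
have rU : rlinear_map C (U h).
 by split=> [u v|r v|v]; [exact: raddfD|exact: linearZ|exact: hC].
have w := wint_map mD rU (JP a b x).
apply: rfun_eq => l rl; have [_ <-] := w l rl; have [_ <-] := JP (a + h) (b + h) x rl.
rewrite Rintegral_shift //.
 by apply: eq_Rintegral => s _ /=; rewrite -UD addrC.
by move=> t; refine (@tcont_real R X (fun s => U s x) l t (group_tcont x t) (fun u v => rfun_lip u v rl)).
Qed.

Let quotient_split (p q r z x : X) (k : R[i]) :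
 q + p - r - q - k *: (z - x) = (p - k *: z) - (r - k *: x).
Proof. vring. Qed.

Let quotient_split' (p q r z x : X) (k : R[i]) :
 p + q - r - q - (- k) *: (z - x) = (p - k *: x) - (r - k *: z).
Proof. vring. Qed.

(** Means of the orbit over [[0, t]] belong to the domain of the generator, with value the
    difference quotient of the orbit over [t], and they tend to [x] as [t] tends to zero. *)
Lemma generator_dense x (e : R) : 0 < e -> exists u v, generator U (u, v) /\ rnorm (u - x) < e.
Proof.
move=> e0; have [d d0 hd] := group_tcont x 0 (divr_gt0 e0 (ltr0n _ 2)).
pose t := d / 2; have t0 : 0 < t by rewrite divr_gt0.
have gJ : generator U (J 0 t x, U t x - x).
 apply/generatorP => c c0; have c2 : 0 < c / 2 by rewrite divr_gt0.
 have [d1 d10 h1] := group_tcont x 0 c2; have [d2 d20 h2] := group_tcont x t c2.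
 exists (Num.min d1 (Num.min d2 t)); first by rewrite !lt_min d10 d20.
 move=> h; rewrite !lt_min => /and3P[hd1 hd2 ht].
 rewrite (J_shift _ _ (ltW t0)) add0r.
 have N1 a b : a <= b -> `|a| <= `|h| -> `|b| <= `|h| -> rnorm (J a b x - (b - a)%:C *: x) <= c / 2 * (b - a).
 move=> ab ah bh; apply: J_near => // s /andP[s1 s2].
 have := h1 s; rewrite subr0 U0 => k; apply/ltW/k; apply: le_lt_trans hd1.
 by move: ah bh; rewrite !ler_norml => /andP[? ?] /andP[? ?]; apply/andP; split; lra.
 have N2 a b : a <= b -> `|a - t| <= `|h| -> `|b - t| <= `|h| -> rnorm (J a b x - (b - a)%:C *: U t x) <= c / 2 * (b - a).
 move=> ab ah bh; apply: J_near => // s /andP[s1 s2].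
 apply/ltW/h2; apply: le_lt_trans hd2.
 by move: ah bh; rewrite !ler_norml => /andP[? ?] /andP[? ?]; apply/andP; split; lra.
 case: (leP 0 h) => h0.
 rewrite ger0_norm // in ht N1 N2 *.
 have e1 := @J_split 0 h (t + h) x; have e2 := @J_split 0 t (t + h) x.
 have := e1; rewrite e2; last by apply/andP; split; lra.
 move=> /(_ _) e3; have {}e3 : J 0 t x + J t (t + h) x = J 0 h x + J h (t + h) x.
 by apply: e3; apply/andP; split; lra.
 have -> : J h (t + h) x = J 0 t x + J t (t + h) x - J 0 h x by rewrite e3 addrAC subrr add0r.
 have n1 := N1 0 h h0; have n2 := N2 t (t + h) _ _ _.
 rewrite subr0 normr0 ger0_norm // in n1; have {}n1 := n1 h0 (lexx _).
 have {}n2 : rnorm (J t (t + h) x - (t + h - t)%:C *: U t x) <= c / 2 * (t + h - t).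
 by apply: n2; rewrite ?subrr ?normr0 ?lerDl // addrAC subrr add0r ger0_norm.
 have th : t + h - t = h by lra.
 rewrite th in n2.
 have -> : J 0 t x + J t (t + h) x - J 0 h x - J 0 t x - h%:C *: (U t x - x) =
 (J t (t + h) x - h%:C *: U t x) - (J 0 h x - h%:C *: x) by rewrite quotient_split.
 by apply: (le_trans (ler_rnormB _ _)); move: n1 n2; lra.
 pose k := - h; have k0 : 0 < k by rewrite oppr_gt0.
 have hk : h = - k by rewrite opprK.
 have nh : `|h| = k by rewrite hk normrN gtr0_norm.
 rewrite nh in ht N1 N2 *; rewrite hk.
 have e1 := @J_split (- k) 0 t x; have e2 := @J_split (- k) (t - k) t x.
 have {}e1 : J (- k) t x = J (- k) 0 x + J 0 t x by apply: e1; apply/andP; split; lra.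
 have {}e2 : J (- k) t x = J (- k) (t - k) x + J (t - k) t x by apply: e2; apply/andP; split; lra.
 have -> : J (- k) (t - k) x = J (- k) 0 x + J 0 t x - J (t - k) t x by rewrite -e1 e2 addrK.
 have n1 : rnorm (J (- k) 0 x - (0 - - k)%:C *: x) <= c / 2 * (0 - - k).
 by apply: N1; [lra|rewrite normrN gtr0_norm|rewrite normr0 ltW].
 have n2 : rnorm (J (t - k) t x - (t - (t - k))%:C *: U t x) <= c / 2 * (t - (t - k)).
 apply: N2; first by lra.
 by rewrite addrAC subrr add0r normrN gtr0_norm.
 by rewrite subrr normr0 ltW.
 have t1 : 0 - - k = k by lra. have t2 : t - (t - k) = k by lra.
 rewrite t1 in n1; rewrite t2 in n2.
 have -> : J (- k) 0 x + J 0 t x - J (t - k) t x - J 0 t x - (- k)%:C *: (U t x - x) =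
 (J (- k) 0 x - k%:C *: x) - (J (t - k) t x - k%:C *: U t x).
 by rewrite rmorphN; exact: quotient_split'.
 by apply: (le_trans (ler_rnormB _ _)); move: n1 n2; lra.
have n : rnorm (J 0 t x - (t - 0)%:C *: x) <= e / 2 * (t - 0).
 apply: J_near; first exact: ltW.
 move=> s /andP[s1 s2]; have := hd s; rewrite subr0 U0 => k; apply/ltW/k.
 by rewrite ger0_norm // (le_lt_trans s2) // /t ltr_pdivrMr // ltr_pMr // ltr1n.
rewrite subr0 in n.
exists (t^-1%:C *: J 0 t x), (t^-1%:C *: (U t x - x)); split.
 apply/generatorP => c c0; have [d' d'0 h'] := (generatorP _ _).1 gJ (c * t) (mulr_gt0 c0 t0).
 exists d' => // h /h' k; rewrite linearZ.
 have -> : t^-1%:C *: U h (J 0 t x) - t^-1%:C *: J 0 t x - h%:C *: (t^-1%:C *: (U t x - x)) =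
 t^-1%:C *: (U h (J 0 t x) - J 0 t x - h%:C *: (U t x - x)) by vring.
 rewrite rnormZ rnorm_real gtr0_norm ?invr_gt0 // ler_pdivrMl //.
 by apply: (le_trans k); rewrite [c * t]mulrC mulrA.
have -> : t^-1%:C *: J 0 t x - x = t^-1%:C *: (J 0 t x - t%:C *: x).
 by rewrite scalerBr scalerA -realcM mulVf ?scale1r // gt_eqF.
rewrite rnormZ rnorm_real gtr0_norm ?invr_gt0 // ltr_pdivrMl //; apply: (le_lt_trans n).
by rewrite mulrC ltr_pM2l // ltr_pdivrMr // ltr_pMr // ltr1n.
Qed.

End groups.

Section exponential_taylor.
Context (R : realType).
Implicit Types (z w : R[i]).

Lemma cdiff_local f g z (r : R) : 0 < r ->
 (forall w : R[i], rnorm (w - z) < r -> f w = g w) -> cdiff g z -> cdiff f z.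
Proof.
move=> r0 fg [p [cp hp]].
have fz : f z = g z by apply: fg; rewrite subrr rnorm0.
exists (fun w => if rnorm (w - z) < r then p w else (f w - f z) / (w - z)); split.
 by apply: (@ccont_local _ _ p _ _ r) => // w h; rewrite h.
move=> w; case: ifPn => h; first by rewrite fz fg.
by rewrite divfK // subr_eq0; apply: contraNneq h => ->; rewrite subrr rnorm0.
Qed.

(** Iterating gives [N z <= 2^n N (z / 2^n)], and a quantity of smaller order than the norm makes
    the right side tend to zero. Estimates of the exponential follow from its doubling formula,
    without power series. *)
Lemma halving_le0 (N : R[i] -> R) z : Re z <= 0 ->
 (forall w, Re w <= 0 -> N (w + w) <= 2 * N w) ->
 (forall e, 0 < e -> exists2 d : R, 0 < d & forall w, rnorm w < d -> N w <= e * rnorm w) -> N z <= 0.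
Proof.
move=> z0 half small; apply/ler_addgt0Pr => e e0; rewrite add0r.
pose c n : R := 2^-1 ^+ n.
have c0 n : 0 < c n by rewrite exprn_gt0 // invr_gt0.
have cS n : c n.+1 + c n.+1 = c n by rewrite /c exprS; lra.
have it n : N z <= 2 ^+ n * N ((c n)%:C * z).
 elim: n => [|n IH]; first by rewrite /c !expr0 mul1r mul1r.
 apply: (le_trans IH); rewrite exprSr -mulrA ler_wpM2l //.
 rewrite -cS rmorphD mulrDl; apply: half.
 by case: (z) z0 => a b /= a0; rewrite mul0r subr0 pmulr_rle0.
have z1 : 0 < rnorm z + 1 by rewrite ltr_wpDl ?rnorm_ge0.
have [d d0 hd] := small _ (divr_gt0 e0 z1).
have [n hn] : exists n, c n * rnorm z < d.
 have cv : c n * rnorm z @[n --> \oo] --> 0 * rnorm z.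
 apply: cvgM; last exact: cvg_cst.
 by apply: cvg_expr; rewrite ger0_norm // invf_lt1 // ltr1n.
 rewrite mul0r in cv; have /cvgrPdist_lt/(_ _ d0)[n _ hN] := cv; exists n.
 have := hN n (leqnn n); rewrite /= sub0r normrN ger0_norm //.
 by rewrite mulr_ge0 ?rnorm_ge0 // ltW.
have nz : rnorm ((c n)%:C * z) = c n * rnorm z by rewrite rnormM rnorm_real ger0_norm // ltW.
have := hd ((c n)%:C * z); rewrite nz => /(_ hn) k.
apply: (le_trans (it n)); apply: (le_trans (ler_wpM2l (exprn_ge0 n (ler0n R 2)) k)).
have -> : 2 ^+ n * (e / (rnorm z + 1) * (c n * rnorm z)) = (2 ^+ n * c n) * (e / (rnorm z + 1) * rnorm z) by ring.
by rewrite /c -exprMn mulfV // expr1n mul1r mulrAC ler_pdivrMr // ler_pM2l // lerDl.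
Qed.

Lemma rnorm_cexpD1 w : Re w <= 0 -> rnorm (cexp w + 1) <= 2.
Proof.
move=> w0; apply: (le_trans (ler_rnormD _ _)).
by rewrite rnorm_cexp rnorm1 -[2]/(1 + 1) lerD // -expR0 ler_expR.
Qed.

Lemma rnorm_double (w : R[i]) : rnorm (w + w) = 2 * rnorm w.
Proof.
have -> : w + w = 2%:C * w by rewrite rmorphMn; ring.
by rewrite rnormM rnorm_real ger0_norm.
Qed.

Lemma cexp_lip z : Re z <= 0 -> rnorm (cexp z - 1) <= rnorm z.
Proof.
move=> z0; rewrite -subr_le0; apply: (halving_le0 (N := fun w => rnorm (cexp w - 1) - rnorm w)) z0 _ _.
 move=> w /rnorm_cexpD1 w2; rewrite rnorm_double mulrBr lerD2r.
 have -> : cexp (w + w) - 1 = (cexp w - 1) * (cexp w + 1) by rewrite cexpD; ring.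
 by rewrite rnormM mulrC ler_wpM2r ?rnorm_ge0.
move=> e /cexp_small[d d0 hd]; exists d => // w /hd h; apply: le_trans h.
by rewrite lerBlDl; exact: ler_rnorm_dist.
Qed.

Lemma cexp_taylor_neg z : Re z <= 0 -> rnorm (cexp z - 1 - z) <= rnorm z ^+ 2.
Proof.
move=> z0; rewrite -subr_le0; apply: (halving_le0 (N := fun w => rnorm (cexp w - 1 - w) - rnorm w ^+ 2)) z0 _ _.
 move=> w w0; rewrite rnorm_double.
 have -> : cexp (w + w) - 1 - (w + w) = (cexp w - 1 - w) * (cexp w + 1) + w * (cexp w - 1) by rewrite cexpD; ring.
 have := ler_rnormD ((cexp w - 1 - w) * (cexp w + 1)) (w * (cexp w - 1)); rewrite !rnormM.
 have := rnorm_cexpD1 w0; have := cexp_lip w0; have := rnorm_ge0 w; have := rnorm_ge0 (cexp w - 1 - w).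
 by move: (rnorm (cexp w - 1 - w)) (rnorm (cexp w + 1)) (rnorm (cexp w - 1)) (rnorm w) (rnorm (_ + _)) => x y u v q; nra.
move=> e /cexp_small[d d0 hd]; exists d => // w /hd h; apply: le_trans h.
by rewrite gerBl sqr_ge0.
Qed.

(** In the right half-plane [exp z] is factored out, which leaves the estimates for [-z] in the left
    half-plane. *)
Lemma cexp_taylor z : rnorm (cexp z - 1 - z) <= 2 * expR `|Re z| * rnorm z ^+ 2.
Proof.
case: (leP (Re z) 0) => z0.
 apply: (le_trans (cexp_taylor_neg z0)); rewrite ler_peMl ?sqr_ge0 //.
 have : 1 <= expR `|Re z| by rewrite -expR0 ler_expR.
 by lra.
have zN : Re (- z) <= 0 by rewrite raddfN oppr_le0 ltW.
have h1 := cexp_taylor_neg zN; have h2 := cexp_lip zN.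
have -> : cexp z - 1 - z = - (cexp z * (cexp (- z) - 1 - (- z))) - z * (cexp z * (cexp (- z) - 1)).
 by rewrite cexpN; field; exact: cexp_neq0.
apply: (le_trans (ler_rnormB _ _)); rewrite rnormN (rnormM (cexp z)) (rnormM z) (rnormM (cexp z)) rnorm_cexp (gtr0_norm z0).
rewrite !rnormN in h1 h2; have e0 := expR_ge0 (Re z); have n0 := rnorm_ge0 z.
have t1 := ler_wpM2l e0 h1; have t2 := ler_wpM2l n0 (ler_wpM2l e0 h2).
have -> : 2 * expR (Re z) * rnorm z ^+ 2 =
 expR (Re z) * rnorm z ^+ 2 + rnorm z * (expR (Re z) * rnorm z) by ring.
exact: lerD.
Qed.

End exponential_taylor.

Lemma thirds (R : realType) (e : R) : e = e / 3 + e / 3 + e / 3. Proof. lra. Qed.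

Section constant_functions.
Context (R : realType) (X : completeNormedModType R[i]).
Implicit Types (s t h : R).

Lemma zero_derivative_constant (W : R -> X) :
 (forall s (e : R), 0 < e -> exists2 d : R, 0 < d &
 forall h, `|h| < d -> rnorm (W (s + h) - W s) <= e * `|h|) ->
 forall s t, W s = W t.
Proof.
move=> hW s t; apply: rfun_eq => l rl.
apply: (@is_derive_0_is_cst R (l \o W)) => r.
have cv : h^-1 *: ((l \o W \o shift r) (h *: (1 : R)) - (l \o W) r) @[h --> (0 : R)^'] --> (0 : R).
 apply/cvgrPdist_lt => e e0.
 have [d d0 hd] := hW r (e / 2) (divr_gt0 e0 (ltr0n _ 2)).
 rewrite near_withinE; apply/nbhs_ballP; exists d => // h; rewrite /ball /= sub0r normrN => hh h0.
 rewrite sub0r normrN /shift /= /GRing.scale /= mulr1 [h + r]addrC normrM normfV.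
 rewrite mulrC ltr_pdivrMr ?normr_gt0 //.
 apply: (le_lt_trans (rfun_lip _ _ rl)); apply: (le_lt_trans (hd h hh)).
 by rewrite ltr_pM2r ?normr_gt0 // ltr_pdivrMr // ltr_pMr // ltr1n.
apply: DeriveDef; first by apply/cvg_ex; exists 0.
exact: (cvg_lim (@Rhausdorff R) cv).
Qed.

End constant_functions.

Section group_calculus.
Context (R : realType) (X : completeNormedModType R[i]) (A : set (X * X)) (phi : R)
 (U : R -> {linear X -> X}).
Hypotheses (sA : sectorial phi A) (iA : injective_operator A) (hU : C0_group U)
 (hgen : generator U = scale_operator (- 'i) (log_operator A)).
Implicit Types (x y : X) (s t h : R) (w : R[i]) (G H : R[i] -> R[i]).

Lemma strip_decayS G b b' a : b' <= b -> strip_decay G b a -> strip_decay G b' a.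
Proof. by move=> bb sd t s sb; apply: sd; exact: lt_le_trans bb. Qed.

Lemma strip_decay_mulw G b a : 0 <= a -> b <= pi -> strip_decay2 G b a ->
 strip_decay (fun w => G w * w) b (a * (1 + pi)).
Proof.
move=> a0 bpi sd t s sb; have [h1 h2] := sd t s sb; split.
 by apply: cdiffM => //; exact: cdiff_id.
rewrite rnormM; apply: le_trans (_ : a * rho t ^+ 2 * ((1 + pi) * (1 + t ^+ 2)) <= _).
 rewrite ler_pM ?rnorm_ge0 //; apply: (le_trans (rnorm_le_ReIm _)) => /=.
 have : `|t| <= 1 + t ^+ 2.
 by rewrite -[t ^+ 2]real_normK ?num_real //; have := sqr_ge0 (`|t| - 1); rewrite !expr2; nra.
 have s1 : `|s| <= pi by rewrite ltW // (lt_le_trans sb).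
 by have := @pi_ge0 R; have := sqr_ge0 t; move: s1; nra.
rewrite /rho; apply: eq_ler; field.
by rewrite gt_eqF // ltr_pwDl ?sqr_ge0.
Qed.

Lemma strip_decay_mulw2 G b a : 0 <= a -> b <= pi -> strip_decay2 G b a ->
 strip_decay (fun w => G w * (w * w)) b (a * (1 + pi ^+ 2)).
Proof.
move=> a0 bpi sd t s sb; have [h1 h2] := sd t s sb; split.
 by apply: cdiffM => //; apply: cdiffM; exact: cdiff_id.
rewrite rnormM; apply: le_trans (_ : a * rho t ^+ 2 * ((1 + pi ^+ 2) * (1 + t ^+ 2)) <= _).
 rewrite ler_pM ?rnorm_ge0 // rnormM -expr2 sqr_rnormc /=.
 have s1 : s ^+ 2 <= pi ^+ 2.
 by rewrite -[s ^+ 2]real_normK ?num_real // ler_pXn2r ?nnegrE ?pi_ge0 // ltW // (lt_le_trans sb).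
 by have := sqr_ge0 t; have := sqr_ge0 (pi : R); move: s1; nra.
rewrite /rho; apply: eq_ler; field.
by rewrite gt_eqF // ltr_pwDl ?sqr_ge0.
Qed.

(** The function [z^{is}] in the coordinate [z = exp w]. *)
Definition iexp s w : R[i] := cexp ('i * s%:C * w).

Lemma Re_iexp s w : Re ('i * s%:C * w) = - (s * Im w).
Proof. by case: w => a b /=; ring. Qed.

Lemma iexp_bounded s b : b <= pi -> bounded_strip (iexp s) b (expR (`|s| * pi)).
Proof.
move=> bpi t e eb; split.
 apply: (@cdiff_comp _ (fun w => 'i * s%:C * w) (@cexp R)); last exact: cdiff_cexp.
 by apply: cdiffM; [exact: cdiff_cst|exact: cdiff_id].
rewrite rnorm_cexp Re_iexp ler_expR /=; apply: (le_trans (ler_norm _)).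
by rewrite normrN normrM ler_wpM2l // ltW // (lt_le_trans eb).
Qed.

Lemma iexpD s h w : iexp (s + h) w = iexp s w * iexp h w.
Proof. by rewrite /iexp -cexpD rmorphD; congr cexp; ring. Qed.

Lemma iexp0 w : iexp 0 w = 1.
Proof. by rewrite /iexp mulr0 mul0r cexp0. Qed.

Section fixed_line.
Variables (nu : R).
Hypothesis hnu : phi < nu < pi.

Let b : R := (nu + pi) / 2.
Let bpi : b <= pi. Proof. by have /andP[_ h] := hnu; rewrite /b; lra. Qed.
Let p0 : 0 < phi. Proof. by case: sA => _ /andP[]. Qed.
Let nb : phi < nu < b. Proof. by have /andP[h1 h2] := hnu; rewrite h1 /b /=; lra. Qed.
Let nub : `|nu| < b. Proof. by have /andP[h1 h2] := nb; rewrite gtr0_norm // (lt_trans p0). Qed.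
Let on : cos nu < cos phi.
Proof.
have /andP[h1 h2] := hnu; have q0 := p0.
by rewrite ltr_cos // in_itv /=; apply/andP; split; lra.
Qed.

Let ereg_sd b' : 0 <= b' < pi -> exists2 a, 0 <= a & strip_decay2 (@ereg R) b' a.
Proof. by move=> /ereg_decay[a a0 h]; exists a => // t s sb; apply: h; exact: ltW. Qed.

(** In symbols, [e(A) y = (e log)(A) x]. The graph of [log A] gives this on a contour and for an
    angle of its own; a strip containing both contours is used to move it to the line [nu]. *)
Lemma log_Psi x y : log_operator A (x, y) ->
 Psi A nu (@ereg R) y = Psi A nu (fun w => ereg w * w) x.
Proof.
move=> [psi [psipi [v [e1 e2]]]].
have /andP[n1 n2] := hnu; have q0 := p0.
pose b' := Num.max b psi.
have b'pi' : b' < pi by rewrite gt_max psipi andbT /b; lra.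
have b'pi := ltW b'pi'.
have nb' : nu < b' by rewrite lt_max; apply/orP; left; rewrite /b; lra.
have psib' : psi <= b' by rewrite le_max lexx orbT.
have [|a a0 sd] := ereg_sd (b' := b'); first by rewrite b'pi' andbT; lra.
have logE w : `|Im w| < pi -> clog (cexp w) = w by case: w => t s; exact: clog_cexp.
pose G := (fun z => regularizer z * clog z) \o @cexp R.
have sdG : strip_decay G b' (a * (1 + pi)).
 move=> t s sb; have [h1 h2] := strip_decay_mulw a0 b'pi sd t sb.
 have spi : `|s| < pi by exact: lt_le_trans b'pi.
 split; last by rewrite /G /= logE.
 apply: (cdiff_local (g := fun w => ereg w * w) (r := pi - `|s|)) h1; first by rewrite subr_gt0.
 move=> w wz; rewrite /G /= logE //.
 have h : `|Im w - s| <= rnorm (w - (t +i* s)).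
 by have := normr_Im_le (w - (t +i* s)); rewrite raddfB.
 have := ler_normD (Im w - s) s; rewrite subrK.
 by move: wz h; lra.
have sde := strip_decay2W a0 sd.
have [_ [phi' [nu' [sA' m1 m2 _]]]] := e1.
have p0' : 0 < phi' by case: sA' => _ /andP[].
have psipi' := ltW psipi.
have m12 : phi' < nu' < psi by rewrite m1 m2.
have v1 := elementary_Psi psipi' (strip_decayS psib' sdG) e1 sA' m12.
have v2 := elementary_Psi psipi' (strip_decayS psib' sde) e2 sA' m12.
have ind F c z : strip_decay F b' c -> Psi A nu' F z = Psi A nu F z.
 move=> sdF; case: (leP phi phi') => pp.
 by apply: (Psi_indep sA (b := b') (a := c)) => //; apply/andP; split; lra.
 by apply: (Psi_indep sA' (b := b') (a := c)) => //; apply/andP; split; lra.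
rewrite -(ind _ _ _ sde) -[RHS](@Psi_ext _ _ _ _ G).
 by rewrite -(ind _ _ _ sdG) -v2 v1.
move=> w hw; rewrite /G /= logE // hw gtr0_norm //; lra.
Qed.

Let E s w := ereg w * iexp s w.
Let wE s w := (ereg w * w) * iexp s w.

Let b0 : 0 <= b < pi. Proof. by have /andP[h1 h2] := hnu; have q0 := p0; rewrite /b; apply/andP; split; lra. Qed.

Let sdereg : exists2 a, 0 <= a & strip_decay (@ereg R) b a.
Proof. by have [a a0 h] := ereg_sd b0; exists a => //; exact: strip_decay2W. Qed.

Let sdE s : exists2 a, 0 <= a & strip_decay (E s) b a.
Proof.
have [a a0 h] := sdereg; exists (a * expR (`|s| * pi)); first by rewrite mulr_ge0.
by apply: strip_decayM => //; exact: iexp_bounded.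
Qed.

Let sdwE s : exists2 a, 0 <= a & strip_decay (wE s) b a.
Proof.
have [a a0 h] := ereg_sd b0; exists (a * (1 + pi) * expR (`|s| * pi)).
 by rewrite !mulr_ge0 // addr_ge0 // pi_ge0.
apply: strip_decayM; [|exact: strip_decay_mulw|exact: iexp_bounded].
by rewrite mulr_ge0 // addr_ge0 // pi_ge0.
Qed.

(** Both sides agree after an application of [e(A)], by multiplicativity and [log_Psi], and [e(A)]
    is injective. *)
Lemma Psi_E_log s x y : log_operator A (x, y) -> Psi A nu (E s) y = Psi A nu (wE s) x.
Proof.
move=> lxy; have [a a0 h] := sdereg; have [a1 _ h1] := sdE s; have [a2 _ h2] := sdwE s.
have [a' a'0 h'] := ereg_sd b0; have hw := strip_decay_mulw a'0 bpi h'.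
apply/eqP; rewrite -subr_eq0; apply/eqP/(Psi_ereg_inj sA iA hnu).
have pb := strip_pair h nub.
rewrite -scaleN1r addrC (Psi_lin sA _ _ _ on pb) scaleN1r addrC; apply/eqP; rewrite subr_eq0; apply/eqP.
rewrite (Psi_mul sA _ h h1 nb bpi) (Psi_mul sA _ h h2 nb bpi).
rewrite (@Psi_ext _ _ _ _ _ (fun w => E s w * ereg w)); last by move=> w _; rewrite mulrC.
rewrite -(Psi_mul sA _ h1 h nb bpi) (log_Psi lxy) (Psi_mul sA _ h1 hw nb bpi).
by apply: Psi_ext => w _; rewrite /E /wE; ring.
Qed.

(* The remainder of the first-order expansion in [h] of [h |-> E (s + h)]. *)
Let D s h w := E (s + h) w - E s w - 'i * h%:C * wE s w.

Let sdD s : exists2 c, 0 <= c & forall h, `|h| <= 1 -> strip_decay (D s h) b (c * h ^+ 2).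
Proof.
have [a a0 sd] := ereg_sd b0; have sd2 := strip_decay_mulw2 a0 bpi sd.
have ip := @iexp_bounded s b bpi.
pose K := expR (`|s| * pi) * (2 * expR pi).
exists (a * (1 + pi ^+ 2) * K); first by rewrite !mulr_ge0 // addr_ge0 ?sqr_ge0.
move=> h h1 t e eb; split.
 have [aE _ hE] := sdE s; have [aE' _ hE'] := sdE (s + h); have [aW _ hW] := sdwE s.
 apply: cdiffB; last by apply: cdiffM; [exact: cdiff_cst|exact: (hW t e eb).1].
 by apply: cdiffB; [exact: (hE' t e eb).1|exact: (hE t e eb).1].
set w := t +i* e.
pose z := 'i * h%:C * w.
have -> : D s h w = ereg w * iexp s w * (cexp z - 1 - z).
 transitivity (ereg w * iexp s w * (cexp z - 1 - 'i * h%:C * w)); last by [].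
 rewrite /D /E /wE iexpD; have -> : iexp h w = cexp z by [].
 by move: (cexp z) (iexp s w) (ereg w) => p q r; ring.
have Rz : `|Re z| <= pi.
 rewrite Re_iexp normrN normrM /=; apply: (le_trans (ler_pM _ _ h1 (ltW eb))) => //.
 by rewrite mul1r.
have T : rnorm (cexp z - 1 - z) <= 2 * expR pi * (h ^+ 2 * rnorm w ^+ 2).
 apply: (le_trans (cexp_taylor z)).
 have -> : rnorm z ^+ 2 = h ^+ 2 * rnorm w ^+ 2.
 rewrite /z (rnormM ('i * h%:C)) (rnormM 'i) rnormi mul1r rnorm_real exprMn.
 by rewrite real_normK ?num_real.
 by apply: ler_wpM2r; [rewrite mulr_ge0 ?sqr_ge0|apply: ler_wpM2l; rewrite ?ler_expR].
have [_ k1] := sd2 t e eb; have [_ k2] := ip t e eb; rewrite -/w in k1 k2.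
rewrite (rnormM (ereg w * iexp s w)) (rnormM (ereg w)).
rewrite (rnormM (ereg w)) (rnormM w) -expr2 in k1.
have -> : a * (1 + pi ^+ 2) * K * h ^+ 2 * rho t =
 (a * (1 + pi ^+ 2) * rho t) * (expR (`|s| * pi)) * (2 * expR pi * h ^+ 2) by rewrite /K; ring.
apply: le_trans (_ : (rnorm (ereg w) * rnorm w ^+ 2) * rnorm (iexp s w) * (2 * expR pi * h ^+ 2) <= _).
 have -> : rnorm (ereg w) * rnorm w ^+ 2 * rnorm (iexp s w) * (2 * expR pi * h ^+ 2) =
 rnorm (ereg w) * rnorm (iexp s w) * (2 * expR pi * (h ^+ 2 * rnorm w ^+ 2)) by ring.
 by rewrite ler_wpM2l // mulr_ge0 ?rnorm_ge0.
have c3 : 0 <= 2 * expR pi * h ^+ 2 by apply: mulr_ge0; [rewrite mulr_ge0|exact: sqr_ge0].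
apply: ler_wpM2r => //; apply: ler_pM => //; last exact: rnorm_ge0.
by apply: mulr_ge0; [exact: rnorm_ge0|exact: sqr_ge0].
Qed.

Lemma log_orbit s x y : log_operator A (x, y) -> log_operator A (U s x, U s y) /\
 generator U (U s x, - 'i *: U s y).
Proof.
move=> lxy; have g : generator U (x, - 'i *: y) by rewrite hgen; exists (x, y).
have eZ : U s (- 'i *: y) = - 'i *: U s y by exact: linearZ.
have g' : generator U (U s x, - 'i *: U s y) by rewrite -eZ; exact: generator_orbit.
split=> //.
have : scale_operator (- 'i) (log_operator A) (U s x, - 'i *: U s y) by rewrite -hgen.
move=> [[u v] /= luv [eu ev]].
by rewrite -(scalerI (_ : - 'i != 0) ev) -?eu // oppr_eq0 eq_complex /= eqxx oner_eq0.
Qed.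

(** The derivative in [s] has two contributions: [i (e w z^{is})(A)] applied to the orbit, and
    [(e z^{is})(A)] applied to [- i log A] of the orbit. They cancel by [Psi_E_log]. The vector is
    kept in the domain of the logarithm so that the orbit is differentiable. *)
Lemma Psi_E_orbit_const s x y : log_operator A (x, y) ->
 Psi A nu (E s) (U s x) = Psi A nu (@ereg R) x.
Proof.
move=> lxy.
have U0 z : U 0 z = z by case: hU.
have -> : Psi A nu (@ereg R) x = Psi A nu (E 0) (U 0 x).
 by rewrite U0; apply: Psi_ext => w _; rewrite /E iexp0 mulr1.
apply: (zero_derivative_constant (W := fun s => Psi A nu (E s) (U s x))) => {}s e e0.
have [l1 g1] := log_orbit s lxy; have g0 : generator U (x, - 'i *: y) by rewrite hgen; exists (x, y).
set x1 := U s x in l1 g1; set y1 := U s y in l1 g1.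
have [K K0 hK] := Psi_norm sA on.
have [aE aE0 hE] := sdE s; have [aW aW0 hW] := sdwE s; have [c c0 hD] := sdD s.
have e3 : 0 < e / 3 by rewrite divr_gt0.
have pos a : 0 <= a -> 0 < K * a + 1 by move=> a0; rewrite ltr_wpDl ?mulr_ge0.
pose B := K * (c * (rnorm x1 + 1)).
have B0 : 0 < B + 1 by rewrite pos // mulr_ge0 // addr_ge0 ?rnorm_ge0.
have m0 : 0 < Num.min 1 (e / 3 / (K * aW + 1)) by rewrite lt_min ltr01 divr_gt0 // pos.
have [d1 d10 h1] := group_tcont hU x s m0.
have [d2 d20 h2] := orbit_derivative hU s g0 (divr_gt0 e3 (pos _ aE0)).
exists (Num.min (Num.min 1 d1) (Num.min d2 (e / 3 / (B + 1)))).
 by rewrite !lt_min ltr01 d10 d20 divr_gt0.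
move=> h; rewrite !lt_min => /andP[/andP[hh1 hhd1] /andP[hhd2 hB]].
set u := U (s + h) x.
have ux : rnorm (u - x1) < Num.min 1 (e / 3 / (K * aW + 1)).
 by apply: h1; rewrite addrC addKr.
move: ux; rewrite lt_min => /andP[ux1 ux2].
have := h2 h hhd2; rewrite -/u -/x1.
have eZ : U s (- 'i *: y) = - 'i *: y1 by exact: linearZ.
rewrite eZ => {}h2.
have sdDh := hD h (ltW hh1).
have [aE' _ hE'] := sdE (s + h).
pose M w := ('i * h%:C) * wE s w + E s w.
have sdM : strip_decay M b (rnorm ('i * h%:C : R[i]) * aW + aE).
 move=> t r rb; have [k1 k2] := hE t r rb; have [k3 k4] := hW t r rb; split.
 by apply: cdiffD => //; apply: cdiffM => //; exact: cdiff_cst.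
 apply: (le_trans (ler_rnormD _ _)); rewrite mulrDl lerD // rnormM -mulrA.
 by rewrite ler_wpM2l ?rnorm_ge0.
have P1 z : Psi A nu (M) z = ('i * h%:C) *: Psi A nu (wE s) z + Psi A nu (E s) z.
 by apply: (Psi_linl sA _ on (strip_pair hW nub) (strip_pair hE nub) (strip_pair sdM nub)).
have P2 z : Psi A nu (E (s + h)) z = Psi A nu (D s h) z + Psi A nu M z.
 rewrite -[Psi A nu (D s h) z]scale1r.
 apply: (Psi_linl sA _ on (strip_pair sdDh nub) (strip_pair sdM nub) (strip_pair hE' nub)) => w _.
 by rewrite mul1r /D /M; ring.
have PB G a z z' : strip_decay G b a -> Psi A nu G (z - z') = Psi A nu G z - Psi A nu G z'.
 move=> sd; rewrite -scaleN1r addrC (Psi_lin sA _ _ _ on (strip_pair sd nub)) scaleN1r addrC.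
 by [].
have PZ G a k z : strip_decay G b a -> Psi A nu G (k *: z) = k *: Psi A nu G z.
 by move=> sd; rewrite (PsiZ sA _ _ on (strip_pair sd nub)).
have -> : Psi A nu (E (s + h)) u - Psi A nu (E s) x1 =
 Psi A nu (D s h) u + ('i * h%:C) *: Psi A nu (wE s) (u - x1)
 + Psi A nu (E s) (u - x1 - h%:C *: (- 'i *: y1)).
 rewrite P2 P1 (PB _ _ _ _ hW) !(PB _ _ _ _ hE) !(PZ _ _ _ _ hE) (Psi_E_log s l1).
 move: (Psi _ _ _ u) (Psi _ _ _ u) (Psi _ _ _ u) (Psi _ _ _ x1) (Psi _ _ _ x1) (h%:C) => p1 p2 p3 p4 p5 k.
 by vring.
have n1 := hK _ _ u (strip_pair sdDh nub).
have n2 := hK _ _ (u - x1) (strip_pair hW nub).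
have n3 := hK _ _ (u - x1 - h%:C *: (- 'i *: y1)) (strip_pair hE nub).
apply: (le_trans (ler_rnormD _ _)); apply: (le_trans (lerD (ler_rnormD _ _) n3)).
have -> : rnorm (('i * h%:C) *: Psi A nu (wE s) (u - x1)) = `|h| * rnorm (Psi A nu (wE s) (u - x1)).
 by rewrite rnormZ rnormM rnormi mul1r rnorm_real.
have q1 : rnorm (Psi A nu (D s h) u) <= e / 3 * `|h|.
 apply: (le_trans n1).
 have u1 : rnorm u <= rnorm x1 + 1.
 by apply: (le_trans (ler_rnorm_dist u x1)); rewrite lerD2l ltW.
 have -> : K * (c * h ^+ 2) * rnorm u = K * (c * rnorm u) * `|h| * `|h|.
 by rewrite -[h ^+ 2]real_normK ?num_real //; ring.
 rewrite ler_wpM2r //; apply: le_trans (_ : (B + 1) * `|h| <= _); last first.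
 by rewrite mulrC -ler_pdivlMr // ltW.
 rewrite ler_wpM2r // /B; apply: le_trans (_ : K * (c * (rnorm x1 + 1)) <= _); last by rewrite lerDl.
 by rewrite !ler_wpM2l.
have q2 : `|h| * rnorm (Psi A nu (wE s) (u - x1)) <= e / 3 * `|h|.
 rewrite mulrC ler_wpM2r //; apply: (le_trans n2).
 apply: le_trans (_ : (K * aW + 1) * rnorm (u - x1) <= _); first by rewrite ler_wpM2r ?rnorm_ge0 // lerDl.
 by rewrite mulrC -ler_pdivlMr ?pos // ltW.
have q3 : K * aE * rnorm (u - x1 - h%:C *: (- 'i *: y1)) <= e / 3 * `|h|.
 apply: le_trans (_ : (K * aE + 1) * rnorm (u - x1 - h%:C *: (- 'i *: y1)) <= _).
 by rewrite ler_wpM2r ?rnorm_ge0 // lerDl.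
 by rewrite mulrC -ler_pdivlMr ?pos // mulrAC.
by rewrite [in leRHS](thirds e) !mulrDl; apply: lerD; [exact: lerD|].
Qed.

(** The domain of the generator is dense and both sides are bounded in [x]. *)
Lemma Psi_E_orbit s x : Psi A nu (E s) (U s x) = Psi A nu (@ereg R) x.
Proof.
have [K K0 hK] := Psi_norm sA on.
have [aE aE0 hE] := sdE s; have [a a0 ha] := sdereg.
have [C C0 hC] := U_bounded hU s.
apply: eq_rnorm_small => e e0.
pose B := K * aE * C + K * a.
have B0 : 0 < B + 1 by rewrite ltr_wpDl // addr_ge0 ?mulr_ge0 // ltW.
have [u [v [g ux]]] := generator_dense hU x (divr_gt0 e0 B0).
have [y luy] : exists y, log_operator A (u, y).
 by move: g; rewrite hgen => -[[u' y] l [/= <- _]]; exists y.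
have h := Psi_E_orbit_const s luy.
have PB G a' z z' : strip_decay G b a' -> Psi A nu G (z - z') = Psi A nu G z - Psi A nu G z'.
 by move=> sd; rewrite -scaleN1r addrC (Psi_lin sA _ _ _ on (strip_pair sd nub)) scaleN1r addrC.
have UB : U s (x - u) = U s x - U s u by rewrite raddfB.
have -> : Psi A nu (E s) (U s x) - Psi A nu (@ereg R) x =
 Psi A nu (E s) (U s (x - u)) - Psi A nu (@ereg R) (x - u).
 by rewrite UB (PB _ _ _ _ hE) (PB _ _ _ _ ha) h opprB addrA subrK.
apply: (le_trans (ler_rnormB _ _)).
have n1 := hK _ _ (U s (x - u)) (strip_pair hE nub); have n2 := hK _ _ (x - u) (strip_pair ha nub).
apply: (le_trans (lerD n1 n2)); apply: le_trans (_ : (B + 1) * rnorm (x - u) <= _).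
 have := ler_wpM2l (mulr_ge0 K0 aE0) (hC (x - u)); have := rnorm_ge0 (x - u).
 by rewrite /B; move: (rnorm (x - u)) => r r0 k; move: k; rewrite mulrA; lra.
by rewrite mulrC -ler_pdivlMr // ltW // rnormB.
Qed.

(* [e(A) A^{-is} = (e z^{-is})(A)]. *)
Lemma Psi_orbit s x : Psi A nu (@ereg R) (U s x) = Psi A nu (E (- s)) x.
Proof.
have [aE aE0 hE] := sdE s; have [aN aN0 hN] := sdE (- s); have [a a0 ha] := sdereg.
have pb := strip_pair ha nub.
apply/eqP; rewrite -subr_eq0; apply/eqP/(Psi_ereg_inj sA iA hnu).
rewrite -scaleN1r addrC (Psi_lin sA _ _ _ on pb) scaleN1r addrC; apply/eqP; rewrite subr_eq0; apply/eqP.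
rewrite (Psi_mul sA _ ha ha nb bpi) (Psi_mul sA _ ha hN nb bpi).
rewrite [RHS](@Psi_ext _ _ _ _ _ (fun w => E (- s) w * ereg w)); last by move=> w _; rewrite mulrC.
rewrite -(Psi_mul sA _ hN ha nb bpi) -(Psi_E_orbit s) (Psi_mul sA _ hN hE nb bpi).
apply: Psi_ext => w _.
have e : iexp (- s) w * iexp s w = 1 by rewrite -iexpD addNr iexp0.
by rewrite /E [RHS]mulrACA e mulr1.
Qed.

End fixed_line.

End group_calculus.

Section half_lines.
Context (R : realType).
Local Notation RM := (measurableTypeR R).
Let mu := @lebesgue_measure R.

Lemma Rintegral_translate (f : R -> R) (e : R) : mu.-integrable [set: RM] (EFin \o f) ->
 mu.-integrable [set: RM] (EFin \o (fun t => f (t + e))) /\ \int[mu]_t f (t + e) = \int[mu]_t f t.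
Proof.
move=> fi0; have /integrableP[mf fi] := fi0.
have ma : measurable_fun [set: RM] (abse \o (EFin \o f)) := measurable_int _ (integrable_abse fi0).
have me : measurable_fun setT (fun t : RM => (t + e : RM)) by exact: measurable_funD.
have tr (g : RM -> \bar R) : measurable_fun setT g -> (forall t, 0 <= g t)%E ->
 (\int[mu]_t g (t + e)%R = \int[mu]_t g t)%E.
 move=> mg g0; have := lebesgue_affine e ltr01 mg g0; rewrite invr1 mul1e => <-.
 by apply: eq_integral => t _; rewrite mul1r.
have i1 : mu.-integrable [set: RM] (EFin \o (fun t => f (t + e))).
 apply/integrableP; split; first exact: (measurableT_comp mf me).
 by rewrite (tr (abse \o (EFin \o f)) ma) // => t; exact: abse_ge0.
split; first exact: i1.
rewrite /Rintegral [in RHS]integralE [in LHS]integralE.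
have mp : measurable_fun [set: RM] ((EFin \o f)^\+)%E by exact: measurable_funepos.
have mn : measurable_fun [set: RM] ((EFin \o f)^\-)%E by exact: measurable_funeneg.
have ep := tr _ mp (funepos_ge0 _); have en := tr _ mn (funeneg_ge0 _).
rewrite -ep -en; congr (fine (_ - _)%E); apply: eq_integral => t _.
 by rewrite !funeposE.
by rewrite !funenegE.
Qed.

Lemma wint_shift (V : normedModType R[i]) (e : R) (h : R -> V) y :
 is_wint [set: RM] h y -> is_wint [set: RM] (fun t => h (t + e)) y.
Proof.
by move=> hy l rl; have [i1 <-] := hy l rl; exact: (Rintegral_translate (f := l \o h) e i1).
Qed.

Lemma expRN_rho_le (d s : R) : 0 < d -> expR (- (d * `|s|)) <= 48 * (1 + d^-1 ^+ 2) * rho s.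
Proof.
move=> d0; have := expRN_rho (d * s); rewrite normrM (gtr0_norm d0) => h.
apply: (le_trans h); rewrite -mulrA ler_wpM2l //.
apply: (le_trans (rho_sqr_le _)).
rewrite /rho -[leLHS]mul1r ler_pdivrMr; last by rewrite ltr_pwDl ?sqr_ge0.
rewrite mulrAC ler_pdivlMr ?ltr_pwDl ?sqr_ge0 // mul1r exprMn.
have e : d^-1 ^+ 2 * (d ^+ 2 * s ^+ 2) = s ^+ 2.
 by rewrite mulrA -exprMn mulVf ?gt_eqF // expr1n mul1r.
have := sqr_ge0 d^-1; have := sqr_ge0 s; have := sqr_ge0 d; rewrite mulrDr mulr1 mulrDl mul1r e.
move: (d^-1 ^+ 2) (d ^+ 2) (s ^+ 2) => p q r q0 r0 p0.
by have := mulr_ge0 q0 r0; lra.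
Qed.

Lemma vFTC (V : normedModType R[i]) (g G : R -> V) (a b : R) : a <= b ->
 (forall s, tcont g s) ->
 (forall s (e : R), 0 < e -> exists2 d : R, 0 < d &
 forall h, `|h| < d -> rnorm (G (s + h) - G s - h%:C *: g s) <= e * `|h|) ->
 is_wint (`[a, b]%classic : set RM) g (G b - G a).
Proof.
move=> ab cg dG l rl; have [lD lZ ln_] := rl.
have cl : continuous (l \o g).
 by move=> t; refine (@tcont_real R V g l t (cg t) (fun u v => rfun_lip u v rl)).
have lB u v : l (u - v) = l u - l v.
 have eN : - v = (-1)%:C *: v by rewrite rmorphN scaleN1r.
 by rewrite eN lD lZ mulN1r.
have dl (s : R) : is_derive s (1 : R) (l \o G) (l (g s)).
 have cv : h^-1 *: ((l \o G \o shift s) (h *: (1 : R)) - (l \o G) s) @[h --> (0 : R)^'] --> l (g s).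
 apply/cvgrPdist_lt => e e0.
 have [d d0 hd] := dG s (e / 2) (divr_gt0 e0 (ltr0n _ 2)).
 rewrite near_withinE; apply/nbhs_ballP; exists d => // h; rewrite /ball /= sub0r normrN => hh h0.
 rewrite /shift /= /GRing.scale /= mulr1 [h + s]addrC distrC.
 have -> : h^-1 * (l (G (s + h)) - l (G s)) - l (g s) = h^-1 * l (G (s + h) - G s - h%:C *: g s).
 by rewrite !lB lZ; field.
 rewrite normrM normfV mulrC ltr_pdivrMr ?normr_gt0 //.
 apply: (le_lt_trans (ln_ _)); apply: (le_lt_trans (hd h hh)).
 by rewrite ltr_pM2r ?normr_gt0 // ltr_pdivrMr // ltr_pMr // ltr1n.
 apply: DeriveDef; first by apply/cvg_ex; exists (l (g s)).
 exact: (cvg_lim (@Rhausdorff R) cv).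
have cG : continuous (l \o G).
 by move=> s; apply: differentiable_continuous; apply/derivable1_diffP; case: (dl s).
split.
 by apply: continuous_compact_integrable; [exact: segment_compact|exact: continuous_subspaceT].
move: ab; rewrite le_eqVlt => /orP[/eqP ->|ab].
 by rewrite set_itv1 Rintegral_set1 lB subrr.
rewrite /Rintegral (@continuous_FTC2 R (l \o g) (l \o G) a b ab) ?lB //.
- exact: continuous_subspaceT.
- split.
 + by move=> s _; case: (dl s).
 + by apply: cvg_at_right_filter; exact: cG.
 + by apply: cvg_at_left_filter; exact: cG.
- by move=> s _; rewrite derive1E; case: (dl s).
Qed.

Lemma iexp_derivative (c : R[i]) (s e : R) : c != 0 -> 0 < e -> exists2 d : R, 0 < d &
 forall h, `|h| < d -> rnorm (iexp (s + h) c / ('i * c) - iexp s c / ('i * c) - h%:C * iexp s c) <= e * `|h|.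
Proof.
move=> c0 e0; have i0 : 'i * c != 0 by rewrite mulf_neq0 // eq_complex /= oner_eq0 andbF.
pose B := rnorm (iexp s c); have B0 : 0 < B by rewrite /B /iexp rnorm_cexp expR_gt0.
have [d d0 hd] := @cexp_small R (e / B) (divr_gt0 e0 B0).
exists (d / rnorm c); first by rewrite divr_gt0 // rnorm_gt0.
move=> h hh; set z := 'i * h%:C * c.
have nz : rnorm z = `|h| * rnorm c by rewrite /z (rnormM ('i * _)) (rnormM 'i) rnormi mul1r rnorm_real.
have -> : iexp (s + h) c / ('i * c) - iexp s c / ('i * c) - h%:C * iexp s c =
 iexp s c * (iexp h c - 1 - z) / ('i * c).
 have -> : z = h%:C * ('i * c) by rewrite /z; ring.
 by rewrite iexpD; move: (iexp s c) (iexp h c) h%:C ('i * c) i0 => p q r k i0; field.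
rewrite rnormM rnormM rnormV (rnormM 'i) rnormi mul1r ler_pdivrMr ?rnorm_gt0 //.
have := hd z; rewrite nz -ltr_pdivlMr ?rnorm_gt0 // => /(_ hh) k.
apply: le_trans (ler_wpM2l (ltW B0) k) _.
by rewrite [leLHS]mulrA [B * _]mulrC divfK ?gt_eqF // mulrA.
Qed.

(** Integrating [exp (i s c)] over the positive half-line gives [i / c], and over the negative one
    with [c'] gives [- i / c']. Glued together, the two exponentials produce the Cauchy kernels of
    an upper and a lower line. *)
Definition two_sided (k k' c c' : R[i]) (s : R) : R[i] :=
 if 0 <= s then k * iexp s c else k' * iexp s c'.

Lemma tcont_iexp (c : R[i]) (s : R) : tcont (fun s => iexp s c) s.
Proof.
apply: (tcont_h (F := fun w => cexp ('i * w * c)) (eta := 0)).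
apply: (@ccont_comp _ _ (fun w => 'i * w * c) (@cexp R)); last exact/cdiff_ccont/cdiff_cexp.
apply: ccontM; last exact: ccont_cst.
by apply: ccontM; [exact: ccont_cst|exact: ccont_id].
Qed.

Lemma tcontZZ (V : normedModType R[i]) (k : R -> R[i]) (h : R -> V) t : tcont k t -> tcont h t ->
 tcont (fun s => k s *: h s) t.
Proof.
move=> ck ch; have lift (W : normedZmodType R[i]) (g : R -> W) : tcont g t -> ccont (fun w => g (Re w)) (t +i* 0).
 move=> c e /c[d d0 hd]; exists d => // w wt; apply: hd; apply: le_lt_trans wt.
 by have := normr_Re_le (w - (t +i* 0)); rewrite raddfB.
have := (tcont_h (F := fun w => k (Re w) *: h (Re w)) (ccontZ (lift _ _ ck) (lift _ _ ch))); exact.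
Qed.

Lemma two_sided_norm (k k' c c' : R[i]) (d s : R) : d <= Im c -> Im c' <= - d ->
 rnorm (two_sided k k' c c' s) <= (rnorm k + rnorm k') * expR (- (d * `|s|)).
Proof.
move=> dc dc'; rewrite /two_sided; case: (leP 0 s) => s0; rewrite rnormM; apply: ler_pM; rewrite ?rnorm_ge0 //.
- by rewrite lerDl rnorm_ge0.
- by rewrite /iexp rnorm_cexp Re_iexp ger0_norm // ler_expR lerN2 mulrC ler_wpM2l.
- by rewrite lerDr rnorm_ge0.
- by rewrite /iexp rnorm_cexp Re_iexp ltr0_norm // ler_expR mulrN opprK; nra.
Qed.

Lemma measurable_two_sided (l : R[i]^o -> R) (k k' c c' : R[i]) : rfun l ->
 measurable_fun [set: RM] (fun s => l (two_sided k k' c c' s)).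
Proof.
move=> rl.
have m (q x : R[i]) : measurable_fun [set: RM] (fun s => l (q * iexp s x)).
 apply: (tcont_measurable (phi := l) (g := fun s => q * iexp s x : R[i]^o)) => [s|u v].
 apply: (tcontZZ (V := R[i]^o) (k := fun=> q) (h := fun s => iexp s x)); last exact: tcont_iexp.
 by move=> e e0; exists 1 => // v _; rewrite subrr rnorm0.
 exact: rfun_lip.
have -> : (fun s => l (two_sided k k' c c' s)) = (fun s => if 0 <= s then l (k * iexp s c) else l (k' * iexp s c')).
 by apply/funext => s; rewrite /two_sided; case: ifP.
apply: measurable_fun_if => //=.
- by apply: measurable_fun_ler => //; exact: measurable_cst.
- by apply: measurable_funS (m k c).
- by apply: measurable_funS (m k' c').
Qed.

Lemma two_sided_wint (k k' c c' : R[i]) : 0 < Im c -> Im c' < 0 ->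
 is_wint (V := R[i]^o) [set: RM] (two_sided k k' c c') (k * ('i / c) - k' * ('i / c')).
Proof.
move=> cp cn l rl.
pose d := Num.min (Im c) (- Im c').
have d0 : 0 < d by rewrite lt_min cp oppr_gt0.
have dc : d <= Im c by rewrite ge_min lexx.
have dc' : Im c' <= - d by rewrite lerNr ge_min lexx orbT.
have il : mu.-integrable [set: RM] (EFin \o (fun s => l (two_sided k k' c c' s))).
 apply: (@le_rintegrable _ _ _ (fun s => (rnorm k + rnorm k') * (48 * (1 + d^-1 ^+ 2)) * rho s)) => //.
 - exact: measurable_two_sided.
 - move=> s _; have [_ _ ln_] := rl; apply: (le_trans (ln_ _)).
 apply: (le_trans (two_sided_norm k k' s dc dc')); rewrite -[leRHS]mulrA.
 by rewrite ler_wpM2l ?addr_ge0 ?rnorm_ge0 //; exact: expRN_rho_le.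
 - exact: integrable_rhoZ.
split=> //.
have c0 : c != 0 by apply: contraTneq cp => ->; rewrite ltxx.
have c0' : c' != 0 by apply: contraTneq cn => ->; rewrite ltxx.
have i0 x : x != 0 -> 'i * x != 0 :> R[i] by move=> x0; rewrite mulf_neq0 // eq_complex /= oner_eq0 andbF.
have w (q x : R[i]) (a b : R) : x != 0 -> a <= b ->
 is_wint (V := R[i]^o) (`[a, b]%classic : set RM) (fun s => q * iexp s x) (q * (iexp b x / ('i * x) - iexp a x / ('i * x))).
 move=> x0 ab; apply: (wintZ (V := R[i]^o)) => //; apply: (@vFTC R[i]^o (fun s => iexp s x) (fun s => iexp s x / ('i * x))) => // [s|s e e0].
 exact: tcont_iexp.
 exact: iexp_derivative.
have lim1 := Rintegral_growing il.
pose v n := k * (iexp n%:R c / ('i * c) - iexp 0 c / ('i * c)) + k' * (iexp 0 c' / ('i * c') - iexp (- n%:R) c' / ('i * c')).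
have lv n : \int[mu]_(s in `[(- n%:R), n%:R]) l (two_sided k k' c c' s) = l (v n : R[i]^o).
 have [lD _ _] := rl; rewrite /v lD.
 have n0 : (0 : R) <= n%:R by [].
 have nn : - n%:R <= 0 :> R by rewrite oppr_le0.
 have [_ <-] := w k c 0 n%:R c0 n0 l rl; have [_ <-] := w k' c' (- n%:R) 0 c0' nn l rl.
 have ii (I : interval R) : mu.-integrable ([set` I] : set RM) (EFin \o (fun s => l (two_sided k k' c c' s))).
 by apply: (integrableS _ _ _ il) => //; exact: measurable_itv.
 have /= e1 := @Rintegral_itvB _ (fun s => l (two_sided k k' c c' s)) (BLeft (- n%:R)) (BRight n%:R) 0 (ii _).
 have {}e1 := e1 (_ : (BLeft (- n%:R) <= BRight 0)%O) (_ : (BRight 0 <= BRight n%:R)%O).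
 rewrite !bnd_simp in e1; have {}e1 := e1 nn n0.
 have e2 : \int[mu]_(s in `]0, n%:R]) l (two_sided k k' c c' s) = \int[mu]_(s in `[0, n%:R]) l (k * iexp s c).
 have [iw _] := w k c 0 n%:R c0 n0 l rl.
 rewrite -Rintegral_itv_obnd_cbnd; last first.
 by apply: integrableS iw => //; apply: subset_itvr; rewrite bnd_simp.
 apply: eq_Rintegral => s; rewrite inE /= in_itv /= => /andP[s0 _].
 by rewrite /two_sided ltW.
 have e3 : \int[mu]_(s in `[- n%:R, 0]) l (two_sided k k' c c' s) = \int[mu]_(s in `[- n%:R, 0]) l (k' * iexp s c').
 have [iw _] := w k' c' (- n%:R) 0 c0' nn l rl.
 rewrite -Rintegral_itv_bndo_bndc; last exact: ii.
 rewrite -[RHS]Rintegral_itv_bndo_bndc; last first.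
 by apply: integrableS iw => //; apply: subset_itvl; rewrite bnd_simp.
 apply: eq_Rintegral => s; rewrite inE /= in_itv /= => /andP[_ s0].
 by rewrite /two_sided leNgt s0.
 by rewrite -e3 -e2 -e1 subrK.
have v0 : l (v n : R[i]^o) @[n --> \oo] --> l (k * ('i / c) - k' * ('i / c') : R[i]^o).
 have [_ _ ln_] := rl.
 pose K := (rnorm k / rnorm c + rnorm k' / rnorm c') * (48 * (1 + d^-1 ^+ 2)).
 have K0 : 0 <= K.
 apply: mulr_ge0; first by apply: addr_ge0; apply: divr_ge0; exact: rnorm_ge0.
 by apply: mulr_ge0 => //; apply: addr_ge0 => //; exact: sqr_ge0.
 have vb n : rnorm (v n - (k * ('i / c) - k' * ('i / c'))) <= K * rho n%:R.
 have iV x : 'i / x = - ('i * x)^-1 :> R[i].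
 rewrite invfM; have -> : ('i : R[i])^-1 = - 'i; last by rewrite mulNr opprK.
 have in0 : 'i != 0 :> R[i] by rewrite eq_complex /= oner_eq0 andbF.
 by apply: (mulfI in0); rewrite mulfV //; cparts.
 have z0 x : iexp 0 x = 1 by exact: iexp0.
 have -> : v n - (k * ('i / c) - k' * ('i / c')) = k * (iexp n%:R c / ('i * c)) - k' * (iexp (- n%:R) c' / ('i * c')).
 by rewrite !iV /v !z0; ring.
 have nd x : rnorm ('i * x : R[i]) = rnorm x by rewrite rnormM rnormi mul1r.
 have n0 : 0 <= n%:R :> R by [].
 have r1 := expRN_rho_le n%:R d0.
 have b1 : rnorm (iexp n%:R c) <= 48 * (1 + d^-1 ^+ 2) * rho n%:R.
 apply: le_trans r1; rewrite /iexp rnorm_cexp Re_iexp ler_expR ger0_norm // lerN2.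
 by rewrite mulrC ler_wpM2l.
 have b2 : rnorm (iexp (- n%:R) c') <= 48 * (1 + d^-1 ^+ 2) * rho n%:R.
 apply: le_trans r1; rewrite /iexp rnorm_cexp Re_iexp ler_expR ger0_norm // mulNr opprK.
 by have := ler_wpM2l n0 dc'; lra.
 apply: (le_trans (ler_rnormB _ _)).
 rewrite (rnormM k) (rnormM k') (rnormM (iexp _ _)) (rnormM (iexp (- _) _)) !rnormV !nd.
 have -> : K * rho n%:R = rnorm k * ((48 * (1 + d^-1 ^+ 2) * rho n%:R) / rnorm c) +
 rnorm k' * ((48 * (1 + d^-1 ^+ 2) * rho n%:R) / rnorm c') by rewrite /K; ring.
 by rewrite lerD // ler_wpM2l ?rnorm_ge0 // ler_wpM2r ?invr_ge0 ?rnorm_ge0.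
 apply/cvgrPdist_le => e e0; exists (Num.truncn (K / e)).+1 => // n /= Kn.
 have Kn' : K / e < n%:R by apply: (lt_le_trans (truncnS_gt _)); rewrite ler_nat.
 rewrite distrC; apply: (le_trans (rfun_lip _ _ rl)); apply: (le_trans (vb n)).
 rewrite /rho ler_pdivrMr ?ltr_pwDl ?sqr_ge0 // mulrC -ler_pdivrMr // (le_trans (ltW Kn')) //.
 have n1 : 1 <= n%:R :> R by rewrite ler1n (leq_trans _ Kn).
 by rewrite expr2; nra.
have lim2 : \int[mu]_(s in `[(- n%:R), n%:R]) l (two_sided k k' c c' s) @[n --> \oo] --> l (k * ('i / c) - k' * ('i / c') : R[i]^o).
 by under eq_fun do rewrite lv; exact: v0.
exact: (cvg_unique (@Rhausdorff R) lim1 lim2).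
Qed.

End half_lines.

(** * Fourier inversion in a strip *)

Section inversion.
Context (R : realType).
Local Notation RM := (measurableTypeR R).
Let mu := @lebesgue_measure R.
Variables (H : R[i] -> R[i]) (b a : R).
Hypotheses (b0 : 0 < b) (a0 : 0 <= a) (sdH : strip_decay2 H b a).

(** The Fourier transform of [H] on the real line; the sign is such that [H w] is recovered from the
    functions [exp (- i s w)], which correspond to [A^{-is}]. *)
Definition kern (s : R) : R[i] := (2 * pi)^-1%:C * lint (fun w => H w * iexp s w) 0.

Lemma cdiff_iexp s (w : R[i]) : cdiff (iexp s) w.
Proof.
apply: (@cdiff_comp _ (fun w => 'i * s%:C * w) (@cexp R)); last exact: cdiff_cexp.
by apply: cdiffM; [exact: cdiff_cst|exact: cdiff_id].
Qed.

Lemma rnorm_iexp s (t e : R) : rnorm (iexp s (t +i* e)) = expR (- (s * e)).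
Proof. by rewrite /iexp rnorm_cexp Re_iexp. Qed.

Let line_iexp s (t e : R) : `|e| < b ->
 rnorm (H (t +i* e) * iexp s (t +i* e)) <= a * expR (- (s * e)) * rho t ^+ 2.
Proof.
move=> eb; have [_ h] := sdH t eb.
by rewrite rnormM rnorm_iexp mulrAC ler_wpM2r ?expR_ge0.
Qed.

(** Cauchy's theorem moves the line for free, and at height [e] the exponential has modulus
    [exp (- s e)]: the width of the strip turns into exponential decay of the kernel. *)
Lemma kern_shift s e : `|e| < b -> kern s = (2 * pi)^-1%:C * lint (fun w => H w * iexp s w) e.
Proof.
move=> eb; rewrite /kern; congr (_ * _).
have sh c d : c <= d -> `|c| < b -> `|d| < b ->
 lint (fun w => H w * iexp s w) c = lint (fun w => H w * iexp s w) d.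
 move=> cd cb db.
 have sb r : c <= r <= d -> `|r| < b.
 by move: cb db; rewrite !ltr_norml => /andP[? ?] /andP[? ?] /andP[? ?]; apply/andP; split; lra.
 apply: (@strip_cauchy _ _ c d (a * expR (`|s| * b))) => // t r /sb rb.
 by apply: cdiffM; [exact: (sdH t rb).1|exact: cdiff_iexp].
 apply: (le_trans (line_iexp s t rb)); apply: ler_pM; [by rewrite mulr_ge0 ?expR_ge0|exact: sqr_ge0| |exact: rho_sqr_le].
 rewrite ler_wpM2l // ler_expR (le_trans (ler_norm _)) // normrN normrM ler_wpM2l //.
 exact: ltW.
by case: (leP 0 e) => e0; [apply: sh|apply/esym/sh] => //; rewrite ?normr0 // ltW.
Qed.

Let two_pi0 : 0 < 2 * pi :> R. Proof. by rewrite mulr_gt0 // pi_gt0. Qed.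

Lemma lint_norm (f : R[i] -> R[i]) e c c' u : (forall t, ccont f (t +i* e)) ->
 (forall t, rnorm (f (t +i* e)) <= c' * rho t) ->
 (forall t, rnorm (f ((t + u) +i* e)) <= c * rho t) -> rnorm (lint f e) <= c * Irho R.
Proof. by move=> cf fb' fb; exact: wint_rho_norm (wint_shift u (line_wint cf fb')) fb. Qed.

(** The height has the sign of [s]. The translation [u] lets the bound follow the place where [H] is
    concentrated, so functions at all moduli [exp u] share one constant. *)
Lemma kern_bound_line u c e s : 0 <= e -> e < b ->
 (forall t s, `|s| <= e -> rnorm (H ((t + u) +i* s)) <= c * rho t) ->
 rnorm (kern s) <= (2 * pi)^-1 * c * Irho R * expR (- (e * `|s|)).
Proof.
move=> e0 eb hc.
have gen (d : R) : `|d| = e -> - (s * d) = - (e * `|s|) ->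
 rnorm (kern s) <= (2 * pi)^-1 * c * Irho R * expR (- (e * `|s|)).
 move=> de sd; have db : `|d| < b by rewrite de.
 rewrite (kern_shift s db) rnormM rnorm_real ger0_norm ?invr_ge0 ?(ltW two_pi0) // -!mulrA.
 rewrite ler_wpM2l ?invr_ge0 ?(ltW two_pi0) // [Irho R * _]mulrC mulrA.
 apply: (lint_norm (c' := a * expR (- (s * d))) (u := u)) => t.
 - by apply: ccontM; [exact/cdiff_ccont/(sdH t db).1|exact/cdiff_ccont/cdiff_iexp].
 - by apply: (le_trans (line_iexp s t db)); rewrite ler_wpM2l ?rho_sqr_le // mulr_ge0 ?expR_ge0.
 - by rewrite rnormM rnorm_iexp sd [leRHS]mulrAC ler_wpM2r ?expR_ge0 // hc // de.
case: (leP 0 s) => s0.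
 by apply: (gen e) => //; rewrite ger0_norm // mulrC.
apply: (gen (- e)) => //; first by rewrite normrN ger0_norm.
by rewrite ltr0_norm // !mulrN mulrC.
Qed.

Lemma kern_bound e s : 0 <= e -> e < b ->
 rnorm (kern s) <= (2 * pi)^-1 * a * Irho R * expR (- (e * `|s|)).
Proof.
move=> e0 eb; apply: (kern_bound_line (u := 0)) => // t r re; rewrite addr0.
have [|_ h] := sdH t (s := r); first exact: le_lt_trans eb.
by apply: (le_trans h); rewrite ler_wpM2l // rho_sqr_le.
Qed.

Lemma tcont_kern s : tcont kern s.
Proof.
pose C := (2 * pi)^-1 * a * Irho R.
have C0 : 0 <= C by rewrite !mulr_ge0 ?invr_ge0 ?Irho_ge0 // ltW.
have lip u : rnorm (kern u - kern s) <= C * `|u - s|.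
 have bb : `|0 : R| < b by rewrite normr0.
 have cc r t : ccont (fun w => H w * iexp r w) (t +i* 0).
 by apply: ccontM; [exact/cdiff_ccont/(sdH t bb).1|exact/cdiff_ccont/cdiff_iexp].
 have wb r t : rnorm (H (t +i* 0) * iexp r (t +i* 0)) <= a * rho t.
 apply: (le_trans (line_iexp r t bb)); rewrite mulr0 oppr0 expR0 mulr1.
 by rewrite ler_wpM2l // rho_sqr_le.
 have w1 := line_wint (cc u) (wb u); have w2 := line_wint (cc s) (wb s).
 have w3 := wintB measurableT w1 w2.
 rewrite /kern -mulrBr rnormM rnorm_real ger0_norm ?invr_ge0 ?(ltW two_pi0) // /C -!mulrA.
 rewrite ler_wpM2l ?invr_ge0 ?(ltW two_pi0) //.
 have -> : a * (Irho R * `|u - s|) = a * `|u - s| * Irho R by ring.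
 apply: (wint_rho_norm w3) => t.
 have us : u = s + (u - s) by rewrite addrC subrK.
 have -> : H (t +i* 0) * iexp u (t +i* 0) - H (t +i* 0) * iexp s (t +i* 0) =
 H (t +i* 0) * iexp s (t +i* 0) * (iexp (u - s) (t +i* 0) - 1).
 by rewrite {1}us iexpD; ring.
 rewrite rnormM.
 have k1 : rnorm (H (t +i* 0) * iexp s (t +i* 0)) <= a * rho t ^+ 2.
 by apply: (le_trans (line_iexp s t bb)); rewrite mulr0 oppr0 expR0 mulr1.
 have k2 : rnorm (iexp (u - s) (t +i* 0) - 1) <= `|u - s| * `|t|.
 have h := @cexp_lip R ('i * (u - s)%:C * (t +i* 0)).
 rewrite Re_iexp /= mulr0 oppr0 in h; apply: (le_trans (h (lexx _))).
 rewrite (rnormM ('i * _)) (rnormM 'i) rnormi mul1r rnorm_real ler_wpM2l //.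
 by apply: (le_trans (rnorm_le_ReIm _)); rewrite /= normr0 addr0.
 have k3 : rho t * `|t| <= 1.
 rewrite /rho mulrC ler_pdivrMr ?ltr_pwDl ?sqr_ge0 // mul1r -[t ^+ 2]real_normK ?num_real //.
 by have := sqr_ge0 (`|t| - 1); have := normr_ge0 t; rewrite !expr2; nra.
 apply: (le_trans (ler_pM (rnorm_ge0 _) (rnorm_ge0 _) k1 k2)).
 have -> : a * rho t ^+ 2 * (`|u - s| * `|t|) = a * `|u - s| * rho t * (rho t * `|t|) by ring.
 by rewrite ler_piMr // !mulr_ge0 ?rho_ge0.
move=> e e0; exists (e / (C + 1)); first by rewrite divr_gt0 // ltr_wpDl.
move=> u; rewrite ltr_pdivlMr ?ltr_wpDl // => h; apply: (le_lt_trans (lip u)).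
by apply: le_lt_trans h; rewrite mulrC ler_wpM2l // lerDl.
Qed.

(** The kernel is written on the upper line for [s >= 0] and on the lower line for [s < 0], where
    each exponential decays. Exchanging the integrals leaves two Cauchy kernels, whose difference is
    the residue of [H] at [w]. *)
Lemma kern_inversion (w : R[i]) : `|Im w| < b ->
 is_wint (V := R[i]^o) [set: RM] (fun s => kern s * iexp (- s) w) (H w).
Proof.
case: w => u v /= vb; set w := u +i* v.
pose e := (`|v| + b) / 2.
have eb : e < b by rewrite /e; lra.
have ve : `|v| < e by rewrite /e; lra.
have e0 : 0 < e by rewrite (le_lt_trans _ ve).
have eb' : `|e| < b by rewrite gtr0_norm.
have eNb' : `|- e| < b by rewrite normrN gtr0_norm.
pose d := e - `|v|; have d0 : 0 < d by rewrite subr_gt0.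
have [ve1 ve2] : - e < v /\ v < e by move: ve; rewrite ltr_norml => /andP[].
pose z (t : R) : R[i] := (t +i* e) - w; pose z' (t : R) : R[i] := (t -i* e) - w.
have Imz t : Im (z t) = e - v by rewrite /z raddfB.
have Imz' t : Im (z' t) = - e - v by rewrite /z' raddfB.
have dz t : d <= Im (z t) by rewrite Imz /d; have := ler_norm v; lra.
have dz' t : Im (z' t) <= - d by rewrite Imz' /d; have := ler_norm (- v); rewrite normrN; lra.
pose F t := two_sided (H (t +i* e)) (H (t -i* e)) (z t) (z' t) : R -> R[i]^o.
have F1 t : is_wint (V := R[i]^o) [set: RM] (F t) (H (t +i* e) * ('i / z t) - H (t -i* e) * ('i / z' t)).
 by apply: two_sided_wint; [exact: lt_le_trans (dz t)|rewrite (le_lt_trans (dz' t)) // oppr_lt0].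
have iw s (r : R) t : iexp s ((t +i* r) - w) = iexp s (t +i* r) * iexp (- s) w.
 by rewrite /iexp -cexpD rmorphN; congr cexp; ring.
have k1 s (r : R) : `|r| < b -> is_wint (V := R[i]^o) [set: RM]
 (fun t => H (t +i* r) * iexp s ((t +i* r) - w)) ((2 * pi)%:C * (kern s * iexp (- s) w)).
 move=> rb; rewrite (kern_shift s rb).
 have -> : (2 * pi)%:C * ((2 * pi)^-1%:C * lint (fun w => H w * iexp s w) r * iexp (- s) w) =
 iexp (- s) w * lint (fun w => H w * iexp s w) r.
 have pp : (2 * pi)%:C * (2 * pi)^-1%:C = 1 :> R[i].
 by rewrite -realcM mulfV // gt_eqF // mulr_gt0 ?pi_gt0.
 move: (lint _ r) (iexp _ w) => L I; rewrite !mulrA.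
 by rewrite -[in LHS]mulrA pp mul1r mulrC || by rewrite pp mul1r mulrC.
 have lw : is_wint (V := R[i]^o) [set: RM] (fun t => H (t +i* r) * iexp s (t +i* r)) (lint (fun w => H w * iexp s w) r).
 apply: (@line_wint _ (fun w => H w * iexp s w) r (a * expR (- (s * r)))) => t.
 by apply: ccontM; [exact/cdiff_ccont/(sdH t rb).1|exact/cdiff_ccont/cdiff_iexp].
 by apply: (le_trans (line_iexp s t rb)); rewrite ler_wpM2l ?mulr_ge0 ?expR_ge0 // rho_sqr_le.
 apply: wint_eq (wintZ (V := R[i]^o) (iexp (- s) w) measurableT lw) _ => // t _.
 by rewrite iw /GRing.scale /=; ring.
have F2 s : is_wint (V := R[i]^o) [set: RM] (F^~ s) ((2 * pi)%:C * (kern s * iexp (- s) w)).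
 rewrite /F /two_sided; case: (leP 0 s) => s0; first exact: k1.
 exact: k1.
have rat (r : R) : `|r| < b -> (forall t, d <= rnorm ((t +i* r) - w)) ->
 is_wint (V := R[i]^o) [set: RM] (fun t => H (t +i* r) * ((t +i* r) - w)^-1) (lint (fun x => H x * (x - w)^-1) r).
 move=> rb dr; apply: (@line_wint _ (fun x => H x * (x - w)^-1) r (a / d)) => t.
 apply/cdiff_ccont/cdiffM; first exact: (sdH t rb).1.
 apply: cdiffV; last by apply: cdiffB; [exact: cdiff_id|exact: cdiff_cst].
 by apply: contraTneq (dr t) => ->; rewrite rnorm0 -ltNge.
 rewrite rnormM rnormV mulrAC; apply: ler_pM; rewrite ?rnorm_ge0 ?invr_ge0 ?rnorm_ge0 //.
 by apply: (le_trans (sdH t rb).2); rewrite ler_wpM2l // rho_sqr_le.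
 by rewrite lef_pV2 ?posrE // (lt_le_trans d0).
have dzn t : d <= rnorm (z t) by apply: (le_trans (dz t)); apply: (le_trans (ler_norm _)); exact: normr_Im_le.
have dzn' t : d <= rnorm (z' t).
 apply: le_trans (normr_Im_le _); rewrite ler0_norm; first by rewrite lerNr; exact: dz'.
 by apply: (le_trans (dz' t)); rewrite oppr_le0 ltW.
have res : lint (fun x => H x * (x - w)^-1) (- e) - lint (fun x => H x * (x - w)^-1) e = 2 * pi%:C * 'i * H w.
 apply: (@strip_residue _ _ (- e) e (a / d + a) u v).
 - by rewrite ve1 ve2.
 - move=> t s /andP[s1 s2] ne; have sb : `|s| < b by rewrite ltr_norml; apply/andP; split; lra.
 apply: cdiffM; first exact: (sdH t sb).1.
 apply: cdiffV; last by apply: cdiffB; [exact: cdiff_id|exact: cdiff_cst].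
 by rewrite subr_eq0 /w eq_complex /= negb_and.
 - move=> t s /andP[s1 s2] far; have sb : `|s| < b by rewrite ltr_norml; apply/andP; split; lra.
 have hb : rnorm (H (t +i* s)) <= a * rho t.
 by apply: (le_trans (sdH t sb).2); rewrite ler_wpM2l // rho_sqr_le.
 have ar : 0 <= a * rho t by rewrite mulr_ge0 ?rho_ge0.
 rewrite rnormM rnormV mulrDl [a / d * _]mulrAC.
 case/orP: far => [/orP[]/eqP es|tu].
 + apply: le_trans (_ : a * rho t / d <= _); last by rewrite lerDl.
 apply: ler_pM; rewrite ?rnorm_ge0 ?invr_ge0 ?rnorm_ge0 //.
 by rewrite es lef_pV2 ?posrE // ?dzn' // (lt_le_trans d0 (dzn' t)).
 + apply: le_trans (_ : a * rho t / d <= _); last by rewrite lerDl.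
 apply: ler_pM; rewrite ?rnorm_ge0 ?invr_ge0 ?rnorm_ge0 //.
 by rewrite es lef_pV2 ?posrE // ?dzn // (lt_le_trans d0 (dzn t)).
 + apply: le_trans (_ : a * rho t <= _); last by rewrite lerDr divr_ge0 // ltW.
 have n1 : 1 <= rnorm ((t +i* s) - w).
 by apply: (le_trans tu); have := normr_Re_le ((t +i* s) - w); rewrite raddfB.
 rewrite -[leRHS]mulr1; apply: ler_pM; rewrite ?rnorm_ge0 ?invr_ge0 ?rnorm_ge0 //.
 by rewrite invf_le1 // (lt_le_trans ltr01).
 - have cH : ccont (H : R[i] -> R[i]^o) w by exact/cdiff_ccont/(sdH u vb).1.
 apply: (residue_of_ccont (V := R[i]^o) (f := fun x => H x * (x - w)^-1) cH) => x xw.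
 by rewrite /GRing.scale /= mulrCA mulfV ?mulr1 // subr_eq0.
have wI : is_wint (V := R[i]^o) [set: RM] (fun t => H (t +i* e) * ('i / z t) - H (t -i* e) * ('i / z' t))
 ((2 * pi)%:C * H w).
 have w1 := rat e eb' dzn; have w2 := rat (- e) eNb' dzn'.
 have w3 := wintZ (V := R[i]^o) 'i measurableT (wintB measurableT w1 w2).
 have ev : (2 * pi)%:C * H w = 'i * (lint (fun x => H x * (x - w)^-1) e - lint (fun x => H x * (x - w)^-1) (- e)).
 rewrite -[X in 'i * X]opprB res; have -> : (2 : R[i]) = 2%:C by rewrite rmorphMn.
 by rewrite realcM; move: (H w) => h; case: h => p q; cparts.
 rewrite ev; apply: wint_eq w3 _ => // t _.
 by rewrite /GRing.scale /= /z /z'; ring.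
have Fb t s : rnorm (F t s) <= (2 * a * rho t) * (48 * (1 + d^-1 ^+ 2) * rho s).
 apply: (le_trans (two_sided_norm _ _ s (dz t) (dz' t))); apply: ler_pM.
 - by rewrite addr_ge0 ?rnorm_ge0.
 - exact: expR_ge0.
 - rewrite -mulrA mulr2n mulrDl mul1r; apply: lerD.
 by apply: (le_trans (sdH t eb').2); rewrite ler_wpM2l // rho_sqr_le.
 by apply: (le_trans (sdH t eNb').2); rewrite ler_wpM2l // rho_sqr_le.
 - exact: expRN_rho_le.
have mF l : rfun l -> measurable_fun setT (fun p : RM * RM => l (F p.1 p.2)).
 move=> rl; refine (@caratheodory_measurable_fun R _ RM (fun t s => l (F t s)) _ _).
 by move=> t; exact: measurable_two_sided.
 move=> s t; refine (@tcont_real R R[i]^o (fun t => F t s) l t _ (fun u v => rfun_lip u v rl)).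
 have c1 (r : R) : `|r| < b -> tcont (fun t => H (t +i* r) * iexp s ((t +i* r) - w) : R[i]^o) t.
 move=> rb; apply: (tcont_h (F := fun x => H x * iexp s (x - w))).
 apply: ccontM; first exact/cdiff_ccont/(sdH t rb).1.
 apply: (@ccont_comp _ _ (fun x => x - w) (iexp s)); last exact/cdiff_ccont/cdiff_iexp.
 by apply: ccontD; [exact: ccont_id|exact: ccont_cst].
 by rewrite /F /two_sided; case: (0 <= s); exact: c1.
have := wint_fubini (integrable_rhoZ (2 * a)) (integrable_rhoZ _) mF Fb F1 F2 wI => wJ.
have := wintZ (V := R[i]^o) (2 * pi)^-1%:C measurableT wJ.
have pp : (2 * pi)^-1%:C * (2 * pi)%:C = 1 :> R[i] by rewrite -realcM mulVf // gt_eqF.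
have sc (x : R[i]) : (2 * pi)^-1%:C *: ((2 * pi)%:C * x : R[i]^o) = x by rewrite /GRing.scale /= mulrA pp mul1r.
rewrite sc => h; apply: wint_eq h _ => // s _; exact: sc.
Qed.

End inversion.

Section group_integrals.
Context (R : realType) (X : completeNormedModType R[i]).
Local Notation RM := (measurableTypeR R).
Let mu := @lebesgue_measure R.

Definition expc (d : R) : R := 48 * (1 + d^-1 ^+ 2).

Lemma expc_ge0 d : 0 <= expc d.
Proof. by rewrite /expc mulr_ge0 // addr_ge0 // sqr_ge0. Qed.

Lemma exp_gap (th e s C c : R) : th < e -> 0 <= C -> 0 <= c ->
 C * expR (- (e * `|s|)) * (c * expR (th * `|s|)) <= C * c * expc (e - th) * rho s.
Proof.
move=> the C0 c0; have := @expRN_rho_le R (e - th) s; rewrite subr_gt0 => /(_ the) h.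
have -> : C * expR (- (e * `|s|)) * (c * expR (th * `|s|)) = C * c * expR (- ((e - th) * `|s|)).
 by rewrite mulrACA -expRD; congr (_ * expR _); ring.
by rewrite -[leRHS]mulrA ler_wpM2l // mulr_ge0.
Qed.

Variables (U : R -> {linear X -> X}) (th M : R).
Hypotheses (hU : C0_group U) (M0 : 0 <= M)
 (Ub : forall s x, rnorm (U s x) <= M * expR (th * `|s|) * rnorm x).

Lemma group_integral_bound (k : R -> R[i]) C e x s : th < e -> 0 <= C ->
 rnorm (k s) <= C * expR (- (e * `|s|)) ->
 rnorm (k s *: U s x) <= C * (M * rnorm x) * expc (e - th) * rho s.
Proof.
move=> the C0 kb; rewrite rnormZ.
apply: le_trans (exp_gap s the C0 (mulr_ge0 M0 (rnorm_ge0 x))).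
by rewrite ler_pM ?rnorm_ge0 // mulrAC.
Qed.

Lemma group_integral_exists (k : R -> R[i]) C e x : (forall s, tcont k s) -> th < e -> 0 <= C ->
 (forall s, rnorm (k s) <= C * expR (- (e * `|s|))) ->
 exists y, is_wint [set: RM] (fun s => k s *: U s x) y.
Proof.
move=> ck the C0 kb.
exact: (wint_exists (fun t => tcontZZ (ck t) (group_tcont hU x t)) (integrable_rhoZ _)
 (fun t => group_integral_bound x the C0 (kb t))).
Qed.

Lemma group_integral_norm (k : R -> R[i]) C e x y : th < e -> 0 <= C ->
 (forall s, rnorm (k s) <= C * expR (- (e * `|s|))) ->
 is_wint [set: RM] (fun s => k s *: U s x) y ->
 rnorm y <= C * M * expc (e - th) * Irho R * rnorm x.
Proof.
move=> the C0 kb wy; have h := wint_rho_norm wy (fun t => group_integral_bound x the C0 (kb t)).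
by apply: (le_trans h); apply: eq_ler; ring.
Qed.

Variables (A : set (X * X)) (phi : R).
Hypotheses (sA : sectorial phi A) (iA : injective_operator A)
 (hgen : generator U = scale_operator (- 'i) (log_operator A)).

(** Applied to the group integral, [e(A)] turns each [A^{-is}] into a contour integral by
    [Psi_orbit]; after exchanging the two integrals, the inversion formula rebuilds [H] on the
    contour. *)
Lemma Psi_group_integral (H : R[i] -> R[i]) b a nu x y : 0 <= a -> strip_decay2 H b a ->
 phi < nu < pi -> nu < b -> is_wint [set: RM] (fun s => kern H s *: U s x) y ->
 Psi A nu (@ereg R) y = Psi A nu (fun w => ereg w * H w) x.
Proof.
move=> a0 sdH hnu nub wy; have /andP[n1 n2] := hnu.
have p0 : 0 < phi by case: sA => _ /andP[].
have nu0 : 0 < nu by exact: lt_trans n1.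
have b0 : 0 < b by exact: lt_trans nub.
have on := ltr_cos_pi p0 n1 (ltW n2).
have [|ae ae0 he] := @ereg_decay R nu; first by rewrite ltW.
have bd (r : R) : `|r| = nu -> `|r| < b by move=> ->.
have lG s (r : R) : `|r| = nu -> line_bound (fun w => ereg w * iexp (- s) w) r (ae * expR (nu * `|s|)).
 move=> rn t; have [|c1 c2] := he t r; first by rewrite rn.
 split; first by apply: ccontM; [exact: cdiff_ccont|exact/cdiff_ccont/cdiff_iexp].
 rewrite rnormM rnorm_iexp mulrAC ler_pM ?rnorm_ge0 ?expR_ge0 //.
 by apply: (le_trans c2); rewrite ler_wpM2l // rho_sqr_le.
 rewrite ler_expR mulNr opprK (le_trans (ler_norm _)) // normrM rn mulrC.
 by [].
have lE (r : R) : `|r| = nu -> line_bound (@ereg R) r ae.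
 move=> rn t; have [|c1 c2] := he t r; first by rewrite rn.
 split; first exact: cdiff_ccont.
 by apply: (le_trans c2); rewrite ler_wpM2l // rho_sqr_le.
have lEH (r : R) : `|r| = nu -> line_bound (fun w => ereg w * H w) r (ae * a).
 move=> rn t; have [|c1 c2] := he t r; first by rewrite rn.
 have [h1 h2] := sdH t r (bd r rn).
 split; first by apply: ccontM; exact: cdiff_ccont.
 rewrite rnormM -mulrA; apply: ler_pM; rewrite ?rnorm_ge0 //.
 apply: (le_trans c2); rewrite -[leRHS]mulr1 ler_wpM2l //.
 by rewrite exprn_ile1 ?rho_ge0 ?rho_le1.
 by apply: (le_trans h2); rewrite ler_wpM2l // rho_sqr_le.
have nN : `|- nu| = nu by rewrite normrN gtr0_norm.
have nP : `|nu| = nu by rewrite gtr0_norm.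
have pG s := conj (lG s _ nN) (lG s _ nP) : pair_bound (fun w => ereg w * iexp (- s) w) nu _.
have pE := conj (lE _ nN) (lE _ nP) : pair_bound (@ereg R) nu _.
have pEH := conj (lEH _ nN) (lEH _ nP) : pair_bound (fun w => ereg w * H w) nu _.
have [KP KP0 hKP] := Psi_norm sA on.
pose F s t := kern H s *: psi_term A (fun w => ereg w * iexp (- s) w) nu x t.
pose I s := kern H s *: ((2 * pi%:C * 'i) *: Psi A nu (fun w => ereg w * iexp (- s) w) x).
have FI s : is_wint [set: RM] (F s) (I s) by apply: wintZ => //; exact: (Psi_wint sA x on (pG s)).
have FJ t : is_wint [set: RM] (F^~ t) (psi_term A (fun w => ereg w * H w) nu x t).
 have one (r : R) : `|r| = nu -> is_wint [set: RM]
 (fun s => kern H s *: line_term A (fun w => ereg w * iexp (- s) w) r x t)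
 (line_term A (fun w => ereg w * H w) r x t).
 move=> rn; have kb : `|Im (t +i* r)| < b by exact: bd.
 have := wint_map measurableT (rlinear_scalel (ereg (t +i* r) *: Q A (t +i* r) x)) (kern_inversion b0 a0 sdH kb).
 have -> : line_term A (fun w => ereg w * H w) r x t = H (t +i* r) *: (ereg (t +i* r) *: Q A (t +i* r) x).
 by rewrite /line_term scalerA mulrC.
 move=> h; apply: wint_eq h _ => // s _.
 by rewrite /line_term /= !scalerA; congr (_ *: _); ring.
 apply: wint_eq (wintB _ (one _ nN) (one _ nP)) _ => // s _.
 by rewrite /F /psi_term scalerBr.
have wI : is_wint [set: RM] I ((2 * pi%:C * 'i) *: Psi A nu (@ereg R) y).
 have rl : rlinear_map (KP * ae) (Psi A nu (@ereg R)).
 split; last by move=> v; exact: hKP.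
 by move=> u v; rewrite -[u]scale1r (Psi_lin sA _ _ _ on pE) !scale1r.
 by move=> r v; exact: (PsiZ sA _ _ on pE).
 have := wintZ (2 * pi%:C * 'i) measurableT (wint_map measurableT rl wy) => h.
 apply: wint_eq h _ => // s _; rewrite /I /= (PsiZ sA _ _ on pE) (Psi_orbit sA iA hU hgen hnu).
 by move: (Psi _ _ _ _) (kern _ _) => v k; rewrite !scalerA [k * _]mulrC.
pose e := (nu + b) / 2.
have ne : nu < e by rewrite /e; move: nub; lra.
have eb : e < b by rewrite /e; move: nub; lra.
have e0 : 0 <= e by move: nu0 ne; lra.
pose CK := (2 * pi)^-1 * a * Irho R.
have CK0 : 0 <= CK by rewrite /CK mulr_ge0 ?Irho_ge0 // mulr_ge0 // invr_ge0 mulr_ge0 ?pi_ge0.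
have [M1 [M10 hM1]] := Qbound_ex sA (offN on); have [M2 [M20 hM2]] := Qbound_ex sA on.
have Fb s t : rnorm (F s t) <= (CK * ae * expc (e - nu) * rho s) * ((M1 + M2) * rnorm x * rho t).
 rewrite rnormZ; have kb := kern_bound b0 a0 sdH s e0 eb.
 have tb : rnorm (psi_term A (fun w => ereg w * iexp (- s) w) nu x t) <=
 (ae * expR (nu * `|s|)) * ((M1 + M2) * rnorm x * rho t).
 apply: (le_trans (ler_rnormB _ _)).
 apply: (le_trans (lerD (line_term_bound x t (lG s _ nN) (conj M10 hM1)) (line_term_bound x t (lG s _ nP) (conj M20 hM2)))).
 by apply: eq_ler; ring.
 apply: (le_trans (ler_pM (rnorm_ge0 _) (rnorm_ge0 _) kb tb)).
 rewrite mulrA ler_wpM2r //; last exact: exp_gap.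
 by rewrite !mulr_ge0 ?addr_ge0 ?rnorm_ge0 ?rho_ge0.
have mF l : rfun l -> measurable_fun setT (fun p : RM * RM => l (F p.1 p.2)).
 move=> rl; refine (@caratheodory_measurable_fun R _ RM (fun s t => l (F s t)) _ _).
 by move=> s; have [ii _] := FI s l rl; apply/measurable_EFinP; exact: measurable_int ii.
 move=> t s; refine (@tcont_real R X (F^~ t) l s _ (fun u v => rfun_lip u v rl)).
 apply: tcontZZ; first exact: (tcont_kern b0 a0 sdH).
 have one (r : R) : tcont (fun s => line_term A (fun w => ereg w * iexp (- s) w) r x t) s.
 have cN : tcont (fun u => iexp (- u) (t +i* r)) s.
 have -> : (fun u : R => iexp (- u) (t +i* r)) = (fun u : R => iexp u (- (t +i* r))).
 by apply/funext => u; rewrite /iexp; congr cexp; rewrite rmorphN; ring.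
 exact: tcont_iexp.
 have -> : (fun s => line_term A (fun w => ereg w * iexp (- s) w) r x t) =
 (fun s => iexp (- s) (t +i* r) *: (ereg (t +i* r) *: Q A (t +i* r) x)).
 by apply/funext => u; rewrite /line_term scalerA mulrC.
 apply: tcontZZ => //; move=> d d0; exists 1 => // u _; by rewrite subrr rnorm0.
 exact: tcontB (one _) (one _).
have := wint_fubini (integrable_rhoZ _) (integrable_rhoZ _) mF Fb FI FJ wI.
exact: (Psi_eq sA on pEH).
Qed.

Lemma group_integral_Psi (H : R[i] -> R[i]) b a nu x y : 0 <= a -> strip_decay2 H b a ->
 phi < nu < b -> b <= pi -> is_wint [set: RM] (fun s => kern H s *: U s x) y -> y = Psi A nu H x.
Proof.
move=> a0 sdH /andP[n1 n2] bpi wy; have hnu : phi < nu < pi by rewrite n1 (lt_le_trans n2).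
have e1 := Psi_group_integral a0 sdH hnu n2 wy.
(* Here [b] may equal [pi], and the regularizer decays only on strips strictly narrower than
   that. *)
pose b' := (nu + b) / 2.
have [b1 b2] : nu < b' /\ b' < b by rewrite /b'; move: n2; split; lra.
have p0 : 0 < phi by case: sA => _ /andP[].
have [|ae ae0 he] := @ereg_decay R b'; first by apply/andP; split; move: p0 n1 b1 b2 bpi; lra.
have sE : strip_decay (@ereg R) b' ae.
 by apply: (strip_decay2W ae0) => t s sb; apply: he; exact: ltW.
have sH : strip_decay H b' a by apply: strip_decayS (ltW b2) _; exact: strip_decay2W.
have nb : phi < nu < b' by rewrite n1.
have m := Psi_mul sA x sE sH nb (ltW (lt_le_trans b2 bpi)).
have on := ltr_cos_pi p0 n1 (ltW (lt_le_trans n2 bpi)).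
have nub : `|nu| < b' by rewrite gtr0_norm // (lt_trans p0).
apply/eqP; rewrite -subr_eq0; apply/eqP/(Psi_ereg_inj sA iA hnu).
rewrite -scaleN1r addrC (Psi_lin sA _ _ _ on (strip_pair sE nub)) scaleN1r addrC m e1 subrr.
by [].
Qed.

End group_integrals.

Section polar_form.
Context (R : realType).

Lemma polar (z : R[i]) : z != 0 -> exists u v : R,
 [/\ z = cexp (u +i* v), `|v| <= pi & `|arg z| = `|v|].
Proof.
move=> z0; have r0 := rnorm_gt0 z0; have cb := Re_div_rnorm z0.
have vpi : `|arg z| <= pi by rewrite abs_arg // acos_lepi.
exists (ln (rnorm z)), (arg z); split=> //; rewrite cexpE lnK ?posrE //.
set c := Re z / rnorm z in cb *.
have Ez : rnorm z * c = Re z by rewrite /c mulrCA mulfV ?mulr1 // gt_eqF.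
have Sz : rnorm z * sin (acos c) = `|Im z|.
 have e : rnorm z ^+ 2 * (1 - c ^+ 2) = Im z ^+ 2.
 have -> : rnorm z ^+ 2 * (1 - c ^+ 2) = rnorm z ^+ 2 - (rnorm z * c) ^+ 2 by ring.
 by rewrite Ez sqr_rnormc addrAC subrr add0r.
 rewrite sin_acos // -[rnorm z]ger0_norm ?rnorm_ge0 // -sqrtr_sqr -sqrtrM ?sqr_ge0 //.
 by rewrite -[in RHS]sqrtr_sqr -e.
have Cz : rnorm z * cos (acos c) = Re z by rewrite acosK ?in_itv.
rewrite /expi /arg -/c; case: (leP 0 (Im z)) => im.
 by apply/eqP; rewrite eq_complex /= !mul0r subr0 addr0 Cz Sz ger0_norm // !eqxx.
apply/eqP; rewrite cosN sinN eq_complex /= !mul0r subr0 addr0 mulrN Cz Sz ltr0_norm //.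
by rewrite opprK !eqxx.
Qed.

Lemma closure_sector0 (phi : R) : 0 < phi < pi -> closure (sector phi : set R[i]^o) 0.
Proof.
move=> /andP[p0 ppi] B /(@nbhs_normP R[i] R[i]^o)[e /= e0 hB].
have [r r0 er] : exists2 r : R, 0 < r & e = r%:C.
 case: e e0 {hB} => a b; rewrite ltcE /= => /andP[/eqP b0 a0]; exists a => //.
 by rewrite b0.
exists (r / 2)%:C; split; last first.
 by apply: hB; rewrite /= sub0r normrN rnormE er ltcR rnorm_real ger0_norm; lra.
have r2 : 0 < r / 2 by lra.
have n0 : (r / 2)%:C != 0 :> R[i] by rewrite eq_complex /= eqxx andbT gt_eqF.
apply/(sectorP _ n0); first by rewrite !ltW.
rewrite rnorm_real gtr0_norm //= gtr_pMr //.
by rewrite cos_lt1 // gtr0_norm // p0 /=; lra.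
Qed.

End polar_form.

Section contraction.
Context (R : realType) (X : completeNormedModType R[i]).

(** The distance of two points is at most twice the sum of their displacements under [T]; this one
    inequality gives the Cauchy property of the iterates and the uniqueness. *)
Lemma contraction_fixed (T : X -> X) : (forall u v, rnorm (T u - T v) <= rnorm (u - v) / 2) ->
 exists! y, T y = y.
Proof.
move=> hT; pose u n := iter n T 0.
have two v w : rnorm (v - w) <= 2 * rnorm (T v - v) + 2 * rnorm (T w - w).
 have -> : v - w = - (T v - v) + ((T v - T w) + (T w - w)) by vring.
 have h1 := ler_rnormD (- (T v - v)) ((T v - T w) + (T w - w)); rewrite rnormN in h1.
 have h2 := ler_rnormD (T v - T w) (T w - w); have h3 := hT v w.
 have h4 : rnorm (v - w) = rnorm (- (T v - v) + ((T v - T w) + (T w - w))) by congr rnorm; vring.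
 by rewrite -h4 in h1 *; move: h1 h2 h3; lra.
pose c := rnorm (T 0 - 0).
have db n : rnorm (T (u n) - u n) <= c * 2^-1 ^+ n.
 elim: n => [|n IH]; first by rewrite expr0 mulr1.
 by rewrite exprSr mulrA /=; apply: (le_trans (hT _ _)); rewrite ler_pM2r.
have cau m n : rnorm (u n - u m) <= 2 * c * 2^-1 ^+ n + 2 * c * 2^-1 ^+ m.
 by apply: (le_trans (two _ _)); have := db n; have := db m; lra.
have b0 : 2 * c * 2^-1 ^+ n @[n --> \oo] --> (0 : R).
 have -> : (0 : R) = 2 * c * 0 by rewrite mulr0.
 apply: cvgM; first exact: cvg_cst.
 by apply: cvg_expr; rewrite ger0_norm ?invr_ge0 // invf_lt1 // ltr1n.
have [y hy] := rnorm_cauchy_cvg cau b0.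
have Ty : T y = y.
 apply: eq_rnorm_small => e e0.
 have e2 : 0 < e / 2 by rewrite divr_gt0.
 have /cvg_rnorm_seqP/(_ _ e2)[N _ hN] := hy.
 have h1 := hN N (leqnn N); have h2 := hN N.+1 (leqnSn N); rewrite /= in h1 h2.
 have h3 := ler_rnormD (T y - T (u N)) (u N.+1 - y); have h4 := hT y (u N).
 have E : T y - T (u N) + (u N.+1 - y) = T y - y by rewrite /u /= addrA subrK.
 rewrite E in h3; rewrite (rnormB y) in h4.
 by move: h1 h2 h3 h4 (rnorm_ge0 (u N - y)); lra.
exists y; split=> // y' e'; apply/eqP; rewrite -subr_eq0; apply/eqP/rnorm_eq0/eqP.
rewrite eq_le rnorm_ge0 andbT; have := two y y'.
by rewrite e' Ty !subrr rnorm0 !mulr0 addr0.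
Qed.

(** Solving at [w] means finding a fixed point of [y |-> (z - A)^-1 (x + (z - w) y)], a contraction
    with factor one half under the distance assumption. *)
Lemma resolvent_neumann (A : set (X * X)) (z w : R[i]) (K : R) : is_operator A -> resolvent_set A z ->
 0 < K -> (forall x, rnorm (z *: resolvent_fun A z x) <= K * rnorm x) ->
 rnorm (z - w) * (2 * K) <= rnorm z -> z != 0 ->
 resolvent_set A w /\ forall x, rnorm z * rnorm (resolvent_fun A w x) <= 2 * K * rnorm x.
Proof.
move=> opA rz K0 bz zw z0; have nz := rnorm_gt0 z0.
have lip c u : rnorm (resolvent_fun A z (c *: u)) <= rnorm c * K / rnorm z * rnorm u.
 rewrite (resolvent_funZ opA rz) rnormZ -!mulrA ler_wpM2l ?rnorm_ge0 //.
 rewrite mulrCA ler_pdivlMl // mulrC; have := bz u; rewrite rnormZ mulrC.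
 by [].
have half u : rnorm (resolvent_fun A z ((z - w) *: u)) <= rnorm u / 2.
 apply: (le_trans (lip _ _)); rewrite mulrC ler_wpM2l ?rnorm_ge0 // ler_pdivrMr //.
 by move: zw; lra.
have rB u v : resolvent_fun A z u - resolvent_fun A z v = resolvent_fun A z (u - v).
 by rewrite -scaleN1r -(resolvent_funZ opA rz) -(resolvent_funD opA rz) scaleN1r.
have solve x y : resolvent A w (x, y) <-> resolvent_fun A z (x + (z - w) *: y) = y.
 have E : z *: y - (x + (z - w) *: y) = w *: y - x by vring.
 split=> [h|h]; first by apply: (resolvent_fun_eq rz); rewrite E.
 by have := resolvent_funP rz (x + (z - w) *: y); rewrite h E.
have bnd x y : resolvent A w (x, y) -> rnorm z * rnorm y <= 2 * K * rnorm x.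
 move=> /solve e; have := ler_rnormD (resolvent_fun A z x) (resolvent_fun A z ((z - w) *: y)).
 rewrite -(resolvent_funD opA rz) e => h1; have h2 := half y.
 have := bz x; rewrite rnormZ => h3.
 have h4 : rnorm y <= 2 * rnorm (resolvent_fun A z x) by move: h1 h2; lra.
 have : rnorm z * rnorm y <= rnorm z * (2 * rnorm (resolvent_fun A z x)) by rewrite ler_pM2l.
 by move: h3; lra.
have rw : resolvent_set A w.
 split.
 move=> x; have [|y [hy u]] := @contraction_fixed (fun y => resolvent_fun A z (x + (z - w) *: y)).
 move=> u v; rewrite rB; have -> : x + (z - w) *: u - (x + (z - w) *: v) = (z - w) *: (u - v) by vring.
 exact: half.
 by exists y; split; [exact/solve|move=> y' /solve; exact: u].
 apply: le_lt_trans (opnorm_le (M := 2 * K / rnorm z) _ _) (ltry _).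
 by move=> u v /bnd h; rewrite [leRHS]mulrAC ler_pdivlMr // mulrC.
 by rewrite mulr_ge0 ?invr_ge0 ?rnorm_ge0 // mulr_ge0 // ltW.
by split=> // x; apply: bnd; exact: resolvent_funP.
Qed.

End contraction.

(** * Lowering the angle of sectoriality to the group type *)

Section sector_angle.
Context (R : realType) (X : completeNormedModType R[i]) (A : set (X * X)).
Local Notation RM := (measurableTypeR R).

(** Invariance under dilations: with the normalising factor, the function with poles of modulus
    [exp u] is the translate by [u] of the one with poles of modulus 1. *)
Lemma gpole_shift (u : R) (p1 p2 w : R[i]) :
 (cexp (u%:C + p1) - cexp (u%:C + p2)) * gpole (u%:C + p1) (u%:C + p2) (u%:C + w) =
 (cexp p1 - cexp p2) * gpole p1 p2 w.
Proof.
rewrite /gpole !cexpD; have := cexp_neq0 (u%:C : R[i]).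
move: (cexp u%:C) (cexp p1) (cexp p2) (cexp w) => E a b z E0.
have -> : (E * a - E * b) * (E * z / ((E * z - E * a) * (E * z - E * b))) =
 (E / E) * (E / E) * ((a - b) * (z / ((z - a) * (z - b)))).
 by rewrite -!mulrBr !invfM; ring.
by rewrite mulfV // !mul1r.
Qed.

Lemma PsiZl phi nu G a c x : sectorial phi A -> cos nu < cos phi -> pair_bound G nu a ->
 pair_bound (fun w => c * G w) nu (rnorm c * a) -> Psi A nu (fun w => c * G w) x = c *: Psi A nu G x.
Proof.
move=> sA on gb gb'; have e w : `|Im w| = `|nu| -> c * G w = (c - 1) * G w + G w by move=> _; ring.
by rewrite (Psi_linl sA x on gb gb gb' e) -[X in _ + X]scale1r -scalerDl subrK.
Qed.

Variables (U : R -> {linear X -> X}) (th M : R).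
Hypotheses (iA : injective_operator A) (hU : C0_group U) (M0 : 0 <= M) (th0 : 0 <= th)
 (Ub : forall s x, rnorm (U s x) <= M * expR (th * `|s|) * rnorm x)
 (hgen : generator U = scale_operator (- 'i) (log_operator A)).

(* The poles may be close to the sector; only their distance to the type [th] of
 the group enters the bound, because the difference is an integral of the group. *)
Lemma Q_diff_bound b0 : th < b0 < pi -> exists2 K : R, 0 <= K & forall phi (u v1 v2 : R) x,
 sectorial phi A -> phi < v1 -> v1 < v2 -> v2 < 2 * pi - phi -> b0 <= v1 -> v2 <= 2 * pi - b0 ->
 rnorm (Q A (u +i* v2) x - Q A (u +i* v1) x) <= K * rnorm x.
Proof.
move=> /andP[tb bpi]; pose del := (b0 - th) / 3.
have d0 : 0 < del by rewrite /del divr_gt0 // subr_gt0.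
pose e1 := th + del; pose b1 := b0 - del.
have [te e1b1 b10 b11] : [/\ th < e1, e1 < b1, b1 < b0 & 0 <= e1].
 by rewrite /e1 /b1; have : 3 * del = b0 - th; [rewrite /del; field|move: d0 th0; split; lra].
have dpi : del <= pi by rewrite /del; move: th0 tb bpi; lra.
have [a a0 sda] := gpole_strip 0 0 d0 dpi.
pose C := (2 * pi)^-1 * (2 * a) * Irho R.
have C0 : 0 <= C by rewrite /C mulr_ge0 ?Irho_ge0 // mulr_ge0 ?invr_ge0 ?mulr_ge0 ?pi_ge0.
exists (C * M * expc (e1 - th) * Irho R).
 by rewrite mulr_ge0 ?Irho_ge0 // mulr_ge0 ?expc_ge0 // mulr_ge0.
move=> phi u v1 v2 x sA pv1 v12 v2p bv1 v2b.
have /andP[p0 ppi] : 0 < phi < pi by case: sA.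
(* Two strips are in play. The wide one, of half-width [b], reaches beyond [phi] so that the
   contours exist, but its constant degenerates as the poles approach it and enters only
   qualitatively. The narrow one, of half-width [b1], depends on the group alone and gives the
   bound. *)
pose m := Num.min v1 (2 * pi - v2); pose mx := Num.max phi b1.
have mx_m : mx < m.
 by rewrite /mx /m gt_max !lt_min; apply/andP; split; apply/andP; split; move: pv1 v2p b10 bv1 v2b; lra.
have [mv1 mv2] : m <= v1 /\ m <= 2 * pi - v2 by rewrite /m !ge_min !lexx orbT.
have [pmx bmx] : phi <= mx /\ b1 <= mx by rewrite /mx !le_max !lexx orbT.
pose b := (mx + m) / 2; pose nu := (phi + b) / 2.
have [mxb bm] : mx < b /\ b < m by rewrite /b; move: mx_m; split; lra.
have nub : phi < nu < b by rewrite /nu; apply/andP; split; move: mxb pmx; lra.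
have bpi' : b <= pi by move: bm mv1 mv2 v12; lra.
have mb0 : 0 < m - b by rewrite subr_gt0.
have mbpi : m - b <= pi by move: mv1 mv2 v12 mxb pmx p0; lra.
pose p1 : R[i] := u +i* v1; pose p2 : R[i] := u +i* v2.
have up (t s : R) : (t + u) +i* s = u%:C + (t +i* s) :> R[i].
 by apply/eqP; rewrite eq_complex /= add0r addrC !eqxx.
have up0 (s : R) : u +i* s = u%:C + (0 +i* s) :> R[i] by rewrite -up add0r.
pose D := cexp p1 - cexp p2; pose H w := D * gpole p1 p2 w.
have [a1 a10 sd1] := gpole_strip u u mb0 mbpi.
have {}sd1 : strip_decay2 (gpole p1 p2) b a1.
 by apply: sd1 => //=; apply/andP; split; move: mv1 mv2 v12; lra.
have sdH : strip_decay2 H b (rnorm D * a1).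
 move=> t s sb; have [h1 h2] := sd1 t s sb; split.
 by apply: cdiffM => //; exact: cdiff_cst.
 by rewrite (rnormM D) -mulrA ler_wpM2l ?rnorm_ge0.
have Da0 : 0 <= rnorm D * a1 by rewrite mulr_ge0 ?rnorm_ge0.
have {}sda : strip_decay2 (gpole (0 +i* v1) (0 +i* v2)) b1 a.
 by apply: sda => //=; rewrite /b1; apply/andP; split; move: bv1 v2b v12; lra.
have hb t s : `|s| <= e1 -> rnorm (H ((t + u) +i* s)) <= 2 * a * rho t.
 move=> se; have [|_ h] := sda t s; first exact: le_lt_trans e1b1.
 rewrite /H /D /p1 /p2 !up0 up gpole_shift (rnormM (_ - _)).
 have D2 : rnorm (cexp (0 +i* v1) - cexp (0 +i* v2) : R[i]) <= 2.
 by apply: (le_trans (ler_rnormB _ _)); rewrite !rnorm_cexp /= expR0; lra.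
 rewrite -mulrA ler_pM ?rnorm_ge0 // (le_trans h) // ler_wpM2l //.
 exact: rho_sqr_le.
have b0' : 0 < b by move: p0 pmx mxb; lra.
have e1b : e1 < b by move: e1b1 bmx mxb; lra.
have kb s : rnorm (kern H s) <= C * expR (- (e1 * `|s|)).
 exact: (kern_bound_line b0' Da0 sdH s b11 e1b hb).
have [y wy] := group_integral_exists hU M0 Ub x (tcont_kern b0' Da0 sdH) te C0 kb.
have ey : y = Psi A nu H x.
 exact: (group_integral_Psi hU sA iA hgen Da0 sdH nub bpi' wy).
have := group_integral_norm M0 Ub te C0 kb wy.
suff -> : y = Q A p2 x - Q A p1 x by [].
rewrite ey; have /andP[n1 n2] := nub.
have hnu : phi < nu < pi by rewrite n1 (lt_le_trans n2).
have on := ltr_cos_pi p0 n1 (ltW (lt_le_trans n2 bpi')).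
have nb : `|nu| < b by rewrite gtr0_norm // (lt_trans p0).
have g1 := strip_pair (strip_decay2W a10 sd1) nb.
have g2 := strip_pair (strip_decay2W Da0 sdH) nb.
rewrite /H (PsiZl x sA on g1 g2) (Psi_gpole sA) //=; last first.
- by move: n2 bm mv2; lra.
- by move: n2 bm mv1; lra.
rewrite scalerA mulfV ?scale1r // subr_eq0 cexp_neq ?(lt_eqF v12) ?orbT //.
by rewrite ltr_norml; apply/andP; split; move: v12 bv1 v2b p0 pv1 v2p; lra.
Qed.

(** The point is compared with the one of the same modulus on the negative axis, where the given
    sectoriality already bounds [Q]. The constant does not depend on the angle [phi] for which [A]
    is currently known to be sectorial. *)
Lemma Q_uniform_bound b0 phi1 : th < b0 < pi -> sectorial phi1 A -> exists2 K : R, 0 < K &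
 forall phi (u v : R) x, sectorial phi A -> phi < `|v| -> `|v| <= pi -> b0 <= `|v| ->
 rnorm (Q A (u +i* v) x) <= K * rnorm x.
Proof.
move=> hb sA1; have [K K0 hK] := Q_diff_bound hb.
have /andP[p0 ppi] : 0 < phi1 < pi by case: sA1.
have [|K1 K10 hK1] := @Q_bound _ _ _ _ sA1 ((phi1 + pi) / 2); first by apply/andP; split; lra.
have b0pi : b0 < pi by have /andP[] := hb.
have piK u x : rnorm (Q A (u +i* pi) x) <= K1 * rnorm x by apply: hK1; rewrite /= cospi cos_geN1.
have e2 (s : R) (u : R) x : Q A (u +i* (2 * pi - s)) x = Q A (u -i* s) x by rewrite /Q cexp_2pi.
exists (K + K1 + 1); first by move: K0 K10; lra.
move=> phi u v x sA pv vpi bv; have /andP[q0 qpi] : 0 < phi < pi by case: sA.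
have n0 := rnorm_ge0 x; have kp := piK u x.
case: (ltrgtP `|v| pi) vpi => // [vpi|vpi] _; last first.
 have -> : Q A (u +i* v) x = Q A (u +i* pi) x.
 move: vpi; case: (ler0P v) => _ vpi; last by rewrite vpi.
 have -> : v = - pi by rewrite -vpi opprK.
 by rewrite -e2; congr (Q A (_ +i* _) x); lra.
 by apply: (le_trans kp); rewrite ler_wpM2r //; move: K0; lra.
have fin w : rnorm (w - Q A (u +i* pi) x) <= K * rnorm x -> rnorm w <= (K + K1 + 1) * rnorm x.
 move=> h; have h1 := ler_rnormD (w - Q A (u +i* pi) x) (Q A (u +i* pi) x).
 by rewrite subrK in h1; rewrite 2!mulrDl mul1r; move: h1 h kp n0; lra.
case: (ler0P v) pv bv vpi => [v0|v0] pv bv vpi; apply: fin.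
 have -> : Q A (u +i* v) x = Q A (u +i* (2 * pi - - v)) x by rewrite e2 opprK.
 by apply: (hK phi) => //; move: pv bv vpi; lra.
by rewrite rnormB; apply: (hK phi) => //; move: pv bv vpi b0pi qpi; lra.
Qed.

(** Uniform resolvent bounds just above the angle extend below it by a Neumann series. Since the
    bound [K] does not depend on [phi], neither does the gain [del], so finitely many repetitions
    reach [b0]. *)
Lemma sectorial_shrink b0 phi1 : th < b0 < pi -> 0 < b0 -> sectorial phi1 A -> exists2 del : R, 0 < del &
 forall phi, sectorial phi A -> sectorial (Num.max b0 (phi - del)) A.
Proof.
move=> /andP[tb bpi] b00 sA1; pose c := (th + b0) / 2.
have [tc cb] : th < c /\ c < b0 by rewrite /c; move: tb; split; lra.
have [|K K0 hK] := Q_uniform_bound (b0 := c) _ sA1; first by rewrite tc (lt_trans cb).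
(* The compared points differ in argument by at most [2 del]: the first term makes [2 del] times
   [2 K] at most 1, as the Neumann series requires, and the second keeps the comparison point above
   [c]. *)
pose del := Num.min ((4 * K)^-1) ((b0 - c) / 2).
have d0 : 0 < del by rewrite lt_min invr_gt0 mulr_gt0 //= divr_gt0 // subr_gt0.
have dK : del * (4 * K) <= 1.
 by rewrite -ler_pdivlMr ?mulr_gt0 // mul1r /del ge_min lexx.
have dc : 2 * del <= b0 - c.
 have : del <= (b0 - c) / 2 by rewrite /del ge_min lexx orbT.
 by lra.
exists del => // phi sA; have opA : is_operator A by case: sA.
have /andP[p0 ppi] : 0 < phi < pi by case: sA.
set phi3 := Num.max b0 (phi - del).
have [l1 l2] : b0 <= phi3 /\ phi - del <= phi3 by rewrite /phi3 !le_max !lexx orbT.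
have p3 : phi3 < pi by rewrite gt_max bpi /=; move: d0 ppi; lra.
(* A point of argument [v] slightly below [phi] is compared with the point [v'] above [phi]. *)
have key u v : phi3 <= `|v| -> `|v| <= pi -> resolvent_set A (cexp (u +i* v)) /\
 forall x, rnorm (Q A (u +i* v) x) <= 2 * K * rnorm x.
 move=> pv vpi.
 have [v' [q1 q2 q3 q4]] : exists v', [/\ phi < `|v'|, `|v'| <= pi, c <= `|v'| & `|v - v'| <= 2 * del].
 case: (ltP phi `|v|) => pv'.
 by exists v; split=> //; [move: l1 pv cb; lra|rewrite subrr normr0; move: d0; lra].
 pose r := Num.min pi (phi + del).
 have [r1 r2 r3] : [/\ phi < r, r <= pi & r <= phi + del].
 by rewrite /r lt_min !ge_min !lexx orbT ppi; split=> //=; move: d0; lra.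
 have r0 : 0 < r by exact: lt_trans r1.
 exists (if 0 <= v then r else - r); case: (leP 0 v) => v0.
 rewrite (ger0_norm v0) in pv pv'.
 rewrite (gtr0_norm r0); split=> //; first by move: l1 pv cb pv'; lra.
 by rewrite ler_norml; apply/andP; split; move: l2 pv pv' r1 r3 d0; lra.
 rewrite (ltr0_norm v0) in pv pv'.
 rewrite normrN (gtr0_norm r0); split=> //; first by move: l1 pv cb pv'; lra.
 by rewrite ler_norml; apply/andP; split; move: l2 pv pv' r1 r3 d0; lra.
 have ow : off phi (u +i* v').
 have ca : cos v' = cos `|v'| by case: (ler0P v') => // _; rewrite cosN.
 rewrite /off /= ca ltr_cos // in_itv /=; apply/andP; split=> //.
 - exact: ltW.
 - exact: ltW.
 have bz := hK phi u v' ^~ sA.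
 have n1 : rnorm (cexp (u +i* v') : R[i]) = expR u by rewrite rnorm_cexp.
 have dist : rnorm (cexp (u +i* v') - cexp (u +i* v) : R[i]) <= expR u * (2 * del).
 have -> : cexp (u +i* v') - cexp (u +i* v) = cexp (u +i* v') * (1 - cexp (0 +i* (v - v'))) :> R[i].
 rewrite mulrBr mulr1 -cexpD; congr (_ - cexp _).
 by apply/eqP; rewrite eq_complex /= addr0 addrC subrK !eqxx.
 rewrite rnormM n1 ler_wpM2l ?expR_ge0 // rnormB.
 have := @cexp_lip R (0 +i* (v - v')) (lexx _) => h; apply: (le_trans h).
 by apply: (le_trans (rnorm_le_ReIm _)); rewrite /= normr0 add0r.
 have [| rw hw] := resolvent_neumann opA (off_resolvent sA ow) K0 (fun x => bz x q1 q2 q3) _ (cexp_neq0 _)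
 (w := cexp (u +i* v)).
 rewrite n1; apply: (le_trans (ler_wpM2r _ dist)); first by rewrite mulr_ge0 // ltW.
 by rewrite -mulrA ger_pMr ?expR_gt0 //; move: dK; lra.
 by split=> // x; have := hw x; rewrite n1 /Q rnormZ rnorm_cexp.
have p30 : 0 < phi3 by exact: lt_le_trans l1.
split=> //; first by rewrite p30.
 move=> z nz; apply: contrapT => nc; apply: nz.
 have z0 : z != 0 by apply: contra_notN nc => /eqP ->; apply: closure_sector0; rewrite p30.
 have [u [v [e vpi ve]]] := polar z0; rewrite e; apply: (key u v _ vpi).1.
 rewrite -ve leNgt; apply/negP => h; apply: nc; apply: subset_closure.
 by split.
move=> psi0 /andP[pp ppi0]; exists (2 * K) => z z0 ns.
have [u [v [e vpi ve]]] := polar z0.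
have [|rz bz] := key u v _ vpi.
 rewrite -ve leNgt; apply/negP => h; apply: ns; split=> //; exact: lt_trans pp.
apply: opnorm_le; last by rewrite mulr_ge0 // ltW.
move=> a b [[a' b'] /= hab [<- <-]]; rewrite e in hab *.
have := bz a'; rewrite /Q; suff -> : resolvent_fun A (cexp (u +i* v)) a' = b' by [].
exact: (resolvent_fun_eq rz).
Qed.

(* A theorem of Pruss and Sohr. *)
Lemma sectorial_of_type b0 phi1 : th < b0 < pi -> 0 < b0 -> sectorial phi1 A -> sectorial b0 A.
Proof.
move=> hb b00 sA1; have [del d0 hd] := sectorial_shrink hb b00 sA1.
have it n : (0 < n)%N -> sectorial (Num.max b0 (phi1 - n%:R * del)) A.
 elim: n => // -[|n] IH _; first by rewrite mul1r; exact: hd.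
 have := hd _ (IH isT); congr sectorial; rewrite /Num.max -[n.+2%:R]natr1 mulrDl mul1r.
 move: (n.+1%:R * del) => r; case: (ltP b0 (phi1 - r)) => h1.
 by rewrite opprD addrA.
 by case: (ltP b0 (b0 - del)) => h2; case: (ltP b0 (phi1 - (r + del))) => h3 //; move: h1 h2 h3 d0; lra.
have [n hn] : exists n : nat, phi1 - n.+1%:R * del <= b0.
 exists (Num.truncn `|phi1 / del|); rewrite lerBlDr.
 have /ltW := truncnS_gt `|phi1 / del| => h; have h' := le_trans (ler_norm _) h.
 by rewrite ler_pdivrMr // in h'; move: h' b00; lra.
by have := it n.+1 isT; rewrite max_l.
Qed.

End sector_angle.

(** * Gaussian sums and Fourier multipliers *)

Section normal_density.
Context (R : realType).
Local Notation RM := (measurableTypeR R).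
Let mu := @lebesgue_measure R.
Variable sg : R.
Let N := @normal_prob R 0 sg.
Let pdf := @normal_pdf R 0 sg.
Local Open Scope ereal_scope.

Let mpdf : measurable_fun [set: RM] (fun x => (pdf x)%:E).
Proof. by apply/measurable_EFinP; exact: measurable_normal_pdf. Qed.

Let pdf0 x : 0 <= (pdf x)%:E. Proof. by rewrite lee_fin normal_pdf_ge0. Qed.

Import HBNNSimple.

Let nnsfun_density (f : {nnsfun RM >-> R}) : \int[N]_x (f x)%:E = \int[mu]_x ((f x)%:E * (pdf x)%:E).
Proof.
under [LHS]eq_integral do rewrite fimfunE -fsumEFin//.
rewrite [LHS]ge0_integral_fsum//; last 2 first.
 - by move=> r; exact/measurable_EFinP/measurableT_comp.
 - by move=> n x _; rewrite EFinM nnfun_muleindic_ge0.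
under [RHS]eq_integral.
 move=> x xD; rewrite fimfunE -fsumEFin// muleC ge0_mule_fsumr; last first.
 by move=> r; rewrite EFinM nnfun_muleindic_ge0.
 over.
rewrite [RHS]ge0_integral_fsum//; last 2 first.
 - by move=> r; apply: emeasurable_funM => //; exact/measurable_EFinP/measurableT_comp.
 - by move=> n x _; rewrite mule_ge0// EFinM nnfun_muleindic_ge0.
apply: eq_fsbigr => r _; rewrite integralZl_indic_nnsfun// integral_indic// setIT.
have [r0|r0] := leP 0%R r; last first.
 rewrite preimage_nnfun0// measure0 mule0 integral0_eq// => x _.
 by rewrite indicE in_set0 mulr0 mule0.
under eq_integral do rewrite EFinM muleCA.
rewrite ge0_integralZl//; last 2 first.
- by apply: emeasurable_funM => //; exact/measurable_EFinP.
- by move=> x _; rewrite mule_ge0// lee_fin.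
have e (E : set RM) : N E = \int[mu]_x ((pdf x)%:E * (\1_E x)%:E).
 rewrite /N /normal_prob [LHS]integral_mkcond; apply: eq_integral => x _.
 by rewrite patchE indicE; case: ifP => _; rewrite ?mule1 ?mule0.
by rewrite -e.
Qed.

Lemma integral_normal_density (f : RM -> \bar R) : measurable_fun setT f -> (forall x, 0 <= f x) ->
 \int[N]_x f x = \int[mu]_x (f x * (pdf x)%:E).
Proof.
move=> mf f0; pose f_ := nnsfun_approx measurableT mf.
transitivity (lim (\int[N]_x (f_ n x)%:E @[n --> \oo])).
 rewrite -monotone_convergence//=.
 - apply: eq_integral => x xD; apply/esym/cvg_lim => //=.
 by apply: cvg_nnsfun_approx => //; rewrite inE.
 - by move=> n; exact/measurable_EFinP/measurable_funTS.
 - by move=> n x _; rewrite lee_fin.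
 - by move=> x _ m n mn; rewrite lee_fin; exact/lefP/nd_nnsfun_approx.
transitivity (lim (\int[mu]_x ((f_ n x)%:E * (pdf x)%:E) @[n --> \oo])).
 by apply: congr_lim; apply/funext => n /=; exact: nnsfun_density.
rewrite -monotone_convergence//=.
- apply: eq_integral => x xD; apply/cvg_lim => //=.
 apply: cvgeZr => //; exact: cvg_nnsfun_approx.
- move=> n; apply: emeasurable_funM => //; exact/measurable_EFinP/measurable_funTS.
- by move=> n x _; rewrite mule_ge0// lee_fin.
- by move=> x _ m n mn; apply: lee_wpmul2r => //; rewrite lee_fin; exact/lefP/nd_nnsfun_approx.
Qed.

End normal_density.

Section rotation.
Context (R : realType).
Local Notation RM := (measurableTypeR R).
Let mu := @lebesgue_measure R.
Local Open Scope ereal_scope.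

(** The rotation is composed of two one-variable affine substitutions, first in [x] for fixed [y]
    and then in [y] for fixed [x], with factors [1/c] and [c]. This is why [c] must be positive;
    other angles are reached by composition. *)
Lemma lebesgue_rotation (c s : R) (F : RM * RM -> \bar R) : (0 < c)%R -> (c ^+ 2 + s ^+ 2 = 1)%R ->
 measurable_fun setT F -> (forall p, 0 <= F p) ->
 \int[mu]_x \int[mu]_y F (c * x + s * y, c * y - s * x)%R = \int[mu]_x \int[mu]_y F (x, y).
Proof.
move=> c0 cs mF F0.
have mpair (f g : RM * RM -> RM) : measurable_fun setT f -> measurable_fun setT g ->
 measurable_fun setT (fun p => F (f p, g p)).
 by move=> mf mg; apply: measurableT_comp mF _; exact/measurable_fun_pair.
have m1 : measurable_fun [set: RM * RM] (fun p : RM * RM => p.1) by exact: measurable_fst.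
have m2 : measurable_fun [set: RM * RM] (fun p : RM * RM => p.2) by exact: measurable_snd.
have mM (k : R) (f : RM * RM -> RM) : measurable_fun setT f -> measurable_fun setT (fun p => k * f p)%R.
 by move=> mf; exact: measurable_funM.
have psec (G : RM * RM -> \bar R) (y : RM) : measurable_fun setT G -> measurable_fun setT (fun x => G (x, y)).
 by move=> mG; apply: measurableT_comp mG _; exact: measurable_pair2.
have psec' (G : RM * RM -> \bar R) (x : RM) : measurable_fun setT G -> measurable_fun setT (fun y => G (x, y)).
 by move=> mG; apply: measurableT_comp mG _; exact: measurable_pair1.
have mF1 : measurable_fun setT (fun p : RM * RM => F (c * p.1 + s * p.2, c * p.2 - s * p.1)%R).
 apply: mpair; first by apply: measurable_funD; exact: mM.
 by apply: measurable_funB; exact: mM.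
have mF2 : measurable_fun setT (fun p : RM * RM => F (p.1, (p.2 - s * p.1) / c)%R).
 apply: mpair => //; have -> : (fun p : RM * RM => (p.2 - s * p.1) / c)%R = (fun p : RM * RM => c^-1 * (p.2 - s * p.1))%R.
 by apply/funext => p; rewrite mulrC.
 by apply: (mM _); apply: measurable_funB => //; exact: mM.
rewrite (@fubini_tonelli _ _ _ _ _ mu mu (fun p => F (c * p.1 + s * p.2, c * p.2 - s * p.1)%R)) //=.
transitivity (\int[mu]_y ((c^-1)%:E * \int[mu]_x F (x, (y - s * x) / c)%R)).
 apply: eq_integral => y _.
 have := @lebesgue_affine R c (s * y) (fun x => F (x, (y - s * x) / c)%R) c0 (psec _ y mF2) (fun=> F0 _) => <-.
 apply: eq_integral => x _; congr (F (_, _)).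
 have -> : (c * y - s * x = (y * (c ^+ 2) - c * s * x) / c)%R by field; rewrite gt_eqF.
 have -> : (c ^+ 2 = 1 - s ^+ 2)%R by rewrite -cs addrK.
 by congr (_ / _)%R; ring.
rewrite ge0_integralZl //; last 3 first.
- exact: (measurable_fun_fubini_tonelli_G (m1 := mu) _ mF2 (fun=> F0 _)).
- by move=> y _; exact: integral_ge0.
- by rewrite lee_fin invr_ge0 ltW.
rewrite -(@fubini_tonelli _ _ _ _ _ mu mu (fun p => F (p.1, (p.2 - s * p.1) / c)%R)) //=.
rewrite -ge0_integralZl //; last 3 first.
- exact: (measurable_fun_fubini_tonelli_F (m2 := mu) _ mF2 (fun=> F0 _)).
- by move=> y _; exact: integral_ge0.
- by rewrite lee_fin invr_ge0 ltW.
apply: eq_integral => x _.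
have ci : (0 < c^-1)%R by rewrite invr_gt0.
have := @lebesgue_affine R c^-1 (- (s * x / c)) (fun y => F (x, y)) ci (psec' _ x mF) (fun=> F0 _).
have -> : \int[mu]_t F (x, c^-1 * t + - (s * x / c))%R = \int[mu]_y F (x, (y - s * x) / c)%R.
 by apply: eq_integral => y _; congr (F (_, _)); ring.
move=> ->; rewrite invrK muleA -EFinM mulVf ?gt_eqF // mul1e.
by [].
Qed.

(** The product of two centred normal densities of equal variance depends only on [x^2 + y^2], so
    rotation invariance passes from Lebesgue measure to the Gaussian law. *)
Lemma normal_rotation (sg c s : R) (F : RM * RM -> \bar R) : (sg != 0)%R -> (0 < c)%R -> (c ^+ 2 + s ^+ 2 = 1)%R ->
 measurable_fun setT F -> (forall p, 0 <= F p) ->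
 \int[normal_prob 0 sg]_x \int[normal_prob 0 sg]_y F (c * x + s * y, c * y - s * x)%R =
 \int[normal_prob 0 sg]_x \int[normal_prob 0 sg]_y F (x, y).
Proof.
move=> sg0 c0 cs mF F0; pose f x := (normal_pdf 0 sg x)%:E : \bar R.
have f0 x : 0 <= f x by rewrite lee_fin normal_pdf_ge0.
have mf : measurable_fun [set: RM] f by apply/measurable_EFinP; exact: measurable_normal_pdf.
have m1 : measurable_fun [set: RM * RM] (fun p : RM * RM => p.1) by exact: measurable_fst.
have m2 : measurable_fun [set: RM * RM] (fun p : RM * RM => p.2) by exact: measurable_snd.
have two (G : RM * RM -> \bar R) : measurable_fun setT G -> (forall p, 0 <= G p) ->
 \int[normal_prob 0 sg]_x \int[normal_prob 0 sg]_y G (x, y) =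
 \int[mu]_x \int[mu]_y (G (x, y) * (f x * f y)).
 move=> mG G0; have mGy x : measurable_fun [set: RM] (fun y => G (x, y)).
 by apply: measurableT_comp mG _; exact: measurable_pair1.
 have mGf : measurable_fun setT (fun p : RM * RM => G p * f p.2).
 by apply: emeasurable_funM => //; exact: measurableT_comp mf m2.
 have e x : \int[normal_prob 0 sg]_y G (x, y) = \int[mu]_y (G (x, y) * f y).
 by rewrite integral_normal_density.
 under eq_integral do rewrite e.
 rewrite integral_normal_density //; last 2 first.
 - by apply: (measurable_fun_fubini_tonelli_F (m2 := mu) _ mGf) => p; rewrite mule_ge0.
 - by move=> x; apply: integral_ge0 => y _; rewrite mule_ge0.
 apply: eq_integral => x _; rewrite muleC -ge0_integralZl //; last 3 first.
 - by apply: emeasurable_funM.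
 - by move=> y _; rewrite mule_ge0.
 - exact: f0.
 by apply: eq_integral => y _; rewrite muleCA.
have ff (x y x' y' : R) : (x ^+ 2 + y ^+ 2 = x' ^+ 2 + y' ^+ 2)%R -> f x * f y = f x' * f y'.
 move=> e; rewrite /f -!EFinM !normal_pdfE //; congr (_%:E).
 rewrite mulrACA [RHS]mulrACA /normal_fun !subr0 -!expRD; congr (_ * expR _)%R.
 by rewrite -!mulrDl -!opprD e.
pose G (p : RM * RM) := F p * (f p.1 * f p.2).
have mG : measurable_fun setT G.
 by apply: emeasurable_funM => //; apply: emeasurable_funM; exact: measurableT_comp mf _.
have G0 p : 0 <= G p by rewrite !mule_ge0.
have mM (k : R) (g : RM * RM -> RM) : measurable_fun setT g -> measurable_fun setT (fun p => k * g p)%R.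
 by move=> mg; exact: measurable_funM.
pose F' (p : RM * RM) := F (c * p.1 + s * p.2, c * p.2 - s * p.1)%R.
have mF' : measurable_fun setT F'.
 apply: measurableT_comp mF _; apply/measurable_fun_pair.
 by apply: measurable_funD; exact: mM.
 by apply: measurable_funB; exact: mM.
have e1 := two F' mF' (fun=> F0 _); have e2 := two F mF F0.
apply: (etrans e1); apply: (etrans _ (esym e2)).
apply: (etrans _ (lebesgue_rotation c0 cs mG G0)); apply: eq_integral => x _; apply: eq_integral => y _.
rewrite /F' /G /=; congr (_ * _); apply: ff.
have -> : ((c * x + s * y) ^+ 2 + (c * y - s * x) ^+ 2 = (c ^+ 2 + s ^+ 2) * (x ^+ 2 + y ^+ 2))%R by ring.
by rewrite cs mul1r.
Qed.

End rotation.

(** * Integrating out independent coordinates *)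

Section independence.
Context (R : realType) (d : measure_display) (Omega : measurableType d) (P : probability Omega R).
Local Notation RM := (measurableTypeR R).
Variables (I : choiceType) (xi : I -> Omega -> R) (sg : R).
Hypotheses (mxi : forall i, measurable_fun [set: Omega] (xi i : Omega -> RM))
 (lxi : forall i (B : set RM), measurable B -> P (xi i @^-1` B) = normal_prob 0 sg B)
 (ixi : mutually_independent P xi).

(** They generate the sigma-algebra of the coordinates outside [D]. Regarding [Omega] as a
    measurable space with this smaller structure expresses that a function ignores the coordinates
    in [D]. *)
Definition cylinders (D : seq I) : set (set Omega) :=
 [set C | exists S B, [/\ uniq S, {in S, forall k, k \notin D}, forall k, measurable (B k : set RM)
 & C = \bigcap_(k in [set` S]) (xi k @^-1` B k)]].

Local Notation TD D := (g_sigma_algebraType (cylinders D)).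

Let mcyl (S : seq I) (B : I -> set RM) : (forall k, measurable (B k)) ->
 measurable (\bigcap_(k in [set` S]) (xi k @^-1` B k)).
Proof.
move=> mB; rewrite bigcap_seq; apply: big_ind => //; first exact: measurableI.
by move=> k _; have := mxi k measurableT (mB k); rewrite setTI.
Qed.

Lemma cylinder_sub D (Y : set (TD D)) : measurable Y -> measurable (Y : set Omega).
Proof.
apply: smallest_sub; first exact: sigma_algebra_measurable.
by move=> _ [S [B [_ _ mB ->]]]; exact: mcyl.
Qed.

Let setI_cyl D : setI_closed (cylinders D).
Proof.
move=> _ _ [S1 [B1 [u1 n1 m1 ->]]] [S2 [B2 [u2 n2 m2 ->]]].
pose C (S : seq I) (B : I -> set RM) k := if k \in S then B k else setT.
exists (undup (S1 ++ S2)), (fun k => C S1 B1 k `&` C S2 B2 k); split.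
- exact: undup_uniq.
- by move=> k; rewrite mem_undup mem_cat => /orP[/n1|/n2].
- by move=> k; apply: measurableI; rewrite /C; case: ifP.
apply/seteqP; split=> w /=.
 move=> [h1 h2] k _; split; rewrite /C; case: ifP => // kS; [exact: h1|exact: h2].
move=> h; split=> k /= kS.
 by have [|] := h k; rewrite /= ?mem_undup ?mem_cat ?kS // /C kS.
by have [|_] := h k; rewrite /= ?mem_undup ?mem_cat ?kS ?orbT // /C kS.
Qed.

Let mid D : measurable_fun [set: Omega] (fun w => w : TD D).
Proof. by move=> _ Y mY; rewrite setTI; have := @cylinder_sub D Y mY. Qed.

Lemma measurable_coordinate D k : k \notin D -> measurable_fun [set: TD D] (xi k : TD D -> RM).
Proof.
move=> kD _ B mB; rewrite setTI; apply: sub_sigma_algebra.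
exists [:: k], (fun=> B); split=> //; first by move=> j; rewrite inE => /eqP ->.
by rewrite bigcap_seq big_seq1.
Qed.

Let idD D : {mfun Omega >-> TD D} := HB.pack (fun w => w : TD D) (isMeasurableFun.Build _ _ _ _ _ (@mid D)).

(** As functions of [B] both sides are finite measures; they agree on cylinders by independence, and
    cylinders are closed under intersection. *)
Let split_prob D i (A : set RM) (B : set (TD D)) : i \in D -> measurable A -> measurable B ->
 P (xi i @^-1` A `&` B) = (normal_prob 0 sg A * P B)%E.
Proof.
move=> iD mA mB; have mA' : measurable (xi i @^-1` A) by rewrite -[_ @^-1` _]setTI; exact: mxi.
pose r : {nonneg R} := NngNum (fine_ge0 (measure_ge0 (normal_prob 0 sg) A)).
pose m1 : {measure set (TD D) -> \bar R} := pushforward (mrestr P mA') (idD D).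
pose m2 : {measure set (TD D) -> \bar R} := mscale r (pushforward P (idD D)).
have Nf : ((fine (normal_prob 0 sg A))%:E = normal_prob 0 sg A)%E.
 by rewrite fineK // fin_num_measure.
pose m1' : {measure set (TD D) -> \bar R} := m1 (@mid D).
pose m2' : {measure set (TD D) -> \bar R} := m2 (@mid D).
have : m1' B = m2' B.
 refine (@measure_unique _ R (TD D) (cylinders D) (fun=> setT) erefl (@setI_cyl D) _ _ m1' m2' _ _ B mB).
 - move=> _; exists [::], (fun=> setT); split=> //.
 by apply/seteqP; split.
 - by rewrite bigcup_const.
 - move=> _ [S [C [uS nS mC ->]]].
 rewrite /m1' /m2' /m1 /m2 /= /pushforward /mrestr /mscale /= /pushforward preimage_id Nf.
 have iS : i \notin S by apply/negP => /nS; rewrite iD.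
 pose C' k := if k == i then A else C k.
 have mC' k : measurable (C' k) by rewrite /C'; case: ifP.
 have C'i : C' i = A by rewrite /C' eqxx.
 have e : \bigcap_(k in [set` i :: S]) (xi k @^-1` C' k) = \bigcap_(k in [set` S]) (xi k @^-1` C k) `&` xi i @^-1` A.
 rewrite !bigcap_seq big_cons C'i setIC; congr (_ `&` _).
 by apply: eq_big_seq => k kS; rewrite /C'; case: eqP => // ki; rewrite ki (negbTE iS) in kS.
 rewrite -e (@ixi (i :: S) C') //=; last by rewrite iS.
 rewrite big_cons C'i lxi //; congr (_ * _)%E.
 rewrite ixi //; apply: eq_big_seq => k kS; rewrite /C'; case: eqP => // ki.
 by rewrite ki (negbTE iS) in kS.
 - move=> k; rewrite /m1' /m1 /= /pushforward /mrestr /= preimage_setT setTI.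
 by rewrite (le_lt_trans (probability_le1 P mA')) // ltry.
by rewrite /m1' /m2' /m1 /m2 /= /pushforward /mrestr /mscale /= /pushforward preimage_id Nf setIC.
Qed.

Lemma independent_integral D i (f : RM * TD D -> \bar R) : i \in D ->
 measurable_fun setT f -> (forall p, 0 <= f p)%E ->
 (\int[P]_w f (xi i w, w) = \int[P]_w \int[normal_prob 0 sg]_x f (x, w))%E.
Proof.
move=> iD mf f0.
have mZ : measurable_fun [set: Omega] (fun w => (xi i w, w) : RM * TD D).
 by apply/measurable_fun_pair => //; exact: mid.
pose Z : {mfun Omega >-> (RM * TD D)%type} := HB.pack (fun w => (xi i w, w) : RM * TD D) (isMeasurableFun.Build _ _ _ _ _ mZ).
have -> : (\int[P]_w f (xi i w, w) = \int[distribution P Z]_z f z)%E by rewrite ge0_integral_distribution.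
have -> : (\int[distribution P Z]_z f z = \int[normal_prob 0 sg \x distribution P (idD D)]_z f z)%E.
 apply: eq_measure_integral => Y mY _; apply/esym/product_measure_unique => // A B mA mB.
 exact: (split_prob iD mA mB).
rewrite fubini_tonelli2 // ge0_integral_distribution //; last first.
 by move=> y; apply: integral_ge0.
exact: (measurable_fun_fubini_tonelli_G (m1 := normal_prob 0 sg) _ mf f0).
Qed.

End independence.

Section measurable_combinations.
Context (R : realType) (X : completeNormedModType R[i]) (d : measure_display) (T : measurableType d).
Local Notation RM := (measurableTypeR R).

Lemma rnorm_line_continuous (u v : X) : continuous (fun t : R => rnorm (u + t%:C *: v)).
Proof.
move=> t; apply/cvgrPdist_le => e e0; have v0 : 0 < rnorm v + 1 by rewrite ltr_wpDl ?rnorm_ge0.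
have d0 : 0 < e / (rnorm v + 1) by rewrite divr_gt0.
apply/nbhs_ballP; exists (e / (rnorm v + 1)) => // s /= st.
have {}st : `|t - s| < e / (rnorm v + 1) := st.
have h (a b : X) : `|rnorm a - rnorm b| <= rnorm (a - b).
 by rewrite ler_norml; have := ler_rnorm_dist a b; have := ler_rnorm_dist b a; rewrite (rnormB b a) => *; apply/andP; split; lra.
apply: (le_trans (h _ _)); have -> : u + t%:C *: v - (u + s%:C *: v) = (t - s)%:C *: v.
 by rewrite rmorphB /=; vring.
rewrite rnormZ rnorm_real; rewrite ltr_pdivlMr // in st; apply: le_trans (ltW st).
by rewrite ler_wpM2l // lerDl.
Qed.

(** One coordinate at a time: the norm is continuous in that coordinate and measurable in the others
    by induction, which is the Caratheodory condition. *)
Lemma measurable_rnorm_combination (I : eqType) (S : seq I) (xi : I -> T -> R) (v : I -> X) (u : X) :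
 {in S, forall k, measurable_fun setT (xi k : T -> RM)} ->
 measurable_fun setT (fun t => rnorm (u + \sum_(k <- S) (xi k t)%:C *: v k)).
Proof.
elim: S u => [|k S IH] u mS; first by under eq_fun do rewrite big_nil addr0; exact: measurable_cst.
have mf : measurable_fun setT (fun p : RM * T => rnorm (u + p.1%:C *: v k + \sum_(j <- S) (xi j p.2)%:C *: v j)).
 apply: (@caratheodory_measurable_fun R _ T (fun r t => rnorm (u + r%:C *: v k + \sum_(j <- S) (xi j t)%:C *: v j))).
 by move=> r; apply: IH => j jS; apply: mS; rewrite inE jS orbT.
 move=> t; have -> : (fun r : R => rnorm (u + r%:C *: v k + \sum_(j <- S) (xi j t)%:C *: v j)) =
 (fun r : R => rnorm ((u + \sum_(j <- S) (xi j t)%:C *: v j) + r%:C *: v k)).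
 by apply/funext => r; rewrite addrAC.
 exact: rnorm_line_continuous.
have -> : (fun t => rnorm (u + \sum_(j <- k :: S) (xi j t)%:C *: v j)) =
 (fun p : RM * T => rnorm (u + p.1%:C *: v k + \sum_(j <- S) (xi j p.2)%:C *: v j)) \o (fun t => (xi k t : RM, t)).
 by apply/funext => t; rewrite /= big_cons addrA.
apply: (measurableT_comp mf); apply/measurable_fun_pair; last exact: measurable_id.
by apply: mS; rewrite mem_head.
Qed.

Lemma measurable_sqr_combination (I : eqType) (S : seq I) (xi : I -> T -> R) (v : I -> X) :
 {in S, forall k, measurable_fun setT (xi k : T -> RM)} ->
 measurable_fun setT (fun t => (rnorm (\sum_(k <- S) (xi k t)%:C *: v k) ^+ 2)%:E).
Proof.
move=> mS; apply/measurable_EFinP; apply: measurable_funX.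
by have := measurable_rnorm_combination v 0 mS; under eq_fun do rewrite add0r.
Qed.

End measurable_combinations.

Section real_rotations.
Context (R : realType) (d : measure_display) (Omega : measurableType d) (P : probability Omega R)
 (X : completeNormedModType R[i]).
Local Notation RM := (measurableTypeR R).
Variables (I : choiceType) (xi : I -> Omega -> R) (sg : R).
Hypotheses (sg0 : sg != 0) (mxi : forall i, measurable_fun [set: Omega] (xi i : Omega -> RM))
 (lxi : forall i (B : set RM), measurable B -> P (xi i @^-1` B) = normal_prob 0 sg B)
 (ixi : mutually_independent P xi).
Variable S : seq I.
Hypothesis uS : uniq S.

Definition second_moment (v : I -> X) : \bar R :=
 (\int[P]_w (rnorm (\sum_(k <- S) (xi k w)%:C *: v k) ^+ 2)%:E)%E.

Let put (i j : I) (x y : R) (f : I -> R) k := if k == i then x else if k == j then y else f k.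

Let F (v : I -> X) i j x y w : \bar R := (rnorm (\sum_(k <- S) (put i j x y (xi^~ w) k)%:C *: v k) ^+ 2)%:E.

Let TD D := g_sigma_algebraType (cylinders xi D).

Let F0 v i j x y w : (0 <= F v i j x y w)%E. Proof. by rewrite lee_fin sqr_ge0. Qed.

Let mF v i j d' (T : measurableType d') (fx fy : T -> RM) (fw : T -> Omega) :
 measurable_fun setT fx -> measurable_fun setT fy ->
 (forall k, k \notin [:: i; j] -> measurable_fun setT (fun t => xi k (fw t) : RM)) ->
 measurable_fun setT (fun t => F v i j (fx t) (fy t) (fw t)).
Proof.
move=> mx my mw; apply: (measurable_sqr_combination (xi := fun k t => put i j (fx t) (fy t) (xi^~ (fw t)) k)).
move=> k _; rewrite /put; case: eqP => [_|/eqP ki]; first exact: mx.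
case: eqP => [_|/eqP kj]; first exact: my.
by apply: mw; rewrite !inE negb_or ki kj.
Qed.

Lemma second_moment_iterated v i j : i != j -> second_moment v =
 (\int[P]_w \int[normal_prob 0 sg]_x \int[normal_prob 0 sg]_y F v i j x y w)%E.
Proof.
move=> ij.
have m1 d1 d2 (T1 : measurableType d1) (T2 : measurableType d2) : measurable_fun [set: T1 * T2] (fst : _ -> T1) by exact: measurable_fst.
have m2 d1 d2 (T1 : measurableType d1) (T2 : measurableType d2) : measurable_fun [set: T1 * T2] (snd : _ -> T2) by exact: measurable_snd.
have e1 : second_moment v = (\int[P]_w F v i j (xi i w) (xi j w) w)%E.
 apply: eq_integral => w _; rewrite /F; congr ((rnorm _ ^+ 2)%:E); apply: eq_bigr => k _.
 by rewrite /put; case: eqP => [->//|_]; case: eqP => [->|].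
have mc D k : k \notin D -> measurable_fun [set: TD D] (xi k : TD D -> RM) by exact: measurable_coordinate.
have e2 : (\int[P]_w F v i j (xi i w) (xi j w) w = \int[P]_w \int[normal_prob 0 sg]_y F v i j (xi i w) y w)%E.
 apply: (@independent_integral R d Omega P I xi sg mxi lxi ixi [:: j] j
 (fun p : RM * TD [:: j] => F v i j (xi i p.2) p.1 p.2)).
 - by rewrite mem_head.
 - apply: mF => [||k].
 + by apply: (measurableT_comp (mc [:: j] i _) (m2 _ _ _ _)); rewrite inE.
 + exact: m1.
 + rewrite !inE negb_or => /andP[_ kj].
 by apply: (measurableT_comp (mc [:: j] k _) (m2 _ _ _ _)); rewrite inE.
 - by move=> p; exact: F0.
have mG : measurable_fun setT (fun p : (RM * TD [:: i; j]) * RM => F v i j p.1.1 p.2 p.1.2).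
 apply: mF => [||k kij].
 - exact: (measurableT_comp (m1 _ _ _ _) (m1 _ _ _ _)).
 - exact: m2.
 - apply: (measurableT_comp (mc [:: i; j] k kij) _); exact: (measurableT_comp (m2 _ _ _ _) (m1 _ _ _ _)).
rewrite e1 e2.
apply: (@independent_integral R d Omega P I xi sg mxi lxi ixi [:: i; j] i
 (fun p : RM * TD [:: i; j] => \int[normal_prob 0 sg]_y F v i j p.1 y p.2)%E).
- by rewrite mem_head.
- exact: (measurable_fun_fubini_tonelli_F (m2 := normal_prob 0 sg) _ mG (fun=> F0 _ _ _ _ _ _)).
- by move=> p; apply: integral_ge0 => y _; exact: F0.
Qed.

Lemma second_moment_rotation (c s : R) (v v' : I -> X) i j : i != j -> i \in S -> j \in S ->
 0 < c -> c ^+ 2 + s ^+ 2 = 1 -> v' i = c%:C *: v i - s%:C *: v j -> v' j = s%:C *: v i + c%:C *: v j ->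
 (forall k, k != i -> k != j -> v' k = v k) -> second_moment v' = second_moment v.
Proof.
move=> ij iS jS c0 cs vi vj vk; rewrite !(second_moment_iterated _ ij); apply: eq_integral => w _.
have mFw : measurable_fun setT (fun p : RM * RM => F v i j p.1 p.2 w).
 by apply: mF => // k _; exact: measurable_cst.
have := normal_rotation sg0 c0 cs mFw (fun=> F0 _ _ _ _ _ _) => /= <-.
apply: eq_integral => x _; apply: eq_integral => y _; rewrite /F; congr ((rnorm _ ^+ 2)%:E).
have jS' : j \in rem i S by rewrite (mem_rem_uniq i uS) !inE eq_sym ij.
have dec (f : I -> X) : \sum_(k <- S) f k = f i + (f j + \sum_(k <- rem j (rem i S)) f k).
 by rewrite (big_rem i iS) (big_rem j jS').
have puti r t f : put i j r t f i = r by rewrite /put eqxx.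
have putj r t f : put i j r t f j = t by rewrite /put eq_sym (negbTE ij) eqxx.
rewrite !dec !puti !putj vi vj.
have -> : \sum_(k <- rem j (rem i S)) (put i j x y (xi^~ w) k)%:C *: v' k =
 \sum_(k <- rem j (rem i S)) (put i j (c * x + s * y) (c * y - s * x) (xi^~ w) k)%:C *: v k.
 apply: eq_big_seq => k; rewrite mem_rem_uniq ?rem_uniq // !inE (mem_rem_uniq i uS) !inE.
 by move=> /andP[kj /andP[ki _]]; rewrite /put (negbTE ki) (negbTE kj) vk.
rewrite !rmorphD !rmorphM /= rmorphN /= rmorphM /=; move: (\sum_(k <- _) _) (v i) (v j) => W a b.
by move: (c%:C) (s%:C) (x%:C) (y%:C) => c' s' x' y'; vring.
Qed.

End real_rotations.

Section gaussian_moments.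
Context (R : realType) (d : measure_display) (Omega : measurableType d) (P : probability Omega R)
 (X : completeNormedModType R[i]).
Variable g : nat -> Omega -> R[i].
Hypothesis hg : complex_gaussian_sequence P g.
Variable N : nat.

Definition gauss2 (x : nat -> X) : \bar R := (\int[P]_w (rnorm (\sum_(k < N) g k w *: x k) ^+ 2)%:E)%E.

(** A complex Gaussian multiplying [x k] is a pair of real ones multiplying [x k] and ['i *: x k],
    so the complex sum becomes a real one over twice as many indices. *)
Let S : seq (nat * bool) := [seq (k, b) | k <- iota 0 N, b <- [:: false; true]].
Let vec (x : nat -> X) (k : nat * bool) : X := if k.2 then 'i *: x k.1 else x k.1.

Let uS : uniq S.
Proof. by apply: allpairs_uniq => //; [exact: iota_uniq|move=> [? ?] [? ?] _ _ [-> ->]]. Qed.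

Let memS k b : (k < N)%N -> (k, b) \in S.
Proof. by move=> kN; apply: allpairs_f; rewrite ?mem_iota //; case: b. Qed.

Lemma gauss2E x : gauss2 x = second_moment P (coordinate g) S (vec x).
Proof.
apply: eq_integral => w _; congr ((rnorm _ ^+ 2)%:E).
rewrite -(big_mkord xpredT (fun k => g k w *: x k)) /index_iota subn0 /S big_allpairs_dep /=.
apply: eq_bigr => k _.
rewrite !big_cons big_nil addr0 /vec /coordinate /=; case: (g k w) => a b /=.
rewrite scalerA -scalerDl; congr (_ *: _).
cparts.
Qed.

Lemma gauss2_ext x y : (forall k, (k < N)%N -> x k = y k) -> gauss2 x = gauss2 y.
Proof.
move=> h; apply: eq_integral => w _; congr ((rnorm _ ^+ 2)%:E); apply: eq_bigr => k _.
by rewrite h.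
Qed.

Let sg0 : (Num.sqrt 2)^-1 != 0 :> R. Proof. by rewrite invr_eq0 gt_eqF // sqrtr_gt0. Qed.

Let rot c s v v' i j := @second_moment_rotation R d Omega P X _ (coordinate g) _ sg0
 (let: And3 m _ _ := hg in m) (let: And3 _ l _ := hg in l) (let: And3 _ _ u := hg in u) S uS c s v v' i j.

Definition phase i (u : R[i]) (x : nat -> X) k := if k == i then u *: x k else x k.
Definition plane i j (c s : R) (x : nat -> X) k :=
 if k == i then c%:C *: x i - s%:C *: x j else if k == j then s%:C *: x i + c%:C *: x j else x k.

Lemma gauss2_phase_pos i u x : (i < N)%N -> 0 < Re u -> rnorm u = 1 -> gauss2 (phase i u x) = gauss2 x.
Proof.
move=> iN u0 u1; rewrite !gauss2E.
apply: (@rot (Re u) (- Im u) _ _ (i, false) (i, true)); rewrite ?memS //.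
- by rewrite xpair_eqE /= andbF.
- by rewrite sqrrN -sqr_rnormc u1 expr1n.
- by rewrite /vec /phase /= eqxx; case: (u) => a b /=; rewrite scalerA -scalerBl; congr (_ *: _); cparts.
- by rewrite /vec /phase /= eqxx; case: (u) => a b /=; rewrite !scalerA -scalerDl; congr (_ *: _); cparts.
- by move=> [k [|]]; rewrite /vec /phase !xpair_eqE /= ?andbT ?andbF ?orbF => h1 h2; rewrite ?(negbTE h1) ?(negbTE h2).
Qed.

Lemma gauss2_plane_pos i j c s x : i != j -> (i < N)%N -> (j < N)%N -> 0 < c -> c ^+ 2 + s ^+ 2 = 1 ->
 gauss2 (plane i j c s x) = gauss2 x.
Proof.
move=> ij iN jN c0 cs; rewrite !gauss2E; have ji : (j == i) = false by rewrite eq_sym (negbTE ij).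
(* The rotation acts on the real and on the imaginary coordinates by the same matrix; in [v1] it has
   been applied to the real ones only. *)
pose v1 k := if k.2 then vec x k else vec (plane i j c s x) k.
transitivity (second_moment P (coordinate g) S v1).
 apply: (@rot c s _ _ (i, true) (j, true)); rewrite ?memS //.
 - by rewrite xpair_eqE /= (negbTE ij).
 - by rewrite /v1 /vec /plane /= eqxx; vring.
 - by rewrite /v1 /vec /plane /= ji eqxx; vring.
 - move=> [k [|]]; rewrite /v1 /vec /plane !xpair_eqE /= ?andbT ?andbF => h1 h2 //.
 by rewrite (negbTE h1) (negbTE h2).
apply: (@rot c s _ _ (i, false) (j, false)); rewrite ?memS //.
- by rewrite xpair_eqE /= (negbTE ij).
- by rewrite /v1 /vec /plane /= eqxx.
- by rewrite /v1 /vec /plane /= ji eqxx.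
- move=> [k [|]]; rewrite /v1 /vec /plane !xpair_eqE /= ?andbT ?andbF => h1 h2 //.
 by rewrite (negbTE h1) (negbTE h2).
Qed.

(** Real rotations are available for positive cosine only. A quarter of the argument lies in
    [[- pi / 4, pi / 4]], so four equal phases achieve any [u]. *)
Lemma gauss2_phase i u x : (i < N)%N -> rnorm u = 1 -> gauss2 (phase i u x) = gauss2 x.
Proof.
move=> iN u1; have u0 : u != 0 by apply: contra_eq_neq u1 => ->; rewrite rnorm0 eq_sym oner_eq0.
have [a [v [e vpi _]]] := polar u0.
have a0 : a = 0.
 by move: u1; rewrite e rnorm_cexp /= -expR0 => /expR_inj.
pose w : R[i] := cexp (0 +i* (v / 4)).
have w1 : rnorm w = 1 by rewrite rnorm_cexp /= expR0.
have w0 : 0 < Re w.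
 by rewrite Re_cexp expR0 mul1r cos_gt0_pihalf //; move: vpi; rewrite ler_norml => /andP[]; have := @pi_gt0 R; lra.
have -> : phase i u x = phase i w (phase i w (phase i w (phase i w x))).
 apply/funext => k; rewrite /phase; case: eqP => // _; rewrite !scalerA; congr (_ *: _).
 rewrite e a0 -!cexpD; congr cexp; apply/eqP; rewrite eq_complex /= !addr0 eqxx /=; by apply/eqP; field.
by rewrite !gauss2_phase_pos.
Qed.

Lemma gauss2_plane i j v x : i != j -> (i < N)%N -> (j < N)%N -> `|v| <= pi ->
 gauss2 (plane i j (cos v) (sin v) x) = gauss2 x.
Proof.
move=> ij iN jN vpi; have ji : (j == i) = false by rewrite eq_sym (negbTE ij).
have dbl (t : R) y : plane i j (cos (t + t)) (sin (t + t)) y = plane i j (cos t) (sin t) (plane i j (cos t) (sin t) y).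
 apply/funext => k; rewrite /plane !eqxx ji cosD sinD rmorphB rmorphD !rmorphM /=.
 move: ((cos t)%:C) ((sin t)%:C) => c s.
 by case: eqP => _; [vring|case: eqP => _; [vring|]].
have -> : v = (v / 4 + v / 4) + (v / 4 + v / 4) by field.
rewrite !dbl !gauss2_plane_pos // ?cos2Dsin2 //.
all: by rewrite cos_gt0_pihalf //; move: vpi; rewrite ler_norml => /andP[]; have := @pi_gt0 R; lra.
Qed.

End gaussian_moments.

Section unitary_invariance.
Context (R : realType).

(** A complex Givens rotation, that is, a matrix of SU(2) acting on the coordinates [i] and [j]; it
    is defined over any module so as to act on vectors and on matrix columns alike. *)
Definition giv (V : lmodType R[i]) i j (al be : R[i]) (x : nat -> V) k : V :=
 if k == i then al *: x i + be *: x j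
 else if k == j then - conjc be *: x i + conjc al *: x j else x k.

Lemma conjc_mul (z : R[i]) : conjc z * z = (rnorm z ^+ 2)%:C.
Proof. by rewrite sqr_rnormc; case: z => a b; cparts. Qed.

Lemma rnorm_conjc (z : R[i]) : rnorm (conjc z) = rnorm z.
Proof. by rewrite !rnormc; case: z => a b /=; rewrite sqrrN. Qed.

Lemma unimodular_part (z : R[i]) : exists2 u : R[i], rnorm u = 1 & z = (rnorm z)%:C * u.
Proof.
have [->|z0] := eqVneq z 0; first by exists 1; rewrite ?rnorm1 // rnorm0 mul0r.
have r0 := rnorm_gt0 z0; exists (z / (rnorm z)%:C).
 by rewrite rnormM rnormV rnorm_real ger0_norm ?rnorm_ge0 // mulfV // gt_eqF.
by rewrite mulrCA mulfV ?mulr1 // eq_complex /= eqxx andbT gt_eqF.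
Qed.

Variable N : nat.
Definition ip (u v : nat -> R[i]) : R[i] := \sum_(a < N) conjc (u a) * v a.

Let ip2 i j (u v : nat -> R[i]) : i != j -> (i < N)%N -> (j < N)%N ->
 ip u v = conjc (u i) * v i + conjc (u j) * v j + \sum_(a < N | (a != i :> nat) && (a != j :> nat)) conjc (u a) * v a.
Proof.
move=> ij iN jN; rewrite /ip (bigD1 (Ordinal iN)) //= (bigD1 (Ordinal jN)) /=; last first.
 by rewrite -val_eqE /= eq_sym.
by rewrite addrA; congr (_ + _); apply: eq_bigl => a; rewrite -!val_eqE.
Qed.

Lemma ip_giv i j al be (u v : nat -> R[i]) : i != j -> (i < N)%N -> (j < N)%N ->
 rnorm al ^+ 2 + rnorm be ^+ 2 = 1 ->
 ip (giv (V := R[i]^o) i j al be u) (giv (V := R[i]^o) i j al be v) = ip u v.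
Proof.
move=> ij iN jN ab; rewrite !(ip2 _ _ ij iN jN) /giv !eqxx eq_sym (negbTE ij).
rewrite (eq_bigr (fun a : 'I_N => conjc (u a) * v a)); last by move=> a /andP[/negbTE -> /negbTE ->].
congr (_ + _); have e : conjc al * al + conjc be * be = 1 by rewrite !conjc_mul -realcD ab.
have cZ (a b : R[i]) : a *: (b : R[i]^o) = a * b by [].
rewrite !cZ !rmorphD !rmorphM /= !rmorphN /= !conjcK.
rewrite -[RHS]mul1r -e; ring.
Qed.

Definition sphase i (w : R[i]) (u : nat -> R[i]) k := if k == i then w * u k else u k.

Lemma ip_phase i (w : R[i]) (u v : nat -> R[i]) : rnorm w = 1 ->
 ip (sphase i w u) (sphase i w v) = ip u v.
Proof.
move=> w1; apply: eq_bigr => a _; rewrite /sphase; case: eqP => // ->.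
by rewrite rmorphM mulrACA /= conjc_mul w1 expr1n mul1r.
Qed.

End unitary_invariance.

Section gaussian_unitary.
Context (R : realType) (d : measure_display) (Omega : measurableType d) (P : probability Omega R)
 (X : completeNormedModType R[i]).
Variable g : nat -> Omega -> R[i].
Hypothesis hg : complex_gaussian_sequence P g.
Variable N : nat.
Local Notation gauss2 := (gauss2 P g N).

(** Writing [al] and [be] as modulus times phase factors the matrix into phases on the two
    coordinates and one real rotation, all of which preserve the second moment. *)
Lemma gauss2_giv i j al be (x : nat -> X) : i != j -> (i < N)%N -> (j < N)%N ->
 rnorm al ^+ 2 + rnorm be ^+ 2 = 1 -> gauss2 (giv i j al be x) = gauss2 x.
Proof.
move=> ij iN jN ab; have ji : (j == i) = false by rewrite eq_sym (negbTE ij).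
have [u u1 eu] := unimodular_part al; have [w w1 ew] := unimodular_part be.
have al1 : -1 <= rnorm al <= 1.
 have := rnorm_ge0 al; have := sqr_ge0 (rnorm be) => b0 a0; apply/andP; split; first lra.
 by rewrite -(@ler_pXn2r _ 2) ?nnegrE // expr1n -ab lerDl.
pose v := - acos (rnorm al).
have cv : cos v = rnorm al by rewrite cosN acosK.
have sv : sin v = - rnorm be.
 rewrite sinN sin_acos //; congr (- _).
 have -> : 1 - rnorm al ^+ 2 = rnorm be ^+ 2 by rewrite -ab addrAC subrr add0r.
 by rewrite sqrtr_sqr ger0_norm ?rnorm_ge0.
have vpi : `|v| <= pi by rewrite normrN ger0_norm ?acos_ge0 // acos_lepi.
have uu : conjc u * u = 1 by rewrite conjc_mul u1 expr1n.
have ww : conjc w * w = 1 by rewrite conjc_mul w1 expr1n.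
have rl (r : R) : conjc r%:C = r%:C by rewrite /= oppr0.
have eal : conjc al = (rnorm al)%:C * conjc u by rewrite {1}eu rmorphM; congr (_ * _); exact: rl.
have ebe : conjc be = (rnorm be)%:C * conjc w by rewrite {1}ew rmorphM; congr (_ * _); exact: rl.
have -> : giv i j al be x = phase j (conjc u * conjc w) (plane i j (cos v) (sin v) (phase i u (phase j w x))).
 apply/funext => k; rewrite /giv /phase /plane cv sv !eqxx ji (negbTE ij).
 rewrite eal ebe {1}eu {1}ew rmorphN /=.
 move: ((rnorm al)%:C) ((rnorm be)%:C) (x i) (x j) => c s a b.
 case: (eqVneq k i) => [->|ki]; first by rewrite (negbTE ij) scaleNr opprK !scalerA.
 case: (eqVneq k j) => // _; rewrite !scalerA scalerDr !scalerA; congr (_ *: _ + _ *: _).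
 have -> : conjc u * conjc w * (- s * u) = - (s * conjc w) * (conjc u * u) by ring.
 by rewrite uu mulr1.
 have -> : conjc u * conjc w * (c * w) = c * conjc u * (conjc w * w) by ring.
 by rewrite ww mulr1.
rewrite (gauss2_phase hg) //; last by rewrite rnormM !rnorm_conjc u1 w1 mulr1.
by rewrite (gauss2_plane hg) // !(gauss2_phase hg).
Qed.

(** Here [v b] is the column of index [b], so [orth] below says that the columns are orthonormal. *)
Definition act (v : nat -> nat -> R[i]) (x : nat -> X) a : X := \sum_(b < N) v b a *: x b.

Definition orth (v : nat -> nat -> R[i]) :=
 forall b c, (b < N)%N -> (c < N)%N -> ip N (v b) (v c) = (b == c)%:R.

Let act_giv i j al be v x : giv i j al be (act v x) = act (fun b => giv (V := R[i]^o) i j al be (v b)) x.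
Proof.
have cZ (a b : R[i]) : a *: (b : R[i]^o) = a * b by [].
apply/funext => k; rewrite /giv /act; case: eqP => _; [|case: eqP => // _];
 by rewrite !scaler_sumr -big_split; apply: eq_bigr => b _; rewrite !cZ scalerDl !scalerA.
Qed.

Let act_phase i w v x : phase i w (act v x) = act (fun b => sphase i w (v b)) x.
Proof.
apply/funext => k; rewrite /phase /sphase /act; case: eqP => // _.
by rewrite scaler_sumr; apply: eq_bigr => b _; rewrite scalerA.
Qed.

Let fixed m (v : nat -> nat -> R[i]) := forall b a, (b < m)%N -> (a < N)%N -> v b a = (a == b)%:R.

(** Orthogonality to a standard basis column forces the corresponding entry of every other column to
    vanish, so columns already treated are not disturbed by later rotations. *)
Let fixed_row m v b c : orth v -> fixed m v -> (b < m)%N -> (b < N)%N -> (c < N)%N -> c != b -> v c b = 0.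
Proof.
move=> ov fv bm bN cN cb; have := ov b c bN cN; rewrite eq_sym (negbTE cb) /ip (bigD1 (Ordinal bN)) //=.
rewrite big1 => [|a ab]; last first.
 rewrite fv // (_ : (a == b :> nat) = false) ?conjc0 ?mul0r //.
 by apply/negbTE; move: ab; rewrite -val_eqE.
by rewrite addr0 fv // eqxx conjc1 mul1r.
Qed.

(* Givens rotations bring the columns one after the other to the standard basis. *)
Lemma gauss2_unitary v x : orth v -> gauss2 (act v x) = gauss2 x.
Proof.
move=> ov; suff main k m v' : (N - m = k)%N -> orth v' -> fixed m v' -> gauss2 (act v' x) = gauss2 x.
 by apply: (main N 0%N) => //; rewrite subn0.
elim: k m v' {v ov} => [|k IH] m v Nm ov fv.
 have Nm' : (N <= m)%N by rewrite -subn_eq0 Nm.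
 apply: gauss2_ext => a aN; rewrite /act (bigD1 (Ordinal aN)) //= big1 => [|b ba].
 by rewrite addr0 fv ?eqxx ?scale1r // (leq_trans aN).
 rewrite fv ?(leq_trans (ltn_ord b)) // (_ : (a == b :> nat) = false) ?scale0r //.
 by apply/negbTE; move: ba; rewrite -val_eqE eq_sym.
have mN : (m < N)%N by rewrite -subn_gt0 Nm.
(* The column [m] is cleared from the bottom: its entries from index [m + 1 + l] on are zero, and
   [l] counts the entries still to be removed. *)
suff inner l u : (m.+1 + l <= N)%N -> orth u -> fixed m u ->
 (forall a, (m.+1 + l <= a)%N -> (a < N)%N -> u m a = 0) -> gauss2 (act u x) = gauss2 x.
 apply: (inner (N - m.+1)%N v) => //; rewrite subnKC // => a h1 h2.
 by rewrite ltnNge h1 in h2.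
elim: l u {v ov fv} => [|l IHl] u lN ou fu u0.
 rewrite addn0 in u0 lN.
 have um a : (a < N)%N -> a != m -> u m a = 0.
 move=> aN am; case: (ltngtP a m) am => // h _; last exact: u0.
 by apply: (fixed_row ou fu) => //; rewrite eq_sym neq_ltn h.
 have umm : rnorm (u m m) = 1.
 have := ou m m mN mN; rewrite eqxx /ip (bigD1 (Ordinal mN)) //= big1 ?addr0 => [|a am].
 rewrite conjc_mul => e; have {}e : rnorm (u m m) ^+ 2 = 1 by case: e.
 by apply/eqP; rewrite -(@eqrXn2 _ 2) ?rnorm_ge0 // e expr1n.
 by rewrite um ?mulr0 //; move: am; rewrite -val_eqE.
 have cu : rnorm (conjc (u m m)) = 1 by rewrite rnorm_conjc.
 rewrite -(gauss2_phase hg _ mN cu) act_phase; apply: (IH m.+1).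
 - by rewrite subnS Nm.
 - by move=> b c bN cN; rewrite ip_phase // ou.
 move=> b a; rewrite ltnS leq_eqVlt => /orP[/eqP ->|bm] aN; rewrite /sphase.
 case: (eqVneq a m) => [->|am]; last by rewrite um.
 by rewrite conjc_mul umm expr1n.
 case: (eqVneq a m) => [->|am]; last by rewrite fu.
 have -> : u b m = 0 by rewrite fu // gtn_eqF.
 by rewrite mulr0 gtn_eqF.
pose n := (m.+1 + l)%N; have nN : (n < N)%N by rewrite /n -addnS.
have mn : m != n by rewrite neq_ltn /n leq_addr.
have nm : (n == m) = false by rewrite eq_sym (negbTE mn).
case: (eqVneq (u m n) 0) => [un0|un0].
 apply: IHl => //; first by rewrite ltnW // -addnS.
 by move=> a; rewrite leq_eqVlt => /orP[/eqP <- //|an] aN; apply: u0 => //; rewrite addnS.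
pose p := u m m; pose q := u m n; pose r := Num.sqrt (rnorm p ^+ 2 + rnorm q ^+ 2).
have q0 : 0 < rnorm q by exact: rnorm_gt0.
have s0 : 0 < rnorm p ^+ 2 + rnorm q ^+ 2 by rewrite ltr_wpDl ?sqr_ge0 // exprn_gt0.
have r0 : 0 < r by rewrite sqrtr_gt0.
have rr : r ^+ 2 = rnorm p ^+ 2 + rnorm q ^+ 2 by rewrite sqr_sqrtr // ltW.
(* With this choice the entry [n] of column [m] becomes [(- q p + p q) / r], which is zero. *)
pose al := conjc p * (r^-1)%:C; pose be := conjc q * (r^-1)%:C.
have ab : rnorm al ^+ 2 + rnorm be ^+ 2 = 1.
 rewrite !rnormM !rnorm_conjc rnorm_real ger0_norm ?invr_ge0 ?ltW // !exprMn -mulrDl -rr -exprMn.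
 by rewrite mulfV ?expr1n // gt_eqF.
rewrite -(gauss2_giv _ mn mN nN ab) act_giv; apply: IHl.
- by rewrite ltnW // -addnS.
- by move=> b c bN cN; rewrite ip_giv // ou.
- move=> b a bm aN; have bm0 : u b m = 0 by rewrite fu // gtn_eqF.
 have bn : (b < n)%N by rewrite /n addSn ltnS ltnW // ltn_addr.
 have bn0 : u b n = 0 by rewrite fu // gtn_eqF.
 rewrite /giv bm0 bn0; case: (eqVneq a m) => [->|am].
 by rewrite !scaler0 addr0 gtn_eqF.
 case: (eqVneq a n) => [->|an]; last by rewrite fu.
 by rewrite !scaler0 addr0 gtn_eqF.
- move=> a; rewrite leq_eqVlt => /orP[/eqP <-|an] aN; rewrite /giv.
 rewrite -/n nm eqxx; have cZ (a1 b1 : R[i]) : a1 *: (b1 : R[i]^o) = a1 * b1 by [].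
 have rl : conjc (r^-1)%:C = (r^-1)%:C by rewrite /= oppr0.
 rewrite !cZ /al /be -/p -/q !rmorphM; rewrite /= in rl; rewrite /= rl !conjcK; ring.
 have am : (a == m) = false by rewrite gtn_eqF // (leq_trans _ an) // ltnS /n addSn leqW // leq_addr.
 have an' : (a == n) = false by rewrite gtn_eqF.
 by rewrite am an' u0 // addnS.
Qed.

End gaussian_unitary.

Section gaussian_contraction.
Context (R : realType) (d : measure_display) (Omega : measurableType d) (P : probability Omega R)
 (X : completeNormedModType R[i]).
Variable g : nat -> Omega -> R[i].
Hypothesis hg : complex_gaussian_sequence P g.
Variable N : nat.
Local Notation gauss2 := (gauss2 P g N).

Lemma measurable_gauss (x : nat -> X) :
 measurable_fun setT (fun w => (rnorm (\sum_(k < N) g k w *: x k) ^+ 2)%:E).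
Proof.
have [mc _ _] := hg.
have -> : (fun w => (rnorm (\sum_(k < N) g k w *: x k) ^+ 2)%:E) =
 (fun w => (rnorm (0 + \sum_(k <- [seq (k, b) | k <- iota 0 N, b <- [:: false; true]])
 (coordinate g k w)%:C *: (if k.2 then 'i *: x k.1 else x k.1)) ^+ 2)%:E).
 apply/funext => w; congr ((rnorm _ ^+ 2)%:E).
 rewrite add0r -(big_mkord xpredT (fun k => g k w *: x k)) /index_iota subn0 big_allpairs_dep /=.
 apply: eq_bigr => k _; rewrite !big_cons big_nil addr0 /coordinate /=; case: (g k w) => a b /=.
 by rewrite scalerA -scalerDl; congr (_ *: _); cparts.
apply/measurable_EFinP; apply: measurable_funX; apply: measurable_rnorm_combination => k _; exact: mc.
Qed.

Lemma gauss2_ge0 (x : nat -> X) : (0 <= gauss2 x)%E.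
Proof. by apply: integral_ge0 => w _; rewrite lee_fin sqr_ge0. Qed.

Lemma gauss2Z c (x : nat -> X) : gauss2 (fun k => c *: x k) = ((rnorm c ^+ 2)%:E * gauss2 x)%E.
Proof.
rewrite /gauss2 -ge0_integralZl //; last 3 first.
- exact: measurable_gauss.
- by move=> w _; rewrite lee_fin sqr_ge0.
- by rewrite lee_fin sqr_ge0.
apply: eq_integral => w _; rewrite -EFinM -exprMn -rnormZ scaler_sumr; congr ((rnorm _ ^+ 2)%:E).
by apply: eq_bigr => k _; rewrite !scalerA mulrC.
Qed.

(** Since [r = l - m] with [l + m = 1], the contracted sum is a convex combination of the original
    one and of the one with the opposite sign at [i]. Both have the same second moment, and the
    square of the norm is convex. *)
Lemma gauss2_real_phase i (r : R) (x : nat -> X) : (i < N)%N -> 0 <= r <= 1 ->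
 (gauss2 (phase i r%:C x) <= gauss2 x)%E.
Proof.
move=> iN /andP[r0 r1]; pose l := (1 + r) / 2; pose m := (1 - r) / 2.
have l0 : 0 <= l by rewrite /l; lra.
have m0 : 0 <= m by rewrite /m; lra.
have lm : l + m = 1 by rewrite /l /m; field.
have mg (y : nat -> X) : measurable_fun setT (fun w => (rnorm (\sum_(k < N) g k w *: y k) ^+ 2)%:E) := measurable_gauss y.
have s0 (y : nat -> X) w : (0 <= (rnorm (\sum_(k < N) g k w *: y k) ^+ 2)%:E)%E by rewrite lee_fin sqr_ge0.
pose y := phase i (- 1) x.
have e1 : gauss2 y = gauss2 x by rewrite (gauss2_phase hg) // rnormN rnorm1.
have -> : gauss2 x = (l%:E * gauss2 x + m%:E * gauss2 y)%E.
 by rewrite e1 -ge0_muleDl ?lee_fin // -EFinD lm mul1e.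
rewrite /gauss2 -!ge0_integralZl // -ge0_integralD //; last 4 first.
- by move=> w _; rewrite mule_ge0.
- by apply: measurable_funeM; exact: mg.
- by move=> w _; rewrite mule_ge0.
- by apply: measurable_funeM; exact: mg.
apply: ge0_le_integral => //.
- by apply: emeasurable_funD; apply: measurable_funeM; exact: mg.
move=> w _; rewrite -!EFinM -EFinD lee_fin.
have -> : \sum_(k < N) g k w *: phase i r%:C x k =
 l%:C *: (\sum_(k < N) g k w *: x k) + m%:C *: (\sum_(k < N) g k w *: y k).
 rewrite !scaler_sumr -big_split; apply: eq_bigr => k _; rewrite /y /phase /=.
 case: eqP => _; last by rewrite -scalerDl -rmorphD /= lm scale1r.
 rewrite !scalerA -scalerDl; congr (_ *: _).
 have -> : r%:C = l%:C - m%:C :> R[i] by rewrite -rmorphB; congr (_%:C); rewrite /l /m; field.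
 ring.
set a := \sum_(k < N) _; set b := \sum_(k < N) _.
have h : rnorm (l%:C *: a + m%:C *: b) <= l * rnorm a + m * rnorm b.
 apply: (le_trans (ler_rnormD _ _)); rewrite !rnormZ !rnorm_real !ger0_norm //.
apply: (@le_trans _ _ ((l * rnorm a + m * rnorm b) ^+ 2)).
 by rewrite lerXn2r // nnegrE ?rnorm_ge0 // addr_ge0 // mulr_ge0 // rnorm_ge0.
have -> : l * rnorm a ^+ 2 + m * rnorm b ^+ 2 = (l * rnorm a + m * rnorm b) ^+ 2 + l * m * (rnorm a - rnorm b) ^+ 2.
 have -> : l = 1 - m by rewrite -lm addrK.
 ring.
by rewrite lerDl mulr_ge0 ?sqr_ge0 // mulr_ge0.
Qed.

Lemma gauss2_contraction (D : nat -> R[i]) (x : nat -> X) : (forall k, (k < N)%N -> rnorm (D k) <= 1) ->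
 (gauss2 (fun k => D k *: x k) <= gauss2 x)%E.
Proof.
move=> D1; pose y n k := if (k < n)%N then D k *: x k else x k.
have step n : (n <= N)%N -> (gauss2 (y n) <= gauss2 x)%E.
 elim: n => [|n IH] nN; first by rewrite (@gauss2_ext _ _ _ P _ g N _ x).
 apply: le_trans (IH (ltnW nN)).
 have [u u1 eu] := unimodular_part (D n).
 rewrite (@gauss2_ext _ _ _ P _ g N _ (phase n (rnorm (D n))%:C (phase n u (y n)))).
 apply: (le_trans (gauss2_real_phase _ nN _)); first by rewrite rnorm_ge0 D1.
 by rewrite (gauss2_phase hg).
 move=> k kN; rewrite /phase /y ltnS leq_eqVlt; case: eqP => [->|//] /=.
 by rewrite ltnn scalerA -eu.
by rewrite (@gauss2_ext _ _ _ P _ g N _ (y N)) ?step // => k kN; rewrite /y kN.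
Qed.

End gaussian_contraction.

Section fourier_matrices.
Context (R : realType).

(** The character [exp (2 pi i t / N)]. A real [t] is allowed because it later runs along the line
    of integration, not only over integers. *)
Definition om (N : nat) (t : R) : R[i] := cexp (0 +i* (2 * pi * t / N%:R)).

Lemma omD N s t : om N (s + t) = om N s * om N t.
Proof. by rewrite /om -cexpD; congr cexp; rewrite mulrDr mulrDl; apply/eqP; rewrite eq_complex /= addr0 !eqxx. Qed.

Lemma om0 N : om N 0 = 1.
Proof. by rewrite /om mulr0 mul0r -[RHS](@cexp0 R). Qed.

Lemma om_conj N t : conjc (om N t) = om N (- t).
Proof.
rewrite /om !cexpE mulrN mulNr rmorphM /expi cosN sinN; congr (_ * _).
by rewrite /= oppr0.
Qed.

Lemma rnorm_om N t : rnorm (om N t) = 1.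
Proof. by rewrite rnorm_cexp /= expR0. Qed.

Lemma om_period N : (0 < N)%N -> om N N%:R = 1.
Proof.
move=> N0; rewrite /om mulfK ?pnatr_eq0 -?lt0n // /cexp /= expR0.
have -> : 2 * pi = pi *+ 2 :> R by rewrite mulr_natl.
by rewrite /expi cos2pi sin2pi mul1r.
Qed.

Lemma omM N t n : om N (t * n%:R) = om N t ^+ n.
Proof. by elim: n => [|n IH]; rewrite ?mulr0 ?om0 // -natr1 mulrDr mulr1 omD IH exprSr. Qed.

Lemma om_sum N (t : R) : (0 < N)%N -> t != 0 -> `|t| < N%:R -> om N (t * N%:R) = 1 ->
 \sum_(a < N) om N (t * a%:R) = 0.
Proof.
move=> N0 t0 tN t1; have N0' : 0 < N%:R :> R by rewrite ltr0n.
have n1 : om N t - 1 != 0.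
 rewrite subr_eq0 -(@cexp0 R) /om (_ : 0 = 0 +i* 0 :> R[i]) //; apply: cexp_neq.
 rewrite subr0 !normrM normfV (gtr0_norm N0') (ger0_norm (pi_ge0 R)) ger0_norm //.
 by rewrite ltr_pdivrMr // ltr_pM2l // mulr_gt0 ?pi_gt0.
 by rewrite eqxx /= !mulf_neq0 ?invr_eq0 ?pnatr_eq0 -?lt0n // gt_eqF ?pi_gt0.
apply: (mulfI n1); rewrite mulr0; under eq_bigr do rewrite omM.
by rewrite -subrX1 -omM t1 subrr.
Qed.

(* The normalized columns of the Fourier matrix of order [N]. *)
Definition fcol (N : nat) (sgn : R) (b a : nat) : R[i] := (Num.sqrt N%:R)^-1%:C * om N (sgn * b%:R * a%:R).

Lemma orth_fcol N (sgn : R) : (0 < N)%N -> sgn ^+ 2 = 1 -> orth N (fcol N sgn).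
Proof.
move=> N0 s1 b c bN cN; have N0' : 0 < N%:R :> R by rewrite ltr0n.
have rl (r : R) : conjc r%:C = r%:C by rewrite /= oppr0.
have sq : (Num.sqrt N%:R)^-1 * (Num.sqrt N%:R)^-1 = N%:R^-1 :> R by rewrite -invfM -expr2 sqr_sqrtr // ltW.
have -> : ip N (fcol N sgn b) (fcol N sgn c) = (N%:R^-1)%:C * \sum_(a < N) om N (sgn * (c%:R - b%:R) * a%:R).
 rewrite /ip mulr_sumr; apply: eq_bigr => a _.
 have -> : conjc (fcol N sgn b a) = (Num.sqrt N%:R)^-1%:C * om N (- (sgn * b%:R * a%:R)).
 by rewrite -om_conj -[X in _ = X * _]rl; exact: rmorphM.
 rewrite mulrACA -realcM sq -omD.
 by congr (_ * om N _); ring.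
have sgn0 : sgn != 0 by apply: contra_eq_neq s1 => ->; rewrite expr0n /= eq_sym oner_eq0.
case: (eqVneq b c) => [->|bc].
 under eq_bigr do rewrite subrr mulr0 mul0r om0.
 rewrite sumr_const card_ord /= -[1 *+ N]/(N%:R) (_ : N%:R = (N%:R)%:C); last by rewrite rmorph_nat.
 by rewrite -realcM mulVf // gt_eqF.
have sn : `|sgn| = 1 by apply/eqP; rewrite -sqr_norm_eq1 // s1.
rewrite om_sum ?mulr0 //.
- rewrite mulf_neq0 // subr_eq0 eqr_nat eq_sym //.
- have bN' : b%:R < N%:R :> R by rewrite ltr_nat.
 have cN' : c%:R < N%:R :> R by rewrite ltr_nat.
 rewrite normrM sn mul1r ltr_norml; move: bN' cN' (ler0n R b) (ler0n R c) => ? ? ? ?.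
 by apply/andP; split; lra.
have p (n : nat) (s : R) : om N (s * n%:R * N%:R) = om N (s * N%:R) ^+ n by rewrite -omM mulrAC.
have per : om N (sgn * N%:R) = 1.
 have : (sgn == 1) || (sgn == -1) by rewrite -eqf_sqr s1 expr1n.
 case/orP => /eqP ->; first by rewrite mul1r om_period.
 by rewrite mulN1r -om_conj om_period // /= oppr0.
rewrite mulrBr mulrBl omD -[X in _ * om N X]mulNr -mulNr p per expr1n mul1r.
have per' : om N (- sgn * N%:R) = 1 by rewrite mulNr -om_conj per /= oppr0.
by rewrite p per' expr1n.
Qed.

End fourier_matrices.

Section type_cotype_fourier.
Context (R : realType) (d : measure_display) (Omega : measurableType d) (P : probability Omega R)
 (X : completeNormedModType R[i]).
Variable g : nat -> Omega -> R[i].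
Hypothesis hg : complex_gaussian_sequence P g.

(** The Fourier multiplier with symbol [D] on the cyclic group of order [N]. Neither Fourier matrix
    is normalised, so the operator is [N] times a product of unitaries and a diagonal. *)
Definition fmult (N : nat) (D : nat -> R[i]) (x : nat -> X) a : X :=
 \sum_(r < N) (om N (a%:R * r%:R) * D r) *: \sum_(b < N) om N (- (b%:R * r%:R)) *: x b.

Lemma gauss2_fmult N kap D (x : nat -> X) : (0 < N)%N -> 0 < kap -> (forall r, (r < N)%N -> rnorm (D r) <= kap) ->
 (gauss2 P g N (fmult N D x) <= ((N%:R * kap) ^+ 2)%:E * gauss2 P g N x)%E.
Proof.
move=> N0 k0 Dk; have N0' : 0 < N%:R :> R by rewrite ltr0n.
pose D' r := D r * (kap^-1)%:C.
pose y := act N (fcol N (- 1)) x.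
have -> : gauss2 P g N (fmult N D x) = gauss2 P g N (fun a => (N%:R * kap)%:C *: act N (fcol N 1) (fun r => D' r *: y r) a).
 apply: gauss2_ext => a aN; rewrite /fmult /act scaler_sumr; apply: eq_bigr => r _.
 rewrite /y /act !scaler_sumr; apply: eq_bigr => b _; rewrite !scalerA; congr (_ *: _).
 rewrite /D' /fcol mul1r [r%:R * a%:R]mulrC mulNr mul1r mulNr.
 set s := (Num.sqrt N%:R)^-1%:C : R[i].
 have e : s * s * (N%:R * kap)%:C * (kap^-1)%:C = 1.
 rewrite -!realcM -expr2 exprVn sqr_sqrtr ?ltW // mulrA mulVf ?gt_eqF // mul1r mulfV ?gt_eqF //.
 move: (om _ _) (om _ _) (D r) => o1 o2 dd; rewrite -[LHS]mulr1 -e; ring.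
have nk : 0 <= N%:R * kap by rewrite mulr_ge0 // ltW.
rewrite gauss2Z // rnorm_real ger0_norm //.
apply: lee_wpmul2l; first by rewrite lee_fin sqr_ge0.
rewrite (gauss2_unitary hg) //; last by apply: orth_fcol => //; rewrite expr1n.
rewrite -[leRHS](gauss2_unitary hg x (v := fcol N (- 1))); last by apply: orth_fcol => //; rewrite sqrrN expr1n.
apply: (gauss2_contraction hg) => r rN; rewrite rnormM rnorm_real ger0_norm ?invr_ge0 ?(ltW k0) //.
by rewrite ler_pdivrMr // mul1r Dk.
Qed.

Lemma powR_add (x r s : R) : 0 < x -> x `^ (r + s) = x `^ r * x `^ s.
Proof. by move=> x0; rewrite powRD // (gt_eqF x0) implybT. Qed.

Lemma power_mean N (q : R) (t : nat -> R) : 1 < q -> (forall a, 0 <= t a) ->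
 \sum_(a < N) t a <= N%:R `^ (1 - q^-1) * (\sum_(a < N) t a `^ q) `^ q^-1.
Proof.
move=> q1 t0; have q0 : 0 < q by lra.
have [->|N0] := posnP N; first by rewrite big_ord0 mulr_ge0 ?powR_ge0.
have N0' : 0 < N%:R :> R by rewrite ltr0n.
set T := (\sum_(a < N) t a `^ q) `^ q^-1.
have S0 : 0 <= \sum_(a < N) t a `^ q by apply: sumr_ge0 => a _; exact: powR_ge0.
have TT : T `^ q = \sum_(a < N) t a `^ q by rewrite /T -powRrM mulVf ?gt_eqF // powRr1.
have := powR_ge0 (\sum_(a < N) t a `^ q) q^-1; rewrite -/T le_eqVlt => /orP[/eqP T0|T0].
 rewrite big1 ?mulr_ge0 ?powR_ge0 -?T0 // => a _.
 have := TT; rewrite -T0 powR0 ?gt_eqF // => /esym e.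
 have z : t a `^ q = 0.
 by apply/eqP; move/eqP: e; rewrite psumr_eq0 => [/allP/(_ a (mem_index_enum _))|i _]; rewrite ?powR_ge0.
 by apply/eqP; move/eqP: z; rewrite powR_eq0 (gt_eqF q0) /= andbT.
(* The scale for which the numbers [(t a / Sc)^q] have mean 1; Young's inequality applied to each
   [t a / Sc] then sums to [N]. *)
pose Sc := T * N%:R `^ (- q^-1).
have Sc0 : 0 < Sc by rewrite mulr_gt0 // powR_gt0.
have -> : N%:R `^ (1 - q^-1) * T = N%:R * Sc.
 by rewrite /Sc powR_add // powRr1 ?(ltW N0') //; ring.
have ScN : Sc `^ q = (\sum_(a < N) t a `^ q) / N%:R.
 rewrite /Sc powRM ?powR_ge0 ?(ltW T0) // TT; congr (_ * _).
 by rewrite -powRrM mulNr mulVf ?gt_eqF // powR_inv1 // ltW.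
pose q' := (1 - q^-1)^-1.
have iq : q^-1 < 1 by rewrite invf_lt1.
have q'0 : 0 < q' by rewrite invr_gt0 subr_gt0.
have cc : q^-1 + q'^-1 = 1 by rewrite /q' invrK addrC subrK.
have one a : t a / Sc <= (t a / Sc) `^ q / q + q'^-1.
 have := conjugate_powR (divr_ge0 (t0 a) (ltW Sc0)) ler01 q0 q'0 cc.
 by rewrite mulr1 powR1 mul1r.
rewrite -ler_pdivrMr // mulr_suml; apply: (@le_trans _ _ (\sum_(a < N) ((t a / Sc) `^ q / q + q'^-1))); first exact: ler_sum.
rewrite big_split /= sumr_const card_ord -mulr_suml.
have -> : \sum_(a < N) (t a / Sc) `^ q = N%:R.
 under eq_bigr do rewrite powRM ?invr_ge0 ?(ltW Sc0) //.
 have e : Sc^-1 `^ q = (Sc `^ q)^-1 by rewrite -powR_inv1 ?(ltW Sc0) // -powRrM mulN1r powRN.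
 by rewrite -mulr_suml e ScN invfM invrK mulrA mulfV ?mul1r // -TT gt_eqF // powR_gt0.
have -> : N%:R / q + q'^-1 *+ N = N%:R * (q^-1 + q'^-1) by rewrite mulrDr -[q'^-1 *+ N]mulr_natl.
by rewrite cc mulr1.
Qed.

Variables (p q : R).
Hypotheses (p1 : 1 <= p) (q1 : 1 < q) (htype : has_type P g X p) (hcotype : has_cotype P g X q).

(** The factors are [N kap] from the unnormalised Fourier matrices and the contraction principle,
    [N^(1/p) B] from type, and [N^(1 - 1/q)] from Hoelder after cotype. *)
Lemma fourier_multiplier_bound : exists2 C : R, 0 <= C & forall N kap B D (x : nat -> X), (0 < N)%N -> 0 < kap ->
 0 <= B -> (forall r, (r < N)%N -> rnorm (D r) <= kap) -> (forall b, (b < N)%N -> rnorm (x b) <= B) ->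
 \sum_(a < N) rnorm (fmult N D x a) <= C * kap * B * N%:R ^+ 2 * N%:R `^ (p^-1 - q^-1).
Proof.
have [C1 h1] := htype; have [C2 h2] := hcotype.
exists (`|C2| * `|C1|) => [|N kap B D x N0 k0 B0 hD hx]; first by rewrite mulr_ge0.
have N0' : 0 < N%:R :> R by rewrite ltr0n.
have p0 : 0 < p by exact: lt_le_trans ltr01 p1.
have hz : (\sum_(a < N) rnorm (fmult N D x a) `^ q) `^ q^-1 <= `|C2| * (N%:R * kap * (`|C1| * (N%:R `^ p^-1 * B))).
 rewrite -lee_fin; apply: (le_trans (h2 N _)).
 have n0 (y : nat -> X) : (0 <= gaussian_norm P g N y)%E by exact: poweR_ge0.
 apply: (@le_trans _ _ (`|C2|%:E * gaussian_norm P g N (fmult N D x))%E).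
 by apply: lee_wpmul2r => //; rewrite lee_fin ler_norm.
 rewrite [in leRHS]EFinM; apply: lee_wpmul2l; first by rewrite lee_fin.
 have h3 : (gaussian_norm P g N (fmult N D x) <= (N%:R * kap)%:E * gaussian_norm P g N x)%E.
 have nk : 0 <= N%:R * kap by rewrite mulr_ge0 // ltW.
 apply: (@le_trans _ _ ((((N%:R * kap) ^+ 2)%:E * gauss2 P g N x) `^ 2^-1)%E).
 have i0 (a : \bar R) : (0 <= a)%E -> a \in `[0%E, +oo%E] by move=> a0; rewrite in_itv /= a0 leey.
 apply: gt0_ler_poweR; rewrite ?invr_ge0 //; last exact: gauss2_fmult.
 by apply: i0; exact: gauss2_ge0.
 by apply: i0; rewrite mule_ge0 ?gauss2_ge0 // lee_fin sqr_ge0.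
 rewrite poweRM ?lee_fin ?sqr_ge0 ?gauss2_ge0 //.
 by rewrite poweR_EFin -powR_mulrn // -powRrM mulfV // powRr1.
 apply: (le_trans h3); rewrite [in leRHS]EFinM; apply: lee_wpmul2l; first by rewrite lee_fin mulr_ge0 // ltW.
 apply: (le_trans (h1 N x)); rewrite lee_fin.
 have sb : (\sum_(k < N) rnorm (x k) `^ p) `^ p^-1 <= N%:R `^ p^-1 * B.
 have -> : N%:R `^ p^-1 * B = (N%:R * B `^ p) `^ p^-1.
 by rewrite powRM ?powR_ge0 ?(ltW N0') // -powRrM mulfV ?gt_eqF // powRr1.
 apply: ge0_ler_powR; rewrite ?nnegrE ?invr_ge0 ?(ltW p0) ?mulr_ge0 ?powR_ge0 ?(ltW N0') //.
 by apply: sumr_ge0 => k _; exact: powR_ge0.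
 apply: (@le_trans _ _ (\sum_(k < N) B `^ p)); last by rewrite sumr_const card_ord mulr_natl.
 by apply: ler_sum => k _; apply: ge0_ler_powR; rewrite ?nnegrE ?rnorm_ge0 ?(ltW p0) ?hx.
 apply: (@le_trans _ _ (`|C1| * (\sum_(k < N) rnorm (x k) `^ p) `^ p^-1)).
 by rewrite ler_wpM2r ?powR_ge0 // ler_norm.
 by rewrite ler_wpM2l.
apply: (le_trans (power_mean N q1 (fun a => rnorm_ge0 _))).
apply: (le_trans (ler_wpM2l (powR_ge0 _ _) hz)).
have -> : N%:R `^ (1 - q^-1) = N%:R * N%:R `^ (- q^-1) :> R.
 by rewrite powR_add // powRr1 // ltW.
have -> : N%:R `^ (p^-1 - q^-1) = N%:R `^ p^-1 * N%:R `^ (- q^-1) :> R by rewrite powR_add.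
by apply: eq_ler; ring.
Qed.

End type_cotype_fourier.

(** * One dyadic block *)

Section periodization.
Context (R : realType).
Local Notation RM := (measurableTypeR R).
Let mu := @lebesgue_measure R.

(** Mean value theorem for [atan] on [[v, v + 1]], where [1 + c^2 <= 3 (1 + v^2)]. Sums of [rho]
    over integer translates then telescope to at most [3 pi]. *)
Lemma rho_atan (v : R) : rho v <= 3 * (atan (v + 1) - atan v).
Proof.
have [||c] := @MVT R atan (fun x => (1 + x ^+ 2)^-1) v (v + 1).
- by rewrite ltrDl.
- by apply: continuous_subspaceT => x; exact: continuous_atan.
rewrite in_itv /= => /andP[c1 c2] ->; rewrite [v + 1]addrC addrK mulr1 -/(rho c).
have h : 1 + c ^+ 2 <= 3 * (1 + v ^+ 2).
 pose d := c - v; have -> : c = v + d by rewrite /d addrC subrK.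
 have d0 : 0 < d by rewrite /d; lra.
 have d1 : d < 1 by rewrite /d; lra.
 have := sqr_ge0 (v - d); have : d * d <= 1 * 1 by rewrite ler_pM // ltW.
 by rewrite -expr2; nra.
rewrite /rho -ler_pdivrMl // -invfM lef_pV2 ?posrE //; last by rewrite ltr_pwDl // sqr_ge0.
by rewrite mulr_gt0 // ltr_pwDl // sqr_ge0.
Qed.

Lemma rho_sum (u : R) m : \sum_(l < m) rho (u + l%:R) <= 3 * pi.
Proof.
have h n : \sum_(l < n) rho (u + l%:R) <= 3 * (atan (u + n%:R) - atan u).
 elim: n => [|n IH]; first by rewrite big_ord0 addr0 subrr mulr0.
 rewrite big_ord_recr /=; have := rho_atan (u + n%:R); rewrite -[n.+1%:R]natr1 addrA.
 by move: IH; lra.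
apply: (le_trans (h m)); have := atan_ltpi2 (u + m%:R); have := atan_gtNpi2 u.
by lra.
Qed.

Lemma sum_blocks (V : nmodType) (F : nat -> V) m N :
 \sum_(j < m * N) F j = \sum_(r < N) \sum_(l < m) F (r + l * N)%N.
Proof.
rewrite -(big_mkord xpredT F) big_nat_mul big_mkord exchange_big /=; apply: eq_bigr => l _.
rewrite -{1}[(l * N)%N]add0n big_addn mulSn addnK big_mkord.
by [].
Qed.

Lemma Rintegral_units (f : R -> R) (a : R) m : continuous f ->
 \int[mu]_(t in `[a, a + m%:R]) f t = \int[mu]_(t in `[0, 1]) \sum_(j < m) f (t + (a + j%:R)).
Proof.
move=> cf; elim: m => [|m IH].
 rewrite addr0 set_itv1 Rintegral_set1; under eq_Rintegral do rewrite big_ord0.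
 by rewrite Rintegral_cst // mul0r.
have ii (g : R -> R) (p q : R) : continuous g -> mu.-integrable (`[p, q]%classic : set RM) (EFin \o g).
 move=> cg; apply: continuous_compact_integrable; first exact: segment_compact.
 exact: continuous_subspaceT.
have ct (c : R) : continuous (fun t => f (t + c)).
 move=> t; apply: (@continuous_comp _ _ _ (fun t : R => t + c) f); last exact: cf.
 by apply: cvgD; [exact: cvg_id|exact: cvg_cst].
have cs n : continuous (fun t => \sum_(j < n) f (t + (a + j%:R))).
 elim: n => [|n IHn] t; first by under eq_fun do rewrite big_ord0; exact: cvg_cst.
 by under eq_fun do rewrite big_ord_recr; apply: cvgD; [exact: IHn|exact: ct].
under [RHS]eq_Rintegral do rewrite big_ord_recr.
rewrite [RHS]RintegralD //; [|exact: ii|exact: ii].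
rewrite -IH; have /= <- := @Rintegral_shift R f 0 1 (a + m%:R) ler01 cf.
rewrite add0r [1 + _]addrC -addrA natr1.
have /= e1 := @Rintegral_itvB _ f (BLeft a) (BRight (a + m.+1%:R)) (a + m%:R) (ii _ _ _ cf).
rewrite -(@Rintegral_itv_obnd_cbnd _ (a + m%:R) (BRight (a + m.+1%:R))); last first.
 have mi (I : interval R) : measurable ([set` I] : set RM) by exact: measurable_itv.
 apply: (integrableS (mi _) (mi _) _ (ii f (a + m%:R) (a + m.+1%:R) cf)).
 by apply: subset_itvr; rewrite bnd_simp.
rewrite -e1 ?bnd_simp ?lerDl // ?lerD2l ?ler_nat //.
by rewrite [RHS]addrC subrK.
Qed.

(* Cutting the line into unit intervals and summing over the integer translates. *)
Lemma Rintegral_le_translates (f : R -> R) (K : R) N : (0 < N)%N -> continuous f ->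
 mu.-integrable [set: RM] (EFin \o f) ->
 (forall c m, \sum_(j < m * N) f (c + j%:R) <= K) -> \int[mu]_t f t <= K.
Proof.
move=> N0 cf fi fK.
have h m : \int[mu]_(t in `[(- (m * N)%:R), (m * N)%:R]) f t <= K.
 have ex : - (m * N)%:R + (2 * m * N)%:R = (m * N)%:R :> R.
 by rewrite -mulnA mul2n -addnn natrD addKr.
 have := @Rintegral_units f (- (m * N)%:R) (2 * m * N) cf; rewrite ex => ->.
 have c1 : \int[mu]_(t in `[(0 : R), 1]) K = K.
 by rewrite Rintegral_cst // fine_lebesgue_itv // subr0 mulr1.
 rewrite -[leRHS]c1; apply: le_Rintegral => //.
 - apply: continuous_compact_integrable; first exact: segment_compact.
 apply: continuous_subspaceT; elim: (2 * m * N)%N => [|n IHn] t.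
 by under eq_fun do rewrite big_ord0; exact: cvg_cst.
 under eq_fun do rewrite big_ord_recr; apply: cvgD; first exact: IHn.
 apply: (@continuous_comp _ _ _ (fun t : R => t + (- (m * N)%:R + n%:R)) f); last exact: cf.
 by apply: cvgD; [exact: cvg_id|exact: cvg_cst].
 - apply: continuous_compact_integrable; first exact: segment_compact.
 by apply: continuous_subspaceT => t; exact: cvg_cst.
 - by move=> t _; under eq_bigr do rewrite addrA; exact: fK.
have s : \int[mu]_(t in `[(- (m * N)%:R), (m * N)%:R]) f t @[m --> \oo] --> \int[mu]_t f t.
 apply: (@cvg_comp _ _ _ (fun m => (m * N)%N) (fun n => \int[mu]_(t in `[(- n%:R), n%:R]) f t) _ \oo _ _ (Rintegral_growing fi)).
 by move=> A [n _ hn]; exists n => // m nm; apply: hn; rewrite /= (leq_trans nm) ?leq_pmulr.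
rewrite -(cvg_lim (@Rhausdorff R) s); apply: limr_le; first exact: (cvgP _ s).
exact: nearW.
Qed.

End periodization.

Section block_estimate.
Context (R : realType) (X : completeNormedModType R[i]).
Local Notation RM := (measurableTypeR R).
Let mu := @lebesgue_measure R.
Variables (C0 p q : R).
Hypotheses (C00 : 0 <= C0)
 (hF : forall N kap B D (x : nat -> X), (0 < N)%N -> 0 < kap ->
 0 <= B -> (forall r, (r < N)%N -> rnorm (D r) <= kap) -> (forall b, (b < N)%N -> rnorm (x b) <= B) ->
 \sum_(a < N) rnorm (fmult N D x a) <= C0 * kap * B * N%:R ^+ 2 * N%:R `^ (p^-1 - q^-1)).

Lemma om_nat N (a r l : nat) : (0 < N)%N -> om N (a%:R * (r + l * N)%:R) = om N (a%:R * r%:R) :> R[i].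
Proof.
move=> N0; have -> : a%:R * (r + l * N)%:R = a%:R * r%:R + N%:R * (a * l)%:R :> R.
 by rewrite natrD !natrM; ring.
by rewrite omD (omM N N%:R) om_period // expr1n mulr1.
Qed.

Lemma om_natN N (a r l : nat) : (0 < N)%N -> om N (- (a%:R * (r + l * N)%:R)) = om N (- (a%:R * r%:R)) :> R[i].
Proof. by move=> N0; rewrite -!om_conj om_nat. Qed.

Lemma tcont_om N (k t : R) : tcont (fun t => om N (k * t) : R[i]) t.
Proof.
have -> : (fun t => om N (k * t)) = (fun t : R => iexp t (2 * pi * k / N%:R)%:C).
 apply/funext => u; rewrite /om /iexp; congr cexp.
 by apply/eqP; rewrite eq_complex /=; apply/andP; split; apply/eqP; ring.
exact: tcont_iexp.
Qed.

Lemma tcont_sum (V : normedModType R[i]) (F : nat -> R -> V) n t : (forall b, tcont (F b) t) ->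
 tcont (fun t => \sum_(b < n) F b t) t.
Proof.
move=> cF; elim: n => [|n IH].
 by move=> e e0; exists 1 => // u _; rewrite !big_ord0 subrr rnorm0.
have c0 : tcont (fun t => 0 - F n t) t.
 by apply: tcontB => // e e0; exists 1 => // u _; rewrite subrr rnorm0.
have -> : (fun t => \sum_(b < n.+1) F b t) = (fun t => \sum_(b < n) F b t - (0 - F n t)).
 by apply/funext => u; rewrite big_ord_recr /= sub0r opprK.
exact: tcontB.
Qed.

Lemma integrable_sum (g : nat -> R -> R) n : (forall a, mu.-integrable [set: RM] (EFin \o g a)) ->
 mu.-integrable [set: RM] (EFin \o (fun t => \sum_(a < n) g a t)) /\
 \int[mu]_t (\sum_(a < n) g a t) = \sum_(a < n) \int[mu]_t g a t.
Proof.
move=> ig; elim: n => [|n [IH1 IH2]].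
 split; last by rewrite big_ord0; under eq_Rintegral do rewrite big_ord0; rewrite Rintegral_cst // mul0r.
 by apply: (eq_rintegrable (f := fun=> 0)) => [||t _]; rewrite ?big_ord0 //; exact: integrable0.
have e t : \sum_(a < n.+1) g a t = \sum_(a < n) g a t + g n t by rewrite big_ord_recr.
split.
 have i2 := integrableD measurableT IH1 (ig n).
 by apply: (eq_rintegrable (f := fun t => \sum_(a < n) g a t + g n t) measurableT) => [|t _]; [exact: i2|rewrite e].
by under eq_Rintegral do rewrite e; rewrite RintegralD // IH2 big_ord_recr.
Qed.

(* The periodization of [G] with period [N] turns the integral operator into an
 average of Fourier multipliers on the cyclic group of order [N]. *)
Lemma rfun_sum (l : X -> R) : rfun l -> forall K (F : nat -> X), \sum_(j < K) l (F j) = l (\sum_(j < K) F j).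
Proof.
move=> [lD _ _] K F; have l0 : l 0 = 0 by have := lD 0 0; rewrite addr0; lra.
by elim: K => [|K IH]; rewrite ?big_ord0 // !big_ord_recr /= IH lD.
Qed.

(** Norming functionals turn the sum of norms into one scalar integral. At integer translates the
    characters depend, up to phases from the offset [c], only on the residue modulo [N]; the values
    of [G] over a residue class are summed first, and this sum is the symbol, at most [A] times
    [3 pi] by [rho_sum]. *)
Lemma toeplitz_bound N (G : R -> R[i]) (A B : R) (x : nat -> X) (Y : nat -> X) : (0 < N)%N ->
 0 < A -> 0 <= B -> (forall t, tcont G t) -> (forall t, rnorm (G t) <= A * rho (t / N%:R)) ->
 (forall b, (b < N)%N -> rnorm (x b) <= B) ->
 (forall a, is_wint [set: RM]
 (fun t => \sum_(b < N) (G t * om N (a%:R * t) * om N (- (b%:R * t))) *: x b) (Y a)) ->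
 \sum_(a < N) rnorm (Y a) <= C0 * (A * (3 * pi)) * B * N%:R ^+ 2 * N%:R `^ (p^-1 - q^-1).
Proof.
move=> N0 A0 B0 cG bG xB wY; have N0' : 0 < N%:R :> R by rewrite ltr0n.
have /choice[l hl] : forall a, exists l : X -> R, rfun l /\ l (Y a) = rnorm (Y a).
 by move=> a; have [l rl e] := hahn_banach (Y a); exists l.
pose term a t := \sum_(b < N) (G t * om N (a%:R * t) * om N (- (b%:R * t))) *: x b.
pose f t := \sum_(a < N) l a (term a t).
have cterm a t : tcont (term a) t.
 apply: (tcont_sum (F := fun b t => (G t * om N (a%:R * t) * om N (- (b%:R * t))) *: x b)) => b.
 apply: tcontZZ; last by move=> e e0; exists 1 => // u _; rewrite subrr rnorm0.
 apply: (tcontZZ (V := R[i]^o) (k := fun t => G t * om N (a%:R * t))).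
 exact: (tcontZZ (V := R[i]^o) (cG t) (tcont_om N a%:R t)).
 have -> : (fun t => om N (- (b%:R * t)) : R[i]^o) = (fun t => om N ((- b%:R) * t)).
 by apply/funext => u; rewrite mulNr.
 exact: tcont_om.
have fi : mu.-integrable [set: RM] (EFin \o f) /\ \int[mu]_t f t = \sum_(a < N) rnorm (Y a).
 have [i1 e1] := integrable_sum N (fun a => proj1 (wY a (l a) (hl a).1)); split; first exact: i1.
 by rewrite /f e1; apply: eq_bigr => a _; rewrite (proj2 (wY a (l a) (hl a).1)) (hl a).2.
have [ii <-] := fi.
apply: (Rintegral_le_translates N0) => //.
 have cf n : continuous (fun t => \sum_(a < n) l a (term a t)).
 elim: n => [|n IHn] t; first by under eq_fun do rewrite big_ord0; exact: cvg_cst.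
 under eq_fun do rewrite big_ord_recr; apply: cvgD; first exact: IHn.
 exact: (@tcont_real R X (term n) (l n) t (cterm n t) (fun u v => rfun_lip u v (hl n).1)).
 exact: cf.
move=> c m; rewrite (sum_blocks (fun j => f (c + j%:R)) m N).
pose D r := \sum_(l0 < m) G (c + (r + l0 * N)%:R).
pose x' b := om N (- (b%:R * c)) *: x b.
have key r : \sum_(l0 < m) f (c + (r + l0 * N)%:R) =
 \sum_(a < N) l a (om N (a%:R * c) *: ((om N (a%:R * r%:R) * D r) *: \sum_(b < N) om N (- (b%:R * r%:R)) *: x' b)).
 rewrite exchange_big /=; apply: eq_bigr => a _.
 rewrite (rfun_sum (hl a).1 m (fun l0 => term a (c + (r + l0 * N)%:R))); congr (l a _).
 rewrite /term exchange_big /= scaler_sumr scaler_sumr; apply: eq_bigr => b _.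
 rewrite -scaler_suml !scalerA; congr (_ *: _).
 transitivity (om N (a%:R * c) * om N (a%:R * r%:R) * (om N (- (b%:R * r%:R)) * om N (- (b%:R * c))) * D r); last by ring.
 rewrite /D mulr_sumr; apply: eq_bigr => j _.
 rewrite [a%:R * _]mulrDr [b%:R * _]mulrDr opprD !omD om_nat // om_natN //.
 by ring.
under eq_bigr do rewrite key.
rewrite exchange_big /=.
have le1 a : \sum_(r < N) l a (om N (a%:R * c) *: ((om N (a%:R * r%:R) * D r) *: \sum_(b < N) om N (- (b%:R * r%:R)) *: x' b)) <=
 rnorm (fmult N D x' a).
 have [lD lZ ln] := (hl a).1.
 rewrite (rfun_sum (hl a).1 N (fun r => om N (a%:R * c) *: ((om N (a%:R * r%:R) * D r) *: \sum_(b < N) om N (- (b%:R * r%:R)) *: x' b))).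
 rewrite -scaler_sumr; apply: (le_trans (ler_norm _)); apply: (le_trans (ln _)).
 by rewrite rnormZ rnorm_om mul1r.
apply: (@le_trans _ _ (\sum_(a < N) rnorm (fmult N D x' a))); first by apply: ler_sum => a _; exact: le1.
apply: hF => //.
- by rewrite mulr_gt0 // mulr_gt0 // pi_gt0.
- move=> r rN; apply: (le_trans (ler_rnorm_sum _ _ _)).
 apply: (@le_trans _ _ (\sum_(l0 < m) A * rho ((c + r%:R) / N%:R + l0%:R))).
 apply: ler_sum => j _; apply: (le_trans (bG _)); rewrite natrD natrM addrA [X in rho X]mulrDl mulfK ?gt_eqF //.
 by rewrite -mulr_sumr ler_pM2l // rho_sum.
- by move=> b bN; rewrite rnormZ rnorm_om mul1r xB.
Qed.

Lemma iexp_om N (k t eta : R) : (0 < N)%N ->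
 iexp (k * (2 * pi / N%:R)) (t +i* eta) = (expR (- (k * (2 * pi / N%:R) * eta)))%:C * om N (k * t) :> R[i].
Proof.
move=> N0; have rc (r : R) : (expR r)%:C = cexp (r +i* 0) :> R[i].
 by rewrite cexpE /expi cos0 sin0 [_ +i* _](_ : _ = 1) ?mulr1.
rewrite rc /om /iexp -cexpD; congr cexp; apply/eqP; rewrite eq_complex /=; apply/andP; split; apply/eqP; ring.
Qed.

Variables (U : R -> {linear X -> X}) (th M e b : R).
Hypotheses (hU : C0_group U) (M0 : 0 <= M) (th0 : 0 <= th) (the : th < e) (eb : e < b)
 (Ub : forall s x, rnorm (U s x) <= M * expR (th * `|s|) * rnorm x).

(** The integral does not change when [s] is translated, so [N^2 y] is the sum over all pairs of the
    integral translated by [(k - j) h], with [h = 2 pi / N]. As [k h] and [j h] stay below [2 pi],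
    the operators [U (k h)] and [U (- j h)] are bounded uniformly in [N]. What is left is a Toeplitz
    matrix in [k - j], whose bound contains a factor [N^2] that cancels. *)
Lemma block_bound : exists2 C : R, 0 <= C & forall N (H : R[i] -> R[i]) a a' x y, (0 < N)%N -> 0 < a ->
 0 <= a' -> strip_decay2 H b a' -> (forall t s, `|s| < b -> rnorm (H (t +i* s)) <= a * rho (t / N%:R)) ->
 is_wint [set: RM] (fun s => kern H s *: U s x) y ->
 rnorm y <= C * a * N%:R `^ (p^-1 - q^-1) * rnorm x.
Proof.
have pi0 := @pi_gt0 R; have e0 : 0 < e by exact: le_lt_trans the.
have b0 : 0 < b by exact: lt_trans eb.
pose E := expR (2 * pi * e); pose T := expR (th * (2 * pi)).
have E0 : 0 <= E by exact: expR_ge0.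
have T0 : 0 <= T by exact: expR_ge0.
exists (C0 * (3 * pi) * (E * (M * T)) * E * (M * T) * M * expc (e - th) * Irho R).
 by rewrite mulr_ge0 ?Irho_ge0 // mulr_ge0 ?expc_ge0 // !mulr_ge0 // ltW.
move=> N H a a' x y N0 a0 a'0 sdH Ha wy; have N0' : 0 < N%:R :> R by rewrite ltr0n.
pose h := 2 * pi / N%:R : R; pose N2 : R := N%:R ^+ 2; pose Nt : R := N%:R `^ (p^-1 - q^-1).
have h0 : 0 <= h by rewrite divr_ge0 ?mulr_ge0 ?ltW.
have ah (k : nat) : (k < N)%N -> 0 <= k%:R * h <= 2 * pi.
 move=> kN; rewrite mulr_ge0 //= /h mulrA ler_pdivrMr // mulrC ler_pM2l ?mulr_gt0 //.
 by rewrite ler_nat ltnW.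
(* Row [k] of the Toeplitz matrix applied to the vectors [U (- j h) x]; [U s] and [U (k h)] are
   split off by the group law and restored in [W]. *)
pose Z k s := \sum_(j < N) kern H (s + (k%:R - j%:R) * h) *: U (- (j%:R * h)) x.
have Uh (k : nat) z : (k < N)%N -> rnorm (U (k%:R * h) z) <= M * T * rnorm z /\ rnorm (U (- (k%:R * h)) z) <= M * T * rnorm z.
 move=> /ah/andP[k0 k1]; split; apply: (le_trans (Ub _ _)); rewrite ler_wpM2r ?rnorm_ge0 // ler_wpM2l // ler_expR ler_wpM2l //.
 by rewrite ger0_norm.
 by rewrite normrN ger0_norm.
have Zb s : \sum_(k < N) rnorm (Z k s) <= C0 * (3 * pi) * (E * (M * T)) * E * a * N2 * Nt * rnorm x * expR (- (e * `|s|)).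
 (* The line is moved in the direction of the sign of [s], which yields the decay [exp (- e s)] in
    the absolute value of [s], stronger than the growth of the group. *)
 pose bt := if 0 <= s then e else - e.
 have btb : `|bt| < b by rewrite /bt; case: ifP => _; rewrite ?normrN gtr0_norm.
 have sbt : s * bt = e * `|s|.
 rewrite /bt; case: (leP 0 s) => s0; first by rewrite ger0_norm // mulrC.
 by rewrite ltr0_norm // !mulrN mulrC.
 have bte : `|bt| <= e by rewrite /bt; case: ifP => _; rewrite ?normrN gtr0_norm.
 pose G t := H (t +i* bt) * iexp s (t +i* bt).
 pose x' (j : nat) := (expR (j%:R * h * bt))%:C *: U (- (j%:R * h)) x.
 have Eb (k : nat) : (k < N)%N -> expR (k%:R * h * bt) <= E /\ expR (- (k%:R * h * bt)) <= E.
 move=> /ah/andP[k0 k1]; have hb : `|k%:R * h * bt| <= 2 * pi * e.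
 by rewrite normrM ger0_norm // ler_pM.
 by move: hb; rewrite ler_norml => /andP[q1 q2]; rewrite !ler_expR; split=> //; rewrite lerNl.
 pose Y (k : nat) := ((2 * pi) * expR (k%:R * h * bt))%:C *: Z k s.
 have A0 : 0 < a * expR (- (e * `|s|)) by rewrite mulr_gt0 // expR_gt0.
 have cH t : ccont H (t +i* bt) by exact/cdiff_ccont/(sdH t _ btb).1.
 have tG t : tcont G t.
 by apply: (tcont_h (F := fun w => H w * iexp s w)); apply: ccontM; [exact: cH|exact/cdiff_ccont/cdiff_iexp].
 have bG t : rnorm (G t) <= a * expR (- (e * `|s|)) * rho (t / N%:R).
 by rewrite rnormM rnorm_iexp sbt mulrAC ler_wpM2r ?expR_ge0 // Ha.
 have B0 : 0 <= E * (M * T) * rnorm x by rewrite !mulr_ge0 ?rnorm_ge0.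
 have xB (j : nat) : (j < N)%N -> rnorm (x' j) <= E * (M * T) * rnorm x.
 move=> jN; rewrite rnormZ rnorm_real ger0_norm ?expR_ge0 // -[leRHS]mulrA ler_pM ?rnorm_ge0 ?expR_ge0 //.
 exact: (Eb j jN).1.
 exact: (Uh j x jN).2.
 have wY (k : nat) : is_wint [set: RM]
 (fun t => \sum_(j < N) (G t * om N (k%:R * t) * om N (- (j%:R * t))) *: x' j) (Y k).
 rewrite /Y /Z scaler_sumr; apply: (wint_sum (index_enum 'I_N) measurableT) => j.
 set s' := s + (k%:R - j%:R) * h.
 have lw : is_wint (V := R[i]^o) [set: RM] (fun t => H (t +i* bt) * iexp s' (t +i* bt)) (lint (fun w => H w * iexp s' w) bt).
 apply: (@line_wint _ (fun w => H w * iexp s' w) bt (a' * expR (- (s' * bt)))) => t.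
 by apply: ccontM; [exact: cH|exact/cdiff_ccont/cdiff_iexp].
 rewrite rnormM rnorm_iexp mulrAC ler_wpM2r ?expR_ge0 //.
 by apply: (le_trans (sdH t _ btb).2); rewrite ler_wpM2l // rho_sqr_le.
 have := wint_map measurableT (rlinear_scalel ((expR (k%:R * h * bt))%:C *: U (- (j%:R * h)) x)) lw => w.
 have pp : (2 * pi)%:C * (2 * pi)^-1%:C = 1 :> R[i] by rewrite -realcM mulfV // gt_eqF // mulr_gt0.
 have -> : (2 * pi * expR (k%:R * h * bt))%:C *: (kern H s' *: U (- (j%:R * h)) x) =
 lint (fun w => H w * iexp s' w) bt *: ((expR (k%:R * h * bt))%:C *: U (- (j%:R * h)) x).
 rewrite (kern_shift b0 a'0 sdH s' btb) !scalerA; congr (_ *: _).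
 move: (lint _ _) => L; rewrite realcM; move: pp; move: ((2 * pi)%:C) ((2 * pi)^-1%:C) => c1 c2 pp.
 by move: (expR _)%:C => ee; rewrite -[RHS]mul1r -pp; ring.
 apply: wint_eq w _ => // t _; rewrite /= /x' !scalerA; congr (_ *: _).
 have -> : iexp s' (t +i* bt) = iexp s (t +i* bt) * iexp (k%:R * h) (t +i* bt) * iexp (- j%:R * h) (t +i* bt) :> R[i].
 by rewrite /s' (_ : s + _ = (s + k%:R * h) + - j%:R * h) ?iexpD //; ring.
 rewrite !iexp_om // !mulNr opprK /G -/h expRN.
 have ek : (expR (k%:R * h * bt))^-1%:C * (expR (k%:R * h * bt))%:C = 1 :> R[i].
 by rewrite -realcM mulVf // gt_eqF // expR_gt0.
 move: ek; move: ((expR (k%:R * h * bt))^-1%:C) ((expR (k%:R * h * bt))%:C) => c1 c2 ek.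
 move: (H _) (iexp _ _) (om _ _) (om _ _) ((expR _)%:C) => hh ii o1 o2 ee.
 by rewrite -[RHS]mul1r -ek; ring.
 have := toeplitz_bound N0 A0 B0 tG bG xB wY => hY.
 apply: (@le_trans _ _ (E * \sum_(k < N) rnorm (Y k))).
 rewrite mulr_sumr; apply: ler_sum => k _; rewrite /Y rnormZ rnorm_real ger0_norm; last first.
 by rewrite !mulr_ge0 ?expR_ge0 // ltW.
 have kN := ltn_ord k; have z0 := rnorm_ge0 (Z k s).
 have e1 : 1 <= E * expR (k%:R * h * bt).
 rewrite -[X in X <= _](expRxMexpNx_1 (k%:R * h * bt)) mulrC ler_wpM2r ?expR_ge0 //.
 exact: (Eb k kN).2.
 have p2 := pi_ge2 R; move: (expR _) e1 => ee e1.
 rewrite (_ : E * _ = (2 * pi * (E * ee)) * rnorm (Z k s)); last by ring.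
 rewrite -[leLHS]mul1r ler_wpM2r // -[leLHS]mul1r; apply: ler_pM => //; by move: p2; lra.
 apply: (le_trans (ler_wpM2l E0 hY)); apply: eq_ler; rewrite -/N2 -/Nt; ring.
pose W s := \sum_(k < N) U s (U (k%:R * h) (Z k s)).
have wW : is_wint [set: RM] W (\sum_(k < N) \sum_(j < N) y).
 have [_ _ UD _] := hU.
 have w1 : is_wint [set: RM] (fun s => \sum_(k < N) \sum_(j < N) kern H (s + (k%:R - j%:R) * h) *: U (s + (k%:R - j%:R) * h) x)
 (\sum_(k < N) \sum_(j < N) y).
 by apply: (wint_sum (index_enum 'I_N) measurableT) => k; apply: (wint_sum (index_enum 'I_N) measurableT) => j; exact: (wint_shift _ wy).
 apply: (wint_eq measurableT w1) => s _.
 apply: eq_bigr => k _; rewrite /Z !linear_sum; apply: eq_bigr => j _; rewrite [U (k%:R * h) (_ *: _)]linearZ [U s (_ *: _)]linearZ /=; congr (_ *: _).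
 by rewrite -!UD; congr (U _ x); ring.
have bW s : rnorm (W s) <= C0 * (3 * pi) * (E * (M * T)) * E * (M * T) * M * expc (e - th) * a * N2 * Nt * rnorm x * rho s.
 apply: (le_trans (ler_rnorm_sum _ _ _)).
 apply: (@le_trans _ _ (\sum_(k < N) M * expR (th * `|s|) * (M * T * rnorm (Z k s)))).
 apply: ler_sum => k _; apply: (le_trans (Ub _ _)); rewrite ler_wpM2l ?mulr_ge0 ?expR_ge0 //.
 exact: (Uh k _ (ltn_ord k)).1.
 rewrite -mulr_sumr -mulr_sumr.
 have := Zb s => zb; have MT : 0 <= M * T by exact: mulr_ge0.
 have Me : 0 <= M * expR (th * `|s|) by rewrite mulr_ge0 ?expR_ge0.
 apply: (le_trans (ler_wpM2l Me (ler_wpM2l MT zb))).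
 pose K1 := C0 * (3 * pi) * (E * (M * T)) * E * a * N2 * Nt * rnorm x * (M * T).
 have K10 : 0 <= K1.
 by rewrite /K1 /N2 /Nt !mulr_ge0 ?rnorm_ge0 ?powR_ge0 ?sqr_ge0 // ltW.
 have := exp_gap s the K10 M0 => g; apply: le_trans (eq_ler _) (le_trans g (eq_ler _)); rewrite /K1; ring.
have := wint_rho_norm wW bW; rewrite !sumr_const !card_ord -mulrnA -scaler_nat rnormZ.
have -> : (N * N)%:R = ((N * N)%:R : R)%:C :> R[i] by rewrite rmorph_nat.
rewrite rnorm_real ger0_norm // natrM -expr2 -/N2 => le.
have N20 : 0 < N2 by rewrite exprn_gt0.
rewrite -(ler_pM2l N20); apply: (le_trans le); apply: eq_ler; rewrite -/Nt; ring.
Qed.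

End block_estimate.

(** * Summation over the blocks *)

Section cutoff_functions.
Context (R : realType).
Implicit Types (H F : R[i] -> R[i]) (r a b B t s : R) (w : R[i]).

(** A holomorphic substitute for a smooth cutoff at scale [1 / r]: the inverse square of this
    polynomial is 1 up to second order at [0], decays like [rho (t r)^2], and has its poles at
    [i / r] and [- i / r], outside the strip for small [r]. *)
Definition cden r w : R[i] := 1 + (r%:C * w) ^+ 2.
Definition cutoff r w : R[i] := (cden r w)^-1 ^+ 2.
(* [cutoff (r / 2) w - cutoff r w = w * cutq r w] *)
Definition cutq r w : R[i] :=
 r%:C * (r%:C * w) * (3 / 4)%:C * ((3 / 4)%:C + (5 / 4)%:C * cden r w) * cutoff r w * cutoff (r / 2) w.

Definition scaled_decay H b a r := forall t s, `|s| < b ->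
 cdiff H (t +i* s) /\ rnorm (H (t +i* s)) <= a * rho (t * r) ^+ 2.

Lemma rho_scale r t : 0 < r -> r <= 1 -> rho (t * r) <= r ^- 2 * rho t.
Proof.
move=> r0 r1; rewrite /rho -invfM lef_pV2 ?posrE ?mulr_gt0 ?exprn_gt0 ?ltr_pwDl ?sqr_ge0 //.
by rewrite exprMn mulrDr mulr1 mulrC lerD2r expr_le1 // ltW.
Qed.

Lemma scaled_decay_strip H b a r : 0 < r -> r <= 1 -> 0 <= a -> scaled_decay H b a r ->
 strip_decay2 H b (a * (r ^- 2) ^+ 2).
Proof.
move=> r0 r1 a0 h t s sb; have [h1 h2] := h t s sb; split=> //; apply: (le_trans h2).
rewrite -mulrA -exprMn ler_wpM2l // lerXn2r ?nnegrE ?rho_ge0 ?rho_scale //.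
by rewrite mulr_ge0 ?rho_ge0 // invr_ge0 sqr_ge0.
Qed.

Section estimates.
Variables (r b : R).
Hypotheses (r0 : 0 < r) (r8 : r <= 8^-1) (bpi : b <= pi).

(** Since [b <= pi <= 4] and [r <= 1/8], the square of [s r] is at most [1/4], so the real part of
    [1 + (r w)^2] is at least [3/4 + (t r)^2]. *)
Lemma cden_ge t s : `|s| < b -> 3 / 4 <= rnorm (cden r (t +i* s)) * rho (t * r).
Proof.
move=> sb; rewrite /rho ler_pdivlMr ?ltr_pwDl ?sqr_ge0 //; apply: le_trans (normr_Re_le _).
apply: le_trans (ler_norm _); rewrite /cden expr2 /= !mul0r !subr0 addr0.
have s4 : `|s| * r <= 2^-1.
 have : `|s| <= 4.
 apply: ltW; apply: (lt_le_trans sb); apply: (le_trans bpi).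
 by have /andP[_] := pihalf_02 R; lra.
 by move=> h; rewrite (_ : 2^-1 = 4 * 8^-1) ?ler_pM //; [exact: ltW|lra].
have : (s * r) ^+ 2 <= 4^-1.
 rewrite -(real_normK (num_real _)) normrM (gtr0_norm r0) (_ : 4^-1 = 2^-1 ^+ 2); last by field.
 by rewrite lerXn2r ?nnegrE // mulr_ge0 // ltW.
have := sqr_ge0 (t * r); rewrite !expr2; move: (r) (t) (s) => r' t' s'; nra.
Qed.

Lemma cdenB t s : `|s| < b -> 3 / 4 <= rnorm (cden r (t +i* s)).
Proof.
move=> /cden_ge h; apply: (le_trans (h t)); rewrite -[leRHS]mulr1 ler_wpM2l ?rnorm_ge0 //.
exact: rho_le1.
Qed.

Lemma cden_neq0 t s : `|s| < b -> cden r (t +i* s) != 0.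
Proof.
move=> /cdenB h; apply/eqP => e; have := h t; rewrite e rnorm0; lra.
Qed.

Lemma cdiff_cden w : cdiff (cden r) w.
Proof.
apply: cdiffD; first exact: cdiff_cst.
by apply: cdiffX; apply: cdiffM; [exact: cdiff_cst|exact: cdiff_id].
Qed.

Lemma cdiff_cut t s : `|s| < b -> cdiff (cutoff r) (t +i* s).
Proof. by move=> sb; apply: cdiffX; apply: cdiffV; [exact: cden_neq0|exact: cdiff_cden]. Qed.

Lemma cdenV t s : `|s| < b -> (rnorm (cden r (t +i* s)))^-1 <= 4 / 3 * rho (t * r).
Proof.
move=> sb; have h := cden_ge t sb; have h2 := cdenB t sb.
have d0 : 0 < rnorm (cden r (t +i* s)) by move: h2; lra.
by rewrite -div1r ler_pdivrMr //; move: h; lra.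
Qed.

Lemma rnorm_cut t s : `|s| < b -> rnorm (cutoff r (t +i* s)) <= 2 * rho (t * r) ^+ 2.
Proof.
move=> sb; have h := cdenV t sb; rewrite rnormX rnormV.
have : (rnorm (cden r (t +i* s)))^-1 ^+ 2 <= (4 / 3 * rho (t * r)) ^+ 2.
 by rewrite lerXn2r ?nnegrE ?mulr_ge0 ?rho_ge0 ?invr_ge0 ?rnorm_ge0 // (le_trans _ h) // invr_ge0 rnorm_ge0.
by rewrite [(4 / 3 * _) ^+ 2]exprMn; have := sqr_ge0 (rho (t * r)); move: (rho _ ^+ 2) (_^-1 ^+ 2) => x y; lra.
Qed.

Lemma rnorm_scaled_le t s : `|s| < b -> rnorm (r%:C * (t +i* s)) <= 4 * rnorm (cden r (t +i* s)).
Proof.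
move=> sb; have := cdenB t sb; rewrite /cden; set z := r%:C * _ => h.
have : rnorm z ^+ 2 <= rnorm (1 + z ^+ 2) + 1.
 rewrite -rnormX (_ : z ^+ 2 = (1 + z ^+ 2) + -1); last by ring.
 by apply: (le_trans (ler_rnormD _ _)); rewrite rnormN rnorm1 [_ + -1](_ : _ = z ^+ 2) //; ring.
by have := rnorm_ge0 z; move: h; move: (rnorm z) (rnorm _) => m d h m0 m2; nra.
Qed.

Lemma scaled_decay_mul F H B a : bounded_strip F b B -> 0 <= a -> forall r', scaled_decay H b a r' ->
 scaled_decay (fun w => F w * H w) b (B * a) r'.
Proof.
move=> hF a0 r' hH t s sb; have [f1 f2] := hF t s sb; have [h1 h2] := hH t s sb; split; first exact: cdiffM.
by rewrite rnormM -mulrA ler_pM ?rnorm_ge0.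
Qed.

Lemma cut_decay : scaled_decay (cutoff r) b 2 r.
Proof. by move=> t s sb; split; [exact: cdiff_cut|exact: rnorm_cut]. Qed.

(* [1 - cutoff r] vanishes to second order at [0], uniformly after scaling. *)
Definition cutr w : R[i] := - (1 + cden r w) * cutoff r w.

Lemma cut_sub1 t s : `|s| < b ->
 cutoff r (t +i* s) - 1 = (r ^+ 2)%:C * ((t +i* s) * (t +i* s) * cutr (t +i* s)).
Proof.
move=> sb; have d0 := cden_neq0 t sb; rewrite /cutr /cutoff.
rewrite (_ : _ * (_ * _ * _) = - ((cden r (t +i* s) - 1) * (1 + cden r (t +i* s))) * (cden r (t +i* s))^-1 ^+ 2).
 by move: (cden _ _) d0 => z z0; field.
by rewrite /cden realcM expr2; move: (_ +i* _) (r%:C) (_^-1 ^+ 2) => w c z; ring.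
Qed.

Lemma cutr_bounded : bounded_strip cutr b 4.
Proof.
move=> t s sb; split.
 by apply: cdiffM; [apply/cdiffN/cdiffD; [exact: cdiff_cst|exact: cdiff_cden]|exact: cdiff_cut].
have h := cdenB t sb; rewrite rnormM rnormN rnormX rnormV exprVn ler_pdivrMr; last by rewrite exprn_gt0 //; move: h; lra.
by have := ler_rnormD 1 (cden r (t +i* s)); rewrite rnorm1; move: h; move: (rnorm _) (rnorm _) => d e; nra.
Qed.

End estimates.

Section differences.
Variables (r b : R).
Hypotheses (r0 : 0 < r) (r8 : r <= 8^-1) (bpi : b <= pi).
Let r20 : 0 < r / 2. Proof. by rewrite divr_gt0. Qed.
Let r28 : r / 2 <= 8^-1. Proof. by move: r0 r8; lra. Qed.

Lemma cutB_decay : scaled_decay (fun w => cutoff (r / 2) w - cutoff r w) b 4 (r / 2).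
Proof.
move=> t s sb; split; first by apply: cdiffB; [exact: (cdiff_cut r20 r28 bpi)|exact: (cdiff_cut r0 r8 bpi)].
have h1 := rnorm_cut r20 r28 bpi t sb; have h2 := rnorm_cut r0 r8 bpi t sb.
have h3 : rho (t * r) ^+ 2 <= rho (t * (r / 2)) ^+ 2.
 rewrite lerXn2r ?nnegrE ?rho_ge0 //; apply: rho_le; rewrite !normrM ler_wpM2l // !ger0_norm ?(ltW r0) ?(ltW r20) //.
 by move: r0; lra.
have := ler_rnormB (cutoff (r / 2) (t +i* s)) (cutoff r (t +i* s)).
by move: h1 h2 h3; move: (rnorm _) (rnorm _) (rnorm _) => x y z; lra.
Qed.

Lemma cutqE t s : `|s| < b -> cutoff (r / 2) (t +i* s) - cutoff r (t +i* s) = (t +i* s) * cutq r (t +i* s).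
Proof.
move=> sb; have d0 := cden_neq0 r0 r8 bpi t sb; have d1 := cden_neq0 r20 r28 bpi t sb.
(* With [z = cden r w] the other denominator is [(3 + z) / 4]. The difference of the inverse squares
   factors through [z - 1], which equals [(r w)^2] and lets one [w] be taken out. *)
have e1 : cden (r / 2) (t +i* s) = (3 / 4)%:C + (1 / 4)%:C * cden r (t +i* s).
 rewrite /cden (_ : (r / 2)%:C = r%:C / 2); last by rewrite rmorphM fmorphV rmorphMn.
 rewrite !rmorphM !fmorphV !rmorphMn rmorph1; by move: (_ +i* _) (r%:C) => w c; field.
rewrite (_ : _ * cutq _ _ = (cden r (t +i* s) - 1) * (3 / 4)%:C * ((3 / 4)%:C + (5 / 4)%:C * cden r (t +i* s)) *
 cutoff r (t +i* s) * cutoff (r / 2) (t +i* s)); last first.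
 by rewrite (_ : cden r _ - 1 = (r%:C * (t +i* s)) ^+ 2); [rewrite /cutq; ring|rewrite /cden addrC addKr].
move: d1; rewrite /cutoff e1; move: (cden r _) d0 => z.
rewrite !rmorphM !fmorphV !rmorphMn rmorph1 => z0 z1; field; rewrite z0 andbT.
have ee : 3 / 4 + 1 / 4 * z = (3 + z) / 4 by field.
by apply: contraNneq z1 => e; rewrite ee e mul0r.
Qed.

(** After division by [w] one free factor [r] remains: this is the gain on the domain of [log A].
    The other factors multiply to [27/2], rounded up to 14. *)
Lemma cutq_decay : scaled_decay (cutq r) b (14 * r) (r / 2).
Proof.
move=> t s sb; have h := cdenB r0 r8 bpi t sb; split.
 have cl c : cdiff (fun w : R[i] => c * w) (t +i* s) by apply: cdiffM; [exact: cdiff_cst|exact: cdiff_id].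
 apply: cdiffM; last exact: (cdiff_cut r20 r28 bpi).
 apply: cdiffM; last exact: (cdiff_cut r0 r8 bpi).
 apply: cdiffM; last by apply: cdiffD; [exact: cdiff_cst|apply: cdiffM; [exact: cdiff_cst|exact: cdiff_cden]].
 by apply: cdiffM; [apply: cdiffM|]; [exact: cdiff_cst|exact: cl|exact: cdiff_cst].
have h1 := rnorm_cut r20 r28 bpi t sb; have h2 := rnorm_scaled_le r0 r8 bpi t sb.
have g (a1 a2 a3 a4 a5 a6 : R[i]) : rnorm (a1 * a2 * a3 * a4 * a5 * a6) =
 rnorm a1 * rnorm a2 * rnorm a3 * rnorm a4 * rnorm a5 * rnorm a6 by rewrite !rnormM.
rewrite /cutq g !rnorm_real; set c2 := rnorm (cutoff (r / 2) _) in h1 *.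
have h3 : rnorm ((3 / 4)%:C + (5 / 4)%:C * cden r (t +i* s)) <= 9 / 4 * rnorm (cden r (t +i* s)).
 apply: (le_trans (ler_rnormD _ _)); rewrite rnormM !rnorm_real !ger0_norm //; move: h; lra.
rewrite rnormX rnormV !ger0_norm ?(ltW r0) //.
move: h h1 h2 h3; move: (_ ^+ 2) => ro; set m := rnorm (r%:C * _); set d := rnorm (cden r _) => h h1 h2 h3.
have dd : d ^- 2 * (d * d) = 1 by rewrite -expr2 mulVf // expf_neq0 // gt_eqF //; move: h; lra.
apply: (@le_trans _ _ (r * (4 * d) * (3 / 4) * (9 / 4 * d) * d^-1 ^+ 2 * (2 * ro))).
 have dn : 0 <= d^-1 ^+ 2 by exact: sqr_ge0.
 set y := rnorm (_ + _) in h3 *; have m0 : 0 <= m by exact: rnorm_ge0.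
 have y0 : 0 <= y by exact: rnorm_ge0.
 have rm : 0 <= r * m * (3 / 4) by rewrite !mulr_ge0 // ltW.
 apply: ler_pM; [by rewrite mulr_ge0 // mulr_ge0|exact: rnorm_ge0| |exact: h1].
 apply: ler_wpM2r => //; apply: ler_pM => //.
 by rewrite ler_wpM2r // ler_wpM2l // ltW.
rewrite exprVn [leLHS](_ : _ = (27 / 2) * (d ^- 2 * (d * d)) * r * ro); last by field; rewrite gt_eqF //; move: h; lra.
have ro0 : 0 <= ro by move: (rnorm_ge0 (cutoff (r / 2) (t +i* s))) h1; rewrite -/c2; lra.
by rewrite dd mulr1 !ler_wpM2r ?(ltW r0) //; lra.
Qed.

End differences.

End cutoff_functions.

(** * The interpolation norm bounds dyadic sums of the K-functional *)

Section real_interpolation.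
Context (R : realType) (X : completeNormedModType R[i]) (B : set (X * X)).
Hypothesis B0 : B (0, 0).

Local Notation RM := (measurableTypeR R).
Let mu := @lebesgue_measure R.

(** For nonnegative functions the integral is a supremum over simple functions below, so
    monotonicity holds without measurability; the integrand of the interpolation norm, an infimum
    over a graph, is compared in this way. *)
Lemma ge0_le_integral_nonmeasurable (D : set RM) (f g : RM -> \bar R) :
 (forall t, D t -> (0 <= g t)%E) -> (forall t, D t -> (g t <= f t)%E) ->
 (\int[mu]_(t in D) g t <= \int[mu]_(t in D) f t)%E.
Proof.
move=> g0 gf; have f0 t : D t -> (0 <= f t)%E by move=> Dt; exact: le_trans (g0 t Dt) (gf t Dt).
rewrite !ge0_integralE //; apply: ge_ereal_sup => _ [h hg <-]; apply: ereal_sup_ubound; exists h => //= t.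
apply: (le_trans (hg t)); rewrite !patchE; case: ifPn => //; rewrite inE; exact: gf.
Qed.

Definition Kreal (t : R) x : R := fine (K_functional B t x).

Lemma K_ge t x c : (forall u, B u -> c <= rnorm (x - u.1) + t * (rnorm u.1 + rnorm u.2)) ->
 (c%:E <= K_functional B t x)%E.
Proof. by move=> h; apply: le_ereal_inf_tmp => _ [u Bu <-]; rewrite lee_fin h. Qed.

Lemma KrealE t x : 0 <= t -> K_functional B t x = (Kreal t x)%:E.
Proof.
move=> t0; rewrite /Kreal fineK // fin_real //; apply/andP; split.
 apply: (@lt_le_trans _ _ 0%E); first exact: ltNyr.
 by apply: (@K_ge _ _ 0) => u _; rewrite addr_ge0 ?rnorm_ge0 // mulr_ge0 // addr_ge0 // rnorm_ge0.
apply: (@le_lt_trans _ _ (rnorm x)%:E); last exact: ltry.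
by apply: ge_ereal_inf; exists (rnorm x)%:E => //; exists (0, 0) => //=; rewrite subr0 !rnorm0 addr0 mulr0 addr0.
Qed.

Lemma Kreal_ge t x c : 0 <= t -> (forall u, B u -> c <= rnorm (x - u.1) + t * (rnorm u.1 + rnorm u.2)) ->
 c <= Kreal t x.
Proof. by move=> t0 /K_ge; rewrite KrealE // lee_fin. Qed.

Lemma Kreal_le t x u : 0 <= t -> B u -> Kreal t x <= rnorm (x - u.1) + t * (rnorm u.1 + rnorm u.2).
Proof. by move=> t0 Bu; rewrite -lee_fin -KrealE //; apply: ereal_inf_lbound; exists u. Qed.

Lemma Kreal_ge0 t x : 0 <= t -> 0 <= Kreal t x.
Proof.
move=> t0; apply: Kreal_ge => // u _.
by rewrite addr_ge0 ?rnorm_ge0 // mulr_ge0 // addr_ge0 // rnorm_ge0.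
Qed.

Lemma Kreal_mono s t x : 0 <= s -> s <= t -> Kreal s x <= Kreal t x.
Proof.
move=> s0 st; apply: Kreal_ge => [|u Bu]; first exact: le_trans st.
by apply: (le_trans (Kreal_le x s0 Bu)); rewrite lerD2l ler_wpM2r // addr_ge0 // rnorm_ge0.
Qed.

Variables (theta : R) (theta01 : 0 <= theta <= 1).

Lemma powR_double (r t : R) : 0 < r -> r < t <= 2 * r -> r^-1 `^ theta / 2 <= t `^ (- theta).
Proof.
move=> r0 /andP[rt t2]; have /andP[h0 h1] := theta01; have t0 := lt_trans r0 rt.
rewrite powRN -[leRHS]mul1r ler_pdivlMr ?powR_gt0 //.
have : t `^ theta <= 2 * r `^ theta.
 apply: (le_trans (ge0_ler_powR h0 _ _ t2)); rewrite ?nnegrE ?mulr_ge0 ?(ltW r0) ?(ltW t0) //.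
 rewrite powRM ?(ltW r0) // ler_wpM2r ?powR_ge0 //.
 by rewrite -[leRHS]powRr1 // ler_powR // ler1n.
have : r^-1 `^ theta * r `^ theta = 1 by rewrite -powRM ?invr_ge0 ?(ltW r0) // mulVf ?gt_eqF // powR1.
have := powR_ge0 r^-1 theta; have := powR_ge0 r theta.
by move: (r^-1 `^ _) (r `^ _) (t `^ _) => a b c; nra.
Qed.

(** On this interval the three factors are at least [r^(- theta) / 2] because [theta <= 1], the
    K-functional at [r] because it is monotone, and [1 / (2 r)]. *)
Lemma interpolation_integrand_ge x (r t : R) : 0 < r -> r < t <= 2 * r ->
 ((r^-1 `^ theta * Kreal r x / (4 * r))%:E <=
 ((t `^ (- theta))%:E * K_functional B t x) `^ 1 * (t^-1)%:E)%E.
Proof.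
move=> r0 rt; have /andP[rt1 rt2] := rt; have t0 := lt_trans r0 rt1.
rewrite KrealE ?(ltW t0) // poweRe1; last by rewrite -EFinM lee_fin mulr_ge0 ?powR_ge0 ?Kreal_ge0 ?(ltW t0).
rewrite -EFinM.
rewrite lee_fin (_ : _ / (4 * r) = r^-1 `^ theta / 2 * Kreal r x * (2 * r)^-1); last first.
 by field; rewrite gt_eqF.
have r0' := ltW r0; have k0 := Kreal_ge0 x r0'.
apply: ler_pM; [by rewrite !mulr_ge0 ?powR_ge0|by rewrite invr_ge0 mulr_ge0| |].
 apply: ler_pM => //; [by rewrite mulr_ge0 ?powR_ge0|exact: powR_double|].
 by apply: Kreal_mono => //; exact: ltW.
by rewrite lef_pV2 ?posrE // mulr_gt0.
Qed.

Let rad (m : nat) : R := 2^-1 ^+ m.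

(** The intervals from [2^-m] to [2 * 2^-m] are disjoint, and the length of each cancels the [r] in
    the lower bound of the integrand, so the factor 4 is all that is lost. *)
Lemma dyadic_K_sum x M :
 ((\sum_(m < M) (rad m)^-1 `^ theta * Kreal (rad m) x)%:E <= 4%:E * interpolation_norm B theta 1 x)%E.
Proof.
have rad0 m : 0 < rad m by rewrite exprn_gt0 // invr_gt0.
pose c (m : nat) := (rad m)^-1 `^ theta * Kreal (rad m) x / (4 * rad m).
have c0 m : 0 <= c m by rewrite /c divr_ge0 ?mulr_ge0 ?powR_ge0 ?Kreal_ge0 ?(ltW (rad0 m)).
pose I m : set RM := `]rad m, (2 * rad m)]%classic.
have mI m : measurable (I m) by exact: measurable_itv.
rewrite /interpolation_norm invr1 poweRe1; last first.
 apply: integral_ge0 => t; rewrite /= in_itv /= andbT => t0.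
 by rewrite mule_ge0 ?poweR_ge0 // lee_fin invr_ge0 ltW.
have h : (\int[mu]_(t in `]0%R, +oo[) \sum_(m < M) ((c m)%:E * (\1_(I m) t)%:E)
 <= \int[mu]_(t in `]0%R, +oo[) (((t `^ (- theta))%:E * K_functional B t x) `^ 1 * (t^-1)%:E))%E.
 apply: ge0_le_integral_nonmeasurable => t; rewrite /= in_itv /= andbT => t0.
 by apply: sume_ge0 => m _; rewrite mule_ge0 // lee_fin ?c0 // indicE.
 case: (pselect (exists m : 'I_M, I m t)) => [[m tm]|no]; last first.
 rewrite big1; first by rewrite mule_ge0 ?poweR_ge0 // lee_fin invr_ge0 ltW.
 by move=> m _; rewrite indicE memNset ?mule0 // => h; apply: no; exists m.
 rewrite (bigD1 m) //= big1 => [|n nm].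
 by rewrite adde0 indicE mem_set // mule1; apply: interpolation_integrand_ge.
 rewrite indicE memNset ?mule0 // => tn.
 move: tm tn nm; rewrite /I /= !in_itv /= => /andP[m1 m2] /andP[n1 n2].
 have sep (i j : nat) : (i < j)%N -> rad i < t -> t <= 2 * rad j -> False.
 move=> ij h1 h2; have h3 : 2 * rad j <= rad i.
 rewrite /rad -(subnK ij) addnS exprS mulrA mulfV // mul1r exprD ger_pMl ?exprn_gt0 ?invr_gt0 //.
 by apply: exprn_ile1; rewrite ?invr_ge0 // invf_le1 // ler1n.
 by move: h1 h2 h3; lra.
 by rewrite neq_ltn => /orP[nm|mn]; [exact: (sep n m)|exact: (sep m n)].
have e : (\int[mu]_(t in `]0%R, +oo[) \sum_(m < M) ((c m)%:E * (\1_(I m) t)%:E))%E =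
 (\sum_(m < M) c m * rad m)%:E.
 have mD : measurable (`]0%R, +oo[%classic : set RM) by exact: measurable_itv.
 have mi m : measurable_fun (`]0%R, +oo[%classic : set RM) (fun t => (\1_(I m) t)%:E : \bar R).
 by apply/measurable_EFinP; exact: measurable_indic.
 rewrite (ge0_integral_sum mu mD (f := fun (m : 'I_M) t => ((c m)%:E * (\1_(I m) t)%:E)%E)); first last.
 - by move=> m t _; rewrite mule_ge0 // lee_fin ?c0 // indicE.
 - by move=> m; apply: emeasurable_funM => //; exact: measurable_cst.
 rewrite -sumEFin; apply: eq_bigr => m _.
 rewrite ge0_integralZl_EFin //.
 rewrite integral_indic // (setIidl _); last first.
 by move=> t; rewrite /I /= !in_itv /= andbT => /andP[+ _]; apply: lt_trans.
 have em : mu (I m) = (rad m)%:E.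
 have := @lebesgue_measure_itv R `]rad m, (2 * rad m)%R]; rewrite /= lte_fin ltr_pMl // ltr1n => h2; apply: (etrans h2).
 by rewrite -EFinB; congr EFin; ring.
 by rewrite EFinM; exact: (congr1 (mule (c m)%:E) em).
rewrite e in h; apply: le_trans (lee_wpmul2l _ h); last by rewrite lee_fin.
rewrite -EFinM lee_fin mulr_sumr; apply: ler_sum => m _; rewrite /c.
by have r0 := rad0 m; move: (rad m) r0 => r r0; apply: eq_ler; field; rewrite gt_eqF.
Qed.

End real_interpolation.

Section absolutely_summable_differences.
Context (R : realType) (X : completeNormedModType R[i]).

Lemma sum_dist_cvg (u : nat -> X) (T : R) : (forall M, \sum_(m < M) rnorm (u m.+1 - u m) <= T) ->
 exists y, u @ \oo --> y /\ rnorm y <= rnorm (u 0%N) + T.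
Proof.
move=> hT; pose s M := \sum_(m < M) rnorm (u m.+1 - u m).
have sS n : s n.+1 = s n + rnorm (u n.+1 - u n) by rewrite /s big_ord_recr.
have mono : nondecreasing_seq s by apply/nondecreasing_seqP => n; rewrite sS lerDl rnorm_ge0.
have ub : has_ubound (range s) by exists T => _ [n _ <-]; exact: hT.
have cs : cvgn s by apply: nondecreasing_is_cvgn.
have sl n : s n <= lim (s @ \oo) by exact: nondecreasing_cvgn_le.
have step m k : rnorm (u (m + k)%N - u m) <= s (m + k)%N - s m.
 elim: k => [|k IH]; first by rewrite addn0 !subrr rnorm0.
 rewrite addnS sS; have := ler_rnormD (u (m + k).+1 - u (m + k)%N) (u (m + k)%N - u m).
 by rewrite addrA subrK; move: IH; lra.
have [y hy] : exists y : X, u @ \oo --> y.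
 apply: (@rnorm_cauchy_cvg _ _ u (fun n => lim (s @ \oo) - s n)) => [m n|].
 wlog mn : m n / (m <= n)%N.
 by move=> h; case: (leqP m n) => [|/ltnW] mn; [exact: h|rewrite rnormB [leRHS]addrC; apply: h].
 by have := step m (n - m)%N; rewrite subnKC //; have := sl n; have := sl m; lra.
 by rewrite -(subrr (lim (s @ \oo))); apply: cvgB => //; exact: cvg_cst.
exists y; split=> //; apply/ler_addgt0Pr => e e0.
have /cvg_rnorm_seqP/(_ _ e0)[N _ hN] := hy; have := hN N (leqnn N).
have h0 : s 0%N = 0 by rewrite /s big_ord0.
have := step 0%N N; rewrite add0n h0; have := hT N; rewrite -/(s N).
have := ler_rnorm_dist y (u N); have := ler_rnorm_dist (u N) (u 0%N); rewrite (rnormB y); lra.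
Qed.

End absolutely_summable_differences.

(** * Convergence of the truncated calculus *)

Section smooth_calculus.
Context (R : realType) (X : completeNormedModType R[i]).
Variables (U : R -> {linear X -> X}) (th M e b : R).
Hypotheses (hU : C0_group U) (M0 : 0 <= M) (th0 : 0 <= th) (the : th < e) (eb : e < b) (bpi : b < pi)
 (Ub : forall s x, rnorm (U s x) <= M * expR (th * `|s|) * rnorm x).
Variables (A : set (X * X)).
Hypotheses (sA : sectorial e A) (iA : injective_operator A)
 (hgen : generator U = scale_operator (- 'i) (log_operator A)).
Variables (C theta : R).
Hypotheses (C0 : 0 <= C) (theta01 : 0 <= theta <= 1).
Hypothesis hblock : forall N (H : R[i] -> R[i]) a a' x y, (0 < N)%N -> 0 < a ->
 0 <= a' -> strip_decay2 H b a' -> (forall t s, `|s| < b -> rnorm (H (t +i* s)) <= a * rho (t / N%:R)) ->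
 is_wint [set: measurableTypeR R] (fun s => kern H s *: U s x) y ->
 rnorm y <= C * a * N%:R `^ theta * rnorm x.

Let nu := (e + b) / 2.
Let e0 : 0 < e. Proof. exact: le_lt_trans the. Qed.
Let b0 : 0 < b. Proof. exact: lt_trans eb. Qed.
Let enu : e < nu < b. Proof. by apply/andP; rewrite /nu; move: eb; split; lra. Qed.
Let enupi : e < nu < pi. Proof. by have /andP[h1 h2] := enu; rewrite h1 (lt_trans h2). Qed.
Let nub : `|nu| < b. Proof. by have /andP[h1 h2] := enu; rewrite gtr0_norm // (lt_trans e0). Qed.
Let on : cos nu < cos e.
Proof. by have /andP[h1 h2] := enupi; have h := e0; rewrite ltr_cos // in_itv /=; apply/andP; split; lra. Qed.
Let bpi' := ltW bpi.

Let rad (m : nat) : R := 2^-1 ^+ m.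
Let rad0 m : 0 < rad m. Proof. by rewrite exprn_gt0 // invr_gt0. Qed.
Let rad1 m : rad m <= 1. Proof. by rewrite exprn_ile1 ?invr_ge0 // invf_le1 // ler1n. Qed.
Let radE m : rad m = (2 ^ m)%:R^-1. Proof. by rewrite /rad natrX exprVn. Qed.
Let radS m : rad m.+1 = rad m / 2. Proof. by rewrite /rad exprSr. Qed.
Let rad8 m : rad m.+3 <= 8^-1. Proof. by rewrite !radS; move: (rad1 m); lra. Qed.

Let Ps := Psi A nu.
Let sdp (H : R[i] -> R[i]) a : strip_decay H b a -> pair_bound H nu a.
Proof. by move=> h; apply: strip_pair nub. Qed.

Lemma log_operator0 : log_operator A (0, 0).
Proof.
have : generator U (0, 0).
 by apply/(generatorP hU) => d d0; exists 1 => // h _; rewrite linear0 scaler0 !subr0 rnorm0 mulr_ge0 // ltW.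
rewrite hgen => -[[u v] luv [/= eu /eqP]].
by rewrite scaler_eq0 oppr_eq0 eq_complex /= oner_eq0 andbF /= => /eqP ev; move: luv; rewrite eu ev.
Qed.

Lemma Psi_block m H a x : 0 <= a -> scaled_decay H b a (rad m) ->
 rnorm (Ps H x) <= C * a * (rad m)^-1 `^ theta * rnorm x.
Proof.
move=> a0 hH; have sd := scaled_decay_strip (rad0 m) (rad1 m) a0 hH.
set a' := a * _ in sd; have a'0 : 0 <= a' by rewrite mulr_ge0 // exprn_ge0 // invr_ge0 sqr_ge0.
have e0' := ltW e0; have I0 := Irho_ge0 R.
have pi1 : 0 <= (2 * pi)^-1 :> R by rewrite invr_ge0 mulr_ge0 // pi_ge0.
have [y wy] := group_integral_exists hU M0 Ub x (tcont_kern b0 a'0 sd) the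
 (mulr_ge0 (mulr_ge0 pi1 a'0) I0) (fun s => kern_bound b0 a'0 sd s e0' eb).
rewrite /Ps -(group_integral_Psi hU sA iA hgen a'0 sd enu bpi' wy).
apply/ler_addgt0Pr => d d0; have w0 : 0 <= C * (rad m)^-1 `^ theta * rnorm x.
 by rewrite !mulr_ge0 ?rnorm_ge0 ?powR_ge0.
(* [hblock] asks for a positive constant, while [a] may be zero; it is applied to [a + d'], with
   [d'] so small that the excess is at most [d]. *)
pose d' := d / (1 + C * (rad m)^-1 `^ theta * rnorm x).
have d'0 : 0 < d' by rewrite divr_gt0 // ltr_wpDr.
have N0 : (0 < 2 ^ m)%N by rewrite expn_gt0.
apply: (le_trans (hblock (a := a + d') N0 _ a'0 sd _ wy)); first by move: a0 d'0; lra.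
 move=> t s sb; have [_ h2] := hH t s sb; apply: (le_trans h2); rewrite -radE.
 by apply: (le_trans (ler_wpM2l a0 (rho_sqr_le _))); rewrite ler_wpM2r ?rho_ge0 // lerDl ltW.
rewrite -[(2 ^ m)%:R]invrK -radE.
rewrite (_ : _ * _ = C * a * (rad m)^-1 `^ theta * rnorm x + d' * (C * (rad m)^-1 `^ theta * rnorm x)); last by ring.
rewrite lerD2l /d' mulrAC ler_pdivrMr ?ltr_wpDr //.
by move: w0 d0; move: (_ * rnorm x) => w; nra.
Qed.

Let ereg_sd : exists2 a, 0 <= a & strip_decay2 (@ereg R) b a.
Proof.
have [|a a0 h] := @ereg_decay R b; first by rewrite (ltW b0).
by exists a => // t s sb; apply: h; exact: ltW.
Qed.

Lemma Psi_ereg_eq y y' : Ps (@ereg R) y = Ps (@ereg R) y' -> y = y'.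
Proof.
have [a a0 sd2] := ereg_sd; have sd := sdp (strip_decay2W a0 sd2) => h; apply/eqP; rewrite -subr_eq0; apply/eqP.
apply: (Psi_ereg_inj sA iA enupi); rewrite addrC -scaleN1r (Psi_lin sA (-1) y' y on sd).
by rewrite -/Ps h scaleN1r addNr.
Qed.

Variables (F : R[i] -> R[i]) (B : R).
Hypotheses (B0 : 0 <= B) (hF : bounded_strip F b B).

(** Indices start at 3 because the cutoff estimates need [r <= 1/8]. Below, [G k] is the difference
    of consecutive truncations, and [G1 k] is its quotient by [w] in the strip. *)
Let S k w := F w * cutoff (rad k.+3) w.
Let G k w := F w * (cutoff (rad k.+4) w - cutoff (rad k.+3) w).
Let G1 k w := F w * cutq (rad k.+3) w.

Let S_decay k : scaled_decay (S k) b (B * 2) (rad k.+3).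
Proof. by apply: scaled_decay_mul => //; apply: cut_decay. Qed.
Let G_decay k : scaled_decay (G k) b (B * 4) (rad k.+4).
Proof. by apply: scaled_decay_mul => //; rewrite radS; apply: cutB_decay. Qed.
Let G1_decay k : scaled_decay (G1 k) b (B * (14 * rad k.+3)) (rad k.+4).
Proof.
apply: (scaled_decay_mul hF (mulr_ge0 (ler0n _ 14) (ltW (rad0 k.+3)))).
by rewrite [rad k.+4]radS; exact: cutq_decay.
Qed.

Let strip H a m : 0 <= a -> scaled_decay H b a (rad m) -> exists2 a', 0 <= a' & strip_decay H b a'.
Proof.
move=> a0 h; exists (a * (rad m ^- 2) ^+ 2); first by rewrite mulr_ge0 // exprn_ge0 // invr_ge0 sqr_ge0.
apply: strip_decay2W; first by rewrite mulr_ge0 // exprn_ge0 // invr_ge0 sqr_ge0.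
exact: scaled_decay_strip.
Qed.
Let B2 : 0 <= B * 2. Proof. by rewrite mulr_ge0. Qed.
Let B4 : 0 <= B * 4. Proof. by rewrite mulr_ge0. Qed.
Let B14 k : 0 <= B * (14 * rad k.+3).
Proof. exact: (mulr_ge0 B0 (mulr_ge0 (ler0n _ 14) (ltW (rad0 _)))). Qed.

Lemma Psi_difference k x : Ps (S k.+1) x - Ps (S k) x = Ps (G k) x.
Proof.
have [a1 _ /sdp h1] := strip B2 (@S_decay k); have [a2 _ /sdp h2] := strip B2 (@S_decay k.+1).
have [a3 _ /sdp h3] := strip B4 (@G_decay k).
rewrite /Ps (Psi_linl sA x on h1 h3 h2 (c := 1)) ?scale1r; last by move=> w _; rewrite /S /G; ring.
by rewrite addrC addKr.
Qed.

(** [G k] is [w] times [G1 k], and the factor [w] is transferred to the vector as [log A]; since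
    only [e(A) v] is expressed through [u], both sides are compared after applying [e(A)]. *)
Lemma Psi_difference_log k u v : log_operator A (u, v) -> Ps (G k) u = Ps (G1 k) v.
Proof.
move=> /(log_Psi sA enupi) huv; apply: Psi_ereg_eq.
have [a a0 sd2] := ereg_sd; have sd := strip_decay2W a0 sd2.
have [a1 _ h1] := strip B4 (@G_decay k); have [a2 _ h2] := strip (B14 k) (@G1_decay k).
rewrite /Ps (Psi_mul sA u sd h1 enu bpi') (Psi_mul sA v sd h2 enu bpi').
rewrite [RHS](@Psi_ext _ _ A nu _ (fun w => G1 k w * ereg w)) => [|w _]; last by rewrite mulrC.
rewrite -(Psi_mul sA v h2 sd enu bpi') huv (Psi_mul sA u h2 (strip_decay_mulw a0 bpi' sd2) enu bpi').
apply: Psi_ext => -[t s] /= hs; rewrite /G /G1 [rad k.+4]radS (cutqE (rad0 _) (rad8 _) bpi' t); last first.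
 by have /andP[h3 h4] := enu; rewrite hs gtr0_norm // (lt_trans e0).
by ring.
Qed.

(** For [u] in the domain of [log A], the part [x - u] is estimated through [G k] with constant 4,
    and [u] through [G1 k] with [14 rad (k + 3) = 28 rad (k + 4)]. The larger constant 28 serves
    both, and the infimum over [u] is the K-functional. *)
Lemma Psi_difference_bound k x :
 rnorm (Ps (S k.+1) x - Ps (S k) x) <= 28 * C * B * ((rad k.+4)^-1 `^ theta * Kreal (log_operator A) (rad k.+4) x).
Proof.
rewrite Psi_difference; set w := _ `^ theta; set r := rad k.+4.
have w0 : 0 <= w by exact: powR_ge0.
have L0 : log_operator A (0, 0) by exact: log_operator0.
have key u : log_operator A u -> rnorm (Ps (G k) x) <= 28 * C * B * w * (rnorm (x - u.1) + r * (rnorm u.1 + rnorm u.2)).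
 case: u => u v /= luv; have [a _ /sdp hG] := strip B4 (@G_decay k).
 rewrite -[x in Ps _ x](subrK u) -[x - u]scale1r /Ps (Psi_lin sA 1 (x - u) u on hG) !scale1r -/Ps.
 rewrite (Psi_difference_log k luv); apply: (le_trans (ler_rnormD _ _)).
 apply: (le_trans (lerD (Psi_block _ B4 (@G_decay k)) (Psi_block _ (B14 k) (@G1_decay k)))).
 rewrite -/w (_ : rad k.+3 = 2 * r); last by rewrite /r [rad k.+4]radS; field.
 have n1 := rnorm_ge0 (x - u); have n2 := rnorm_ge0 u; have n3 := rnorm_ge0 v.
 have r0 : 0 <= r := ltW (rad0 _).
 have c0 : 0 <= C * B * w by rewrite !mulr_ge0.
 have := mulr_ge0 c0 n1; have := mulr_ge0 c0 (mulr_ge0 r0 n2).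
 by move: (rnorm (x - u)) (rnorm u) (rnorm v) => m1 m2 m3; nra.
have c0 : 0 <= 28 * C * B * w by rewrite !mulr_ge0.
rewrite mulrA; move: key c0; move: (28 * C * B * w) => c key; rewrite le_eqVlt => /orP[/eqP c0|c0].
 by rewrite -c0 mul0r; have := key _ L0; rewrite -c0 mul0r.
rewrite mulrC -ler_pdivrMr //; apply: (Kreal_ge L0); first exact: (ltW (rad0 _)).
by move=> u /key; rewrite ler_pdivrMr // mulrC.
Qed.

(** [1 - cutoff r] is [r^2 w^2] times a bounded function and the regularizer absorbs [w^2], so
    [e(A)] of the truncations tends to [(e F)(A) x] at least as fast as [rad k]; as [e(A)] is
    bounded, it also tends to [e(A) y]. *)
Lemma limit_identified x y : (fun k => Ps (S k) x) @ \oo --> y ->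
 Ps (@ereg R) y = Ps (fun w => ereg w * F w) x.
Proof.
move=> hy; have [a a0 sd2] := ereg_sd; have sd := strip_decay2W a0 sd2.
have [K K0 hK] := Psi_norm sA on; pose a1 := a * (1 + pi ^+ 2).
have a10 : 0 <= a1 by rewrite mulr_ge0 // addr_ge0 // sqr_ge0.
have sdF := sdp (strip_decayM a0 sd hF).
have bnd k : rnorm (Ps (@ereg R) y - Ps (fun w => ereg w * F w) x) <=
 K * a * rnorm (Ps (S k) x - y) + K * (a1 * (B * 4)) * rnorm x * rad k.
 pose r := rad k.+3; pose D w := ereg w * (w * w) * ((r ^+ 2)%:C * (F w * cutr r w)).
 have r0 : 0 <= r := ltW (rad0 _).
 have sdD : strip_decay D b (a1 * (r ^+ 2 * (B * 4))).
 apply: (strip_decayM a10 (strip_decay_mulw2 a0 bpi' sd2)) => t s sb.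
 have [f1 f2] := hF t sb; have [g1 g2] := cutr_bounded (rad0 k.+3) (rad8 k) bpi' t sb; split.
 by apply: cdiffM; [exact: cdiff_cst|exact: cdiffM].
 rewrite rnormM rnorm_real ger0_norm ?sqr_ge0 // ler_wpM2l ?sqr_ge0 // rnormM.
 by apply: ler_pM; rewrite ?rnorm_ge0.
 have [a2 a20 sdS] := strip B2 (@S_decay k).
 have bS : bounded_strip (S k) b a2.
 by move=> t s sb; have [h1 h2] := sdS t s sb; split=> //; rewrite (le_trans h2) // ler_piMr ?rho_le1.
 have e1 : Ps (@ereg R) (Ps (S k) x) = Ps D x + Ps (fun w => ereg w * F w) x.
 rewrite /Ps (Psi_mul sA x sd sdS enu bpi').
 rewrite (Psi_linl sA x on (sdp sdD) sdF (sdp (strip_decayM a0 sd bS)) (c := 1)) ?scale1r // => -[t s] /= hs.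
 have sb : `|s| < b by have /andP[h3 h4] := enu; rewrite hs gtr0_norm // (lt_trans e0).
 have ec : cutoff r (t +i* s) = (r ^+ 2)%:C * ((t +i* s) * (t +i* s) * cutr r (t +i* s)) + 1.
 by rewrite -(cut_sub1 (rad0 _) (rad8 _) bpi' t sb) subrK.
 by rewrite /D /S -/r ec; move: (cutr _ _) ((r ^+ 2)%:C) (F _) (ereg _) => c1 c2 c3 c4; ring.
 have e2 : Ps (@ereg R) (y - Ps (S k) x) = Ps (@ereg R) y - Ps (@ereg R) (Ps (S k) x).
 by rewrite addrC -scaleN1r /Ps (Psi_lin sA _ _ _ on (sdp sd)) scaleN1r addrC.
 have -> : Ps (@ereg R) y - Ps (fun w => ereg w * F w) x = Ps (@ereg R) (y - Ps (S k) x) + Ps D x.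
 by rewrite e2 e1; move: (Ps _ _) (Ps D x) (Ps _ x) => u v w; vring.
 apply: (le_trans (ler_rnormD _ _)); apply: lerD; first by rewrite rnormB; exact: hK (sdp sd).
 apply: (le_trans (hK _ _ _ (sdp sdD))).
 have rr : r ^+ 2 <= rad k.
 apply: (@le_trans _ _ r); first by rewrite expr2 ler_piMl // rad1.
 by rewrite /r !radS; have := rad0 k; lra.
 rewrite (_ : _ * rnorm x = K * (a1 * (B * 4)) * rnorm x * r ^+ 2); last by ring.
 exact: (ler_wpM2l (mulr_ge0 (mulr_ge0 K0 (mulr_ge0 a10 B4)) (rnorm_ge0 x)) rr).
apply: eq_rnorm_small => d d0.
pose c1 := K * a; pose c2 := K * (a1 * (B * 4)) * rnorm x.
have c10 : 0 <= c1 by rewrite mulr_ge0.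
have c20 : 0 <= c2 := mulr_ge0 (mulr_ge0 K0 (mulr_ge0 a10 B4)) (rnorm_ge0 x).
pose d' := d / (1 + c1 + c2); have d'0 : 0 < d' by rewrite divr_gt0 //; move: c10 c20; lra.
have rc : rad n @[n --> \oo] --> (0 : R).
 by apply: cvg_expr; rewrite ger0_norm ?invr_ge0 // invf_lt1 // ltr1n.
have /cvg_rnorm_seqP/(_ _ d'0)[N1 _ h1] := hy; have /cvgrPdist_lt/(_ _ d'0)[N2 _ h2] := rc.
have /= k1 := h1 _ (leq_maxl N1 N2); have /= k2 := h2 _ (leq_maxr N1 N2).
rewrite sub0r normrN gtr0_norm ?rad0 // in k2.
apply: (le_trans (bnd (maxn N1 N2))); rewrite -/c1 -/c2.
have -> : d = c1 * d' + c2 * d' + d' by rewrite /d'; field; rewrite gt_eqF //; move: c10 c20; lra.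
have := ler_wpM2l c10 (ltW k1); have := ler_wpM2l c20 (ltW k2); move: d'0; lra.
Qed.

(** The constant is 16 + 28. The first truncation has constant [2 B] at scale 8, and [8^theta <= 8];
    its norm is controlled because the norm of [x] is at most the K-functional at 1, the term of
    index 0. The differences contribute 28. *)
Lemma smooth_calculus_exists x T :
 (forall m, \sum_(i < m) (rad i)^-1 `^ theta * Kreal (log_operator A) (rad i) x <= T) ->
 exists y, Ps (@ereg R) y = Ps (fun w => ereg w * F w) x /\ rnorm y <= 44 * C * B * T.
Proof.
move=> hT; have L0 : log_operator A (0, 0) by exact: log_operator0.
pose f i := (rad i)^-1 `^ theta * Kreal (log_operator A) (rad i) x.
have f0 i : 0 <= f i by rewrite mulr_ge0 ?powR_ge0 // Kreal_ge0 // (ltW (rad0 i)).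
have CB : 0 <= C * B by rewrite mulr_ge0.
have [y [hy ny]] : exists y : X, (fun k => Ps (S k) x) @ \oo --> y /\ rnorm y <= rnorm (Ps (S 0) x) + 28 * C * B * T.
 apply: sum_dist_cvg => m; apply: (@le_trans _ _ (28 * C * B * \sum_(i < m) f i.+4)).
 by rewrite mulr_sumr; apply: ler_sum => i _; exact: Psi_difference_bound.
 rewrite ler_wpM2l ?mulr_ge0 //; apply: le_trans (hT (4 + m)%N).
 by rewrite big_split_ord /= lerDr sumr_ge0 // => i _; exact: f0.
exists y; split; first exact: limit_identified hy.
 have xT : rnorm x <= T.
 apply: le_trans (hT 1%N); rewrite big_ord1 /rad expr0 invr1 powR1 mul1r; apply: Kreal_ge => // u _.
 by have := ler_rnorm_dist x u.1; have := rnorm_ge0 u.2; lra.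
 have w8 : (rad 3)^-1 `^ theta <= 8.
 rewrite (_ : (rad 3)^-1 = 8) ; last by rewrite /rad !exprS expr0; field.
 by rewrite -[leRHS]powRr1 // ler_powR ?ler1n //; have /andP[] := theta01.
 have h := Psi_block x B2 (@S_decay 0); apply: (le_trans ny).
 have p0 := powR_ge0 (rad 3)^-1 theta; have x0 := rnorm_ge0 x.
 apply: (@le_trans _ _ (C * (B * 2) * 8 * T + 28 * C * B * T)); last by apply: eq_ler; ring.
 rewrite lerD2r; apply: (le_trans h); apply: ler_pM => //; first by rewrite !mulr_ge0.
 by rewrite ler_wpM2l // mulr_ge0.
Qed.

End smooth_calculus.

(** * Functions on the sector as functions on the strip *)

Section bounded_holomorphic_functions.
Context (R : realType).
Implicit Types (f g : R[i] -> R[i]) (psi : R).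

Lemma cdiff_derivable f z : cdiff f z -> derivable (f : R[i]^o -> R[i]^o) z 1.
Proof.
move=> [phi [cp e]]; apply/cvg_ex; exists (phi z : R[i]^o); apply/cvgrPdist_lt => d d0.
have [d1 d2] := gt0_complex d0.
have [r r0 hr] := cp _ d1; rewrite near_withinE; apply/nbhs_ballP; exists r%:C; rewrite /= ?ltcR // => h.
rewrite /ball /= sub0r normrN rnormE ltcR => hh h0.
have -> : h *: (1 : R[i]^o) + z = h + z :> R[i] by rewrite /GRing.scale /= mulr1.
rewrite e addrK [h^-1 *: _]mulrC mulfK // d2 rnormE ltcR rnormB.
by apply: hr; rewrite addrK.
Qed.

Variable psi : R.
Hypothesis hpsi : 0 < psi < pi.

Lemma sector_cexp_lt t s : `|s| < psi -> sector psi (cexp (t +i* s)).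
Proof.
have /andP[p0 ppi] := hpsi; move=> sb; apply/sector_cexp; first by rewrite !ltW.
have -> : cos s = cos `|s| by case: (ger0P s) => // _; rewrite cosN.
by rewrite ltr_cos ?in_itv //= ?(ltW p0) ?(ltW ppi) // normr_ge0 (le_trans (ltW sb)) // ltW.
Qed.

Lemma sector_exp z : sector psi z -> exists t s, z = cexp (t +i* s) /\ `|s| < psi.
Proof. by move=> [z0 az]; have [t [s [e _ es]]] := polar z0; exists t, s; rewrite -es. Qed.

Lemma Hinf_norm_ge f z : Hinf psi f -> sector psi z -> rnorm (f z) <= Hinf_norm psi f.
Proof. by move=> [_ ub] sz; apply: ub_le_sup => //; exists z. Qed.

Lemma Hinf_norm_ge0 f : Hinf psi f -> 0 <= Hinf_norm psi f.
Proof.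
move=> hf; apply: (le_trans (rnorm_ge0 (f (cexp (0 +i* 0))))); apply: Hinf_norm_ge => //.
by apply: sector_cexp_lt; rewrite normr0; have /andP[] := hpsi.
Qed.

Lemma Hinf_bounded_strip f : Hinf psi f -> bounded_strip (f \o @cexp R) psi (Hinf_norm psi f).
Proof.
move=> hf t s sb; have sc := sector_cexp_lt t sb; split; last exact: (Hinf_norm_ge hf sc).
by apply: cdiff_comp; [exact: cdiff_cexp|apply: derivable_cdiff; exact: hf.1].
Qed.

Lemma ereg_bound : exists2 a, 0 <= a & strip_decay2 (@ereg R) psi a.
Proof.
have /andP[p0 ppi] := hpsi; have [|a a0 h] := @ereg_decay R psi; first by rewrite (ltW p0).
by exists a => // t s sb; apply: h; exact: ltW.
Qed.

Lemma sector_one z : sector psi z -> 1 + z != 0.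
Proof.
move=> /sector_exp[t [s [-> sb]]]; have /andP[p0 ppi] := hpsi.
have [|h1 h2] := @one_cexp_ge R psi t s _ (ltW sb); first by rewrite (ltW p0).
apply/eqP => e; move: h1; rewrite e rnorm0 leNgt mulr_gt0 // ltr_wpDr // expR_gt0.
Qed.

Lemma Hinf0_regularizer_mul f : Hinf psi f -> Hinf0 psi (fun z => regularizer z * f z).
Proof.
move=> hf; have [a a0 ha] := ereg_bound; have n0 := Hinf_norm_ge0 hf.
have bz z : sector psi z -> rnorm (regularizer z) <= a.
 move=> /sector_exp[t [s [-> sb]]]; have [_ h] := ha t s sb; apply: (le_trans h).
 by rewrite ler_piMr // exprn_ile1 ?rho_ge0 ?rho_le1.
split; first split.
- move=> z sz; apply: cdiff_derivable; apply: cdiffM; last exact: (derivable_cdiff (hf.1 z sz)).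
 apply: cdiffM; first exact: cdiff_id.
 apply: cdiffV; first by rewrite expf_neq0 // sector_one.
 by apply: cdiffX; apply: cdiffD; [exact: cdiff_cst|exact: cdiff_id].
- exists (a * Hinf_norm psi f) => _ [z sz <-]; rewrite rnormM.
 by apply: ler_pM; rewrite ?rnorm_ge0 ?bz ?Hinf_norm_ge.
exists (Hinf_norm psi f + 1), 1; split=> //; first by rewrite ltr_wpDl.
move=> z sz; rewrite rnormM rnorm_regularizer powRr1 ?rnorm_ge0 // mulr1 powR_mulrn ?rnorm_ge0 // mulrC mulrA.
rewrite ler_wpM2r ?invr_ge0 ?exprn_ge0 ?rnorm_ge0 // ler_wpM2r ?rnorm_ge0 //.
by rewrite (le_trans (Hinf_norm_ge hf sz)) // lerDl.
Qed.

Lemma Hinf_cst1 : Hinf psi (fun=> 1).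
Proof. by split=> [z _|]; [exact: derivable_cst|exists 1 => _ [z _ <-]; rewrite rnorm1]. Qed.

Lemma Hinf0_regularizer : Hinf0 psi (@regularizer R).
Proof.
have := Hinf0_regularizer_mul Hinf_cst1; congr (Hinf0 psi _).
by apply/funext => z; rewrite mulr1.
Qed.

End bounded_holomorphic_functions.

Theorem theorem5p1 (R : realType)
 (d : measure_display) (Omega : measurableType d) (P : probability Omega R)
 (gamma : nat -> Omega -> R[i])
 (hgamma : complex_gaussian_sequence P gamma)
 (X : completeNormedModType R[i]) (hX : exists x : X, x != 0)
 (p q : R) (hp : 1 <= p <= 2) (hq : 2 <= q)
 (htype : has_type P gamma X p) (hcotype : has_cotype P gamma X q)
 (A : set (X * X)) (U : R -> {linear X -> X})
 (hA : BIP A U) (htheta : group_type U < pi)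
 (psi : R) (hpsi : group_type U < psi < pi) :
 exists C : R, 0 <= C /\
 forall f : R[i] -> R[i], Hinf psi f ->
 interpolation_space (log_operator A) (p^-1 - q^-1) 1
 `<=` domain (functional_calculus A psi f) /\
 (opnorm_from (interpolation_norm (log_operator A) (p^-1 - q^-1) 1)
 (functional_calculus A psi f)
 <= (C * Hinf_norm psi f)%:E)%E.
Proof.
have [[phi1 sA1] iA hU hgen] := hA; have /andP[gp ppi] := hpsi; have /andP[p1 p2] := hp.
have [th [M [th0 thp M1 Ub]]] := group_type_bound hU gp.
have M0 : 0 <= M by exact: le_trans M1.
(* Equally spaced levels [th < e < b < psi]: the kernels decay at rate [e] against the growth [th]
   of the group, [A] will be sectorial of angle [e], and the blocks live on the strip of half-width
   [b]. *)
pose e := (2 * th + psi) / 3; pose b := (th + 2 * psi) / 3.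
have the : th < e by rewrite /e; move: thp; lra.
have eb : e < b by rewrite /e /b; move: thp; lra.
have bp : b < psi by rewrite /b; move: thp; lra.
have bpi : b < pi by exact: lt_trans ppi.
have e0 : 0 < e by exact: le_lt_trans the.
have psi0 : 0 < psi < pi by rewrite ppi (le_lt_trans th0).
(* The given angle [phi1] may exceed [psi]; only now are the contours inside the sector of angle
   [psi] known to exist. *)
have sA : sectorial e A.
 by apply: (sectorial_of_type iA hU M0 th0 Ub hgen _ e0 sA1); rewrite the (lt_trans eb).
have q1 : 1 < q by move: hq; lra.
have theta01 : 0 <= p^-1 - q^-1 <= 1.
 have h1 : q^-1 <= p^-1 by rewrite lef_pV2 ?posrE; move: hq p1 p2; lra.
 have h2 : p^-1 <= 1 by rewrite invf_le1 //; move: p1; lra.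
 have h3 : 0 <= q^-1 by rewrite invr_ge0; move: hq; lra.
 by apply/andP; split; move: h1 h2 h3; lra.
have [C0 C00 hF] := fourier_multiplier_bound hgamma p1 q1 htype hcotype.
have [C C1 hB] := block_bound C00 hF hU M0 th0 the eb Ub.
have L0 := log_operator0 hU hgen.
have [a a0 sd2] := ereg_bound psi0; have sd := strip_decay2W a0 sd2.
pose nu := (e + b) / 2; have ppi' := ltW ppi.
have enu : e < nu < psi by apply/andP; rewrite /nu; move: eb bp; split; lra.
(* [176 = 4 * 44]: the 4 compares the dyadic sum with the interpolation norm, the 44 comes from the
   sum over the blocks. *)
exists (176 * C); split; first by rewrite mulr_ge0.
move=> f hf; set F := f \o @cexp R; have F0 := Hinf_norm_ge0 psi0 hf.
have bF := Hinf_bounded_strip psi0 hf.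
have bFb : bounded_strip F b (Hinf_norm psi f) by move=> t s sb; apply: bF; exact: lt_trans bp.
have sdF : strip_decay ((fun z => regularizer z * f z) \o @cexp R) psi (a * Hinf_norm psi f).
 exact: strip_decayM a0 sd bF.
have key x r : (4%:E * interpolation_norm (log_operator A) (p^-1 - q^-1) 1 x <= r%:E)%E ->
 exists y, Psi A nu (@ereg R) y = Psi A nu (fun w => ereg w * F w) x /\ rnorm y <= 44 * C * Hinf_norm psi f * r.
 move=> hr; apply: (smooth_calculus_exists hU M0 th0 the eb bpi Ub sA iA hgen C1 theta01 hB F0 bFb) => m.
 by rewrite -lee_fin; apply: le_trans hr; exact: dyadic_K_sum.
have calc x y : Psi A nu (@ereg R) y = Psi A nu (fun w => ereg w * F w) x -> functional_calculus A psi f (x, y).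
 move=> h; exists (Psi A nu (@ereg R) y); split; last exact: (Psi_elementary _ ppi' sd (Hinf0_regularizer psi0) sA enu).
 by rewrite h; exact: (Psi_elementary _ ppi' sdF (Hinf0_regularizer_mul psi0 hf) sA enu).
split.
 move=> x; rewrite /interpolation_space /= => hx.
 pose r := fine (4%:E * interpolation_norm (log_operator A) (p^-1 - q^-1) 1 x)%E.
 have [|y [h _]] := key x r; last by exists (x, y) => //; exact: calc.
 have n0 : (0 <= interpolation_norm (log_operator A) (p^-1 - q^-1) 1 x)%E by exact: poweR_ge0.
 rewrite /r fineK // fin_numElt (lt_le_trans (ltNyr 0)) ?mule_ge0 //=.
 by move: hx n0; case: (interpolation_norm _ _ _ _) => // s _ _; rewrite -EFinM ltry.
apply: ge_ereal_sup => _ [[x y] /= [[v [e1 e2]] h1] <-]; rewrite lee_fin.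
have [|y' [h n]] := key x 4; first by rewrite -[leRHS]mule1 lee_wpmul2l.
have -> : y = y'; last by apply: (le_trans n); apply: eq_ler; ring.
(* Single-valuedness of [f(A)]: whichever contours the graph used, [e(A) y] and [e(A) y'] both equal
   [(e f)(A) x], and [e(A)] is injective. *)
apply: (Psi_ereg_eq th0 the eb bpi sA iA); rewrite -/nu h.
have <- := elementary_Psi ppi' sd e2 sA enu; exact: (elementary_Psi ppi' sdF e1 sA enu).
Qed.
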